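(* Let $T>0$, $(\bar x_0,\bar u_0)\in\mathbb{R}^n\times U$, and let $(u,v)=(u,v_1,v_2)\in BV([0,T],U)\times L^1([0,T],V)\times L^1([0,T],V)$ with $u(0)=\bar u_0$. A map $x:[0,T]\to\mathbb{R}^n$ is an E-BVS limit solution, associated to $(u,v)$, of the Cauchy problem $$\dot x(t)=g_0(x(t),u(t),v_1(t))+\sum_{i=1}^m g_i(x(t),u(t),v_2(t))\,\dot u_i(t)\ \text{ for a.e. } t\in[0,T],\qquad x(0)=\bar x_0,\quad u(0)=\bar u_0,$$ if and only if $x$ is a graph completion solution of the same Cauchy problem associated to the same control $(u,v)$.
   Context: Standing assumptions. - $U\subset\mathbb{R}^m$ and $V\subset\mathbb{R}^l$ are compact. $U$ has the Whitney property: there is $C\ge 1$ such that for every $(u_1,u_2)\in U\times U$ there is an absolutely continuous path $\tilde u:[0,1]\to U$ with $\tilde u(0)=u_1$, $\tilde u(1)=u_2$ and total variation $Var[\tilde u]\le C|u_1-u_2|$. - For every $i=0,\dots,m$, $g_i:\mathbb{R}^n\times U\times V\to\mathbb{R}^n$ is continuous, and $(x,u)\mapsto g_i(x,u,v)$ is locally Lipschitz on $\mathbb{R}^n\times U$ uniformly in $v\in V$. There is $M>0$ such that $|g_i(x,u,v)|\le M(1+|(x,u)|)$ for all $(x,u,v)\in\mathbb{R}^n\times U\times V$ and all $i$. Notation. $\mathcal{L}^1([0,T],E)$ is the set of everywhere (pointwise) defined Lebesgue integrable functions $[0,T]\to E$; $L^1([0,T],E)$ is its usual quotient; $\|\cdot\|_{L^1(T)}$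 is the $L^1$-norm on $[0,T]$. $AC(T)$ is the set of absolutely continuous functions $[0,T]\to U$; $BV([0,T],U)$ is the set of functions $[0,T]\to U$ of bounded total variation, and $Var_{I}(f)$ is the total variation of $f$ on the interval $I$. Elements $v$, $\psi$ of $L^1$-spaces are identified, when pointwise values are needed, with suitable Borel measurable representatives. For $(u,v_1,v_2)\in AC(T)\times L^1([0,T],V)\times L^1([0,T],V)$ with $u(0)=\bar u_0$, $x[\bar x_0,\bar u_0,u,v]$ denotes the unique Carathéodory solution on $[0,T]$ of the Cauchy problem. E-BVS limit solution: a map $x\in\mathcal{L}^1([0,T],\mathbb{R}^n)$ is an E-BVS (extended BVS) limit solution corresponding to $(u,v)=(u,v_1,v_2)$ if there is a sequence $(u_k,v_k)=(u_k,v_{1_k},v_{2_k})\subset AC(T)\times L^1([0,T],V)\times L^1([0,T],V)$ with $u_k(0)=\bar u_0$, with the $u_k$ having equibounded variation on $[0,T]$, and such that (i) setting $x_k:=x[\bar x_0,\bar u_0,u_k,v_k]$, for every $\tau\in[0,T]$, $$|(x_k,u_k)(\tau)-(x,u)(\tau)|+\|(x_k,u_k,v_k)-(x,u,v)\|_{L^1(T)}\to 0\quad\text{as }k\to+\infty;$$ (ii) there is a measurable function $\psi_2:[0,+\infty[\,\to V$ such that, setting $\sigma_k(t):=t+Var_{[0,t]}(u_k)$ for $t\in[0,T]$ and $V_k:=Var_{[0,T]}(u_k)$, $$\int_0^{T+V_k}\big|v_{2_k}\circ\sigma_k^{-1}(s)-\psi_2(s)\big|\,ds\to 0\quad\text{as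 }k\to+\infty.$$ Feasible space-time controls: $\Gamma_f(\bar u_0)$ is the set of all $(\varphi_0,\varphi,\psi,S)=(\varphi_0,\varphi,\psi_1,\psi_2,S)$ with $S>0$, $(\varphi_0,\varphi):[0,S]\to[0,+\infty[\,\times U$ Lipschitz continuous, $\psi=(\psi_1,\psi_2)\in L^1([0,S],V)\times L^1([0,S],V)$, $(\varphi_0,\varphi)(0)=(0,\bar u_0)$, $\varphi_0(S)=T$, $\varphi_0'(s)\ge 0$ and $\varphi_0'(s)+|\varphi'(s)|=1$ for a.e. $s\in[0,S]$. For such a control, $\xi[\bar x_0,\bar u_0,\varphi_0,\varphi,\psi]$ denotes the solution on $[0,S]$ of the space-time system $$\xi'(s)=g_0(\xi,\varphi,\psi_1)\varphi_0'(s)+\sum_{i=1}^m g_i(\xi,\varphi,\psi_2)\varphi_i'(s)\ \text{ for a.e. } s\in[0,S],\qquad \xi(0)=\bar x_0.$$ Graph completion: $(\varphi_0,\varphi,\psi,S)\in\Gamma_f(\bar u_0)$ is a graph completion of $(u,v)\in BV([0,T],U)\times L^1([0,T],V)\times L^1([0,T],V)$ (with $u(0)=\bar u_0$) if for every $t\in[0,T]$ there is $s\in[0,S]$ such that $(\varphi_0,\varphi,\psi)(s)=(t,u(t),v(t))$. A clock is a strictly increasing function $\sigma:[0,T]\to[0,S]$ with $\sigma(0)=0$, $\sigma(T)=S$ and $(\varphi_0,\varphi)(\sigma(t))=(t,u(t))$ for every $t\in[0,T]$. Graph completion solution: a map $x:[0,T]\to\mathbb{R}^n$ is a graph completion solution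 of the Cauchy problem associated to $(u,v)$ if there are a graph completion $(\varphi_0,\varphi,\psi,S)$ of $(u,v)$ and a clock $\sigma$ such that $x(t)=\xi[\bar x_0,\bar u_0,\varphi_0,\varphi,\psi](\sigma(t))$ for all $t\in[0,T]$. *)

(* Defs.v *)
From mathcomp Require Import all_boot all_order all_algebra.
From mathcomp Require Import all_classical all_reals all_analysis.

Set Implicit Arguments.
Unset Strict Implicit.
Unset Printing Implicit Defensive.

Import Order.TTheory GRing.Theory Num.Theory.
Import numFieldNormedType.Exports.

Local Open Scope classical_set_scope.
Local Open Scope ring_scope.

(* A function on a compact interval [a, b] is represented by a total function
   on R, of which only the values on [a, b] are used. *)

(* The norm that the library puts on 'rV[R]_d is the sup norm; |.| below is the
   Euclidean one. The norm of a tuple of vectors is the norm of their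
   concatenation with row_mx. *)
Definition enorm (R : realType) (d : nat) (x : 'rV[R]_d) : R :=
  Num.sqrt (\sum_(i < d) x ord0 i ^+ 2).

Section paths.
Context (R : realType) (d : nat).
Implicit Types (a b : R) (f : R -> 'rV[R]_d) (E : set 'rV[R]_d).

(* Vector-valued versions of the library's variation and total_variation,
   which are for real-valued functions. *)
Definition evariation a b f (s : seq R) : R :=
  let F := f \o nth b (a :: s) in
  \sum_(0 <= i < size s) enorm (F i.+1 - F i).

Definition total_evariation a b f : \bar R :=
  ereal_sup [set (evariation a b f s)%:E | s in itv_partition a b].

Definition abs_continuous a b f :=
  forall e : R, 0 < e -> exists2 r : R, 0 < r &
    forall (N : nat) (p q : 'I_N -> R),
      (forall i, a <= p i /\ p i <= q i /\ q i <= b) ->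
      trivIset setT (fun i => `]p i, q i[%classic) ->
      \sum_(i < N) (q i - p i) < r ->
      \sum_(i < N) enorm (f (q i) - f (p i)) < e.

Definition valued_in a b E f := forall t : R, t \in `[a, b] -> E (f t).

Definition AC_fun a b E f := valued_in a b E f /\ abs_continuous a b f.

Definition BV_fun a b E f := valued_in a b E f /\ (total_evariation a b f < +oo)%E.

(* Pointwise defined integrable functions. Elements of the quotient L^1 are
   represented by such functions, considered up to equality a.e.
   Integrability here includes Borel measurability. *)
Definition L1_fun a b E f := valued_in a b E f /\
  forall i : 'I_d,
    (@lebesgue_measure R).-integrable `[a, b] (EFin \o (fun t => f t ord0 i)).

Definition L1_norm a b f : \bar R :=
  (\int[@lebesgue_measure R]_(t in `[a, b]%classic) (enorm (f t))%:E)%E.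

Definition whitney E := exists2 C : R, 1 <= C &
  forall e1 e2, E e1 -> E e2 ->
    exists f, [/\ AC_fun 0 1 E f, f 0 = e1, f 1 = e2 &
      (total_evariation 0 1 f <= (C * enorm (e1 - e2))%:E)%E].

(* sigma(t) = t + Var_[0,t](f) *)
Definition arc_clock f (t : R) : R := t + fine (total_evariation 0 t f).

End paths.

Section vector_field_hypotheses.
Context (R : realType) (n m l : nat) (U : set 'rV[R]_m) (V : set 'rV[R]_l).
Implicit Type h : 'rV[R]_n -> 'rV[R]_m -> 'rV[R]_l -> 'rV[R]_n.

Definition field_continuous h :=
  {within (setT `*` U) `*` V, continuous
    (fun z : ('rV[R]_n * 'rV[R]_m) * 'rV[R]_l => h z.1.1 z.1.2 z.2)}.

Definition locally_lipschitz_unif h :=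
  forall x u, U u -> exists r L : R, 0 < r /\
    forall x1 u1 x2 u2 v, U u1 -> U u2 -> V v ->
      enorm (row_mx (x1 - x) (u1 - u)) < r ->
      enorm (row_mx (x2 - x) (u2 - u)) < r ->
      enorm (h x1 u1 v - h x2 u2 v) <= L * enorm (row_mx (x1 - x2) (u1 - u2)).

Definition linear_growth (M : R) h :=
  forall x u v, U u -> V v -> enorm (h x u v) <= M * (1 + enorm (row_mx x u)).

End vector_field_hypotheses.

Section control_system.
Context (R : realType) (n m l : nat) (U : set 'rV[R]_m) (V : set 'rV[R]_l).
(* g ord0 is the drift g_0; g (lift ord0 i), for i : 'I_m, is the field that
   multiplies the derivative of the i-th component of the control. *)
Context (g : 'I_m.+1 -> 'rV[R]_n -> 'rV[R]_m -> 'rV[R]_l -> 'rV[R]_n).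
Context (T : R) (x0 : 'rV[R]_n) (u0 : 'rV[R]_m).
Implicit Types (x xi : R -> 'rV[R]_n) (u phi : R -> 'rV[R]_m)
  (v psi : R -> 'rV[R]_l) (sigma : R -> R) (Smax : R).

Local Notation mu := (@lebesgue_measure R).

Definition caratheodory_solution u v1 v2 x :=
  [/\ abs_continuous 0 T x, x 0 = x0 &
    {ae mu, forall t : R, t \in `[0, T] ->
      is_derive t 1 x
        (g ord0 (x t) (u t) (v1 t)
         + \sum_(i < m) (derive1 u t) ord0 i *: g (lift ord0 i) (x t) (u t) (v2 t))}].

(* As solutions are unique, x_k = x[x0, u0, u_k, v_k] is expressed by saying
   that x_k solves the Cauchy problem. *)
Definition E_BVS_limit_solution u v1 v2 x :=
  L1_fun 0 T setT x /\
  exists (uk : nat -> R -> 'rV[R]_m) (v1k v2k : nat -> R -> 'rV[R]_l)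
    (xk : nat -> R -> 'rV[R]_n),
  [/\ forall k, [/\ AC_fun 0 T U (uk k), uk k 0 = u0,
                    L1_fun 0 T V (v1k k) & L1_fun 0 T V (v2k k)],
      exists K : R, forall k, (total_evariation 0 T (uk k) <= K%:E)%E,
      forall k, caratheodory_solution (uk k) (v1k k) (v2k k) (xk k),
      forall tau : R, tau \in `[0, T] ->
        ((enorm (row_mx (xk k tau - x tau) (uk k tau - u tau)))%:E
         + L1_norm 0 T (fun t =>
             row_mx (row_mx (xk k t - x t) (uk k t - u t))
                    (row_mx (v1k k t - v1 t) (v2k k t - v2 t))))%E
        @[k --> \oo] --> 0%E
    & exists psi2 : R -> 'rV[R]_l,
        [/\ forall s : R, 0 <= s -> V (psi2 s),
            forall i : 'I_l,
              measurable_fun (`[0, +oo[%classic : set R)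
                (fun s => psi2 s ord0 i) &
            L1_norm 0 (T + fine (total_evariation 0 T (uk k)))
              (fun s => v2k k ('pinv_(fun=> 0) `[0, T]%classic
                                 (arc_clock (uk k)) s) - psi2 s)
            @[k --> \oo] --> 0%E]].

(* (phi0, phi, psi1, psi2, Smax) belongs to Gamma_f(u0) *)
Definition feasible_control (phi0 : R -> R) phi psi1 psi2 Smax :=
  [/\ 0 < Smax,
      [/\ forall s : R, s \in `[0, Smax] -> 0 <= phi0 s,
          valued_in 0 Smax U phi &
          [lipschitz (phi0 s, phi s) | s in `[0, Smax]%classic]],
      L1_fun 0 Smax V psi1 /\ L1_fun 0 Smax V psi2,
      [/\ phi0 0 = 0, phi 0 = u0 & phi0 Smax = T] &
      {ae mu, forall s : R, s \in `[0, Smax] ->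
        0 <= derive1 phi0 s /\ derive1 phi0 s + enorm (derive1 phi s) = 1}].

Definition space_time_solution (phi0 : R -> R) phi psi1 psi2 Smax xi :=
  [/\ abs_continuous 0 Smax xi, xi 0 = x0 &
    {ae mu, forall s : R, s \in `[0, Smax] ->
      is_derive s 1 xi
        (derive1 phi0 s *: g ord0 (xi s) (phi s) (psi1 s)
         + \sum_(i < m)
             (derive1 phi s) ord0 i *: g (lift ord0 i) (xi s) (phi s) (psi2 s))}].

(* The values v(t) and psi(s) are those of suitable representatives w and chi
   of the classes of v and psi. *)
Definition graph_completion u v1 v2 (phi0 : R -> R) phi psi1 psi2 Smax :=
  feasible_control phi0 phi psi1 psi2 Smax /\
  exists w1 w2 chi1 chi2 : R -> 'rV[R]_l,
  [/\ [/\ L1_fun 0 T V w1, L1_fun 0 T V w2, L1_fun 0 Smax V chi1 & L1_fun 0 Smax V chi2],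
      w1 = v1 %[ae mu in `[0, T]%classic] /\
        w2 = v2 %[ae mu in `[0, T]%classic],
      chi1 = psi1 %[ae mu in `[0, Smax]%classic] /\
        chi2 = psi2 %[ae mu in `[0, Smax]%classic] &
      forall t : R, t \in `[0, T] -> exists2 s : R, s \in `[0, Smax] &
        [/\ phi0 s = t, phi s = u t, chi1 s = w1 t & chi2 s = w2 t]].

Definition clock u (phi0 : R -> R) phi Smax sigma :=
  [/\ forall t : R, t \in `[0, T] -> sigma t \in `[0, Smax],
      {in `[0, T] &, forall t1 t2, t1 < t2 -> sigma t1 < sigma t2},
      sigma 0 = 0, sigma T = Smax &
      forall t : R, t \in `[0, T] -> phi0 (sigma t) = t /\ phi (sigma t) = u t].

Definition graph_completion_solution u v1 v2 x :=
  exists (phi0 : R -> R) phi psi1 psi2 Smax sigma xi,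
  [/\ graph_completion u v1 v2 phi0 phi psi1 psi2 Smax,
      clock u phi0 phi Smax sigma,
      space_time_solution phi0 phi psi1 psi2 Smax xi &
      forall t : R, t \in `[0, T] -> x t = xi (sigma t)].

End control_system.

(* Main.v *)
Require Import Defs.
From HB Require Import structures.
From mathcomp Require Import all_boot all_order all_algebra.
From mathcomp Require Import all_classical all_reals all_analysis.
From mathcomp Require Import measurable_realfun ring lra.

(** Both notions of solution are compared in space-time. The arc-length clock
    t + Var_[0,t](u) of an absolutely continuous control u has a nonexpansive inverse
    tau, and u o tau is nonexpansive too. In the variable s = t + Var_[0,t](u) the
    Cauchy problem becomes an equation whose densities, the derivatives of tau and of
    u o tau, are bounded by 1 (caratheodory_space_time). For equations with bounded
    densities the solution depends continuously on the controls when these converge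
    uniformly, so that their densities converge only weakly, and when the ordinary
    controls converge in mean (ode_stability).

    From limit solutions to graph completions. The variations are equibounded, so all
    the inverse clocks tauk live on one interval [0, S]. Along an ultrafilter finer
    than the filter of neighbourhoods of infinity, tauk and uk o tauk converge
    uniformly to some phi0 and phi, and the arc-length clocks converge at every time to
    some sigma (limit_clock). The limit graph may be parametrized with speed less than
    1, since variation can be lost in the limit; reparametrization by its arc length
    gives a feasible control (arc_length_feasible) and the clock. Continuous dependence
    identifies the limit of the solutions with the solution along the limit graph.
    Condition (ii) of limit solutions yields the control psi2, and psi2 o sigma = v2
    a.e. because the densities of tauk converge weakly to the derivative of phi0
    (limit_control).

    From graph completions to limit solutions. The clock sigma of the completion is
    approximated by Lipschitz clocks that converge to it at every time, jumps included
    (approximate_clock). Composed with phi they give Lipschitz controls uk, with values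
    in U and with uk 0 = u0. As s is the arc length of the graph (phi0, phi), the
    arc-length clock of uk is t + sgk t - phi0 (sgk t), which converges to sigma t; so
    in space-time the controls converge to (phi0, phi), and continuous dependence
    applies again. With psi2 along the arc-length clock of uk as second ordinary
    control, condition (ii) holds without error.

    The analysis on the line that this rests on is developed first: Lipschitz functions
    are integrals of their derivatives (lip_derive), a monotone Lipschitz function has
    derivative zero almost everywhere over a null set (lip_null), a function with derivative zero a.e. is constant if an
    absolutely continuous function controls its oscillations (ac_derive0), and the speed
    of a Lipschitz curve is the derivative of its variation (vlip_var_derive). *)

Set Implicit Arguments.
Unset Strict Implicit.
Unset Printing Implicit Defensive.

Import Order.TTheory GRing.Theory Num.Theory.
Import numFieldNormedType.Exports.

Local Open Scope classical_set_scope.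
Local Open Scope ring_scope.

(** * The Euclidean norm *)

Section euclidean_norm.
Context {R : realType}.
Implicit Types d : nat.

Lemma enorm_ge0 d (x : 'rV[R]_d) : 0 <= enorm x.
Proof. exact: sqrtr_ge0. Qed.

Lemma enorm_sqr d (x : 'rV[R]_d) : enorm x ^+ 2 = \sum_(i < d) x ord0 i ^+ 2.
Proof. by rewrite sqr_sqrtr// sumr_ge0// => i _; exact: sqr_ge0. Qed.

Lemma enorm_coord d (x : 'rV[R]_d) i : `|x ord0 i| <= enorm x.
Proof.
rewrite -sqrtr_sqr ler_wsqrtr// (bigD1 i)//= lerDl sumr_ge0// => j _.
exact: sqr_ge0.
Qed.

Lemma enorm_le_sum d (x : 'rV[R]_d) : enorm x <= \sum_(i < d) `|x ord0 i|.
Proof.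
rewrite -(@ler_pXn2r _ 2)// ?nnegrE ?enorm_ge0 ?sumr_ge0// enorm_sqr.
suff : \sum_(i < d) x ord0 i ^+ 2 <= (\sum_(i < d) `|x ord0 i|) ^+ 2 /\
    0 <= \sum_(i < d) `|x ord0 i| by case.
apply: (big_ind2 (fun p q => p <= q ^+ 2 /\ 0 <= q)) => [|p q p' q' [h1 h2] [h3 h4]|i _].
- by rewrite expr0n lexx.
- split; last exact: addr_ge0.
  rewrite sqrrD; have : 0 <= q * q' by exact: mulr_ge0.
  by rewrite -mulr_natl; lra.
- by rewrite -normrX ler_norm.
Qed.

Lemma enorm0 d : enorm (0 : 'rV[R]_d) = 0.
Proof.
apply/eqP; rewrite eq_le enorm_ge0 andbT (le_trans (enorm_le_sum _))//.
by rewrite big1// => i _; rewrite mxE normr0.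
Qed.

Lemma enormN d (x : 'rV[R]_d) : enorm (- x) = enorm x.
Proof. by congr Num.sqrt; apply: eq_bigr => i _; rewrite mxE sqrrN. Qed.

Lemma enormB d (x y : 'rV[R]_d) : enorm (x - y) = enorm (y - x).
Proof. by rewrite -enormN opprB. Qed.

Lemma enormZ d c (x : 'rV[R]_d) : enorm (c *: x) = `|c| * enorm x.
Proof.
rewrite /enorm -sqrtr_sqr -sqrtrM ?sqr_ge0// mulr_sumr; congr Num.sqrt.
by apply: eq_bigr => i _; rewrite mxE exprMn.
Qed.

Lemma enorm_eq0 d (x : 'rV[R]_d) : enorm x = 0 -> x = 0.
Proof.
move=> x0; apply/rowP => i; rewrite mxE; apply/eqP.
by rewrite -normr_le0 -x0 enorm_coord.
Qed.

Lemma enormD d (x y : 'rV[R]_d) : enorm (x + y) <= enorm x + enorm y.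
Proof.
have [x0|x0] := eqVneq (enorm x) 0.
  by rewrite (enorm_eq0 x0) add0r enorm0 add0r.
have [y0|y0] := eqVneq (enorm y) 0.
  by rewrite (enorm_eq0 y0) addr0 enorm0 addr0.
have A0 : 0 < enorm x by rewrite lt_neqAle eq_sym x0 enorm_ge0.
have B0 : 0 < enorm y by rewrite lt_neqAle eq_sym y0 enorm_ge0.
rewrite -(@ler_pXn2r _ 2)// ?nnegrE ?enorm_ge0 ?addr_ge0 ?enorm_ge0//.
pose p := \sum_(i < d) x ord0 i * y ord0 i.
have -> : enorm (x + y) ^+ 2 = enorm x ^+ 2 + enorm y ^+ 2 + 2 * p.
  rewrite !enorm_sqr /p mulr_sumr -!big_split/=; apply: eq_bigr => i _.
  by rewrite mxE; ring.
have : 0 <= \sum_(i < d) (x ord0 i * enorm y - y ord0 i * enorm x) ^+ 2.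
  by apply: sumr_ge0 => i _; exact: sqr_ge0.
have -> : \sum_(i < d) (x ord0 i * enorm y - y ord0 i * enorm x) ^+ 2 =
    2 * (enorm x * enorm y) * (enorm x * enorm y - p).
  transitivity ((enorm y ^+ 2) * (enorm x ^+ 2) + (enorm x ^+ 2) * (enorm y ^+ 2) -
     2 * enorm x * enorm y * p); last by ring.
  rewrite [X in _ * X + _]enorm_sqr [X in _ + _ * X]enorm_sqr /p !mulr_sumr -sumrN.
  by rewrite -!big_split/=; apply: eq_bigr => i _; ring.
rewrite pmulr_rge0 ?mulr_gt0// subr_ge0 => h; rewrite sqrrD.
by rewrite -addrA [_ + 2 * p]addrC addrA lerD2r lerD2l -[leRHS]mulr_natl ler_pM2l.
Qed.

Lemma enorm_triangle d (y x z : 'rV[R]_d) : enorm (x - z) <= enorm (x - y) + enorm (y - z).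
Proof. by rewrite -[x - z](subrKA y) enormD. Qed.

Lemma enorm_row_mxE d1 d2 (x : 'rV[R]_d1) (y : 'rV[R]_d2) :
  enorm (row_mx x y) ^+ 2 = enorm x ^+ 2 + enorm y ^+ 2.
Proof.
rewrite !enorm_sqr big_split_ord/=; congr (_ + _); apply: eq_bigr => i _.
  by rewrite row_mxEl.
by rewrite row_mxEr.
Qed.

Lemma enorm_row_mx d1 d2 (x : 'rV[R]_d1) (y : 'rV[R]_d2) :
  enorm (row_mx x y) <= enorm x + enorm y.
Proof.
rewrite -(@ler_pXn2r _ 2)// ?nnegrE ?enorm_ge0 ?addr_ge0 ?enorm_ge0//.
rewrite enorm_row_mxE sqrrD -addrA lerD2l lerDr mulrn_wge0//.
by rewrite mulr_ge0 ?enorm_ge0.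
Qed.

Lemma enorm_row_mxl d1 d2 (x : 'rV[R]_d1) (y : 'rV[R]_d2) :
  enorm x <= enorm (row_mx x y).
Proof.
by rewrite -(@ler_pXn2r _ 2)// ?nnegrE ?enorm_ge0// enorm_row_mxE lerDl sqr_ge0.
Qed.

Lemma enorm_row_mxr d1 d2 (x : 'rV[R]_d1) (y : 'rV[R]_d2) :
  enorm y <= enorm (row_mx x y).
Proof.
by rewrite -(@ler_pXn2r _ 2)// ?nnegrE ?enorm_ge0// enorm_row_mxE lerDr sqr_ge0.
Qed.

Lemma enorm_mx_norm d (x : 'rV[R]_d) : `|x| <= enorm x.
Proof.
rewrite /Num.Def.normr/= mx_normrE; apply: bigmax_le; first exact: enorm_ge0.
by move=> [i j] _; rewrite /= (ord1 i) enorm_coord.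
Qed.

Lemma mx_norm_enorm d (x : 'rV[R]_d) : enorm x <= d%:R * `|x|.
Proof.
rewrite (le_trans (enorm_le_sum x))// -[d in d%:R]card_ord -sum1_card natr_sum.
rewrite mulr_suml; apply: ler_sum => i _; rewrite mul1r.
rewrite [leRHS]/Num.Def.normr/= mx_normrE.
exact: (le_bigmax _ (fun ij => `|x ij.1 ij.2|) (ord0, i)).
Qed.

End euclidean_norm.

(** * Bounded measurable integrands *)

Section bounded_measurable.
Context {R : realType}.
Implicit Types (f g h : R -> R) (a b c C : R).
Local Notation mu := (@lebesgue_measure R).

(** The integrands below are bounded and defined on the whole line; this class
    is stable under all the operations used, so integrability is never an
    issue. *)
Definition bm f := measurable_fun setT f /\ exists C, forall s, `|f s| <= C.

Lemma bm_cst c : bm (fun=> c).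
Proof. by split; [exact: measurable_cst | exists `|c|]. Qed.

Lemma bmD f g : bm f -> bm g -> bm (fun s => f s + g s).
Proof.
move=> [mf [C fC]] [mg [D gD]]; split; first exact: measurable_funD.
by exists (C + D) => s; rewrite (le_trans (ler_normD _ _))// lerD.
Qed.

Lemma bmN f : bm f -> bm (fun s => - f s).
Proof.
move=> [mf [C fC]]; split; first exact: measurableT_comp.
by exists C => s; rewrite normrN.
Qed.

Lemma bmB f g : bm f -> bm g -> bm (fun s => f s - g s).
Proof. by move=> bf bg; apply: bmD => //; exact: bmN. Qed.

Lemma bmM f g : bm f -> bm g -> bm (fun s => f s * g s).
Proof.
move=> [mf [C fC]] [mg [D gD]]; split; first exact: measurable_funM.
by exists (C * D) => s; rewrite normrM ler_pM.
Qed.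

Lemma bm_norm f : bm f -> bm (fun s => `|f s|).
Proof.
move=> [mf [C fC]]; split; first exact: measurableT_comp.
by exists C => s; rewrite normr_id.
Qed.

Lemma bm_sum (J : Type) (r : seq J) (P : pred J) (F : J -> R -> R) :
  (forall i, bm (F i)) -> bm (fun s => \sum_(i <- r | P i) F i s).
Proof.
move=> bF; elim: r => [|i r IH].
  by under eq_fun do rewrite big_nil; exact: bm_cst.
under eq_fun do rewrite big_cons.
by case: (P i) => //; exact: bmD.
Qed.

Lemma bm_integrable a b f : bm f -> mu.-integrable `[a, b] (EFin \o f).
Proof.
move=> [mf [C fC]].
apply: measurable_bounded_integrable => //.
- by rewrite /= lebesgue_measure_itv /=; case: ifP => _; rewrite -?EFinD ltry.
- exact: measurable_funTS.
- exists C; split; first exact: num_real.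
  by move=> M CM s _; exact: le_trans (fC s) (ltW CM).
Qed.

Lemma bm_indic (A : set R) : measurable A -> bm (\1_A : R -> R).
Proof.
move=> mA; split; first exact: measurable_indic.
by exists 1 => s; rewrite indicE; case: (_ \in _); rewrite ?normr1 ?normr0.
Qed.

Definition integ a b f := \int[mu]_(x in `[a, b]) f x.

Lemma integ_D a b f g : bm f -> bm g ->
  integ a b (fun s => f s + g s) = integ a b f + integ a b g.
Proof. by move=> bf bg; rewrite /integ RintegralD//; exact: bm_integrable. Qed.

Lemma integ_Zl a b c f : bm f -> integ a b (fun s => c * f s) = c * integ a b f.
Proof. by move=> bf; rewrite /integ RintegralZl//; exact: bm_integrable. Qed.

Lemma integ_B a b f g : bm f -> bm g ->
  integ a b (fun s => f s - g s) = integ a b f - integ a b g.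
Proof. by move=> bf bg; rewrite /integ RintegralB//; exact: bm_integrable. Qed.

Lemma integ_cst a b c : a <= b -> integ a b (fun=> c) = c * (b - a).
Proof.
move=> ab; rewrite /integ Rintegral_cst//= lebesgue_measure_itv/= lte_fin.
case: ltgtP ab => // -> _.
by rewrite subrr !mulr0.
Qed.

Lemma integ_sum (J : Type) (r : seq J) (P : pred J) (F : J -> R -> R) a b :
  (forall i, bm (F i)) ->
  integ a b (fun s => \sum_(i <- r | P i) F i s) = \sum_(i <- r | P i) integ a b (F i).
Proof.
move=> bF; elim: r => [|i r IH].
  rewrite big_nil; under [fun s => _]eq_fun do rewrite big_nil.
  rewrite -(mul0r 0) integ_Zl ?mul0r//; exact: bm_cst.
rewrite big_cons -IH; under [fun s => _]eq_fun do rewrite big_cons.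
by case: (P i) => //; rewrite integ_D//; exact: bm_sum.
Qed.

Lemma integ_le a b f g : bm f -> bm g -> (forall s, a <= s <= b -> f s <= g s) ->
  integ a b f <= integ a b g.
Proof.
by move=> bf bg fg; apply: le_Rintegral => //; exact: bm_integrable.
Qed.

Lemma integ_eq a b f g : (forall s, a <= s <= b -> f s = g s) -> integ a b f = integ a b g.
Proof.
by move=> fg; apply: eq_Rintegral => s; rewrite inE/= in_itv/=; exact: fg.
Qed.

Lemma integ_ge0 a b f : (forall s, a <= s <= b -> 0 <= f s) -> 0 <= integ a b f.
Proof.
by move=> f0; apply: Rintegral_ge0 => s /=; rewrite in_itv/=; exact: f0.
Qed.

Lemma integ_norm a b f : bm f -> `|integ a b f| <= integ a b (fun s => `|f s|).
Proof. by move=> bf; apply: le_normr_Rintegral => //; exact: bm_integrable. Qed.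

Lemma integ_bound a b f C : bm f -> a <= b -> (forall s, a <= s <= b -> `|f s| <= C) ->
  `|integ a b f| <= C * (b - a).
Proof.
move=> bf ab fC; rewrite (le_trans (integ_norm _ _ bf))// -integ_cst//.
by apply: integ_le => //; [exact: bm_norm | exact: bm_cst].
Qed.

Lemma integ_cat a b c f : bm f -> a <= b -> b <= c -> integ a c f = integ a b f + integ b c f.
Proof.
move=> bf ab bc; have := @Rintegral_itvB _ f (BLeft a) (BRight c) b.
rewrite !bnd_simp => /(_ (bm_integrable _ _ bf) ab bc)/eqP.
rewrite Rintegral_itv_obnd_cbnd; last first.
  by apply: integrableS (bm_integrable b c bf) => //; exact: subset_itv_oc_cc.
by rewrite subr_eq addrC => /eqP.
Qed.

Lemma integ_aa a f : integ a a f = 0.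
Proof. by rewrite /integ set_itv1 Rintegral_set1. Qed.

Lemma aeS (P Q : R -> Prop) : (forall t, P t -> Q t) ->
  {ae mu, forall t, P t} -> {ae mu, forall t, Q t}.
Proof. by move=> PQ; apply: filterS PQ; exact: (ae_filter_ringOfSetsType mu). Qed.

Lemma aeI (P Q : R -> Prop) : {ae mu, forall t, P t} -> {ae mu, forall t, Q t} ->
  {ae mu, forall t, P t /\ Q t}.
Proof.
by move=> aP aQ; apply: filterI => //; exact: (ae_filter_ringOfSetsType mu).
Qed.

Lemma ae_ne c : {ae mu, forall t : R, t != c}.
Proof.
exists [set c]; split => //; first exact: lebesgue_measure_set1.
by move=> t /= /negP; rewrite negbK => /eqP.
Qed.

Lemma integ_eq_ae a b f g : bm f -> bm g ->
  {ae mu, forall t, a < t < b -> f t = g t} -> integ a b f = integ a b g.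
Proof.
move=> [mf _] [mg _] fg; rewrite /integ /Rintegral; congr fine.
apply: ae_eq_integral => //; try exact/measurable_EFinP/measurable_funTS.
have := aeI fg (aeI (ae_ne a) (ae_ne b)); apply: aeS => t [+ [ta tb]] /=.
rewrite in_itv/= => h /andP[a_t t_b]; rewrite h// lt_neqAle eq_sym ta a_t/=.
by rewrite lt_neqAle tb.
Qed.

Lemma integ_le_ae a b f g : bm f -> bm g ->
  {ae mu, forall t, a < t < b -> f t <= g t} -> integ a b f <= integ a b g.
Proof.
move=> bf bg fg; pose h t := Num.max (f t) (g t).
have bh : bm h.
  case: bf bg => [mf [C fC]] [mg [D gD]]; split; first exact: measurable_maxr.
  exists (C + D) => s; rewrite /h maxEle; case: ifP => _.
    by rewrite (le_trans (gD s))// lerDr (le_trans _ (fC s)).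
  by rewrite (le_trans (fC s))// lerDl (le_trans _ (gD s)).
rewrite (@le_trans _ _ (integ a b h))//.
  by apply: integ_le => // s _; rewrite /h le_max lexx.
rewrite le_eqVlt; apply/orP; left; apply/eqP; apply: integ_eq_ae => //.
by apply: aeS fg => t fg /fg /max_idPr.
Qed.

End bounded_measurable.

(** * Lipschitz functions and their derivatives *)

Section fundamental_theorem.
Context {R : realType}.
Implicit Types (f g h : R -> R) (a b c C L : R).
Local Notation mu := (@lebesgue_measure R).

Lemma bm_locally_integrable f : bm f -> locally_integrable setT f.
Proof.
move=> [mf [C fC]]; split => //; first exact: openT.
move=> K _ cK; have := compact_bounded cK.
move=> [M [_ MK]].
have KM : K `<=` `[- (M + 1), M + 1].
  move=> x Kx; rewrite /= in_itv/= -ler_norml; apply: MK => //.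
  by rewrite ltrDl.
have bf : bm f by split=> //; exists C.
have : mu.-integrable K (EFin \o f).
  apply: (@integrableS _ _ _ mu `[- (M + 1), M + 1]%classic K) => //.
    exact: compact_measurable.
  exact: bm_integrable.
by move=> /integrableP[].
Qed.

Lemma integ_derive a h : bm h ->
  {ae mu, forall t : R, a < t -> is_derive t 1 (fun s => integ a s h) (h t)}.
Proof.
move=> bh; have := @FTC1 R h (BLeft a) (fun y => bm_integrable _ _ bh)
  (bm_locally_integrable bh).
apply: aeS => t + at0; have aLt : (a%:E < t%:E)%E by rewrite lte_fin.
move=> /(_ aLt) [dt et].
by apply: DeriveDef; [exact: dt | rewrite -derive1E; exact: et].
Qed.

Definition lip_on a b L f :=
  forall s t, a <= s -> s <= t -> t <= b -> `|f t - f s| <= L * (t - s).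

Lemma clamp_ge a b c : a <= b -> a <= Num.max a (Num.min b c) <= b.
Proof. by move=> ab; rewrite le_max lexx ge_max ab ge_min lexx. Qed.

Lemma clamp_id a b c : a <= c <= b -> Num.max a (Num.min b c) = c.
Proof. by move=> /andP[ac cb]; rewrite min_r// max_r. Qed.

Lemma clamp_lip a b s t : s <= t ->
  0 <= Num.max a (Num.min b t) - Num.max a (Num.min b s) <= t - s.
Proof.
have maxB x y : x <= y -> 0 <= Num.max a y - Num.max a x <= y - x.
  by move=> xy; case: (leP a x); case: (leP a y); lra.
have minB x y : x <= y -> 0 <= Num.min b y - Num.min b x <= y - x.
  by move=> xy; case: (leP b x); case: (leP b y); lra.
move=> st; have /andP[h1 h2] := minB _ _ st.
have h3 : Num.min b s <= Num.min b t by rewrite -subr_ge0.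
by have /andP[-> /= h4] := maxB _ _ h3; exact: le_trans h4 h2.
Qed.

Lemma clamp_dist a b s t :
  `|Num.max a (Num.min b s) - Num.max a (Num.min b t)| <= `|s - t|.
Proof.
have H x y : x <= y -> `|Num.max a (Num.min b x) - Num.max a (Num.min b y)| <= `|x - y|.
  move=> xy; have /andP[h1 h2] := clamp_lip a b xy.
  by rewrite distrC (distrC x) ger0_norm// ger0_norm// subr_ge0.
have /orP[/H//|/H] := le_total s t.
by rewrite distrC (distrC t).
Qed.

Lemma bm_clamp a b f : a <= b -> measurable_fun setT f ->
  bm (fun s => Num.max a (Num.min b (f s))).
Proof.
move=> ab mf; split.
  by apply: measurable_maxr => //; apply: measurable_minr.
exists (`|a| + `|b|) => s; have /andP[h1 h2] := clamp_ge (f s) ab.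
rewrite ler_norml; have := ler_norm b; have := ler_norm (- a).
rewrite normrN; have := normr_ge0 a; have := normr_ge0 b; lra.
Qed.

(** A cover of a null set by intervals of small total length is, up to the
    factor K, a cover of small Stieltjes measure. *)
Lemma stieltjes_null (G : cumulative R R) K : 0 < K ->
  (forall s t, s <= t -> G t - G s <= K * (t - s)) ->
  lebesgue_stieltjes_measure G `<< mu.
Proof.
move=> K0 GK; apply/null_content_dominatesP => A mA muA0.
apply/eqP; rewrite eq_le measure_ge0 andbT; apply/lee_addgt0Pr => e e0.
rewrite add0e.
have : (mu A < (e / K)%:E)%E by rewrite muA0 lte_fin divr_gt0.
move=> /ereal_inf_lt [_ [F [mF AF] <-] Fe].
apply: (@le_trans _ _ (\sum_(k <oo) wlength G (F k))%E).
  by apply: ereal_inf_lbound; exists F.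
have -> : e%:E = (K%:E * (e / K)%:E)%E by rewrite -EFinM mulrC divfK// gt_eqF.
apply: (@le_trans _ _ (K%:E * \sum_(k <oo) wlength idfun (F k))%E); last first.
  by rewrite lee_pmul2l//; exact: ltW.
rewrite -nneseriesZl//.
apply: lee_nneseries => // k _.
have [[p q] _ <-] := mF k.
have [pq|qp] := leP p q; last first.
  by rewrite set_itv_ge /= ?wlength0 ?mule0// bnd_simp -leNgt ltW.
by rewrite !wlength_itv_bnd//= -EFinM lee_fin GK.
Qed.

End fundamental_theorem.

Section derivatives.
Context {R : realType}.
Implicit Types (f g h : R -> R) (a b c C L t d : R).

(** The approximation form has no quotient, so y = t needs no separate
    treatment; the rules below come from it. *)
Lemma is_deriveP f t d : is_derive t 1 f d <->
  forall e : R, 0 < e -> exists2 r : R, 0 < r &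
    forall y, `|y - t| < r -> `|f y - f t - d * (y - t)| <= e * `|y - t|.
Proof.
split=> [[/cvg_ex[/= l fl] dE] e e0|H].
  have ld : l = d.
    by rewrite -dE; apply/esym/cvg_lim => //; exact: norm_hausdorff.
  rewrite {}ld in fl.
  move/cvgrPdist_le : fl => /(_ _ e0) [r /= r0 rP].
  exists r => // y yr.
  have [->|yt] := eqVneq y t; first by rewrite !subrr mulr0 subr0 normr0 mulr0.
  have yt0 : y - t != 0 by rewrite subr_eq0.
  have := rP (y - t); rewrite /ball_ /= sub0r normrN yr => /(_ isT yt0).
  rewrite [_%:A]mulr1 subrK => h.
  have -> : f y - f t - d * (y - t) =
      - (d - (y - t)^-1 *: (f y - f t)) * (y - t).
    by rewrite /GRing.scale/=; field.
  by rewrite normrM normrN ler_wpM2r.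
have fl : h^-1 *: (f (h *: (1 : R) + t) - f t) @[h --> 0^'] --> d.
  apply/cvgrPdist_le => e e0; have [r r0 rP] := H _ e0.
  exists r => //= k; rewrite /ball_/= sub0r normrN => kr k0.
  have := rP (k + t); rewrite addrK kr => /(_ isT).
  rewrite [k%:A]mulr1 => hk.
  have -> : d - k^-1 *: (f (k + t) - f t) =
     - (f (k + t) - f t - d * k) / k.
    by rewrite /GRing.scale/=; field.
  by rewrite normrM normrN normfV ler_pdivrMr// normr_gt0.
by apply: DeriveDef; [apply/cvg_ex; exists d|exact/cvg_lim].
Qed.

Lemma is_derive_near f g t d r : 0 < r ->
  (forall y, `|y - t| < r -> f y = g y) -> is_derive t 1 f d -> is_derive t 1 g d.
Proof.
move=> r0 fg /is_deriveP fd; apply/is_deriveP => e /fd [r' r'0 r'P].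
exists (Num.min r r'); first by rewrite lt_min r0.
move=> y; rewrite lt_min => /andP[yr yr']; rewrite -!fg ?subrr ?normr0//.
exact: r'P.
Qed.

Lemma is_derive_uniq f t d d' : is_derive t 1 f d -> is_derive t 1 f d' -> d = d'.
Proof. by move=> h h'; rewrite -(@derive_val _ _ _ _ _ _ _ h) (@derive_val _ _ _ _ _ _ _ h'). Qed.

Lemma is_derive_ub f t d L : is_derive t 1 f d ->
  (exists2 r : R, 0 < r & forall y, t < y < t + r -> f y - f t <= L * (y - t)) ->
  d <= L.
Proof.
move=> /is_deriveP fd [r r0 fL]; apply/ler_addgt0Pr => e /fd [r' r'0 r'P].
pose k := Num.min r r' / 2.
have k0 : 0 < k by rewrite divr_gt0// lt_min r0.
have [kr kr'] : k < r /\ k < r'.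
  have : Num.min r r' <= r by rewrite ge_min lexx.
  have : Num.min r r' <= r' by rewrite ge_min lexx orbT.
  by rewrite /k in k0 *; lra.
have := fL (t + k); rewrite ltrDl k0 ltrD2l kr addrAC subrr add0r => /(_ isT) h1.
have := r'P (t + k); rewrite addrAC subrr add0r gtr0_norm// kr' => /(_ isT).
rewrite ler_norml => /andP[h2 _].
rewrite -(ler_pM2r k0) mulrDl; lra.
Qed.

Lemma is_deriveN f t d : is_derive t 1 f d -> is_derive t 1 (fun s => - f s) (- d).
Proof.
move=> /is_deriveP fd; apply/is_deriveP => e /fd [r r0 rP]; exists r => // y /rP.
by rewrite -normrN; congr (`|_| <= _); ring.
Qed.

Lemma is_deriveDf f g t d d' : is_derive t 1 f d -> is_derive t 1 g d' ->
  is_derive t 1 (fun s => f s + g s) (d + d').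
Proof. by move=> h h'; exact: is_deriveD. Qed.

Lemma is_deriveBf f g t d d' : is_derive t 1 f d -> is_derive t 1 g d' ->
  is_derive t 1 (fun s => f s - g s) (d - d').
Proof. by move=> h h'; apply: is_deriveDf => //; exact: is_deriveN. Qed.

Lemma is_derive_idf t : is_derive t 1 (fun s => s) (1 : R).
Proof. exact: is_derive_id. Qed.

Lemma is_deriveZf f t d c : is_derive t 1 f d -> is_derive t 1 (fun s => c * f s) (c * d).
Proof. by move=> h; exact: is_deriveZ. Qed.

Lemma is_derive_cstf t c : is_derive t 1 (fun=> c) (0 : R).
Proof. exact: is_derive_cst. Qed.

Lemma is_derive_lb f t d L : is_derive t 1 f d ->
  (exists2 r : R, 0 < r & forall y, t < y < t + r -> L * (y - t) <= f y - f t) ->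
  L <= d.
Proof.
move=> /is_deriveN fd [r r0 fL]; rewrite -lerN2; apply: (is_derive_ub fd).
by exists r => // y /fL; lra.
Qed.

(** For the end points of the intervals on which a monotone function is
    constant. *)
Lemma is_derive_const_side f t d s : is_derive t 1 f d -> s != t ->
  (forall y, Num.min s t <= y <= Num.max s t -> f y = f t) -> d = 0.
Proof.
move=> /is_deriveP fd st fc; apply/eqP; rewrite -normr_le0.
apply/ler_addgt0Pr => e /fd [r r0 rP]; rewrite add0r.
have st0 : 0 < `|s - t| by rewrite normr_gt0 subr_eq0.
pose k := Num.min (r / `|s - t|) 1 / 2.
have k0 : 0 < k by rewrite divr_gt0 ?lt_min ?divr_gt0 ?ltr01 ?ltr0n.
have kr : k < r / `|s - t|.
  have : Num.min (r / `|s - t|) 1 <= r / `|s - t| by rewrite ge_min lexx.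
  by rewrite /k in k0 *; lra.
have k1 : k < 1.
  have : Num.min (r / `|s - t|) 1 <= 1 by rewrite ge_min lexx orbT.
  by rewrite /k; lra.
clearbody k.
have := rP (t + k * (s - t)); rewrite addrAC subrr add0r normrM gtr0_norm//.
rewrite -ltr_pdivlMr// kr => /(_ isT).
rewrite fc; last by case: (ltgtP s t) st => // ? _; apply/andP; split; nra.
rewrite subrr sub0r normrN !normrM (gtr0_norm k0) ler_pM2r//.
by rewrite mulr_gt0.
Qed.

Lemma is_derive_compf f g t d d' : is_derive t 1 g d -> is_derive (g t) 1 f d' ->
  is_derive t 1 (fun s => f (g s)) (d' * d).
Proof.
move=> /is_deriveP gd /is_deriveP fd; apply/is_deriveP => e e0.
have D1 : 0 < `|d| + 1 by rewrite ltr_wpDl.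
have D2 : 0 < `|d'| + 1 by rewrite ltr_wpDl.
have [r r0 rP] := fd _ (divr_gt0 (divr_gt0 e0 (@ltr0n R 2)) D1).
have [r1 r10 r1P] := gd _ (@ltr01 R).
have [r2 r20 r2P] := gd _ (divr_gt0 (divr_gt0 e0 (@ltr0n R 2)) D2).
exists (Num.min (Num.min r1 r2) (r / (`|d| + 1))).
  by rewrite !lt_min r10 r20 divr_gt0.
move=> y; rewrite !lt_min ltr_pdivlMr// => /andP[/andP[/r1P h1 /r2P h2] yr].
have gy : `|g y - g t| <= `|y - t| * (`|d| + 1).
  have -> : g y - g t = (g y - g t - d * (y - t)) + d * (y - t) by ring.
  rewrite (le_trans (ler_normD _ _))// normrM; lra.
have {}h3 := rP _ (le_lt_trans gy yr).
have -> : f (g y) - f (g t) - d' * d * (y - t) =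
  (f (g y) - f (g t) - d' * (g y - g t)) + d' * (g y - g t - d * (y - t)) by ring.
rewrite (le_trans (ler_normD _ _))// normrM.
have {}h3 : `|f (g y) - f (g t) - d' * (g y - g t)| <= e / 2 * `|y - t|.
  rewrite (le_trans h3)// mulrAC ler_pdivrMr// -[leRHS]mulrA.
  by rewrite ler_wpM2l// divr_ge0// ltW.
have : `|d'| * `|g y - g t - d * (y - t)| <= e / 2 * `|y - t|.
  rewrite (@le_trans _ _ ((`|d'| + 1) * `|g y - g t - d * (y - t)|))//.
    by rewrite ler_wpM2r// lerDl.
  rewrite mulrC -ler_pdivlMr// (le_trans h2)// le_eqVlt; apply/orP; left.
  by apply/eqP; ring.
lra.
Qed.

(** Where the inner derivative vanishes, the chain rule holds for outer
    functions that are merely Lipschitz along g. *)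
Lemma is_derive_comp0 f g t C : is_derive t 1 g 0 ->
  (exists2 r : R, 0 < r & forall y, `|y - t| < r -> `|f y - f t| <= C * `|g y - g t|) ->
  is_derive t 1 f 0.
Proof.
move=> /is_deriveP gd [r r0 fC]; apply/is_deriveP => e e0.
have C1 : 0 < `|C| + 1 by rewrite ltr_wpDl.
have [r' r'0 r'P] := gd _ (divr_gt0 e0 C1).
exists (Num.min r r'); first by rewrite lt_min r0.
move=> y; rewrite lt_min => /andP[/fC h1 /r'P]; rewrite !mul0r !subr0 => h2.
rewrite (le_trans h1)// (@le_trans _ _ ((`|C| + 1) * `|g y - g t|))//.
  by rewrite ler_wpM2r// (le_trans (ler_norm _))// lerDl.
by rewrite -ler_pdivlMl// mulrA [_^-1 * _]mulrC.
Qed.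

Lemma is_derive_rVP (n : nat) (F : R -> 'rV[R]_n) t (D : 'rV[R]_n) :
  is_derive t 1 F D <-> forall i, is_derive t 1 (fun s => F s ord0 i) (D ord0 i).
Proof.
split=> [[Fd FD] i|H].
  move/derivable_mxP : (Fd) => Fdi.
  apply: DeriveDef; first exact: Fdi.
  by rewrite -FD derive_mx// mxE.
have Fd : derivable F t 1.
  by apply/derivable_mxP => i j; rewrite (ord1 i); case: (H j).
apply: DeriveDef => //; rewrite derive_mx//; apply/rowP => j; rewrite mxE.
by case: (H j).
Qed.

Lemma is_derive1E f t d : is_derive t 1 f d -> derive1 f t = d.
Proof. by case=> _ <-; rewrite derive1E. Qed.

End derivatives.

Section lipschitz_ftc.
Context {R : realType}.
Implicit Types (f g h : R -> R) (a b c C L : R).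
Local Notation mu := (@lebesgue_measure R).

Lemma is_derive_lip a b L f t d : lip_on a b L f -> a < t < b ->
  is_derive t 1 f d -> `|d| <= L.
Proof.
move=> lf /andP[a_t tb] fd; rewrite ler_norml; apply/andP; split.
  apply: (is_derive_lb fd); exists (b - t); first by rewrite subr_gt0.
  move=> y /andP[ty yb]; have := lf t y (ltW a_t) (ltW ty).
  by rewrite ler_norml => /(_ _)/andP[|? ?]; lra.
apply: (is_derive_ub fd); exists (b - t); first by rewrite subr_gt0.
move=> y /andP[ty yb]; have := lf t y (ltW a_t) (ltW ty).
by rewrite ler_norml => /(_ _)/andP[|? ?]; lra.
Qed.

(** Rademacher's theorem on the line, with the fundamental theorem of calculus.
    After adding L t the function is nondecreasing, and it is the distribution
    function of a Stieltjes measure that is absolutely continuous by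
    stieltjes_null; its Radon-Nikodym density is the derivative a.e. by
    Lebesgue differentiation. The derivative is clamped so that its bound holds
    everywhere. *)
Lemma lip_derive a b L f : a < b -> 0 <= L -> lip_on a b L f ->
  exists h, [/\ bm h, forall t, `|h t| <= L,
    {ae mu, forall t, a < t < b -> is_derive t 1 f (h t)} &
    forall s t, a <= s -> s <= t -> t <= b -> integ s t h = f t - f s].
Proof.
move=> ab L0 lf.
pose cl t := Num.max a (Num.min b t).
have clab t : a <= cl t <= b by apply: clamp_ge; exact: ltW.
have cl_id t : a <= t <= b -> cl t = t by exact: clamp_id.
(* extended by constants, to be a function on the line *)
pose g t := f (cl t) + L * cl t.
have gB s t : s <= t -> 0 <= g t - g s <= (L + L + 1) * (t - s).
  move=> st; have /andP[c1 c2] := clamp_lip a b st.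
  have := lf (cl s) (cl t) (proj1 (andP (clab s))) _ (proj2 (andP (clab t))).
  rewrite -subr_ge0 c1 => /(_ isT); rewrite ler_norml -/(cl s) -/(cl t) in c1 c2 *.
  have : L * (cl t - cl s) <= L * (t - s) by rewrite ler_wpM2l.
  by rewrite /g => h1 /andP[h2 h3]; apply/andP; split; lra.
have ndg : {homo g : s t / s <= t}.
  by move=> s t /gB/andP[h _]; rewrite -subr_ge0.
have cg : continuous g.
  move=> t; apply/cvgrPdist_le => e e0; near=> s.
  have /ltW ts : `|t - s| < e / (L + L + 1).
    near: s; apply: cvgr_dist_lt => //; rewrite divr_gt0//; lra.
  have L3 : 0 < L + L + 1 by lra.
  rewrite ler_pdivlMr// mulrC in ts; apply: le_trans ts.
  have [st|/ltW ts] := leP s t.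
    have /andP[h1 h2] := gB _ _ st.
    by rewrite ger0_norm// ger0_norm ?subr_ge0.
  have /andP[h1 h2] := gB _ _ ts.
  rewrite distrC ger0_norm//; by rewrite distrC ger0_norm ?subr_ge0.
pose G0 := isCumulative.Build R _ R g ndg (right_continuousW cg).
pose G : cumulative R R := HB.pack g G0.
pose nu := lebesgue_stieltjes_measure G.
have nuE s t : s <= t -> nu `]s, t]%classic = (g t - g s)%:E.
  move=> st; rewrite /nu /lebesgue_stieltjes_measure /measure_extension.
  by rewrite measurable_mu_extE/= ?wlength_itv_bnd//; exact: is_ocitv.
have nufin : (nu `]a, b]%classic < +oo)%E by rewrite nuE ?ltry// ltW.
pose nu' : {finite_measure set (measurableTypeR R) -> \bar R} :=
  @mfrestr _ (measurableTypeR R) R `]a, b]%classic nu (measurable_itv _) nufin.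
have nu'mu : nu' `<< mu.
  apply/null_content_dominatesP => A mA A0.
  have /null_content_dominatesP numu : nu `<< mu.
    apply: (@stieltjes_null _ G (L + L + 1)); first by lra.
    by move=> s t /gB/andP[].
  apply/eqP; rewrite eq_le measure_ge0 andbT.
  rewrite -[X in (_ <= X)%E](numu A mA A0) [leLHS]/(nu (A `&` `]a, b]%classic)).
  by apply: le_measure; rewrite ?inE//; exact: measurableI.
have [d [d0 dfin di dE]] := radon_nikodym_sigma_finite nu'mu.
pose dr := fine \o d.
have dE' : EFin \o dr = d by apply/funext => t; rewrite /= fineK.
have mdr : measurable_fun setT dr.
  by apply/measurable_EFinP; rewrite dE'; exact: measurable_int di.
have idr A : measurable A -> mu.-integrable A (EFin \o dr).
  by move=> mA; rewrite dE'; exact: integrableS di.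
have drE (s t : R) : a <= s -> s <= t -> t <= b ->
    (\int[mu]_(x in `[s, t]) (dr x)%:E = (g t - g s)%:E)%E.
  move=> as_ st tb; rewrite -integral_itv_obnd_cbnd//; last first.
    by apply/measurable_EFinP; exact: measurable_funTS.
  rewrite -nuE//; under eq_integral do rewrite /dr/= fineK//.
  rewrite -dE// [LHS]/(nu (`]s, t]%classic `&` `]a, b]%classic)) setIidl// => x/=.
  by rewrite !in_itv/= => /andP[sx xt]; rewrite (le_lt_trans as_)//= (le_trans xt).
have locdr : locally_integrable setT dr.
  by have := integrable_locally_restrict measurableT (idr _ measurableT); rewrite patch_setT.
have F1 := @FTC1 R dr (BLeft a) (fun y => idr _ (measurable_itv _)) locdr.
have fder : {ae mu, forall t, a < t < b -> is_derive t 1 f (dr t - L)}.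
  apply: aeS F1 => t + /andP[at0 tb]; have aLt : (a%:E < t%:E)%E by rewrite lte_fin.
  move=> /(_ aLt) [dt et].
  have Fd : is_derive t 1 (fun x => \int[mu]_(s in `[a, x]) dr s) (dr t).
    by apply: DeriveDef; [exact: dt | rewrite -derive1E; exact: et].
  have := is_deriveDf Fd (is_deriveBf (is_derive_cstf t (f a + L * a))
    (is_deriveZf L (is_derive_idf t))).
  rewrite sub0r mulr1; apply: (@is_derive_near _ _ _ _ _ (Num.min (t - a) (b - t))).
    by rewrite lt_min !subr_gt0 at0.
  move=> y; rewrite lt_min !ltr_norml => /andP[/andP[h1 h2] /andP[h3 h4]].
  have ay : a <= y by lra. have yb : y <= b by lra.
  rewrite /Rintegral drE//= /g !cl_id ?lexx ?ay ?yb ?(ltW ab)//; ring.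
pose h t := Num.max (- L) (Num.min L (dr t - L)).
have hE : {ae mu, forall t, a < t < b -> h t = dr t - L}.
  apply: aeS fder => t + tab => /(_ tab) /(is_derive_lip lf tab).
  by rewrite ler_norml => ?; exact: clamp_id.
have bh : bm h by apply: bm_clamp; [lra | apply: measurable_funB].
exists h; split => //.
- by move=> t; rewrite ler_norml; apply: clamp_ge; lra.
- by apply: aeS (aeI fder hE) => t [+ +] tab => /(_ tab) ? /(_ tab) ->.
move=> s t as_ st tb.
have : integ s t (fun x => h x + L) = g t - g s.
  have -> : g t - g s = fine (g t - g s)%:E by [].
  rewrite -drE// /integ /Rintegral; congr fine; apply: ae_eq_integral => //.
  - apply/measurable_EFinP/measurable_funTS; apply: measurable_funD => //.
    by case: bh.
  - exact/measurable_EFinP/measurable_funTS.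
  apply: aeS (aeI hE (aeI (ae_ne a) (ae_ne b))) => x [h1 [xa xb]] /=.
  rewrite in_itv/= => /andP[sx xt]; rewrite h1 ?subrK//.
  rewrite !lt_neqAle eq_sym xa xb (le_trans as_ sx) (le_trans xt tb)//.
rewrite integ_D//; last exact: bm_cst.
rewrite integ_cst// /g !cl_id ?as_ ?tb ?(le_trans as_ st) ?(le_trans st tb)//.
by move=> e; lra.
Unshelve. all: by end_near. Qed.

End lipschitz_ftc.

(** * Absolute continuity and change of variable *)

Section absolute_continuity.
Context {R : realType}.
Implicit Types (a b c e t : R) (G : set R).
Local Notation mu := (@lebesgue_measure R).

(** The points up to which the bound holds form a set that contains its
    supremum and can be continued beyond any point before b. Pointwise
    differential information becomes global in this way, without covering
    lemmas. *)
Lemma local_majorization (q : R -> R -> R) (F : R -> R) a b : a <= b ->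
  (forall s r t, a <= s -> s <= r -> r <= t -> t <= b -> q s t <= q s r + q r t) ->
  (forall t, a <= t <= b -> exists2 r : R, 0 < r & forall x y,
     a <= x -> y <= b -> t - r < x -> x <= t -> t <= y -> y < t + r ->
     q x y <= F y - F x) ->
  q a b <= F b - F a.
Proof.
move=> ab qD loc.
pose S := [set t | a <= t <= b /\ q a t <= F t - F a].
have Sa : S a.
  split; first by rewrite lexx.
  by have [|r r0] := loc a; [rewrite lexx | apply=> //; lra].
have hS : has_sup S.
  by split; [exists a | exists b => t [/andP[_ ->]]].
pose c := sup S.
have leS t : S t -> t <= c by move=> St; apply: ub_le_sup => //; exact: hS.2.
have ac : a <= c by exact: leS.
have cb : c <= b by apply: ge_sup; [exists a | move=> t [/andP[_ ->]]].
have [r r0 rP] := loc c (introT andP (conj ac cb)).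
have [t [tab St] ct] := sup_adherent r0 hS.
have tc : t <= c by exact: leS.
case/andP: tab => a_t tb.
have H y : c <= y -> y <= b -> y < c + r -> q a y <= F y - F a.
  move=> cy yb yr; have := rP t y a_t yb ct tc cy yr.
  have := qD a t y (lexx _) a_t (le_trans tc cy) yb; lra.
have [cb'|bc] := ltP c b; last first.
  by have -> : b = c by [lra]; apply: H; lra.
pose y := Num.min b (c + r / 2).
have yb : y <= b by rewrite ge_min lexx.
have yr : y <= c + r / 2 by rewrite ge_min lexx orbT.
have cy : c < y by rewrite lt_min cb' ltrDl divr_gt0.
have : S y by split; [apply/andP; split; lra | apply: H; lra].
by move=> /leS; lra.
Qed.

Let family a t G (N : nat) (p q : 'I_N -> R) :=
  [/\ forall i, a <= p i /\ p i <= q i /\ q i <= t,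
      trivIset setT (fun i => `]p i, q i[%classic) &
      forall i, `]p i, q i[%classic `<=` G].

Lemma family_measure a t G N (p q : 'I_N -> R) : measurable G ->
  family a t G p q -> ((\sum_(i < N) (q i - p i))%:E <= mu G)%E.
Proof.
move=> mG [pq tI pqG].
have -> : ((\sum_(i < N) (q i - p i))%:E = \sum_(i < N) mu `]p i, q i[%classic)%E.
  rewrite -sumEFin; apply: eq_bigr => i _; rewrite lebesgue_measure_itv/= lte_fin.
  have [_ [pqi _]] := pq i; case: ltgtP pqi => // -> _; by rewrite subrr.
rewrite -(measure_bigsetU_ord mu predT)//; apply: le_measure; rewrite ?inE//.
  exact: bigsetU_measurable.
apply: (big_ind (fun A => A `<=` G)) => [|A B AG BG x []|i _]; [exact: sub0set|exact: AG|exact: BG|exact: pqG].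
Qed.

(** The majorant at t is the supremum of the sums of increments of f over
    families of intervals inside G before t. Absolute continuity makes all
    these sums small, and adjoining the interval from x to y to a family before
    x bounds the increment. The set G stands for a neighbourhood of the
    exceptional null set of an equation that holds a.e. *)
Lemma ac_small_majorant d (f : R -> 'rV[R]_d) a b e : a <= b ->
  abs_continuous a b f -> 0 < e -> exists2 r : R, 0 < r & forall G,
    measurable G -> (mu G < r%:E)%E -> exists phi : R -> R,
    [/\ forall s t, a <= s -> s <= t -> t <= b -> phi s <= phi t,
        phi b - phi a <= e &
        forall x y, a <= x -> x <= y -> y <= b -> `]x, y[%classic `<=` G ->
          enorm (f y - f x) <= phi y - phi x].
Proof.
move=> ab fAC e0; have [r r0 rP] := fAC _ e0; exists r => // G mG Gr.
pose V t := [set z | exists N (p q : 'I_N -> R), family a t G p q /\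
   z = \sum_(i < N) enorm (f (q i) - f (p i))].
have V0 t : V t 0.
  exists 0%N, (fun=> 0), (fun=> 0); split; last by rewrite big_ord0.
  by split; [case|case|case].
have Ve t z : t <= b -> V t z -> z <= e.
  move=> tb [N [p [q [[pq tI pqG] ->]]]]; apply/ltW/rP => //.
    by move=> i; have [? [? ?]] := pq i; split => //; split=> //; exact: le_trans tb.
  rewrite -lte_fin; apply: le_lt_trans Gr; exact: (family_measure mG).
have Vsup t : t <= b -> has_sup (V t).
  by move=> tb; split; [exists 0 | exists e => z; exact: Ve].
exists (fun t => sup (V t)); split.
- move=> s t as_ st tb; apply: ge_sup; first by exists 0.
  move=> z [N [p [q [[pq tI pqG] ->]]]]; apply: ub_le_sup; first exact: (Vsup _ tb).2.
  exists N, p, q; split => //; split => // i; have [? [? ?]] := pq i.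
  by split => //; split => //; exact: le_trans st.
- have : sup (V b) <= e by apply: ge_sup; [exists 0 | move=> z; exact: Ve].
  have : 0 <= sup (V a) by apply: ub_le_sup => //; exact: (Vsup _ ab).2.
  lra.
move=> x y ax xy yb xyG; rewrite lerBrDr addrC.
apply/ler_addgt0Pr => e' e'0.
have [_ [N [p [q [[pq tI pqG] ->]]]] zs] := sup_adherent e'0 (Vsup x (le_trans xy yb)).
suff : \sum_(i < N) enorm (f (q i) - f (p i)) + enorm (f y - f x) <= sup (V y) by lra.
apply: ub_le_sup; first exact: (Vsup _ yb).2.
pose ext (u : 'I_N -> R) z (i : 'I_N.+1) := if unlift ord_max i is Some j then u j else z.
have wid (i : 'I_N) : widen_ord (leqnSn N) i = lift ord_max i.
  by apply: ord_inj; rewrite lift_max.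
have extw u z i : ext u z (widen_ord (leqnSn N) i) = u i by rewrite /ext wid liftK.
have extm u z : ext u z ord_max = z by rewrite /ext unlift_none.
exists N.+1, (ext p x), (ext q y); split; last first.
  by rewrite big_ord_recr/= !extm; congr (_ + _); apply: eq_bigr => i _; rewrite !extw.
split.
- move=> i; rewrite /ext; case: unliftP => [j _|_]; last by [].
  by have [? [? ?]] := pq j; split => //; split => //; exact: le_trans xy.
- move=> i j _ _; rewrite /ext; case: unliftP => [i' ->|->]; case: unliftP => [j' ->|->] //.
  + by move=> /(tI _ _ I I) ->.
  + move=> [z /= []]; rewrite !in_itv/= => /andP[_ h1] /andP[h2 _].
    by have [_ [_ h3]] := pq i'; have := lt_trans h2 (lt_le_trans h1 h3); rewrite ltxx.
  + move=> [z /= []]; rewrite !in_itv/= => /andP[h2 _] /andP[_ h1].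
    by have [_ [_ h3]] := pq j'; have := lt_trans h2 (lt_le_trans h1 h3); rewrite ltxx.
- move=> i; rewrite /ext; case: unliftP => [j _|_] //; exact: pqG.
Qed.

End absolute_continuity.

Section change_of_variable.
Context {R : realType}.
Implicit Types (a b c e t C L : R) (G : set R) (f g h phi : R -> R).
Local Notation mu := (@lebesgue_measure R).

Lemma ae_open (P : R -> Prop) e : {ae mu, forall t, P t} -> 0 < e ->
  exists G, [/\ open G, (mu G < e%:E)%E & forall t, ~ G t -> P t].
Proof.
move=> [A [mA A0 PA]] e0.
have A0' : lebesgue_measure A = 0%E := A0.
have [|G [oG AG GA]] := lebesgue_regularity_outer mA _ e0.
  by apply: (@le_lt_trans _ _ 0%E); rewrite ?ltry// -[leRHS]A0'.
exists G; split => //; last by move=> t Gt; apply: contrapT => /PA/AG.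
rewrite (le_lt_trans _ GA)// -[in leLHS](setDUK AG).
have mG : measurable G by exact: open_measurable.
apply: (le_trans (measureU2 mu mA (measurableD mG mA))).
by rewrite [X in (X + _)%E](A0' : mu A = 0%E) add0e.
Qed.

Lemma integ_incr a s t h : bm h -> a <= s -> s <= t ->
  integ a t h - integ a s h = integ s t h.
Proof. by move=> bh as_ st; rewrite (integ_cat bh as_ st) addrAC subrr add0r. Qed.

Lemma integ_lip a b C h : bm h -> (forall t, `|h t| <= C) ->
  lip_on a b C (fun t => integ a t h).
Proof.
move=> bh hC s t as_ st tb; rewrite integ_incr//; exact: integ_bound.
Qed.

Lemma integ_eq0_ae a b f : bm f -> {ae mu, forall t, a < t < b -> 0 <= f t} ->
  integ a b f <= 0 -> {ae mu, forall t, a < t < b -> f t = 0}.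
Proof.
move=> bf f0 If.
have bnf := bm_norm bf.
have : integ a b (fun s => `|f s|) <= 0.
  apply: le_trans If; rewrite le_eqVlt; apply/orP; left; apply/eqP.
  by apply: integ_eq_ae => //; apply: aeS f0 => t + tab => /(_ tab) /ger0_norm.
rewrite /integ /Rintegral => h.
have : (\int[mu]_(x in `[a, b]) `|(EFin \o f) x| = 0)%E.
  have /integrableP[_ h2] := bm_integrable a b bf.
  have h3 : (0 <= \int[mu]_(x in `[a, b]) `|(EFin \o f) x|)%E by exact: integral_ge0.
  apply/eqP; rewrite eq_le h3 andbT -[X in (X <= _)%E]fineK ?lee_fin//.
  by rewrite ge0_fin_numE.
have mf : measurable_fun `[a, b]%classic (EFin \o f).
  by apply/measurable_EFinP/measurable_funTS; case: bf.
move=> /(ae_eq_integral_abs mu (measurable_itv _) mf).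
apply: aeS => t H /andP[at_ tb].
by have [] : (EFin \o f) t = cst 0%E t by apply: H; rewrite /= in_itv/= !ltW.
Qed.

Lemma is_derive_integ_open a t h G : bm h -> a < t -> open G -> G t ->
  (forall s, G s -> h s = 1) -> is_derive t 1 (fun s => integ a s h) 1.
Proof.
move=> bh at0 oG Gt h1.
have [r /= r0 rG] : exists2 r : R, 0 < r & ball t r `<=` G.
  by have /nbhs_ballP[r r0 rG] := open_nbhs_nbhs (conj oG Gt); exists r.
have := is_derive_idf t.
have k0 : 0 < Num.min r (t - a) by rewrite lt_min r0 subr_gt0.
have := is_deriveDf (is_derive_cstf t (integ a t h - t)) (is_derive_idf t).
rewrite add0r => + _; apply: (is_derive_near k0) => y.
rewrite lt_min !ltr_norml => /andP[/andP[h2 h3] /andP[h4 h5]].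
have E s s' : t - r < s -> s <= s' -> s' < t + r -> integ s s' h = s' - s.
  move=> rs ss' sr; rewrite (@integ_eq _ _ _ _ (cst 1)) ?integ_cst ?mul1r//.
  move=> z /andP[sz zs']; apply: h1; apply: rG.
  by rewrite /ball/= ltr_norml; apply/andP; split; lra.
have [ty|yt] := leP t y.
  rewrite (@integ_cat _ a t y _ bh)//; last lra.
  by rewrite (E t y)//; [ring|lra|lra].
rewrite (@integ_cat _ a y t _ bh)//; [|lra|lra].
by rewrite (E y t)//; [ring|lra|lra|lra].
Qed.

Lemma lip_continuous a b C f : a <= b -> lip_on a b C f ->
  continuous (fun t => f (Num.max a (Num.min b t))).
Proof.
move=> ab lf t; apply/cvgrPdist_le => e e0.
have C1 : 0 < `|C| + 1 by rewrite ltr_wpDl.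
near=> s.
have /ltW ts : `|t - s| < e / (`|C| + 1).
  by near: s; apply: cvgr_dist_lt => //; rewrite divr_gt0.
rewrite ler_pdivlMr// mulrC in ts; apply: le_trans ts.
have H x y : x <= y -> `|f (Num.max a (Num.min b y)) - f (Num.max a (Num.min b x))| <=
    (`|C| + 1) * (y - x).
  move=> xy; have /andP[h1 h2] := clamp_lip a b xy.
  have /andP[h3 _] := clamp_ge x ab; have /andP[_ h4] := clamp_ge y ab.
  rewrite (le_trans (lf _ _ h3 _ h4))//; first by rewrite -subr_ge0.
  rewrite (@le_trans _ _ (`|C| * (y - x)))//; last by rewrite ler_wpM2r ?lerDl// subr_ge0.
  by rewrite (le_trans (ler_wpM2r h1 (ler_norm C)))// ler_wpM2l.
have [ts|/ltW st] := leP t s.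
  by rewrite distrC (distrC t s) (@ger0_norm _ (s - t)) ?subr_ge0// H.
by rewrite (@ger0_norm _ (t - s)) ?subr_ge0// H.
Unshelve. all: by end_near. Qed.

Lemma lip_measurable a b C f : a <= b -> lip_on a b C f ->
  measurable_fun setT (fun t => f (Num.max a (Num.min b t))).
Proof. by move=> ab /(lip_continuous ab); exact: continuous_measurable_fun. Qed.

(** A monotone Lipschitz phi has derivative zero almost everywhere over a null
    set B. Let G be an open set around B of measure at most e, and F t the
    measure of G below phi t; then F' = phi' where phi is in B, so the integral
    of phi' over the preimage of B is at most the increase of F, which is at
    most e. *)
Lemma lip_null a b L phi (P : R -> Prop) : a < b -> 0 <= L -> lip_on a b L phi ->
  (forall s t, a <= s -> s <= t -> t <= b -> phi s <= phi t) ->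
  {ae mu, forall t, P t} ->
  {ae mu, forall t, a < t < b -> P (phi t) \/ is_derive t 1 phi 0}.
Proof.
move=> ab L0 lphi ndphi aeP.
have [h [bh hL hd _]] := lip_derive ab L0 lphi.
have [B [mB B0 PB]] := aeP.
pose psi t := phi (Num.max a (Num.min b t)).
have mpsi : measurable_fun setT psi by exact: (lip_measurable (ltW ab) lphi).
have psiE t : a < t < b -> psi t = phi t.
  by move=> /andP[at_ tb]; rewrite /psi clamp_id// !ltW.
have h0 : {ae mu, forall t, a < t < b -> 0 <= h t}.
  apply: aeS hd => t + /[dup] tab /andP[at_ tb] => /(_ tab) td.
  apply: (is_derive_lb td); exists (b - t); first by rewrite subr_gt0.
  by move=> y /andP[ty yb]; rewrite mul0r subr_ge0 ndphi//; lra.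
pose k t := \1_B (psi t) * h t.
have bk : bm k.
  apply: bmM => //; have [m1 [C1 C1P]] := bm_indic mB; split; last by exists C1.
  exact: (measurableT_comp m1 mpsi).
have k0 : {ae mu, forall t, a < t < b -> 0 <= k t}.
  by apply: aeS h0 => t + tab => /(_ tab) ?; rewrite mulr_ge0// indicE ler0n.
suff Ik : integ a b k <= 0.
  apply: aeS (aeI hd (integ_eq0_ae bk k0 Ik)) => t [+ +] tab => /(_ tab) td /(_ tab).
  rewrite /k psiE//; have [Bt|Bt] := pselect (B (phi t)).
    by rewrite indicE mem_set// mul1r => h00; right; rewrite -h00.
  by move=> _; left; apply: contrapT => /PB.
apply/ler_addgt0Pr => e e0; rewrite add0r.
have aeB : {ae mu, forall t, ~ B t} by exists B; split => // t /=; exact: contrapT.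
have [G [oG Ge GP]] := ae_open aeB e0.
(* integrals start to the left of phi a, for differentiability at phi a *)
pose c := phi a - 1; pose g : R -> R := \1_G.
have mG : measurable G by exact: open_measurable.
have bg : bm g by exact: bm_indic.
have g01 t : 0 <= g t <= 1 by rewrite /g indicE; case: (_ \in _); rewrite ?ler01 ?lexx.
have gn t : `|g t| <= 1 by have /andP[? ?] := g01 t; rewrite ger0_norm.
pose F t := integ c t g.
have lF : lip_on a b L (fun t => F (phi t)).
  move=> s t as_ st tb; have ca : c <= phi s by rewrite /c lerBlDr ler_wpDr// ndphi//; lra.
  have := integ_lip bg gn ca (ndphi _ _ as_ st tb) (lexx _).
  rewrite mul1r => /le_trans; apply.
  by rewrite (le_trans (ler_norm _))// lphi.
have [h' [bh' _ hd' hI']] := lip_derive ab L0 lF.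
have kh' : {ae mu, forall t, a < t < b -> k t <= h' t}.
  apply: aeS (aeI hd hd') => t [+ +] /[dup] tab /andP[at_ tb] => /(_ tab) td /(_ tab) td'.
  have ct : c < phi t.
    by rewrite /c ltrBlDr (@le_lt_trans _ _ (phi t)) ?ltrDl// ndphi//; lra.
  have h'0 : 0 <= h' t.
    apply: (is_derive_lb td'); exists (b - t); first by rewrite subr_gt0.
    move=> y /andP[ty yb]; rewrite mul0r /F integ_incr ?(ltW ct) ?ndphi//; try lra.
    by apply: integ_ge0 => s _; have /andP[] := g01 s.
  rewrite /k psiE// indicE; have [Bt|Bt] := pselect (B (phi t)); last first.
    by rewrite memNset// mul0r.
  rewrite mem_set// mul1r.
  have Gt : G (phi t) by apply: contrapT => /GP.
  have g1 s : G s -> g s = 1 by move=> Gs; rewrite /g indicE mem_set.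
  have := is_derive_compf td (is_derive_integ_open bg ct oG Gt g1).
  by rewrite mul1r => /is_derive_uniq /(_ td') ->.
rewrite (le_trans (integ_le_ae bk bh' kh'))// hI'// ?(ltW ab)//.
have ab' := ndphi _ _ (lexx a) (ltW ab) (lexx b).
rewrite /F integ_incr//; last by rewrite /c; lra.
rewrite -lee_fin (le_trans _ (ltW Ge))//.
rewrite /integ /Rintegral fineK; last first.
  exact: integrable_fin_num (bm_integrable _ _ bg).
by rewrite integral_indic//; apply: measureIl => //; exact: measurable_itv.
Qed.

End change_of_variable.

Section fundamental_theorem_ac.
Context {R : realType}.
Implicit Types (a b c e t C L : R) (G : set R) (f g h phi : R -> R).
Local Notation mu := (@lebesgue_measure R).

(** Almost every t falls under one of two cases: phi t is a point where f is
    the derivative of its integral, and the chain rule applies; or phi has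
    derivative zero at t, and so has the integral, which is Lipschitz in its
    upper bound. *)
Lemma is_derive_integ_comp a b L phi f : a < b -> 0 <= L -> lip_on a b L phi ->
  (forall s t, a <= s -> s <= t -> t <= b -> phi s <= phi t) ->
  bm f ->
  {ae mu, forall t, a < t < b -> forall d, is_derive t 1 phi d ->
    is_derive t 1 (fun s => integ (phi a) (phi s) f) (f (phi t) * d)}.
Proof.
move=> ab L0 lphi nd bf; pose c := phi a - 1.
have aeF : {ae mu, forall t, c < t -> is_derive t 1 (fun s => integ c s f) (f t)}.
  exact: integ_derive.
have cphi t : a <= t -> t <= b -> c < phi t.
  move=> at_ tb; rewrite /c ltrBlDr (@le_lt_trans _ _ (phi t)) ?ltrDl//.
  exact: nd.
have [_ [C fC]] := bf.
apply: aeS (lip_null ab L0 lphi nd aeF) => t + /[dup] tab /andP[at_ tb].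
have k0 : 0 < Num.min (t - a) (b - t) by rewrite lt_min !subr_gt0 at_.
have near_in y : `|y - t| < Num.min (t - a) (b - t) -> a <= y /\ y <= b.
  by rewrite lt_min !ltr_norml => /andP[/andP[? ?] /andP[? ?]]; split; lra.
have pat : phi a <= phi t by apply: nd => //; exact: ltW.
have ctp : c < phi t by apply: cphi; exact: ltW.
move=> /(_ tab) [Fd|d0] d dphi; last first.
  have -> : d = 0 by exact: is_derive_uniq dphi d0.
  rewrite mulr0; apply: (is_derive_comp0 (C := C) d0); exists (Num.min (t - a) (b - t)) => //.
  move=> y /near_in[ay yb].
  have pay : phi a <= phi y by apply: nd.
  have [ty|/ltW yt] := leP t y.
    have pty : phi t <= phi y by apply: nd => //; exact: ltW.
    rewrite integ_incr// (@ger0_norm _ (phi y - phi t)) ?subr_ge0//.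
    by apply: integ_bound.
  have pyt : phi y <= phi t by apply: nd => //; exact: ltW.
  rewrite distrC (distrC (phi y)) integ_incr// (@ger0_norm _ (phi t - phi y)) ?subr_ge0//.
  by apply: integ_bound.
have := is_deriveBf (is_derive_compf dphi (Fd ctp)) (is_derive_cstf t (integ c (phi a) f)).
rewrite subr0; apply: (is_derive_near k0) => y /near_in[ay yb].
by rewrite integ_incr ?nd// /c; lra.
Qed.

(** Both sides are Lipschitz functions of t that start from zero and have the
    same derivative a.e.; this is why phi need not be injective. *)
Lemma integ_comp a b L phi f h : a < b -> 0 <= L -> lip_on a b L phi ->
  (forall s t, a <= s -> s <= t -> t <= b -> phi s <= phi t) ->
  measurable_fun setT phi -> bm f -> bm h ->
  {ae mu, forall t, a < t < b -> is_derive t 1 phi (h t)} ->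
  forall t, a <= t <= b ->
  integ (phi a) (phi t) f = integ a t (fun s => f (phi s) * h s).
Proof.
move=> ab L0 lphi nd mphi bf bh hd.
have [mf [C fC]] := bf.
have C0 : 0 <= C by apply: le_trans (fC 0).
pose F t := integ (phi a) (phi t) f.
have lF : lip_on a b (C * L) F.
  move=> s t as_ st tb; rewrite /F integ_incr ?nd//; last exact: le_trans tb.
  rewrite (le_trans (integ_bound bf _ (fun s _ => fC s))) ?nd// -mulrA ler_wpM2l//.
  by rewrite (le_trans (ler_norm _))// lphi.
have [k [bk _ kd kI]] := lip_derive ab (mulr_ge0 C0 L0) lF.
have bfh : bm (fun s => f (phi s) * h s).
  apply: bmM => //; split; last by exists C.
  exact: (measurableT_comp mf mphi).
move=> t /andP[at_ tb].
have -> : integ (phi a) (phi t) f = F t - F a by rewrite /F integ_aa subr0.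
rewrite -kI//; apply: integ_eq_ae => //.
have := is_derive_integ_comp ab L0 lphi nd bf.
move=> /(aeI hd) /(aeI kd); apply: aeS => s [h1 [h2 h3]] /andP[as_ st].
have sab : a < s < b by rewrite as_ (lt_le_trans st).
exact: is_derive_uniq (h1 sab) (h3 sab _ (h2 sab)).
Qed.

Lemma abs_continuous_row_mx d1 d2 (x : R -> 'rV[R]_d1) (u : R -> 'rV[R]_d2) a b :
  abs_continuous a b x -> abs_continuous a b u ->
  abs_continuous a b (fun t => row_mx (x t) (u t)).
Proof.
move=> xAC uAC e e0; have e2 : 0 < e / 2 by rewrite divr_gt0.
have [r r0 rP] := xAC _ e2; have [r' r'0 r'P] := uAC _ e2.
exists (Num.min r r'); first by rewrite lt_min r0.
move=> N p q pq tI; rewrite lt_min => /andP[/(rP N p q pq tI) h1 /(r'P N p q pq tI) h2].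
have -> : e = e / 2 + e / 2 by rewrite -splitr.
apply: le_lt_trans (ltrD h1 h2); rewrite -big_split/=; apply: ler_sum => i _.
by rewrite opp_row_mx add_row_mx enorm_row_mx.
Qed.

(** A function whose oscillations are controlled by those of an absolutely
    continuous one is constant as soon as its derivative vanishes a.e.:
    a small open set around the exceptional points carries little variation of
    the control, and elsewhere the increments are small relative to the step. *)
Lemma ac_derive0 d (w : R -> 'rV[R]_d) f a b C : a <= b -> 0 <= C ->
  abs_continuous a b w ->
  (forall s t (psi : R -> R), a <= s -> s <= t -> t <= b ->
     (forall x y, s <= x -> x <= y -> y <= t -> enorm (w y - w x) <= psi y - psi x) ->
     `|f t - f s| <= C * ((t - s) + (psi t - psi s))) ->
  {ae mu, forall t, a < t < b -> is_derive t 1 f 0} -> f b = f a.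
Proof.
move=> ab C0 wAC fw f0; apply/eqP; rewrite -subr_eq0 -normr_le0.
apply/ler_addgt0Pr => e0' e0'0; rewrite add0r.
(* F below increases by at most e times this number *)
pose K := C + C + (b - a) + 1.
have K0 : 0 < K by rewrite /K; lra.
pose e := e0' / K; have e0 : 0 < e by rewrite divr_gt0.
have [r r0 rP] := ac_small_majorant ab wAC e0.
have re0 : 0 < Num.min r e by rewrite lt_min r0.
have [G [oG Gre GP]] := ae_open (aeI f0 (aeI (ae_ne a) (ae_ne b))) re0.
have mG : measurable G by exact: open_measurable.
have [|phi [ndphi phie phiw]] := rP G mG.
  by rewrite (lt_le_trans Gre)// lee_fin ge_min lexx.
pose g : R -> R := \1_G; have bg : bm g by exact: bm_indic.
have g0 s : 0 <= g s by rewrite /g indicE ler0n.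
have Ig0 s t : 0 <= integ s t g by apply: integ_ge0.
(* the three terms pay, in this order, for the points where f has derivative zero,
   for the variation of w inside G and for the measure of G *)
pose F t := e * t + C * phi t + C * integ a t g.
have main : `|f b - f a| <= F b - F a.
  apply: (@local_majorization _ (fun s t => `|f t - f s|)) => //.
    move=> s t t' _ _ _ _; have -> : f t' - f s = (f t - f s) + (f t' - f t) by ring.
    exact: ler_normD.
  move=> t /andP[at_ tb].
  have FB x y : a <= x -> x <= y -> y <= b -> F y - F x =
      e * (y - x) + C * (phi y - phi x) + C * integ x y g.
    by move=> ax xy yb; rewrite /F -(integ_incr bg ax xy); ring.
  have [Gt|Gt] := pselect (G t).
    have [k /= k0 kG] : exists2 k : R, 0 < k & ball t k `<=` G.
      by have /nbhs_ballP[k k0 kG] := open_nbhs_nbhs (conj oG Gt); exists k.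
    exists k => // x y ax yb kx xt ty yk; have xy := le_trans xt ty.
    have inG z : x <= z <= y -> G z.
      move=> /andP[xz zy]; apply: kG; rewrite /ball/= ltr_norml; apply/andP; split; lra.
    have -> : F y - F x = e * (y - x) + C * (phi y - phi x) + C * (y - x).
      rewrite FB//; congr (_ + C * _).
      rewrite (@integ_eq _ _ _ _ (cst 1)) ?integ_cst ?mul1r//.
      by move=> z /inG Gz; rewrite /g indicE mem_set.
    have H x' y' : x <= x' -> x' <= y' -> y' <= y -> enorm (w y' - w x') <= phi y' - phi x'.
      move=> xx' x'y' y'y; apply: phiw => //; [exact: le_trans xx'|exact: le_trans yb|].
      move=> z /=; rewrite in_itv/= => /andP[h1 h2]; apply: inG.
      by rewrite (le_trans xx' (ltW h1)) (le_trans (ltW h2) y'y).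
    have := fw _ _ _ ax xy yb H.
    have : 0 <= e * (y - x) by rewrite mulr_ge0 ?(ltW e0) ?subr_ge0.
    lra.
  have [td [ta tb']] := GP _ Gt.
  have tab : a < t < b by rewrite !lt_neqAle at_ tb eq_sym ta tb'.
  have /is_deriveP/(_ e e0)[k k0 kP] := td tab.
  exists k => // x y ax yb kx xt ty yk; have xy := le_trans xt ty.
  rewrite FB//.
  have := kP x; have := kP y; rewrite !mul0r !subr0 !ltr_norml.
  move=> /(_ _)h1 /(_ _)h2.
  have {}h1 : `|f y - f t| <= e * (y - t).
    by rewrite -(@ger0_norm _ (y - t)) ?subr_ge0//; apply: h1; apply/andP; split; lra.
  have {}h2 : `|f x - f t| <= e * (t - x).
    rewrite -(@ger0_norm _ (t - x)) ?subr_ge0// (distrC t x).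
    by apply: h2; apply/andP; split; lra.
  have -> : f y - f x = (f y - f t) - (f x - f t) by ring.
  have := ler_normB (f y - f t) (f x - f t).
  have : 0 <= C * (phi y - phi x) by rewrite mulr_ge0// subr_ge0 ndphi.
  have : 0 <= C * integ x y g by rewrite mulr_ge0.
  lra.
rewrite (le_trans main)//.
have IG : integ a b g <= e.
  have : (integ a b g)%:E = (\int[mu]_(x in `[a, b]) (g x)%:E)%E.
    rewrite /integ /Rintegral fineK//.
    exact: integrable_fin_num (bm_integrable _ _ bg).
  rewrite integral_indic// => E; rewrite -lee_fin E.
  apply: le_trans (measureIl mu mG (measurable_itv _)) _.
  by rewrite (le_trans (ltW Gre))// lee_fin ge_min lexx orbT.
rewrite /F integ_aa.
have -> : e0' = e * (C + C + (b - a) + 1) by rewrite /e divfK// gt_eqF.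
have : C * (phi b - phi a) <= C * e by rewrite ler_wpM2l.
have : C * integ a b g <= C * e by rewrite ler_wpM2l.
lra.
Qed.

(** The difference between w and the integral of F has derivative zero a.e.,
    and its oscillations are controlled by those of w and of t. *)
Lemma ac_integ d (w : R -> 'rV[R]_d) (i : 'I_d) (F : R -> R) a b : a <= b ->
  abs_continuous a b w -> bm F ->
  {ae mu, forall t, a < t < b -> is_derive t 1 (fun s => w s ord0 i) (F t)} ->
  w b ord0 i = w a ord0 i + integ a b F.
Proof.
move=> ab wAC bF wF; have [mF [C FC]] := bF.
have C0 : 0 <= C by apply: le_trans (FC 0).
have C1 : 0 <= Num.max 1 C by rewrite le_max ler01.
have := @ac_derive0 _ w (fun t => w t ord0 i - integ a t F) a b (Num.max 1 C) ab C1 wAC.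
rewrite integ_aa subr0 => H; rewrite -[LHS](subrK (integ a b F)) H//.
  move=> s t psi as_ st tb wpsi.
  have -> : w t ord0 i - integ a t F - (w s ord0 i - integ a s F) =
    (w t - w s) ord0 i - integ s t F by rewrite -(integ_incr bF as_ st) !mxE; ring.
  rewrite (le_trans (ler_normB _ _))// addrC mulrDr lerD//.
    rewrite (le_trans (integ_bound bF st (fun s _ => FC s)))// ler_wpM2r ?subr_ge0//.
    by rewrite le_max lexx orbT.
  rewrite (le_trans (enorm_coord _ _))// (le_trans (wpsi _ _ _ _ _))//.
  by rewrite ler_peMl ?le_max ?lexx// (le_trans (enorm_ge0 _) (wpsi _ _ _ _ _)).
apply: aeS (aeI wF (integ_derive a bF)) => t [+ +] /[dup] tab /andP[at_ tb].
move=> /(_ tab) h1 /(_ at_) h2.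
by have := is_deriveBf h1 h2; rewrite subrr.
Qed.

End fundamental_theorem_ac.

(** * Total variation *)

Section total_variation.
Context {R : realType} {d : nat}.
Implicit Types (a b c e t x y C L : R) (f : R -> 'rV[R]_d) (F : R -> R).
Local Notation mu := (@lebesgue_measure R).

(** Total variation is used through majorants: the variation from a is the least of
    them (tv_le, var_majorant, var_min). Partitions occur only in the proof of this. *)
Definition majorant a b f F := forall x y, a <= x -> x <= y -> y <= b ->
  enorm (f y - f x) <= F y - F x.

Lemma evariation_cons a b f x s :
  evariation a b f (x :: s) = enorm (f x - f a) + evariation x b f s.
Proof. by rewrite /evariation /= big_nat_recl. Qed.

Lemma evariation_cat a b c f s s' : last a s = c ->
  evariation a b f (s ++ s') = evariation a c f s + evariation c b f s'.
Proof.
elim: s a => [|x s IH] a /=; first by move=> ->; rewrite {2}/evariation big_nil add0r.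
by move=> /IH h; rewrite !evariation_cons h addrA.
Qed.

Lemma evariation_ge0 a b f s : 0 <= evariation a b f s.
Proof. by apply: sumr_ge0 => i _; exact: enorm_ge0. Qed.

Lemma tv_ge_evar a b f s : itv_partition a b s ->
  ((evariation a b f s)%:E <= total_evariation a b f)%E.
Proof. by move=> h; apply: ereal_sup_ubound; exists s. Qed.

Lemma tv_le a b f F : a <= b -> majorant a b f F ->
  (total_evariation a b f <= (F b - F a)%:E)%E.
Proof.
move=> ab fF; apply: ge_ereal_sup => _ [s [ps ls] <-]; rewrite lee_fin.
elim: s a ab ps ls fF => [|x s IH] a ab /=.
  by move=> _ /eqP -> _; rewrite /evariation big_nil subrr.
move=> /andP[ax ps] ls fF.
have xb : x <= b.
  by apply: (@itv_partition_le _ _ x b s); split.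
rewrite evariation_cons; have := IH x xb ps ls.
have := fF a x (lexx _) (ltW ax) xb.
have fF' : majorant x b f F.
  by move=> y z xy; apply: fF; rewrite (le_trans (ltW ax)).
by move=> + /(_ fF'); lra.
Qed.

Lemma tv_partition a b f : a <= b -> (0 <= total_evariation a b f)%E.
Proof.
rewrite le_eqVlt => /predU1P[->|ab].
  by apply: le_trans (tv_ge_evar _ (s := [::]) _); [rewrite lee_fin evariation_ge0|].
apply: le_trans (tv_ge_evar f (s := [:: b]) _); first by rewrite lee_fin evariation_ge0.
by split => //=; rewrite ab.
Qed.

Lemma tv_ge a b f : a <= b -> ((enorm (f b - f a))%:E <= total_evariation a b f)%E.
Proof.
rewrite le_eqVlt => /predU1P[->|ab]; first by rewrite subrr enorm0 tv_partition.
apply: le_trans (tv_ge_evar f (s := [:: b]) _); last by split => //=; rewrite ab.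
by rewrite evariation_cons /evariation big_nil addr0.
Qed.

Lemma tv_superadd a c b f : a <= c -> c <= b ->
  (total_evariation a c f + total_evariation c b f <= total_evariation a b f)%E.
Proof.
move=> ac cb.
have [->|] := eqVneq (total_evariation a b f) +oo%E; first by rewrite leey.
have := tv_partition f (le_trans ac cb).
case E : (total_evariation a b f) => [B| |]// _ _.
have H1 s s' : itv_partition a c s -> itv_partition c b s' ->
    evariation a c f s + evariation c b f s' <= B.
  move=> [ps ls] [ps' ls']; rewrite -lee_fin -E -evariation_cat; last exact/eqP.
  by apply: tv_ge_evar; split; rewrite ?cat_path ?ps ?last_cat (eqP ls).
have H2 s' : itv_partition c b s' -> (total_evariation a c f <= (B - evariation c b f s')%:E)%E.
  move=> h'; apply: ge_ereal_sup => _ [s h <-]; rewrite lee_fin.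
  by have := H1 _ _ h h'; lra.
have [s0 h0] : exists s0, itv_partition c b s0.
  move: cb; rewrite le_eqVlt => /predU1P[->|cb]; first by exists [::]; split => /=.
  by exists [:: b]; split => //=; rewrite cb.
have := H2 _ h0; have := tv_partition f ac.
case: (total_evariation a c f) H2 => [A| |]// H2 _ _.
have : (total_evariation c b f <= (B - A)%:E)%E.
  apply: ge_ereal_sup => _ [s h <-]; rewrite lee_fin.
  by have := H2 _ h; rewrite lee_fin; lra.
have := tv_partition f cb.
by case: (total_evariation c b f) => [C| |]// _; rewrite -EFinD !lee_fin; lra.
Qed.

Definition var a b f := fine (total_evariation a b f).

Lemma varE a b f : a <= b -> (total_evariation a b f < +oo)%E ->
  total_evariation a b f = (var a b f)%:E.
Proof. by move=> ab fin; rewrite /var fineK// ge0_fin_numE// tv_partition. Qed.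

Lemma tv_sub_fin a x y b f : a <= x -> x <= y -> y <= b ->
  (total_evariation a b f < +oo)%E -> (total_evariation x y f < +oo)%E.
Proof.
move=> ax xy yb; apply: le_lt_trans.
apply: le_trans (tv_superadd f ax (le_trans xy yb)).
apply: (@le_trans _ _ (total_evariation x b f)); last by rewrite leeDr// tv_partition.
apply: le_trans (tv_superadd f xy yb).
by rewrite leeDl// tv_partition.
Qed.

Lemma var_ge0 a b f : a <= b -> 0 <= var a b f.
Proof. by move=> ab; rewrite fine_ge0// tv_partition. Qed.

Lemma var_aa a f : var a a f = 0.
Proof.
apply/eqP; rewrite eq_le var_ge0// andbT.
have h : majorant a a f (fun=> 0).
  move=> x y ax xy ya; have -> : x = y by apply/eqP; rewrite eq_le xy (le_trans ya).
  by rewrite !subrr enorm0.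
have := tv_le (lexx a) h; rewrite subrr => h'.
by rewrite -lee_fin -(varE (lexx a))// (le_lt_trans h')// ltry.
Qed.

Lemma var_superadd a x y b f : a <= x -> x <= y -> y <= b ->
  (total_evariation a b f < +oo)%E -> var x y f <= var a y f - var a x f.
Proof.
move=> ax xy yb fin; have := tv_superadd f ax xy.
have ay := le_trans ax xy.
rewrite (varE ax (tv_sub_fin (lexx a) ax (le_trans xy yb) fin)).
rewrite (varE xy (tv_sub_fin ax xy yb fin)) (varE ay (tv_sub_fin (lexx a) ay yb fin)).
by rewrite -EFinD lee_fin; lra.
Qed.

Lemma var_majorant a b f : (total_evariation a b f < +oo)%E ->
  majorant a b f (fun t => var a t f).
Proof.
move=> fin x y ax xy yb; apply: le_trans (var_superadd ax xy yb fin).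
by rewrite -lee_fin -(varE xy (tv_sub_fin ax xy yb fin)) tv_ge.
Qed.

Lemma var_nd a b f : (total_evariation a b f < +oo)%E ->
  forall x y, a <= x -> x <= y -> y <= b -> var a x f <= var a y f.
Proof.
move=> fin x y ax xy yb; rewrite -subr_ge0.
by apply: le_trans (var_superadd ax xy yb fin); exact: var_ge0.
Qed.

(** Otherwise var a _ f could be replaced between x and y by a majorant that
    grows less, which contradicts its minimality at y. *)
Lemma var_min a b f F x y : (total_evariation a b f < +oo)%E ->
  a <= x -> x <= y -> y <= b -> majorant x y f F ->
  var a y f - var a x f <= F y - F x.
Proof.
move=> fin ax xy yb fF.
pose F' t := if t <= x then var a t f else var a x f + F t - F x.
have fF' : majorant a y f F'.
  move=> s t as_ st ty; rewrite /F'; case: (leP t x) => tx; case: (leP s x) => sx.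
  - by apply: (var_majorant fin) => //; exact: le_trans tx (le_trans xy yb).
  - by have := lt_le_trans sx st; rewrite ltNge tx.
  - apply: le_trans (enorm_triangle (f x) _ _) _.
    have h1 := fF x t (lexx _) (ltW tx) ty.
    have h2 := var_majorant fin as_ sx (le_trans xy yb).
    by lra.
  - by have := fF s t (ltW sx) st ty; lra.
have := tv_le (le_trans ax xy) fF'.
rewrite (varE (le_trans ax xy) (tv_sub_fin (lexx a) (le_trans ax xy) yb fin)) lee_fin /F' ax var_aa subr0.
case: (leP y x) => yx; last by lra.
have -> : y = x by apply/eqP; rewrite eq_le yx.
by lra.
Qed.

(** Along h, a majorant of f is a majorant of f o h, and along a monotone right
    inverse of h a majorant of f o h is one of f. *)
Lemma tv_comp a b f (h : R -> R) : a <= b ->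
  (forall s t, a <= s -> s <= t -> t <= b -> h s <= h t) ->
  (forall y, h a <= y <= h b -> exists2 x, a <= x <= b & h x = y) ->
  total_evariation a b (f \o h) = total_evariation (h a) (h b) f.
Proof.
move=> ab nd surj; have hab := nd _ _ (lexx a) ab (lexx b).
apply/eqP; rewrite eq_le; apply/andP; split.
  have [->|] := eqVneq (total_evariation (h a) (h b) f) +oo%E; first by rewrite leey.
  rewrite -ltey => fin; rewrite (varE hab fin) -[var _ _ _]subr0 -(var_aa (h a) f).
  apply: (tv_le (F := fun t => var (h a) (h t) f)) => // x y ax xy yb.
  by apply: (var_majorant fin); apply: nd => //; [exact: le_trans yb|exact: le_trans xy].
have [->|] := eqVneq (total_evariation a b (f \o h)) +oo%E; first by rewrite leey.
rewrite -ltey => fin; rewrite (varE ab fin).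
have /choice[rho rhoP] y : exists x, h a <= y <= h b -> a <= x <= b /\ h x = y.
  have [/surj[x ? ?]|hy] := boolP (h a <= y <= h b); first by exists x.
  by exists 0 => hy'; case: (negP hy).
have rhond x y : h a <= x -> x < y -> y <= h b -> rho x <= rho y.
  move=> ax xy yb; have [/andP[h1 h2] h3] := rhoP x (introT andP (conj ax (le_trans (ltW xy) yb))).
  have [/andP[h4 h5] h6] := rhoP y (introT andP (conj (le_trans ax (ltW xy)) yb)).
  rewrite leNgt; apply/negP => yx; have := nd _ _ h4 (ltW yx) h2.
  by rewrite h3 h6 leNgt xy.
have M : majorant (h a) (h b) f (fun y => var a (rho y) (f \o h)).
  move=> x y ax; rewrite le_eqVlt => /predU1P[->|xy] yb; first by rewrite !subrr enorm0.
  have [/andP[h1 h2] h3] := rhoP x (introT andP (conj ax (le_trans (ltW xy) yb))).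
  have [/andP[h4 h5] h6] := rhoP y (introT andP (conj (le_trans ax (ltW xy)) yb)).
  have := var_majorant fin h1 (rhond _ _ ax xy yb) h5.
  by rewrite /= h3 h6.
apply: (le_trans (tv_le hab M)); rewrite lee_fin.
have [/andP[h1 h2] h3] := rhoP (h a) (introT andP (conj (lexx _) hab)).
have [/andP[h4 h5] h6] := rhoP (h b) (introT andP (conj hab (lexx _))).
have := var_ge0 (f \o h) h1; have := var_nd fin h4 h5 (lexx _); lra.
Qed.

Lemma vlip_tv a b f L : a <= b ->
  (forall s t, a <= s -> s <= t -> t <= b -> enorm (f t - f s) <= L * (t - s)) ->
  (total_evariation a b f <= (L * (b - a))%:E)%E.
Proof.
move=> ab lf; rewrite mulrBr; apply: (tv_le (F := fun t => L * t)) => // x y ax xy yb.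
by rewrite -mulrBr lf.
Qed.

(** On an interval of small length the majorant of ac_small_majorant is small,
    and it bounds the variation by minimality. *)
Lemma ac_var_small a b f e t : a <= t <= b -> abs_continuous a b f ->
  (total_evariation a b f < +oo)%E -> 0 < e ->
  exists2 r : R, 0 < r & forall x y, a <= x -> x <= y -> y <= b ->
    t - r < x -> y < t + r -> var a y f - var a x f <= e.
Proof.
move=> /andP[at_ tb] fAC fin e0; have ab := le_trans at_ tb.
have [r r0 rP] := ac_small_majorant ab fAC e0.
pose k := r / 3; have k0 : 0 < k by rewrite divr_gt0.
have [||phi [ndphi phie phif]] := rP `]t - k, t + k[%classic.
- exact: measurable_itv.
- rewrite lebesgue_measure_itv/= lte_fin; case: ifP => _; last by rewrite lte_fin.
  by rewrite -EFinD lte_fin /k; lra.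
exists k => // x y ax xy yb kx yk.
have : majorant x y f phi.
  move=> s z xs sz zy; apply: phif => //; [exact: le_trans xs|exact: le_trans yb|].
  by move=> q /=; rewrite !in_itv/= => /andP[h1 h2]; apply/andP; split; lra.
move=> /(var_min fin ax xy yb) h; apply: (le_trans h).
apply: le_trans phie; have := ndphi _ _ (lexx a) ax (le_trans xy yb).
by have := ndphi _ _ (le_trans ax xy) yb (lexx b); lra.
Qed.

End total_variation.

Section vector_lipschitz.
Context {R : realType} {d : nat}.
Implicit Types (a b c e t x y C L : R) (f D : R -> 'rV[R]_d) (F : R -> R).
Local Notation mu := (@lebesgue_measure R).

Definition vlip_on a b L f := forall s t, a <= s -> s <= t -> t <= b ->
  enorm (f t - f s) <= L * (t - s).

Lemma vlip_coord a b L f i : vlip_on a b L f -> lip_on a b L (fun t => f t ord0 i).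
Proof.
move=> lf s t as_ st tb; apply: le_trans (lf s t as_ st tb).
by rewrite -[f t ord0 i - _](_ : (f t - f s) ord0 i = _) ?enorm_coord// !mxE.
Qed.

Lemma vlip_derive a b L f : a < b -> 0 <= L -> vlip_on a b L f -> exists D,
  [/\ forall i, bm (fun t => D t ord0 i), forall t i, `|D t ord0 i| <= L,
      {ae mu, forall t, a < t < b -> is_derive t 1 f (D t)} &
      forall s t i, a <= s -> s <= t -> t <= b ->
        integ s t (fun t => D t ord0 i) = f t ord0 i - f s ord0 i].
Proof.
move=> ab L0 lf.
have /choice[h hP] i := lip_derive ab L0 (vlip_coord i lf).
exists (fun t => \row_i h i t); split.
- by move=> i; under eq_fun do rewrite mxE; case: (hP i).
- by move=> t i; rewrite mxE; case: (hP i).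
- have : {ae mu, forall t, forall i, a < t < b -> is_derive t 1 (fun s => f s ord0 i) (h i t)}.
    have H i : {ae mu, forall t, a < t < b -> is_derive t 1 (fun s => f s ord0 i) (h i t)}.
      by case: (hP i).
    by apply: filter_forall; exact: H.
  apply: aeS => t H tab; apply/is_derive_rVP => i; rewrite mxE; exact: H.
- move=> s t i as_ st tb; under [fun t => _]eq_fun do rewrite mxE.
  by case: (hP i) => _ _ _; apply.
Qed.

Lemma enorm_CS (x y : 'rV[R]_d) :
  \sum_(i < d) x ord0 i * y ord0 i <= enorm x * enorm y.
Proof.
have := enormD x y; rewrite -(@ler_pXn2r _ 2)// ?nnegrE ?enorm_ge0 ?addr_ge0 ?enorm_ge0//.
have -> : enorm (x + y) ^+ 2 = enorm x ^+ 2 + enorm y ^+ 2 + 2 * \sum_(i < d) x ord0 i * y ord0 i.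
  rewrite !enorm_sqr mulr_sumr -!big_split/=; apply: eq_bigr => i _.
  by rewrite mxE; ring.
by rewrite sqrrD -mulr_natl; lra.
Qed.

Lemma bm_enorm D : (forall i, bm (fun t => D t ord0 i)) -> bm (fun t => enorm (D t)).
Proof.
move=> bD; split.
  apply: (@measurableT_comp _ _ _ _ _ _ (@Num.sqrt R)).
    by apply: continuous_measurable_fun; exact: sqrt_continuous.
  suff [] : bm (fun t => \sum_(i < d) D t ord0 i ^+ 2) by [].
  by apply: bm_sum => i; under eq_fun do rewrite expr2; exact: bmM.
have [_ [C CP]] : bm (fun t => \sum_(i < d) `|D t ord0 i|).
  by apply: bm_sum => i; exact: bm_norm.
exists C => s; rewrite ger0_norm ?enorm_ge0// (le_trans (enorm_le_sum _))//.
by rewrite (le_trans (ler_norm _)).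
Qed.

(** The scalar product with z turns the claim into an inequality of real
    integrals. *)
Lemma enorm_integ a b D (z : 'rV[R]_d) : a <= b -> (forall i, bm (fun t => D t ord0 i)) ->
  (forall i, z ord0 i = integ a b (fun t => D t ord0 i)) ->
  enorm z <= integ a b (fun t => enorm (D t)).
Proof.
move=> ab bD zE; have bE := bm_enorm bD.
have [->|z0] := eqVneq (enorm z) 0.
  by apply: integ_ge0 => s _; exact: enorm_ge0.
have {}z0 : 0 < enorm z by rewrite lt_neqAle eq_sym z0 enorm_ge0.
rewrite -(ler_pM2l z0) -expr2 enorm_sqr -integ_Zl//.
have -> : \sum_(i < d) z ord0 i ^+ 2 =
    integ a b (fun t => \sum_(i < d) z ord0 i * D t ord0 i).
  rewrite integ_sum; last by move=> i; apply: bmM => //; exact: bm_cst.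
  by apply: eq_bigr => i _; rewrite integ_Zl// -zE expr2.
apply: integ_le.
- by apply: bm_sum => i; apply: bmM => //; exact: bm_cst.
- by apply: bmM => //; exact: bm_cst.
- by move=> s _; exact: enorm_CS.
Qed.

Lemma is_derive_sumf n (g : 'I_n -> R -> R) t (k : 'I_n -> R) :
  (forall i, is_derive t 1 (g i) (k i)) ->
  is_derive t 1 (fun y => \sum_(i < n) g i y) (\sum_(i < n) k i).
Proof.
elim: n g k => [|n IH] g k gk.
  by rewrite big_ord0; under eq_fun do rewrite big_ord0; exact: is_derive_cstf.
rewrite big_ord_recr/=; under eq_fun do rewrite big_ord_recr/=.
by apply: is_deriveDf => //; exact: IH.
Qed.

(** The scalar product of f with its own derivative D grows at t with slope
    |D|^2, and at most at the rate of |D| F. *)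
Lemma is_derive_enorm_le f F t (D : 'rV[R]_d) L : is_derive t 1 f D -> is_derive t 1 F L ->
  (exists2 r : R, 0 < r & forall y, t < y < t + r -> enorm (f y - f t) <= F y - F t) ->
  enorm D <= L.
Proof.
move=> /is_derive_rVP fD FL [r r0 rP].
have [->|D0] := eqVneq (enorm D) 0.
  apply: (is_derive_lb FL); exists r => // y /rP; rewrite mul0r.
  exact: le_trans (enorm_ge0 _).
have {}D0 : 0 < enorm D by rewrite lt_neqAle eq_sym D0 enorm_ge0.
rewrite -(ler_pM2l D0) -expr2 enorm_sqr.
have H : is_derive t 1 (fun y => \sum_(i < d) D ord0 i * f y ord0 i - enorm D * F y)
    (\sum_(i < d) D ord0 i * D ord0 i - enorm D * L).
  have h1 := is_derive_sumf (fun i => is_deriveZf (D ord0 i) (fD i)).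
  exact: (is_deriveBf h1 (is_deriveZf (enorm D) FL)).
under eq_bigr do rewrite expr2.
have := is_derive_ub H (L := 0).
rewrite subr_le0; apply; exists r => // y yr; have := rP y yr.
have {yr}ty : t < y by case/andP: yr.
rewrite mul0r -(ler_pM2l D0) => h.
have -> : \sum_(i < d) D ord0 i * f y ord0 i - enorm D * F y -
    (\sum_(i < d) D ord0 i * f t ord0 i - enorm D * F t) =
    \sum_(i < d) D ord0 i * (f y - f t) ord0 i - enorm D * (F y - F t).
  have -> : \sum_(i < d) D ord0 i * (f y - f t) ord0 i =
    \sum_(i < d) D ord0 i * f y ord0 i - \sum_(i < d) D ord0 i * f t ord0 i.
    by rewrite -sumrB; apply: eq_bigr => i _; rewrite !mxE mulrBr.
  by ring.
by have := enorm_CS D (f y - f t); lra.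
Qed.

(** The speed |f'| is at most the derivative of the variation, because the
    variation is a majorant of f. Conversely the integral of the speed is a
    majorant of f, so by minimality the two have the same total integral, and
    the inequality is an equality almost everywhere. *)
Lemma vlip_var_derive a b L f : a < b -> 0 <= L -> vlip_on a b L f ->
  {ae mu, forall t, a < t < b -> forall D : 'rV[R]_d, is_derive t 1 f D ->
     is_derive t 1 (fun t => var a t f) (enorm D)}.
Proof.
move=> ab L0 lf; have [D [bD _ fD DI]] := vlip_derive ab L0 lf.
have fin : (total_evariation a b f < +oo)%E.
  by rewrite (le_lt_trans (vlip_tv (ltW ab) lf))// ltry.
have bE := bm_enorm bD; have Wm := var_majorant fin.
have lW : lip_on a b L (fun t => var a t f).
  move=> s t as_ st tb; have nd := var_nd fin as_ st tb.
  rewrite ger0_norm ?subr_ge0// mulrBr.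
  apply: (@var_min _ _ a b f (fun t => L * t) s t) => // x y sx xy yt.
  by rewrite -mulrBr lf//; [exact: le_trans sx|exact: le_trans tb].
have [w [bw _ wd wI]] := lip_derive ab L0 lW.
have ew : {ae mu, forall t, a < t < b -> enorm (D t) <= w t}.
  apply: aeS (aeI fD wd) => t [+ +] /[dup] tab /andP[at_ tb].
  move=> /(_ tab) ft /(_ tab) Wt; apply: (is_derive_enorm_le ft Wt).
  exists (b - t); first by rewrite subr_gt0.
  by move=> y /andP[ty yb]; apply: Wm; [exact: ltW|exact: ltW|lra].
have bwe : bm (fun t => w t - enorm (D t)) by exact: bmB.
have : {ae mu, forall t, a < t < b -> w t - enorm (D t) = 0}.
  apply: integ_eq0_ae => //.
    by apply: aeS ew => t + tab => /(_ tab); rewrite subr_ge0.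
  rewrite integ_B// wI ?(ltW ab)// var_aa subr0 subr_le0.
  rewrite -[var a b f]subr0 -(var_aa a f) -[leRHS]subr0 -(integ_aa a (fun t => enorm (D t))).
  apply: (@var_min _ _ a b f (fun t => integ a t (fun t => enorm (D t))) a b) => //.
    exact: ltW.
  move=> x y ax xy yb; rewrite integ_incr//; apply: enorm_integ => // i.
  by rewrite DI// !mxE.
move=> /(aeI wd)/(aeI fD); apply: aeS => t [+ [+ +]] tab D' fD'.
move=> /(_ tab) fDt /(_ tab) Wt /(_ tab)/eqP; rewrite subr_eq0 => /eqP wE.
suff -> : D' = D t by rewrite -wE.
apply/rowP => i; move/is_derive_rVP : fD' => /(_ i) h1.
by move/is_derive_rVP : fDt => /(_ i); exact: is_derive_uniq.
Qed.

End vector_lipschitz.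

(** * Vector fields on compact sets *)

Section field_measurability.
Context {R : realType} {n m l : nat} (U : set 'rV[R]_m) (V : set 'rV[R]_l).
Implicit Types (h : 'rV[R]_n -> 'rV[R]_m -> 'rV[R]_l -> 'rV[R]_n).

Definition vmeas d (f : R -> 'rV[R]_d) := forall i, measurable_fun setT (fun t => f t ord0 i).

Lemma field_continuousP h : field_continuous U V h ->
  forall x u v, U u -> V v -> forall e, 0 < e -> exists2 r : R, 0 < r &
    forall x' u' v', U u' -> V v' -> enorm (x' - x) < r -> enorm (u' - u) < r ->
      enorm (v' - v) < r -> enorm (h x' u' v' - h x u v) < e.
Proof.
move=> /subspace_continuousP hc x u v Uu Vv e e0.
have := hc ((x, u), v) (conj (conj Logic.I Uu) Vv) => /cvgrPdist_lt.
have en : 0 < e / (n%:R + 1) by rewrite divr_gt0// ltr_wpDl.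
move=> /(_ _ en); rewrite near_withinE => /nbhs_ballP[r /= r0 rP].
exists r => // x' u' v' Uu' Vv' xr ur vr.
have dist d (a b : 'rV[R]_d) : enorm (a - b) < r -> ball b r a.
  move=> abr; rewrite -ball_normE /ball_/= distrC.
  exact: le_lt_trans (enorm_mx_norm _) abr.
have := rP ((x', u'), v') (conj (conj (dist _ _ _ xr) (dist _ _ _ ur)) (dist _ _ _ vr)).
move=> /(_ (conj (conj Logic.I Uu') Vv')) /=; rewrite distrC => H.
apply: le_lt_trans (mx_norm_enorm _) _.
rewrite -(@ltr_pM2l _ (n%:R + 1)) in H; last by rewrite ltr_wpDl.
have E : (n%:R + 1) * (e / (n%:R + 1)) = e.
  by rewrite mulrC divfK// gt_eqF// ltr_wpDl.
rewrite E in H.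
by apply: le_lt_trans H; rewrite ler_wpM2r// lerDl.
Qed.

Let J : countType := ('rV[rat]_n * 'rV[rat]_m * 'rV[rat]_l * nat)%type.

Let near_rat d (q : 'rV[rat]_d) (k : nat) (x : 'rV[R]_d) :=
  forall i, `|x ord0 i - ratr (q ord0 i)| < k.+1%:R^-1.

Lemma near_rat_ex d (x : 'rV[R]_d) k : exists q, near_rat q k x.
Proof.
have /choice[q qP] (i : 'I_d) : exists q : rat, `|x ord0 i - ratr q| < k.+1%:R^-1.
  have k0 : 0 < k.+1%:R^-1 :> R by rewrite invr_gt0.
  have [|q] := @rat_in_itvoo R (x ord0 i - k.+1%:R^-1) (x ord0 i + k.+1%:R^-1).
    by rewrite ltrD2l (lt_trans _ k0)// oppr_lt0.
  rewrite in_itv/= => /andP[h1 h2]; exists q.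
  by rewrite ltr_distlC h1 h2.
by exists (\row_i q i) => i; rewrite mxE.
Qed.

Lemma near_rat_dist d (q : 'rV[rat]_d) k (x y : 'rV[R]_d) :
  near_rat q k x -> near_rat q k y -> enorm (y - x) <= d%:R * (2 / k.+1%:R).
Proof.
move=> qx qy; rewrite (le_trans (enorm_le_sum _))//.
rewrite -[d in d%:R]card_ord -sum1_card natr_sum mulr_suml.
apply: ler_sum => i _; rewrite mul1r !mxE.
have -> : y ord0 i - x ord0 i =
  (y ord0 i - ratr (q ord0 i)) - (x ord0 i - ratr (q ord0 i)) by ring.
rewrite (le_trans (ler_normB _ _))// mulr_natl mulr2n lerD//; exact: ltW.
Qed.

Lemma measurable_near_rat d (q : 'rV[rat]_d) k (f : R -> 'rV[R]_d) : vmeas f ->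
  measurable [set t | near_rat q k (f t)].
Proof.
move=> mf.
rewrite (_ : [set t | _] = \bigcap_(i in [set: 'I_d])
    [set t | `|f t ord0 i - ratr (q ord0 i)| < k.+1%:R^-1]); last first.
  by apply/seteqP; split => [t H i _|t H i]; exact: H.
apply: fin_bigcap_measurable => // i _.
have mg : measurable_fun setT (fun t => `|f t ord0 i - ratr (q ord0 i)|).
  by apply: measurableT_comp => //; apply: measurable_funB.
rewrite (_ : [set t | _] = setT `&` (fun t => `|f t ord0 i - ratr (q ord0 i)|) @^-1` `]-oo, k.+1%:R^-1[%classic).
  exact: mg.
by apply/seteqP; split => t /=; rewrite in_itv/= => // -[].
Qed.

(** The field is continuous only as a function on admissible values. The set
    where it exceeds a is the union of the preimages of the boxes with rational
    centre, countably many, on whose admissible points it exceeds a. *)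
Lemma measurable_field h (y : R -> 'rV[R]_n) (p : R -> 'rV[R]_m) (c : R -> 'rV[R]_l) :
  field_continuous U V h -> vmeas y -> vmeas p -> vmeas c ->
  (forall t, U (p t)) -> (forall t, V (c t)) -> vmeas (fun t => h (y t) (p t) (c t)).
Proof.
move=> hc my mp mc Up Vc i.
have {}hc := field_continuousP hc.
apply: (measurability _ (RGenOInfty.measurableE R)) => //.
move=> _ [_ [a ->] <-]; rewrite setTI.
pose good (j : J) := forall x u v, U u -> V v ->
  near_rat j.1.1.1 j.2 x -> near_rat j.1.1.2 j.2 u -> near_rat j.1.2 j.2 v ->
  a < h x u v ord0 i.
pose B (j : J) := [set t | near_rat j.1.1.1 j.2 (y t)] `&`
  [set t | near_rat j.1.1.2 j.2 (p t)] `&` [set t | near_rat j.1.2 j.2 (c t)].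
pose F (k : nat) := if unpickle k is Some j then
  (if `[< good j >] then B j else set0) else set0.
rewrite (_ : _ @^-1` _ = \bigcup_k F k).
  apply: bigcupT_measurable => k; rewrite /F; case: unpickle => // j.
  case: ifP => // _; apply: measurableI; first apply: measurableI;
  exact: measurable_near_rat.
apply/seteqP; split => [t|t [k _]]; last first.
  rewrite /F; case: unpickle => // j; case: ifPn => // /asboolP gj [[h1 h2] h3] /=.
  by rewrite in_itv/= andbT; exact: gj.
rewrite /= in_itv/= andbT => ah.
have e0 : 0 < h (y t) (p t) (c t) ord0 i - a by rewrite subr_gt0.
have [r r0 rP] := hc (y t) _ _ (Up t) (Vc t) _ e0.
pose N := (n + m + l)%:R : R.
have [k kr] : exists k : nat, N * (2 / k.+1%:R) < r.
  pose k := Num.bound (N * 2 / r); exists k.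
  rewrite mulrA ltr_pdivrMr// [ltRHS]mulrC -ltr_pdivrMr//.
  apply: (@lt_le_trans _ _ (k%:R : R)); last by rewrite ler_nat.
  by rewrite archi_boundP// divr_ge0 ?mulr_ge0// ltW.
have [qy Hy] := near_rat_ex (y t) k.
have [qp Hp] := near_rat_ex (p t) k.
have [qc Hc] := near_rat_ex (c t) k.
pose j0 : J := (qy, qp, qc, k).
exists (pickle j0); first exact: Logic.I.
rewrite /F pickleK; case: ifPn => [_|]; first by split; first split.
move=> /asboolP[] x u v Uu Vv /= hx hu hv.
have le d (dN : (d <= n + m + l)%N) : d%:R * (2 / k.+1%:R) < r :> R.
  by apply: le_lt_trans kr; rewrite ler_wpM2r ?ler_nat ?divr_ge0.
have := rP x u v Uu Vv.
have /le_lt_trans/(_ (le n _)) -> := near_rat_dist Hy hx; last by rewrite -addnA leq_addr.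
have /le_lt_trans/(_ (le m _)) -> := near_rat_dist Hp hu; last by rewrite addnAC leq_addl.
have /le_lt_trans/(_ (le l _)) -> := near_rat_dist Hc hv; last by rewrite leq_addl.
move=> /(_ isT isT isT); apply: contraTT; rewrite -!leNgt => ha.
rewrite (le_trans _ (enorm_coord _ i))// !mxE ler_normr; apply/orP; right.
by rewrite opprB lerD2l lerN2.
Qed.

End field_measurability.

Section ultralimits.
Context {R : realType}.
Implicit Types (F : set_system nat).

(** The limit is the supremum of the eventual lower bounds: an ultrafilter that
    does not keep the sequence below a number keeps it above. *)
Lemma ultra_lim F (a : nat -> R) B : UltraFilter F -> (forall k, `|a k| <= B) ->
  exists l, forall e : R, 0 < e -> \forall k \near F, `|a k - l| < e.
Proof.
move=> FU aB; pose S := [set x | \forall k \near F, x <= a k].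
have FP : ProperFilter F by exact: ultra_proper.
have SB : S (- B).
  by apply: filterE => k; have := aB k; rewrite ler_norml => /andP[].
have hS : has_sup S.
  split; first by exists (- B).
  exists B => x Sx; have [k xk] := filter_ex Sx.
  by have := aB k; rewrite ler_norml => /andP[_]; exact: le_trans.
exists (sup S) => e e0.
have [x Sx xl] := sup_adherent e0 hS.
have H2 : \forall k \near F, a k < sup S + e.
  have [//|h] := in_ultra_setVsetC [set k | a k < sup S + e] FU.
  have : S (sup S + e) by apply: filterS h => k /= /negP; rewrite -leNgt.
  by move=> /(ub_le_sup hS.2); rewrite gerDl leNgt e0.
apply: filterS2 Sx H2 => k h1 h2; rewrite ltr_distl.
by rewrite (lt_le_trans xl h1) h2.
Qed.

Lemma near_enorm_lim F d (a : nat -> 'rV[R]_d) (l : 'rV[R]_d) : Filter F ->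
  (forall i e, 0 < e -> \forall k \near F, `|a k ord0 i - l ord0 i| < e) ->
  forall e, 0 < e -> \forall k \near F, enorm (a k - l) < e.
Proof.
move=> FF al e e0.
have e1 : 0 < e / (d%:R + 1) by rewrite divr_gt0// ltr_wpDl.
have : \forall k \near F, forall i, `|a k ord0 i - l ord0 i| < e / (d%:R + 1).
  by apply: filter_forall => i; exact: al.
apply: filterS => k ak; rewrite (le_lt_trans (enorm_le_sum _))//.
apply: (@le_lt_trans _ _ (d%:R * (e / (d%:R + 1)))).
  rewrite mulr_natl -[X in _ *+ X]card_ord -sumr_const.
  by apply: ler_sum => i _; rewrite !mxE; exact: ltW (ak i).
rewrite mulrA ltr_pdivrMr ?ltr_wpDl// mulrC ltr_pM2l// ltrDl//.
Qed.

Lemma ultra_vlim F d (a : nat -> 'rV[R]_d) B : UltraFilter F ->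
  (forall k, enorm (a k) <= B) ->
  exists l, forall e : R, 0 < e -> \forall k \near F, enorm (a k - l) < e.
Proof.
move=> FU aB; have FP : ProperFilter F by exact: ultra_proper.
have /choice[l lP] i : exists l, forall e : R, 0 < e -> \forall k \near F, `|a k ord0 i - l| < e.
  by apply: (ultra_lim (B := B)) => // k; exact: le_trans (enorm_coord _ _) (aB k).
exists (\row_i l i); apply: near_enorm_lim => i e e0.
by apply: filterS (lP i e e0) => k; rewrite mxE.
Qed.

Lemma compact_enorm_bounded d (U : set 'rV[R]_d) : compact U ->
  exists2 B : R, 0 <= B & forall u, U u -> enorm u <= B.
Proof.
move=> /compact_bounded[M [_ MU]]; exists (d%:R * (`|M| + 1)).
  by rewrite mulr_ge0// addr_ge0.
move=> u Uu; rewrite (le_trans (mx_norm_enorm u))// ler_wpM2l//.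
by apply: MU => //; rewrite (le_lt_trans (ler_norm M))// ltrDl.
Qed.

Lemma compact_enorm_lim F d (U : set 'rV[R]_d) (a : nat -> 'rV[R]_d) l :
  ProperFilter F -> compact U -> (forall k, U (a k)) ->
  (forall e : R, 0 < e -> \forall k \near F, enorm (a k - l) < e) -> U l.
Proof.
move=> FP cU Ua al; have clU : closed U by apply: compact_closed cU; exact: norm_hausdorff.
apply: (closed_cvg U clU) (filterE _ Ua : \forall k \near F, U (a k)) _ _.
apply/cvgrPdist_lt => e e0; apply: filterS (al e e0) => k.
by rewrite distrC; exact: le_lt_trans (enorm_mx_norm _).
Qed.

Lemma near_invn_lt F (C e : R) : Filter F -> \oo `<=` F -> 0 < e ->
  \forall k \near F, C / k.+1%:R < e.
Proof.
move=> FF ooF e0; apply: ooF; exists (Num.bound `|C / e|) => // k /= Ck.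
rewrite ltr_pdivrMr// mulrC -ltr_pdivrMr//.
apply: (lt_le_trans (le_lt_trans (ler_norm _) (archi_boundP (normr_ge0 _)))).
rewrite ler_nat; exact: leq_trans Ck _.
Qed.

End ultralimits.

Section field_estimates.
Context {R : realType} {n m l : nat} (U : set 'rV[R]_m) (V : set 'rV[R]_l).
Context (h : 'rV[R]_n -> 'rV[R]_m -> 'rV[R]_l -> 'rV[R]_n).
Hypotheses (U_compact : compact U) (V_compact : compact V).

Lemma field_bounded r M : 0 <= M -> linear_growth U V M h ->
  exists2 B : R, 0 <= B &
    forall x u v, enorm x <= r -> U u -> V v -> enorm (h x u v) <= B.
Proof.
move=> M0 gM; have [BU BU0 UB] := compact_enorm_bounded U_compact.
exists (M * (1 + (`|r| + BU))); first by rewrite mulr_ge0// !addr_ge0.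
move=> x u v xr Uu Vv; rewrite (le_trans (gM _ _ _ Uu Vv))// ler_wpM2l//.
rewrite lerD2l (le_trans (enorm_row_mx _ _))// lerD ?UB//.
by rewrite (le_trans xr)// ler_norm.
Qed.

(** The local Lipschitz estimates are uniform over compact sets: a sequence of
    pairs violating them would have, along an ultrafilter, a common limit, near
    which one of the local estimates holds. *)
Lemma field_lipschitz r M : 0 <= M -> linear_growth U V M h ->
  locally_lipschitz_unif U V h ->
  exists2 L : R, 0 <= L & forall x1 x2 u1 u2 v, enorm x1 <= r -> enorm x2 <= r ->
    U u1 -> U u2 -> V v ->
    enorm (h x1 u1 v - h x2 u2 v) <= L * (enorm (x1 - x2) + enorm (u1 - u2)).
Proof.
move=> M0 gM lipg; have [B B0 hB] := field_bounded r M0 gM.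
apply: contrapT => noL.
have /choice[w wP] (k : nat) : exists w : ('rV[R]_n * 'rV[R]_n) * ('rV[R]_m * 'rV[R]_m) * 'rV[R]_l,
   [/\ enorm w.1.1.1 <= r, enorm w.1.1.2 <= r, U w.1.2.1, U w.1.2.2 & V w.2] /\
   k.+1%:R * (enorm (w.1.1.1 - w.1.1.2) + enorm (w.1.2.1 - w.1.2.2)) <
   enorm (h w.1.1.1 w.1.2.1 w.2 - h w.1.1.2 w.1.2.2 w.2).
  apply: contrapT => noW; apply: noL; exists k.+1%:R => // x1 x2 u1 u2 v x1r x2r Uu1 Uu2 Vv.
  rewrite leNgt; apply/negP => H; apply: noW; exists ((x1, x2), (u1, u2), v).
  by split.
have [F [FU ooF]] := ultraFilterLemma (eventually_filter : ProperFilter \oo).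
have FP : ProperFilter F by exact: ultra_proper.
have [BU BU0 UB] := compact_enorm_bounded U_compact.
have [|xs xsP] := @ultra_vlim _ F _ (fun k => (w k).1.1.1) r FU.
  by move=> k; case: (wP k) => -[].
have [|us usP] := @ultra_vlim _ F _ (fun k => (w k).1.2.1) BU FU.
  by move=> k; case: (wP k) => -[? ? Uu _ _] _; exact: UB.
have Uus : U us.
  by apply: (compact_enorm_lim FP U_compact _ usP) => k; case: (wP k) => -[].
have [q [L [q0 LP]]] := lipg xs us Uus.
have q4 : 0 < q / 4 by rewrite divr_gt0.
have F1 := xsP _ q4; have F2 := usP _ q4.
have F3 := near_invn_lt (B + B) FP ooF q4.
have F4 := near_invn_lt L FP ooF (@ltr01 R).
have [k [[H1 H2] [H3 H4]]] := filter_ex (filterI (filterI F1 F2) (filterI F3 F4)).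
have [[h1 h2 h3 h4 h5] h6] := wP k.
have d0 : 0 <= enorm ((w k).1.1.1 - (w k).1.1.2) + enorm ((w k).1.2.1 - (w k).1.2.2).
  by rewrite addr_ge0 ?enorm_ge0.
have dq : enorm ((w k).1.1.1 - (w k).1.1.2) + enorm ((w k).1.2.1 - (w k).1.2.2) < q / 4.
  apply: le_lt_trans H3; rewrite ler_pdivlMr// mulrC (le_trans (ltW h6))//.
  rewrite (le_trans (enormD _ _))// enormN lerD// hB//.
have x2s : enorm ((w k).1.1.2 - xs) < q / 4 + q / 4.
  apply: le_lt_trans (enorm_triangle (w k).1.1.1 _ _) _; rewrite enormB.
  by have := enorm_ge0 ((w k).1.2.1 - (w k).1.2.2); lra.
have u2s : enorm ((w k).1.2.2 - us) < q / 4 + q / 4.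
  apply: le_lt_trans (enorm_triangle (w k).1.2.1 _ _) _; rewrite enormB.
  by have := enorm_ge0 ((w k).1.1.1 - (w k).1.1.2); lra.
have := LP (w k).1.1.1 (w k).1.2.1 (w k).1.1.2 (w k).1.2.2 (w k).2 h3 h4 h5.
move=> /(_ _ _)/le_trans H.
have {H} : enorm (h (w k).1.1.1 (w k).1.2.1 (w k).2 - h (w k).1.1.2 (w k).1.2.2 (w k).2) <=
    L * enorm (row_mx ((w k).1.1.1 - (w k).1.1.2) ((w k).1.2.1 - (w k).1.2.2)).
  apply: LP => //; rewrite (le_lt_trans (enorm_row_mx _ _))//; lra.
have rw := enorm_row_mx ((w k).1.1.1 - (w k).1.1.2) ((w k).1.2.1 - (w k).1.2.2).
move=> /(lt_le_trans h6); apply/negP; rewrite -leNgt.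
have Lk : L <= k.+1%:R by move: H4; rewrite ltr_pdivrMr// mul1r => /ltW.
rewrite (@le_trans _ _ (k.+1%:R * enorm (row_mx ((w k).1.1.1 - (w k).1.1.2) ((w k).1.2.1 - (w k).1.2.2))))//.
  by rewrite ler_wpM2r ?enorm_ge0.
by rewrite ler_wpM2l.
Qed.

(** The compactness argument of field_lipschitz, with continuity at the limit
    point in place of the local Lipschitz estimate. *)
Lemma field_modulus r M e : 0 <= M -> linear_growth U V M h ->
  field_continuous U V h -> 0 < e ->
  exists2 C : R, 0 <= C & forall x u v v', enorm x <= r -> U u -> V v -> V v' ->
    enorm (h x u v - h x u v') <= e + C * enorm (v - v').
Proof.
move=> M0 gM ch e0; have [B B0 hB] := field_bounded r M0 gM.
have {}ch := field_continuousP ch.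
apply: contrapT => noC.
have /choice[w wP] (k : nat) : exists w : 'rV[R]_n * 'rV[R]_m * ('rV[R]_l * 'rV[R]_l),
   [/\ enorm w.1.1 <= r, U w.1.2, V w.2.1 & V w.2.2] /\
   e + k.+1%:R * enorm (w.2.1 - w.2.2) <
   enorm (h w.1.1 w.1.2 w.2.1 - h w.1.1 w.1.2 w.2.2).
  apply: contrapT => noW; apply: noC; exists k.+1%:R => // x u v v' xr Uu Vv Vv'.
  by rewrite leNgt; apply/negP => H; apply: noW; exists (x, u, (v, v')).
have [F [FU ooF]] := ultraFilterLemma (eventually_filter : ProperFilter \oo).
have FP : ProperFilter F by exact: ultra_proper.
have [BU BU0 UB] := compact_enorm_bounded U_compact.
have [BV BV0 VB] := compact_enorm_bounded V_compact.
have [|xs xsP] := @ultra_vlim _ F _ (fun k => (w k).1.1) r FU.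
  by move=> k; case: (wP k) => -[].
have [|us usP] := @ultra_vlim _ F _ (fun k => (w k).1.2) BU FU.
  by move=> k; case: (wP k) => -[_ Uu _ _] _; exact: UB.
have [|vs vsP] := @ultra_vlim _ F _ (fun k => (w k).2.1) BV FU.
  by move=> k; case: (wP k) => -[_ _ Vv _] _; exact: VB.
have Uus : U us.
  by apply: (compact_enorm_lim FP U_compact _ usP) => k; case: (wP k) => -[].
have Vvs : V vs.
  by apply: (compact_enorm_lim FP V_compact _ vsP) => k; case: (wP k) => -[].
have e2 : 0 < e / 2 by rewrite divr_gt0.
have [q q0 qP] := ch xs us vs Uus Vvs _ e2.
have q2 : 0 < q / 2 by rewrite divr_gt0.
have [k [[H1 H2] [H3 H4]]] := filter_ex (filterI (filterI (xsP _ q0) (usP _ q0))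
  (filterI (vsP _ q2) (near_invn_lt (B + B) FP ooF q2))).
have [[h1 h2 h3 h4] h6] := wP k.
have bd : enorm (h (w k).1.1 (w k).1.2 (w k).2.1 - h (w k).1.1 (w k).1.2 (w k).2.2) <= B + B.
  by rewrite (le_trans (enormD _ _))// enormN lerD// hB.
have dq : enorm ((w k).2.1 - (w k).2.2) < q / 2.
  by apply: le_lt_trans H4; rewrite ler_pdivlMr// mulrC; lra.
have v2s : enorm ((w k).2.2 - vs) < q.
  by apply: le_lt_trans (enorm_triangle (w k).2.1 _ _) _; rewrite enormB; lra.
have v1s : enorm ((w k).2.1 - vs) < q by lra.
have := qP _ _ _ h2 h3 H1 H2 v1s; have := qP _ _ _ h2 h4 H1 H2 v2s.
have := enorm_triangle (h xs us vs) (h (w k).1.1 (w k).1.2 (w k).2.1) (h (w k).1.1 (w k).1.2 (w k).2.2).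
rewrite [enorm (h xs us vs - _)]enormB.
have : 0 <= k.+1%:R * enorm ((w k).2.1 - (w k).2.2) by rewrite mulr_ge0 ?enorm_ge0.
lra.
Qed.

End field_estimates.

(** * Differential equations with bounded densities *)

Section gronwall.
Context {R : realType}.
Implicit Types (K S t a : R).

(** The weight of Bielecki's norm, for which integration against K is a
    contraction of ratio 1/2 (integ_expw) on intervals of any length. *)
Definition expw K S t := expR (2 * K * Num.max 0 (Num.min S t)).

Lemma bm_expw K S : 0 <= S -> bm (expw K S).
Proof.
move=> S0; have cm : continuous (fun t : R => 2 * K * Num.max 0 (Num.min S t)).
  have lf : lip_on 0 S `|2 * K| (fun t : R => 2 * K * t).
    by move=> s t _ st _; rewrite -mulrBr normrM ler_wpM2l// ger0_norm// subr_ge0.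
  exact: (lip_continuous S0 lf).
split.
  apply: measurableT_comp; last exact: continuous_measurable_fun.
  by apply: continuous_measurable_fun; exact: continuous_expR.
exists (expR (`|2 * K| * S)) => t; rewrite ger0_norm ?expR_ge0// ler_expR.
rewrite (le_trans (ler_norm _))// normrM ler_wpM2l//.
by have /andP[h1 h2] := clamp_ge t S0; rewrite ger0_norm.
Qed.

Lemma expw_ge1 K S t : 0 <= K -> 0 <= S -> 1 <= expw K S t.
Proof.
move=> K0 S0; rewrite -expR0 ler_expR !mulr_ge0//.
by have /andP[] := clamp_ge t S0.
Qed.

Lemma expw_le K S t : 0 <= K -> 0 <= S -> expw K S t <= expR (2 * K * S).
Proof.
move=> K0 S0; rewrite ler_expR ler_wpM2l ?mulr_ge0//.
by have /andP[] := clamp_ge t S0.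
Qed.

Lemma is_derive_expRM (c t : R) : is_derive t 1 (fun s => expR (c * s)) (c * expR (c * t)).
Proof.
rewrite mulrC; apply: (@is_derive_compf _ expR (fun s => c * s) t c (expR (c * t))).
by have := is_deriveZf c (is_derive_idf t); rewrite mulr1.
Qed.

Lemma integ_expw K S t : 0 <= K -> 0 <= t <= S ->
  K * integ 0 t (expw K S) <= expw K S t / 2.
Proof.
move=> K0 /andP[t0 tS]; have S0 := le_trans t0 tS.
move: t0; rewrite le_eqVlt => /predU1P[<-|t0].
  by rewrite integ_aa mulr0 divr_ge0// expR_ge0.
pose F (s : R) := expR (2 * K * s); pose f s := 2 * K * F s.
have cF : continuous F.
  move=> s; apply: (@continuous_comp _ _ _ (fun s => 2 * K * s) expR); last exact: continuous_expR.
  exact: mulrl_continuous.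
have cf : continuous f.
  move=> s; apply: (@continuous_comp _ _ _ F (fun y => 2 * K * y)); first exact: cF.
  exact: mulrl_continuous.
have dF (s : R) : is_derive s 1 F (f s) by exact: is_derive_expRM.
have := @continuous_FTC2 _ f F 0 t t0 (continuous_subspaceT cf).
have h1 : derivable_oo_LRcontinuous F 0 t.
  split; first by move=> s _; case: (dF s).
    by apply: cvg_at_right_filter; exact: cF.
  by apply: cvg_at_left_filter; exact: cF.
move=> /(_ h1)/(_ (fun s _ => is_derive1E (dF s))) E.
have {E} : integ 0 t f = F t - F 0 by rewrite /integ /Rintegral E.
have -> : integ 0 t f = 2 * (K * integ 0 t (expw K S)).
  have bw := bm_expw K S0.
  have bKw : bm (fun s => K * expw K S s) by apply: bmM => //; exact: bm_cst.
  rewrite -(integ_Zl _ _ K bw) -(integ_Zl _ _ 2 bKw).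
  apply: integ_eq => s /andP[s0 st]; rewrite /f /F /expw clamp_id ?mulrA//.
  by rewrite s0 (le_trans st).
have -> : F t = expw K S t by rewrite /expw clamp_id// tS (ltW t0).
have := expR_ge0 (2 * K * 0) : 0 <= F 0; lra.
Qed.

(** Integral form of Gronwall's inequality, obtained by weighting z with a fast
    exponential: the supremum of the quotient is absorbed. *)
Lemma gronwall K S a (z : R -> R) : 0 <= K -> 0 <= S -> 0 <= a -> bm z ->
  (forall t, 0 <= z t) ->
  (forall t, 0 <= t <= S -> z t <= a + K * integ 0 t z) ->
  forall t, 0 <= t <= S -> z t <= 2 * a * expR (2 * K * S).
Proof.
move=> K0 S0 a0 bz z0 zI; have [_ [B zB]] := bz.
pose Q := [set q | exists2 t, 0 <= t <= S & q = z t / expw K S t].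
have w0 t : 0 < expw K S t by rewrite expR_gt0.
have hQ : has_sup Q.
  split; first by exists (z 0 / expw K S 0), 0; rewrite ?lexx.
  exists B => _ [t _ ->]; rewrite ler_pdivrMr//.
  rewrite (le_trans (ler_norm _))// (le_trans (zB t))// ler_peMr ?expw_ge1//.
  exact: le_trans (zB 0).
pose A := sup Q.
have zA t : 0 <= t <= S -> z t <= A * expw K S t.
  by move=> tS; rewrite -ler_pdivrMr//; apply: ub_le_sup; [exact: hQ.2|exists t].
have A0 : 0 <= A.
  apply: (@le_trans _ _ (z 0 / expw K S 0)); first by rewrite divr_ge0// ltW.
  by rewrite ler_pdivrMr// zA// lexx.
have bw := bm_expw K S0.
have : A <= a + A / 2.
  apply: ge_sup; first exact: hQ.1.
  move=> _ [t /[dup] tS /andP[t0 tS'] ->]; rewrite ler_pdivrMr//.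
  rewrite (le_trans (zI t tS))// mulrDl lerD//.
    by rewrite ler_peMr// expw_ge1.
  apply: (@le_trans _ _ (A * (K * integ 0 t (expw K S)))); last first.
    by rewrite -[A / 2 * _]mulrA ler_wpM2l// [leRHS]mulrC integ_expw.
  rewrite mulrCA ler_wpM2l// -integ_Zl//; apply: integ_le => //.
    by apply: bmM => //; exact: bm_cst.
  by move=> s /andP[s0 st]; apply: zA; rewrite s0 (le_trans st).
move=> A2 t tS; rewrite (le_trans (zA t tS))// ler_pM// ?expw_le//; first exact: ltW.
by lra.
Qed.

End gronwall.

Section differential_equation.
Context {R : realType} {n m l : nat} (U : set 'rV[R]_m) (V : set 'rV[R]_l).
Context (g : 'I_m.+1 -> 'rV[R]_n -> 'rV[R]_m -> 'rV[R]_l -> 'rV[R]_n) (M : R).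
Hypotheses (U_compact : compact U) (V_compact : compact V) (M_ge0 : 0 <= M)
  (g_continuous : forall i, field_continuous U V (g i))
  (g_lipschitz : forall i, locally_lipschitz_unif U V (g i))
  (g_growth : forall i, linear_growth U V M (g i)).
Local Notation mu := (@lebesgue_measure R).
Implicit Types (S W : R) (x : 'rV[R]_n) (p : R -> 'rV[R]_m) (y z : R -> 'rV[R]_n)
  (c : 'I_m.+1 -> R -> 'rV[R]_l) (w : 'I_m.+1 -> R -> R).

(** The equation in t and the equation in space-time have this common form: the
    densities w are (1, u') in the first and (phi0', phi') in the second. *)
Definition rhs w p c y (t : R) : 'rV[R]_n :=
  \sum_(j < m.+1) w j t *: g j (y t) (p t) (c j t).

Definition admissible W w p c :=
  [/\ vmeas p /\ (forall t, U (p t)),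
      (forall j, vmeas (c j)) /\ (forall j t, V (c j t)),
      forall j, bm (w j) & forall j t, `|w j t| <= W].

(** Unlike the differential form with a.e. equality, the integral form passes
    to uniform limits and to changes of parameter. *)
Definition integral_solution S (x0 : 'rV[R]_n) w p c y :=
  [/\ vmeas y, exists B, forall t, enorm (y t) <= B &
    forall t i, 0 <= t <= S ->
      y t ord0 i = x0 ord0 i + integ 0 t (fun s => rhs w p c y s ord0 i)].

Lemma enorm_sum d (J : Type) (r : seq J) (P : pred J) (F : J -> 'rV[R]_d) :
  enorm (\sum_(j <- r | P j) F j) <= \sum_(j <- r | P j) enorm (F j).
Proof.
apply: (big_ind2 (fun a b => enorm a <= b)) => //; first by rewrite enorm0.
by move=> a b a' b' h h'; rewrite (le_trans (enormD _ _))// lerD.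
Qed.

Lemma admissible_ge0 W w p c : admissible W w p c -> 0 <= W.
Proof. by case=> _ _ _ /(_ ord0 0); exact: le_trans. Qed.

Lemma bm_field j p (v : R -> 'rV[R]_l) y i : vmeas p -> (forall t, U (p t)) ->
  vmeas v -> (forall t, V (v t)) -> vmeas y -> (exists B, forall t, enorm (y t) <= B) ->
  bm (fun t => g j (y t) (p t) (v t) ord0 i).
Proof.
move=> mp Up mv Vv my [B yB]; split.
  exact: (measurable_field (@g_continuous j) my mp mv Up Vv).
have [D _ gD] := field_bounded U_compact B M_ge0 (@g_growth j).
by exists D => t; rewrite (le_trans (enorm_coord _ _))// gD.
Qed.

Lemma bm_rhs W w p c y : admissible W w p c -> vmeas y ->
  (exists B, forall t, enorm (y t) <= B) -> forall i, bm (fun t => rhs w p c y t ord0 i).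
Proof.
move=> [[mp Up] [mc Vc] bw wW] my yB i.
rewrite (_ : (fun t => _) = fun t => \sum_(j < m.+1) w j t * g j (y t) (p t) (c j t) ord0 i).
  by apply: bm_sum => j; apply: bmM => //; exact: bm_field.
by apply/funext => t; rewrite /rhs summxE; apply: eq_bigr => j _; rewrite mxE.
Qed.

Lemma rhs_growth W BU w p c y t : admissible W w p c ->
  (forall u, U u -> enorm u <= BU) ->
  enorm (rhs w p c y t) <= m.+1%:R * W * M * (1 + BU) + m.+1%:R * W * M * enorm (y t).
Proof.
move=> adm UB; have W0 := admissible_ge0 adm; case: adm => [[mp Up] [mc Vc] bw wW].
rewrite (le_trans (enorm_sum _ _ _))//.
apply: (@le_trans _ _ (\sum_(j < m.+1) W * (M * (1 + (enorm (y t) + BU))))).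
  apply: ler_sum => j _; rewrite enormZ ler_pM ?enorm_ge0//.
  rewrite (le_trans (@g_growth j _ _ _ (Up t) (Vc j t)))// ler_wpM2l// lerD2l.
  by rewrite (le_trans (enorm_row_mx _ _))// lerD2l UB.
by rewrite sumr_const card_ord -mulr_natl le_eqVlt; apply/orP; left; apply/eqP; ring.
Qed.

Lemma rhs_lipschitz W r : 0 <= W -> exists2 K : R, 0 <= K &
  forall w p q c y z t, (forall j t, `|w j t| <= W) -> (forall j t, V (c j t)) ->
   U (p t) -> U (q t) -> enorm (y t) <= r -> enorm (z t) <= r ->
   enorm (rhs w p c y t - rhs w q c z t) <= K * (enorm (y t - z t) + enorm (p t - q t)).
Proof.
move=> W0.
have /choice[L LP] j : exists L : R, 0 <= L /\ forall x1 x2 u1 u2 v, enorm x1 <= r -> enorm x2 <= r ->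
    U u1 -> U u2 -> V v ->
    enorm (g j x1 u1 v - g j x2 u2 v) <= L * (enorm (x1 - x2) + enorm (u1 - u2)).
  have [L L0 LP] := field_lipschitz U_compact r M_ge0 (@g_growth j) (@g_lipschitz j).
  by exists L.
exists (\sum_(j < m.+1) W * L j).
  by apply: sumr_ge0 => j _; rewrite mulr_ge0//; case: (LP j).
move=> w p q c y z t wW Vc Up Uq yr zr.
rewrite /rhs -sumrB (le_trans (enorm_sum _ _ _))// mulr_suml; apply: ler_sum => j _.
rewrite -scalerBr enormZ -mulrA ler_pM ?enorm_ge0//.
by case: (LP j) => _; apply.
Qed.

Lemma integral_solution_le S (x0 : 'rV[R]_n) W BU w p c y t : admissible W w p c ->
  (forall u, U u -> enorm u <= BU) -> integral_solution S x0 w p c y ->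
  0 <= t <= S ->
  enorm (y t) <= enorm x0 + m.+1%:R * W * M * (1 + BU) * S +
     m.+1%:R * W * M * integ 0 t (fun s => enorm (y s)).
Proof.
move=> adm UB [my yB yE] /[dup] tS /andP[t0 t1].
have W0 := admissible_ge0 adm.
have BU0 : 0 <= BU by case: adm => [[_ /(_ 0)/UB h] _ _ _]; exact: le_trans (enorm_ge0 _) h.
have br := bm_rhs adm my yB.
have by' : bm (fun t => enorm (y t)).
  apply: bm_enorm => i; split; first exact: my.
  by case: yB => B yB; exists B => s; exact: le_trans (enorm_coord _ _) (yB s).
have -> : y t = x0 + (y t - x0) by rewrite addrC subrK.
rewrite (le_trans (enormD _ _))// -addrA lerD2l.
apply: le_trans (enorm_integ t0 br _) _.
  by move=> i; rewrite !mxE yE// addrAC subrr add0r.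
set C := m.+1%:R * W * M.
have C0 : 0 <= C by rewrite !mulr_ge0.
apply: (@le_trans _ _ (integ 0 t (fun s => C * (1 + BU) + C * enorm (y s)))).
  apply: integ_le; [exact: bm_enorm | | by move=> s _; exact: rhs_growth].
  by apply: bmD; [exact: bm_cst | apply: bmM => //; exact: bm_cst].
rewrite integ_D; [|exact: bm_cst|by apply: bmM => //; exact: bm_cst].
rewrite integ_cst// integ_Zl// subr0 lerD2r ler_wpM2l// mulr_ge0// addr_ge0//.
Qed.

(** The radius depends on the controls through their bounds only; so the
    solutions of a whole sequence stay in a ball, where the fields are bounded
    and Lipschitz. *)
Lemma ode_bound S W (x0 : 'rV[R]_n) : 0 <= S -> exists r, forall w p c y, admissible W w p c ->
  integral_solution S x0 w p c y -> forall t, 0 <= t <= S -> enorm (y t) <= r.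
Proof.
move=> S0; have [BU BU0 UB] := compact_enorm_bounded U_compact.
exists (2 * (enorm x0 + m.+1%:R * W * M * (1 + BU) * S) * expR (2 * (m.+1%:R * W * M) * S)).
move=> w p c y adm sol t tS; have W0 := admissible_ge0 adm.
have by' : bm (fun t => enorm (y t)).
  case: sol => my [B yB] _; apply: bm_enorm => i; split; first exact: my.
  by exists B => s; exact: le_trans (enorm_coord _ _) (yB s).
apply: (gronwall _ S0 _ by') tS => //.
- by rewrite !mulr_ge0.
- by rewrite addr_ge0 ?enorm_ge0// !mulr_ge0// addr_ge0.
- by move=> s; exact: enorm_ge0.
- by move=> s; exact: integral_solution_le adm UB sol.
Qed.

Lemma integral_solution_vlip S (x0 : 'rV[R]_n) W w p c y : admissible W w p c ->
  integral_solution S x0 w p c y -> exists2 L, 0 <= L & vlip_on 0 S L y.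
Proof.
move=> adm [my [B yB] yE]; have br := bm_rhs adm my (ex_intro _ B yB).
have [_ [L LP]] := bm_enorm br; exists L; first exact: le_trans (LP 0).
move=> s t s0 st tS; apply: (le_trans (enorm_integ st br _)).
  move=> i; rewrite !mxE !yE ?s0 ?tS ?(le_trans s0) ?(le_trans st)//.
  by rewrite -(integ_incr (br i) s0 st); ring.
rewrite (le_trans (ler_norm _))//; apply: integ_bound => // ; exact: bm_enorm.
Qed.

Lemma integral_solution_derive S (x0 : 'rV[R]_n) W w p c y : admissible W w p c ->
  integral_solution S x0 w p c y ->
  {ae mu, forall t, 0 < t < S -> is_derive t 1 y (rhs w p c y t)}.
Proof.
move=> adm [my yB yE]; have br := bm_rhs adm my yB.
have : {ae mu, forall t, forall i, 0 < t < S ->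
    is_derive t 1 (fun s => y s ord0 i) (rhs w p c y t ord0 i)}.
  have H i : {ae mu, forall t, 0 < t < S ->
    is_derive t 1 (fun s => y s ord0 i) (rhs w p c y t ord0 i)}.
    apply: aeS (integ_derive 0 (br i)) => t + /andP[t0 tS] => /(_ t0) h.
    have := is_deriveDf (is_derive_cstf t (x0 ord0 i)) h; rewrite add0r.
    have k0 : 0 < Num.min t (S - t) by rewrite lt_min t0 subr_gt0.
    apply: (is_derive_near k0) => s; rewrite lt_min !ltr_norml.
    by move=> /andP[/andP[h1 h2] /andP[h3 h4]]; rewrite yE//; apply/andP; split; lra.
  by apply: filter_forall; exact: H.
by apply: aeS => t H tab; apply/is_derive_rVP => i; exact: H.
Qed.

End differential_equation.

Section existence.
Context {R : realType} {n m l : nat} (U : set 'rV[R]_m) (V : set 'rV[R]_l).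
Context (g : 'I_m.+1 -> 'rV[R]_n -> 'rV[R]_m -> 'rV[R]_l -> 'rV[R]_n) (M : R).
Hypotheses (U_compact : compact U) (M_ge0 : 0 <= M)
  (g_continuous : forall i, field_continuous U V (g i))
  (g_lipschitz : forall i, locally_lipschitz_unif U V (g i))
  (g_growth : forall i, linear_growth U V M (g i)).
Local Notation mu := (@lebesgue_measure R).

Definition vclamp d r (x : 'rV[R]_d) : 'rV[R]_d :=
  \row_i Num.max (- r) (Num.min r (x ord0 i)).

Lemma vclamp_id d r (x : 'rV[R]_d) : enorm x <= r -> vclamp r x = x.
Proof.
move=> xr; apply/rowP => i; rewrite mxE clamp_id// -ler_norml.
exact: le_trans (enorm_coord _ _) xr.
Qed.

Lemma vclamp_bound d r (x : 'rV[R]_d) : 0 <= r -> enorm (vclamp r x) <= d%:R * r.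
Proof.
move=> r0; rewrite (le_trans (enorm_le_sum _))// mulr_natl -[X in _ *+ X]card_ord -sumr_const.
by apply: ler_sum => i _; rewrite mxE ler_norml; apply: clamp_ge; lra.
Qed.

Lemma enorm_le_coord d (x y : 'rV[R]_d) :
  (forall i, `|x ord0 i| <= `|y ord0 i|) -> enorm x <= enorm y.
Proof.
move=> xy; apply: ler_wsqrtr; apply: ler_sum => i _.
rewrite -[x _ _ ^+ 2](real_normK (num_real _)) -[y _ _ ^+ 2](real_normK (num_real _)).
by rewrite lerXn2r ?nnegrE.
Qed.

Lemma vclamp_lip d r (x y : 'rV[R]_d) : enorm (vclamp r x - vclamp r y) <= enorm (x - y).
Proof.
by apply: enorm_le_coord => i; rewrite !mxE; exact: clamp_dist.
Qed.

Lemma vclamp_le d r (x : 'rV[R]_d) : 0 <= r -> enorm (vclamp r x) <= enorm x.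
Proof.
move=> r0; have := vclamp_lip r x 0; rewrite subr0 [vclamp r 0]vclamp_id ?enorm0//.
by rewrite subr0.
Qed.

Lemma half_pow_small (C e : R) : 0 < e -> exists k : nat, C / 2 ^+ k < e.
Proof.
move=> e0; exists (Num.bound `|C / e|).
rewrite ltr_pdivrMr ?exprn_gt0// mulrC -ltr_pdivrMr//.
apply: (lt_le_trans (le_lt_trans (ler_norm _) (archi_boundP (normr_ge0 _)))).
by rewrite -natrX ler_nat ltnW// ltn_expl.
Qed.

Lemma vmeas_vclamp d r (y : R -> 'rV[R]_d) : vmeas y -> vmeas (fun t => vclamp r (y t)).
Proof.
move=> my i; under eq_fun do rewrite mxE.
by apply: measurable_maxr => //; apply: measurable_minr.
Qed.

(** Picard iteration for the field truncated outside a ball: the truncated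
    field is Lipschitz, so the iterates converge for the weighted norm, and the
    limit satisfies the a priori bound of the original equation, which keeps it
    in the ball where the truncation changes nothing. *)
Lemma ode_exists (S W : R) (x0 : 'rV[R]_n) w p c : 0 <= S -> admissible U V W w p c ->
  exists y, integral_solution g S x0 w p c y.
Proof.
move=> S0 adm; have W0 := admissible_ge0 adm.
have [BU BU0 UB] := compact_enorm_bounded U_compact.
pose r := 2 * (enorm x0 + m.+1%:R * W * M * (1 + BU) * S) * expR (2 * (m.+1%:R * W * M) * S).
have r0 : 0 <= r.
  by rewrite mulr_ge0 ?expR_ge0// mulr_ge0// addr_ge0 ?enorm_ge0// !mulr_ge0// addr_ge0.
pose tr (y : R -> 'rV[R]_n) (t : R) := vclamp r (y t).
have trB y t : enorm (tr y t) <= n%:R * r by exact: vclamp_bound.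
have [K K0 KP] := rhs_lipschitz U_compact M_ge0 g_lipschitz g_growth (n%:R * r) W0.
pose cl (t : R) := Num.max 0 (Num.min S t).
have clS t : 0 <= cl t <= S by exact: clamp_ge.
pose f y := rhs g w p c (tr y).
have bf y : vmeas y -> forall i, bm (fun t => f y t ord0 i).
  move=> my; apply: (bm_rhs U_compact M_ge0 g_continuous g_growth adm).
    exact: vmeas_vclamp.
  by exists (n%:R * r).
pose Phi y (t : R) : 'rV[R]_n := x0 + \row_i integ 0 (cl t) (fun s => f y s ord0 i).
pose B := m.+1%:R * W * M * (1 + BU) + m.+1%:R * W * M * (n%:R * r).
have fB y t : enorm (f y t) <= B.
  apply: le_trans (rhs_growth M_ge0 g_growth _ _ adm UB) _.
  by rewrite lerD2l ler_wpM2l// !mulr_ge0.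
have B0 : 0 <= B by apply: le_trans (fB (fun=> 0) 0); exact: enorm_ge0.
have PhiL y : vmeas y -> vlip_on 0 S B (Phi y).
  move=> my s t s0 st tS.
  apply: le_trans (enorm_integ st (bf y my) _) _.
    move=> i; rewrite /Phi !mxE /cl !clamp_id ?s0 ?tS ?(le_trans s0) ?(le_trans st)//.
    by rewrite -(integ_incr (bf y my i) s0 st); ring.
  apply: le_trans (ler_norm _) _; apply: integ_bound => //; first exact: bm_enorm (bf y my).
  by move=> q _; rewrite ger0_norm ?enorm_ge0.
have Phicl y t : Phi y (cl t) = Phi y t.
  by rewrite /Phi /cl clamp_id//; exact: clS.
have vlipM y : vlip_on 0 S B y -> (forall t, y (cl t) = y t) -> vmeas y.
  move=> yL ycl i.
  have -> : (fun t => y t ord0 i) = (fun t => y (cl t) ord0 i).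
    by apply/funext => t; rewrite ycl.
  exact: (lip_measurable S0 (vlip_coord i yL)).
have PhiM y : vmeas y -> vmeas (Phi y).
  by move=> my; apply: vlipM; [exact: PhiL | exact: Phicl].
have fL y z t : enorm (f y t - f z t) <= K * enorm (y t - z t).
  case: (adm) => [[mp Up] [mc Vc] bw wW].
  apply: le_trans (KP w p p c (tr y) (tr z) t wW Vc (Up t) (Up t) (trB y t) (trB z t)) _.
  by rewrite subrr enorm0 addr0 ler_wpM2l// vclamp_lip.
have PhiD y z t : vmeas y -> vmeas z -> 0 <= t <= S ->
    bm (fun s => enorm (y s - z s)) ->
    enorm (Phi y t - Phi z t) <= K * integ 0 t (fun s => enorm (y s - z s)).
  move=> my mz tS bd; have /andP[t0 _] := tS.
  have bD i : bm (fun s => (f y s - f z s) ord0 i).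
    by under eq_fun do rewrite !mxE; apply: bmB; exact: bf.
  apply: le_trans (enorm_integ t0 bD _) _.
    move=> i; under [fun s => _]eq_fun do rewrite !mxE.
    rewrite integ_B; [|exact: bf|exact: bf].
    by rewrite /Phi /cl clamp_id// !mxE; ring.
  rewrite -integ_Zl//; apply: integ_le => //; first exact: bm_enorm.
    by apply: bmM => //; exact: bm_cst.
pose yk k := iter k Phi (fun=> x0).
have ykM k : vmeas (yk k) by elim: k => [|k IH]; [move=> i; exact: measurable_cst|exact: PhiM].
have ykcl k t : yk k (cl t) = yk k t by case: k => //= k; exact: Phicl.
have ykB k t : enorm (yk k t) <= enorm x0 + B * S.
  case: k => [|k]; first by rewrite lerDl mulr_ge0.
  have /andP[h1 h2] := clS t.
  rewrite /= /Phi (le_trans (enormD _ _))// lerD2l.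
  apply: le_trans (enorm_integ h1 (bf _ (ykM k)) _) _; first by move=> i; rewrite !mxE.
  apply: (@le_trans _ _ (B * (cl t - 0))); last by rewrite subr0 ler_wpM2l.
  apply: le_trans (ler_norm _) _; apply: integ_bound => //.
    exact: bm_enorm (bf _ (ykM k)).
  by move=> q _; rewrite ger0_norm ?enorm_ge0.
have bmv (y : R -> 'rV[R]_n) : vmeas y -> (exists C, forall t, enorm (y t) <= C) -> forall i, bm (fun t => y t ord0 i).
  move=> my [C yC] i; split; first exact: my.
  by exists C => t; exact: le_trans (enorm_coord _ _) (yC t).
have bmd (y z : R -> 'rV[R]_n) : vmeas y -> (exists C, forall t, enorm (y t) <= C) -> vmeas z ->
    (exists C, forall t, enorm (z t) <= C) -> bm (fun s => enorm (y s - z s)).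
  move=> my yC mz zC; apply: bm_enorm => i.
  by under eq_fun do rewrite !mxE; apply: bmB; exact: bmv.
have ykC k : exists C, forall t, enorm (yk k t) <= C by exists (enorm x0 + B * S).
have bdif k : bm (fun s => enorm (yk k.+1 s - yk k s)) by exact: bmd.
pose A := 2 * (enorm x0 + B * S).
have A0 : 0 <= A by rewrite mulr_ge0// addr_ge0 ?enorm_ge0// mulr_ge0.
have bw := bm_expw K S0.
have step k : forall t, 0 <= t <= S ->
    enorm (yk k.+1 t - yk k t) <= A / 2 ^+ k * expw K S t.
  elim: k => [|k IH] t tS.
    rewrite expr0 divr1 (@le_trans _ _ A)//; last by rewrite ler_peMr// expw_ge1.
    rewrite (le_trans (enormD _ _))// enormN /A; have := ykB 1%N t; have := ykB 0%N t; lra.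
  have /andP[t0 tS'] := tS.
  apply: le_trans (PhiD _ _ t (ykM k.+1) (ykM k) tS (bdif k)) _.
  have Ak : 0 <= A / 2 ^+ k by rewrite divr_ge0.
  apply: (@le_trans _ _ (A / 2 ^+ k * (K * integ 0 t (expw K S)))).
    rewrite mulrCA ler_wpM2l// -integ_Zl//; apply: integ_le => //.
      by apply: bmM => //; exact: bm_cst.
    by move=> s /andP[s0 st]; apply: IH; rewrite s0 (le_trans st).
  have -> : A / 2 ^+ k.+1 * expw K S t = A / 2 ^+ k * (expw K S t / 2).
    by rewrite exprS; field; rewrite expf_neq0.
  by rewrite ler_wpM2l// integ_expw.
pose E0 := A * expR (2 * K * S).
have E00 : 0 <= E0 by rewrite mulr_ge0 ?expR_ge0.
have E0k k : 0 <= E0 / 2 ^+ k by apply: divr_ge0 => //; exact: exprn_ge0.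
have E0k2 k : 0 <= 2 * E0 / 2 ^+ k.
  by apply: divr_ge0; [exact: mulr_ge0 | exact: exprn_ge0].
have step' k t : enorm (yk k.+1 t - yk k t) <= E0 / 2 ^+ k.
  rewrite -(ykcl k.+1) -(ykcl k) (le_trans (step k _ (clS t)))// /E0 mulrAC.
  by rewrite ler_wpM2r ?invr_ge0 ?exprn_ge0// ler_wpM2l// expw_le.
have cauchy k j t : enorm (yk (j + k)%N t - yk k t) <= 2 * E0 / 2 ^+ k - 2 * E0 / 2 ^+ (j + k).
  elim: j => [|j IH]; first by rewrite add0n !subrr enorm0.
  apply: le_trans (enorm_triangle (yk (j + k)%N t) _ _) _.
  have := step' (j + k)%N t; rewrite addSn exprS.
  have -> : 2 * E0 / (2 * 2 ^+ (j + k)) = E0 / 2 ^+ (j + k).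
    by field; rewrite expf_neq0.
  have E2 : 2 * E0 / 2 ^+ (j + k) = E0 / 2 ^+ (j + k) + E0 / 2 ^+ (j + k) by ring.
  by rewrite E2 in IH; lra.
have [F [FU ooF]] := ultraFilterLemma (eventually_filter : ProperFilter \oo).
have FP : ProperFilter F by exact: ultra_proper.
have /choice[y0 y0P] t := @ultra_vlim _ F _ (fun k => yk k t) _ FU (fun k => ykB k t).
pose y t := y0 (cl t).
have ylim k t : enorm (yk k t - y t) <= 2 * E0 / 2 ^+ k.
  apply/ler_addgt0Pr => e e0.
  have kk : \forall k' \near F, (k <= k')%N by apply: ooF; exists k.
  have [k' [kk' h]] := filter_ex (filterI kk (y0P (cl t) e e0)).
  have := enorm_triangle (yk k' t) (yk k t) (y t); rewrite ykcl in h.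
  have := cauchy k (k' - k)%N t; rewrite subnK// enormB.
  have := E0k2 k'.
  by rewrite -/(y t) in h; lra.
have ycl t : y (cl t) = y t by rewrite /y /cl clamp_id//; exact: clS.
have yL : vlip_on 0 S B y.
  move=> s t s0 st tS; apply/ler_addgt0Pr => e e0.
  have [k kP] := half_pow_small (E0 + E0) e0.
  have E1 : 2 * E0 / 2 ^+ k.+1 = E0 / 2 ^+ k by rewrite exprS; field; rewrite expf_neq0.
  have h1 : enorm (y t - yk k.+1 t) <= E0 / 2 ^+ k by rewrite enormB -E1.
  have h2 : enorm (yk k.+1 s - y s) <= E0 / 2 ^+ k by rewrite -E1.
  have h3 : enorm (yk k.+1 t - yk k.+1 s) <= B * (t - s) by exact: PhiL.
  apply: le_trans (enorm_triangle (yk k.+1 t) _ _) _.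
  apply: le_trans (lerD h1 (le_trans (enorm_triangle (yk k.+1 s) _ _) (lerD h3 h2))) _.
  by rewrite addrCA lerD2l -mulrDl ltW.
have my : vmeas y by exact: vlipM yL ycl.
have yC : exists C, forall t, enorm (y t) <= C.
  exists (enorm x0 + B * S + 2 * E0) => t; rewrite -(subrK (yk 0%N t) (y t)) addrC.
  apply: le_trans (enormD _ _) (lerD (ykB 0%N t) _); rewrite enormB.
  by have := ylim 0%N t; rewrite expr0 divr1.
have Phiy t : 0 <= t <= S -> Phi y t = y t.
  move=> tS; have /andP[t0 tS'] := tS.
  apply/eqP; rewrite -subr_eq0; apply/eqP/enorm_eq0/eqP.
  rewrite eq_le enorm_ge0 andbT; apply/ler_addgt0Pr => e e0; rewrite add0r.
  have [k kP] := half_pow_small (2 * E0 * (K * S + 1)) e0.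
  have bd := bmd _ _ my yC (ykM k) (ykC k).
  have h1 := PhiD y (yk k) t my (ykM k) tS bd.
  have h2 : K * integ 0 t (fun s => enorm (y s - yk k s)) <= K * (2 * E0 / 2 ^+ k * S).
    rewrite ler_wpM2l// (@le_trans _ _ (2 * E0 / 2 ^+ k * (t - 0)))//; last first.
      by rewrite subr0 ler_wpM2l.
    apply: le_trans (ler_norm _) _; apply: integ_bound => // s _.
    by rewrite ger0_norm ?enorm_ge0// enormB.
  have E1 : 2 * E0 / 2 ^+ k.+1 = E0 / 2 ^+ k by rewrite exprS; field; rewrite expf_neq0.
  have h4 : enorm (yk k.+1 t - y t) <= E0 / 2 ^+ k by rewrite -E1.
  apply: le_trans (enorm_triangle (yk k.+1 t) _ _) _.
  apply: le_trans (lerD (le_trans h1 h2) h4) _; apply: le_trans (ltW kP).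
  have -> : 2 * E0 * (K * S + 1) / 2 ^+ k = K * (2 * E0 / 2 ^+ k * S) + 2 * (E0 / 2 ^+ k) by ring.
  by rewrite lerD2l mulr_natl mulr2n lerDl.
have by' : bm (fun t => enorm (y t)) by apply: bm_enorm; exact: bmv.
have yr t : enorm (y t) <= r.
  rewrite -ycl; apply: (gronwall (K := m.+1%:R * W * M) _ S0 _ by') (clS t).
  - by rewrite !mulr_ge0.
  - by rewrite addr_ge0 ?enorm_ge0// !mulr_ge0// addr_ge0.
  - by move=> s; exact: enorm_ge0.
  move=> s /[dup] sS /andP[s0 sS'].
  rewrite -[in leLHS]Phiy// /Phi (le_trans (enormD _ _))// -addrA lerD2l.
  have -> : cl s = s by rewrite /cl clamp_id.
  apply: le_trans (enorm_integ s0 (bf _ my) _) _; first by move=> i; rewrite !mxE.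
  set C := m.+1%:R * W * M.
  have C0 : 0 <= C by rewrite !mulr_ge0.
  have bC : bm (fun q => C * enorm (y q)) by apply: bmM => //; exact: bm_cst.
  apply: (@le_trans _ _ (integ 0 s (fun q => C * (1 + BU) + C * enorm (y q)))).
    apply: integ_le; [exact: bm_enorm (bf _ my) | by apply: bmD => //; exact: bm_cst|].
    move=> q _; apply: le_trans (rhs_growth M_ge0 g_growth _ _ adm UB) _.
    by rewrite lerD2l ler_wpM2l// vclamp_le.
  rewrite integ_D//; last exact: bm_cst.
  by rewrite integ_cst// integ_Zl// subr0 lerD2r ler_wpM2l// mulr_ge0// addr_ge0.
exists y; split => // t i tS; rewrite -[in LHS]Phiy// /Phi !mxE; congr (_ + _).
have -> : cl t = t by rewrite /cl clamp_id.
by apply: integ_eq => s _; rewrite /f /rhs /tr vclamp_id.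
Qed.

End existence.

(** * Weak convergence and continuous dependence *)

Section weak_convergence.
Context {R : realType}.
Implicit Types (a b s t e B S W L : R) (f h c d : R -> R).
Local Notation mu := (@lebesgue_measure R).

Definition unif_cont c := forall e : R, 0 < e -> exists2 r : R, 0 < r &
  forall s t, `|s - t| <= r -> `|c s - c t| <= e.

(** A sequence of pairs that violates uniform continuity would have both
    members converging to one point along an ultrafilter. *)
Lemma continuous_clamp_unif S c : 0 <= S -> continuous c ->
  unif_cont (fun t => c (Num.max 0 (Num.min S t))).
Proof.
move=> S0 cc e e0; apply: contrapT => nuc.
pose cl t := Num.max 0 (Num.min S t).
have clB (t : R) : `|cl t| <= S.
  by have /andP[h1 h2] := clamp_ge t S0; rewrite ger0_norm.
have clL s t : `|cl s - cl t| <= `|s - t| by exact: clamp_dist.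
have /choice[w wP] (k : nat) : exists w : R * R, `|w.1 - w.2| <= 1 / k.+1%:R /\
    e < `|c (cl w.1) - c (cl w.2)|.
  apply: contrapT => nw; apply: nuc; exists (1 / k.+1%:R) => // s t st.
  by rewrite leNgt; apply/negP => h; apply: nw; exists (s, t).
have [F [FU ooF]] := ultraFilterLemma (eventually_filter : ProperFilter \oo).
have FP : ProperFilter F by exact: ultra_proper.
have [q qP] := @ultra_lim _ F (fun k => cl (w k).1) S FU (fun k => clB _).
have e2 : 0 < e / 2 by rewrite divr_gt0.
have /cvgrPdist_lt/(_ _ e2)/nbhs_ballP[r /= r0 rP] := cc q.
have r2 : 0 < r / 2 by rewrite divr_gt0.
have [k [h1 h2]] := filter_ex (filterI (qP _ r2) (near_invn_lt 1 FP ooF r2)).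
have [h3 h4] := wP k.
have h5 := le_lt_trans (clL (w k).1 (w k).2) (le_lt_trans h3 h2).
have := rP (cl (w k).1); rewrite /ball/= distrC => /(_ _)h6.
have := rP (cl (w k).2); rewrite /ball/= distrC => /(_ _)h7.
have {}h6 : `|c q - c (cl (w k).1)| < e / 2 by apply: h6; lra.
have {}h7 : `|c q - c (cl (w k).2)| < e / 2.
  apply: h7; have -> : cl (w k).2 - q = (cl (w k).1 - q) - (cl (w k).1 - cl (w k).2) by ring.
  by apply: le_lt_trans (ler_normB _ _) _; move: h1 h5; clear; rewrite /=; lra.
have := ler_normB (c q - c (cl (w k).2)) (c q - c (cl (w k).1)).
have -> : c q - c (cl (w k).2) - (c q - c (cl (w k).1)) =
  c (cl (w k).1) - c (cl (w k).2) by ring.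
lra.
Qed.

(** An approximation in mean by continuous functions is clamped twice: in the
    argument, which makes it uniformly continuous, and in the value, which
    decreases the distance to h. *)
Lemma bm_dense h B S e : bm h -> (forall t, `|h t| <= B) -> 0 <= S -> 0 < e ->
  exists c, [/\ bm c, forall t, `|c t| <= B, unif_cont c &
    integ 0 S (fun s => `|h s - c s|) <= e].
Proof.
move=> bh hB S0 e0.
have ih := bm_integrable 0 S bh.
have fin : (mu `[0%R, S]%classic < +oo)%E.
  by rewrite /= lebesgue_measure_itv /=; case: ifP => _; rewrite -?EFinD ltry.
have [c_ [cc ic cv]] := approximation_continuous_integrable (measurable_itv _) fin ih.
have [k kP] : exists k, (\int[mu]_(z in `[0%R, S]) `|(h z - c_ k z)%:E| < e%:E)%E.
  have /fine_cvgP[h1 /cvgrPdist_lt/(_ _ e0) h2] := cv.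
  have [k [h3 h4]] := filter_ex (filterI h1 h2); exists k.
  rewrite -[X in (X < _)%E]fineK// lte_fin.
  by move: h4; rewrite /= sub0r normrN; exact: le_lt_trans (ler_norm _).
have B0 : 0 <= B by apply: le_trans (hB 0).
pose cl t := Num.max 0 (Num.min S t).
pose c t := Num.max (- B) (Num.min B (c_ k (cl t))).
have mc : measurable_fun setT (fun t => c_ k (cl t)).
  apply: measurableT_comp; first exact: continuous_measurable_fun (cc k).
  by apply: measurable_maxr => //; apply: measurable_minr.
have cB t : `|c t| <= B by rewrite ler_norml; apply: clamp_ge; lra.
have bc : bm c by apply: bm_clamp => //; lra.
exists c; split => //.
  move=> e' e'0; have [r r0 rP] := continuous_clamp_unif S0 (cc k) e'0.
  by exists r => // s t /rP; apply: le_trans; exact: clamp_dist.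
rewrite -lee_fin; apply: le_trans (ltW kP).
rewrite /integ /Rintegral fineK; last first.
  apply: integrable_fin_num => //; apply: (bm_integrable 0 S (bm_norm (bmB bh bc))).
apply: ge0_le_integral => //.
- apply/measurable_EFinP/measurable_funTS.
  by have [] := bm_norm (bmB bh bc).
- apply/measurable_EFinP/measurable_funTS; apply: measurableT_comp => //.
  apply: measurable_funB; [by case: bh | exact: continuous_measurable_fun (cc k)].
move=> t; rewrite /= in_itv/= => tS; rewrite lee_fin /c /cl [Num.max 0 _]clamp_id//.
have hid : Num.max (- B) (Num.min B (h t)) = h t by rewrite clamp_id// -ler_norml.
by have := clamp_dist (- B) B (h t) (c_ k t); rewrite hid.
Qed.

(** On each piece of length S / (N + 1) the factor c is replaced by its value
    at the left end: the error is at most the oscillation L times the mass W of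
    d, and what remains is an increment of the primitive of d. *)
Lemma osc_integ d c S L B W eta N i : 0 <= S -> bm d -> bm c -> (forall t, `|d t| <= W) ->
  (forall t, `|c t| <= B) ->
  (forall s t, `|s - t| <= S / N.+1%:R -> `|c s - c t| <= L) ->
  (forall t, 0 <= t <= S -> `|integ 0 t d| <= eta) -> (i <= N.+1)%N ->
  forall t, 0 <= t <= i%:R * (S / N.+1%:R) ->
  `|integ 0 t (fun s => d s * c s)| <= L * W * t + i%:R * (2 * B * eta).
Proof.
move=> S0 bd bc dW cB cL dI; pose q := S / N.+1%:R.
have q0 : 0 <= q by rewrite divr_ge0.
have bdc : bm (fun s => d s * c s) by exact: bmM.
have W0 : 0 <= W by apply: le_trans (dW 0).
have B0 : 0 <= B by apply: le_trans (cB 0).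
have L0 : 0 <= L by apply: le_trans (cL 0 0 _); rewrite subrr normr0.
have e0 : 0 <= eta by apply: le_trans (dI 0 _); rewrite ?lexx.
rewrite -/q; elim: i => [_ t|i IH iN t /andP[t0 ti]].
  rewrite mul0r => ti; have -> : t = 0 by apply/eqP; rewrite eq_le andbC.
  by rewrite integ_aa normr0 mulr0 mul0r addr0.
have {}IH := IH (ltnW iN).
have [ti'|/ltW it] := leP t (i%:R * q).
  apply: le_trans (IH t _) _; first by rewrite t0.
  by rewrite lerD2l ler_wpM2r ?mulr_ge0// ler_nat.
set s0 := i%:R * q in IH it.
have s00 : 0 <= s0 by rewrite mulr_ge0.
have tS : t <= S.
  apply: le_trans ti _; rewrite /q mulrCA ler_piMr// ler_pdivrMr// mul1r ler_nat//.
rewrite (integ_cat bdc s00 it).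
have -> : integ s0 t (fun s => d s * c s) =
   integ s0 t (fun s => d s * (c s - c s0)) + integ s0 t d * c s0.
  rewrite [_ * c s0]mulrC -integ_Zl// -integ_D; last 2 first.
  - by apply: bmM => //; apply: bmB => //; exact: bm_cst.
  - by apply: bmM => //; exact: bm_cst.
  by apply: integ_eq => s _; ring.
have h1 := IH s0; rewrite s00 lexx in h1; have {}h1 := h1 isT.
have h2 : `|integ s0 t (fun s => d s * (c s - c s0))| <= W * L * (t - s0).
  apply: integ_bound => //.
    by apply: bmM => //; apply: bmB => //; exact: bm_cst.
  move=> s /andP[s1 s2]; rewrite normrM ler_pM//; apply: cL; rewrite ger0_norm ?subr_ge0//.
  rewrite (@le_trans _ _ (t - s0)) ?lerD2r// lerBlDl.
  by move: ti; rewrite -natr1 mulrDl mul1r.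
have h3 : `|integ s0 t d * c s0| <= 2 * B * eta.
  rewrite normrM mulrC -mulrA mulrCA ler_pM// -(integ_incr bd s00 it).
  rewrite (le_trans (ler_normB _ _))// mulr_natl mulr2n lerD// dI ?t0 ?tS ?s00//.
  exact: le_trans it tS.
apply: le_trans (ler_normD _ _) _; apply: le_trans (lerD h1 (le_trans (ler_normD _ _) (lerD h2 h3))) _.
rewrite -natr1 le_eqVlt; apply/orP; left; apply/eqP; ring.
Qed.

Lemma absorb_le (A e : R) : 0 <= A -> 0 <= e -> A * (e / (A + 1)) <= e.
Proof.
move=> A0 e0; rewrite mulrA ler_pdivrMr ?ltr_wpDl// mulrC ler_wpM2l//.
by rewrite lerDl.
Qed.

(** The factor h is replaced in mean by a uniformly continuous function, for
    which osc_integ shows that only the primitives of dk matter. *)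
Lemma weak_cvg (F : set_system nat) (dk : nat -> R -> R) h S W : ProperFilter F ->
  0 <= S -> (forall k, bm (dk k)) -> (forall k t, `|dk k t| <= W) -> bm h ->
  (forall e, 0 < e -> \forall k \near F, forall t, 0 <= t <= S -> `|integ 0 t (dk k)| <= e) ->
  forall e, 0 < e -> \forall k \near F, forall t, 0 <= t <= S ->
    `|integ 0 t (fun s => dk k s * h s)| <= e.
Proof.
move=> FF S0 bd dW bh dI e e0; have [_ [B hB]] := bh.
have W0 : 0 <= W by apply: le_trans (dW 0%N 0).
have B0 : 0 <= B by apply: le_trans (hB 0).
have e40 : 0 < e / 4 by rewrite divr_gt0.
have e4 : 0 < e / 4 / (W + 1) by rewrite !divr_gt0// ltr_wpDl.
have [c [bc cB cu ch]] := bm_dense bh hB S0 e4.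
have L0 : 0 < e / 4 / (W * S + 1) by rewrite !divr_gt0// ltr_wpDl// mulr_ge0.
have [r r0 rP] := cu _ L0.
have [N Nr] : exists N : nat, S / N.+1%:R <= r.
  exists (Num.bound `|S / r|); rewrite ler_pdivrMr// mulrC -ler_pdivrMr//.
  rewrite ltW//; apply: (lt_le_trans (le_lt_trans (ler_norm _) (archi_boundP (normr_ge0 _)))).
  by rewrite ler_nat.
have eta0 : 0 < e / 4 / (N.+1%:R * (2 * B) + 1).
  by rewrite !divr_gt0// ltr_wpDl// !mulr_ge0.
apply: filterS (dI _ eta0) => k kP t tS; have /andP[t0 tS'] := tS.
have bdc : bm (fun s => dk k s * c s) by exact: bmM.
have bhc : bm (fun s => `|h s - c s|) by apply: bm_norm; exact: bmB.
have -> : integ 0 t (fun s => dk k s * h s) =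
    integ 0 t (fun s => dk k s * (h s - c s)) + integ 0 t (fun s => dk k s * c s).
  rewrite -integ_D//; first by apply: integ_eq => s _; ring.
  by apply: bmM => //; exact: bmB.
have h1 : `|integ 0 t (fun s => dk k s * (h s - c s))| <= e / 4.
  have bdhc : bm (fun s => dk k s * (h s - c s)) by apply: bmM => //; exact: bmB.
  apply: le_trans (integ_norm _ _ bdhc) _.
  apply: (@le_trans _ _ (W * integ 0 S (fun s => `|h s - c s|))).
    rewrite (integ_cat bhc t0 tS') mulrDr; apply: ler_wpDr.
      by rewrite mulr_ge0// integ_ge0.
    rewrite -integ_Zl//; apply: integ_le; [exact: bm_norm|apply: bmM => //; exact: bm_cst|].
    by move=> s _; rewrite normrM ler_wpM2r.
  by apply: le_trans (ler_wpM2l W0 ch) _; rewrite absorb_le// ltW.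
have h2 := @osc_integ (dk k) c S _ B W _ N N.+1 S0 (bd k) bc (dW k) cB
  (fun s t st => rP s t (le_trans st Nr)) kP (leqnn _) t.
have : 0 <= t <= N.+1%:R * (S / N.+1%:R) by rewrite mulrC divfK// t0.
move=> /h2 {}h2; apply: le_trans (ler_normD _ _) _.
have h3 : e / 4 / (W * S + 1) * W * t <= e / 4.
  rewrite -mulrA mulrC.
  apply: (@le_trans _ _ (W * S * (e / 4 / (W * S + 1)))); last first.
    by rewrite absorb_le// ?mulr_ge0// ltW.
  by rewrite ler_wpM2r ?ler_wpM2l// ltW.
have h4 : N.+1%:R * (2 * B * (e / 4 / (N.+1%:R * (2 * B) + 1))) <= e / 4.
  by rewrite mulrA absorb_le ?mulr_ge0// ltW.
by apply: le_trans (lerD h1 (le_trans h2 (lerD h3 h4))) _; move: e0; clear; lra.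
Qed.

End weak_convergence.

Section composition_convergence.
Context {R : realType}.
Variables (F : set_system nat) (S T W : R).
Hypotheses (FF : ProperFilter F) (S_ge0 : 0 <= S) (T_ge0 : 0 <= T).
Variables (phik dk : nat -> R -> R) (phi d : R -> R).
Hypotheses (mphik : forall k, measurable_fun setT (phik k)) (mphi : measurable_fun setT phi)
  (bdk : forall k, bm (dk k)) (bd : bm d) (dk_ge0 : forall k s, 0 <= dk k s)
  (dk_le : forall k s, dk k s <= W) (d_ge0 : forall s, 0 <= d s) (d_le : forall s, d s <= W)
  (dkP : forall k f, bm f -> integ 0 T f = integ 0 S (fun s => f (phik k s) * dk k s))
  (dP : forall f, bm f -> integ 0 T f = integ 0 S (fun s => f (phi s) * d s))
  (phik_cvg : forall e : R, 0 < e -> \forall k \near F, forall s, 0 <= s <= S ->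
     `|phik k s - phi s| <= e)
  (dk_cvg : forall e : R, 0 < e -> \forall k \near F, forall s, 0 <= s <= S ->
     `|integ 0 s (dk k) - integ 0 s d| <= e).

Lemma bm_comp (f psi : R -> R) : bm f -> measurable_fun setT psi -> bm (fun s => f (psi s)).
Proof.
by move=> [mf [C fC]] mpsi; split; [exact: (measurableT_comp mf mpsi)|exists C].
Qed.

(** Against the moving density dk, which transports Lebesgue measure on [0, T]
    along phik, composition with phik is stable in mean even for discontinuous v:
    v is replaced by a continuous function at a cost that phik does not see. *)
Lemma comp_cvg (v : R -> R) : bm v -> forall e, 0 < e -> \forall k \near F,
  integ 0 S (fun s => `|v (phik k s) - v (phi s)| * dk k s) <= e.
Proof.
move=> bv e e0; have [_ [B vB]] := bv.
have W0 : 0 <= W by apply: le_trans (d_ge0 0) (d_le 0).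
have e4 : 0 < e / 4 by rewrite divr_gt0.
have [c [bc cB cu vc]] := bm_dense bv vB T_ge0 e4.
have w0 : 0 < e / 4 / (W * S + 1) by rewrite divr_gt0// ltr_wpDl// mulr_ge0.
have [r r0 rP] := cu _ w0.
have bvc : bm (fun s => `|v s - c s|) by apply: bm_norm; exact: bmB.
have weak : \forall k \near F, forall t, 0 <= t <= S ->
    `|integ 0 t (fun s => (dk k s - d s) * `|v (phi s) - c (phi s)|)| <= e / 4.
  apply: (weak_cvg (W := W) FF S_ge0) => //.
  - by move=> k; exact: bmB.
  - move=> k t; rewrite ler_norml; have := dk_ge0 k t; have := dk_le k t.
    by have := d_ge0 t; have := d_le t; move=> *; apply/andP; split; lra.
  - exact: (bm_comp bvc mphi).
  - move=> e' e'0; apply: filterS (dk_cvg e'0) => k H t tS.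
    by rewrite integ_B//; exact: H.
apply: filterS2 weak (phik_cvg r0) => k H1 H2.
have bvk := bm_comp bv (mphik k); have bvp := bm_comp bv mphi.
have bck := bm_comp bc (mphik k); have bcp := bm_comp bc mphi.
have bvck := bm_comp bvc (mphik k); have bvcp := bm_comp bvc mphi.
pose A s := `|v (phik k s) - c (phik k s)| * dk k s.
pose C s := (dk k s - d s) * `|v (phi s) - c (phi s)|.
pose D s := `|v (phi s) - c (phi s)| * d s.
have bA : bm A by exact: bmM.
have bC : bm C by apply: bmM => //; exact: bmB.
have bD : bm D by exact: bmM.
have bE : bm (fun=> e / 4 / (W * S + 1) * W) by exact: bm_cst.
apply: (@le_trans _ _ (integ 0 S (fun s => (A s + e / 4 / (W * S + 1) * W) + (C s + D s)))).
  apply: integ_le.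
  - by apply: bmM => //; apply: bm_norm; exact: bmB.
  - by apply: bmD; exact: bmD.
  move=> s sS; rewrite /A /C /D.
  have -> : `|v (phik k s) - c (phik k s)| * dk k s + e / 4 / (W * S + 1) * W +
     ((dk k s - d s) * `|v (phi s) - c (phi s)| + `|v (phi s) - c (phi s)| * d s) =
     (`|v (phik k s) - c (phik k s)| + `|v (phi s) - c (phi s)|) * dk k s +
      e / 4 / (W * S + 1) * W by ring.
  apply: (@le_trans _ _ ((`|v (phik k s) - c (phik k s)| + `|v (phi s) - c (phi s)|) * dk k s +
      e / 4 / (W * S + 1) * dk k s)); last by rewrite lerD2l ler_wpM2l// ltW.
  rewrite -mulrDl ler_wpM2r//.
  have -> : v (phik k s) - v (phi s) = (v (phik k s) - c (phik k s)) -
    (v (phi s) - c (phi s)) + (c (phik k s) - c (phi s)) by ring.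
  rewrite (le_trans (ler_normD _ _))// lerD ?ler_normB//.
  by apply: rP; exact: H2.
rewrite integ_D; [|by apply: bmD|by apply: bmD].
rewrite integ_D// integ_D// integ_cst// subr0 -(dkP k bvc) -(dP bvc).
have h1 : integ 0 S C <= e / 4.
  by apply: le_trans (ler_norm _) _; apply: H1; rewrite S_ge0 lexx.
have h2 : e / 4 / (W * S + 1) * W * S <= e / 4.
  by rewrite -mulrA mulrC absorb_le// ?mulr_ge0// ltW.
by apply: le_trans (lerD (lerD vc h2) (lerD h1 vc)) _; rewrite le_eqVlt; apply/orP; left; apply/eqP; field.
Qed.

Lemma vcomp_cvg n (v : R -> 'rV[R]_n) : (forall i, bm (fun t => v t ord0 i)) ->
  forall e, 0 < e -> \forall k \near F,
  integ 0 S (fun s => enorm (v (phik k s) - v (phi s)) * dk k s) <= e.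
Proof.
move=> bv e e0; have en : 0 < e / (n%:R + 1) by rewrite divr_gt0// ltr_wpDl.
have : \forall k \near F, forall i,
    integ 0 S (fun s => `|v (phik k s) ord0 i - v (phi s) ord0 i| * dk k s) <= e / (n%:R + 1).
  by apply: filter_forall => i; exact: (comp_cvg (bv i) en).
apply: filterS => k H.
have bi i : bm (fun s => `|v (phik k s) ord0 i - v (phi s) ord0 i| * dk k s).
  apply: bmM => //; apply: bm_norm; apply: bmB.
    exact: (bm_comp (bv i) (mphik k)).
  exact: (bm_comp (bv i) mphi).
apply: (@le_trans _ _ (integ 0 S (fun s => \sum_i `|v (phik k s) ord0 i - v (phi s) ord0 i| * dk k s))).
  apply: integ_le.
  - apply: bmM => //; apply: bm_enorm => i; under eq_fun do rewrite !mxE; apply: bmB.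
      exact: (bm_comp (bv i) (mphik k)).
    exact: (bm_comp (bv i) mphi).
  - exact: bm_sum.
  move=> s _; rewrite -mulr_suml ler_wpM2r// (le_trans (enorm_le_sum _))//.
  by apply: ler_sum => i _; rewrite !mxE.
rewrite integ_sum//; apply: (@le_trans _ _ (\sum_(i < n) e / (n%:R + 1))).
  by apply: ler_sum => i _; exact: H.
rewrite sumr_const card_ord (_ : _ *+ n = n%:R * (e / (n%:R + 1))); last by rewrite mulr_natl.
by rewrite absorb_le// ltW.
Qed.

End composition_convergence.

Section stability.
Context {R : realType} {n m l : nat} (U : set 'rV[R]_m) (V : set 'rV[R]_l).
Context (g : 'I_m.+1 -> 'rV[R]_n -> 'rV[R]_m -> 'rV[R]_l -> 'rV[R]_n) (M : R).
Hypotheses (U_compact : compact U) (V_compact : compact V) (M_ge0 : 0 <= M)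
  (g_continuous : forall i, field_continuous U V (g i))
  (g_lipschitz : forall i, locally_lipschitz_unif U V (g i))
  (g_growth : forall i, linear_growth U V M (g i)).

(** The difference of the solutions satisfies Gronwall's inequality up to small
    errors. The densities converge only weakly, but their change is integrated
    against the fields along the limit solution, which do not depend on k; the
    changes of the state and of the controls are multiplied by bounded densities. *)
Lemma ode_stability (F : set_system nat) (S W : R) (x0 : 'rV[R]_n)
    w p c (y : R -> 'rV[R]_n) wk pk ck (yk : nat -> R -> 'rV[R]_n) :
  ProperFilter F -> 0 <= S ->
  admissible U V W w p c -> integral_solution g S x0 w p c y ->
  (forall k, admissible U V W (wk k) (pk k) (ck k)) ->
  (forall k, integral_solution g S x0 (wk k) (pk k) (ck k) (yk k)) ->
  (forall e : R, 0 < e -> \forall k \near F, forall t, 0 <= t <= S ->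
     enorm (pk k t - p t) <= e) ->
  (forall j (e : R), 0 < e -> \forall k \near F, forall t, 0 <= t <= S ->
     `|integ 0 t (wk k j) - integ 0 t (w j)| <= e) ->
  (forall j (e : R), 0 < e -> \forall k \near F,
     integ 0 S (fun s => enorm (ck k j s - c j s) * `|wk k j s|) <= e) ->
  forall e : R, 0 < e -> \forall k \near F, forall t, 0 <= t <= S ->
    enorm (yk k t - y t) <= e.
Proof.
move=> FF S0 adm sol admk solk pkp wkw ckc e e0.
have W0 := admissible_ge0 adm.
have [r rP] := ode_bound U_compact M_ge0 g_continuous g_growth W x0 S0.
have [K K0 KP] := rhs_lipschitz U_compact M_ge0 g_lipschitz g_growth r W0.
have yr := rP _ _ _ _ adm sol; have ykr k := rP _ _ _ _ (admk k) (solk k).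
pose X := 2 * expR (2 * K * S).
have X0 : 0 < X by rewrite mulr_gt0// expR_gt0.
pose a := e / X / 4; have a0 : 0 < a by rewrite !divr_gt0.
(* e1 is for the change of p, e2 for the modulus of continuity of the fields in c;
   the changes of c and of w get bounds of the same form below *)
pose e1 := a / (K * S + 1).
have e10 : 0 < e1 by rewrite divr_gt0// ltr_wpDl// mulr_ge0.
pose e2 := a / (m.+1%:R * W * S + 1).
have e20 : 0 < e2 by rewrite divr_gt0// ltr_wpDl// !mulr_ge0.
have /choice[C CP] j : exists C : R, 0 <= C /\ forall x u v v', enorm x <= r -> U u -> V v -> V v' ->
    enorm (g j x u v - g j x u v') <= e2 + C * enorm (v - v').
  have [C C0 CP] := field_modulus U_compact V_compact r M_ge0 (@g_growth j) (@g_continuous j) e20.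
  by exists C.
pose sC := \sum_(j < m.+1) C j.
have C0 j : 0 <= C j by case: (CP j).
have e30 : 0 < a / (sC + 1) by rewrite divr_gt0// ltr_wpDl// sumr_ge0.
have en0 : 0 < a / (n%:R * m.+1%:R + 1) by rewrite divr_gt0// ltr_wpDl// mulr_ge0.
have [[mp Up] [mc Vc] bw wW] := adm; have [my yB yE] := sol.
pose H j i s := g j (y s) (p s) (c j s) ord0 i.
have bH j i : bm (H j i).
  exact: (bm_field U_compact M_ge0 g_continuous g_growth).
have weak : \forall k \near F, forall j i t, 0 <= t <= S ->
    `|integ 0 t (fun s => (wk k j s - w j s) * H j i s)| <= a / (n%:R * m.+1%:R + 1).
  apply: filter_forall => j; apply: filter_forall => i.
  apply: (weak_cvg (W := W + W) FF S0) => //.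
  - by move=> k; have [_ _ bwk _] := admk k; exact: bmB.
  - move=> k t; have [_ _ _ wkW] := admk k.
    by rewrite (le_trans (ler_normB _ _))// lerD.
  - move=> e' e'0; apply: filterS (wkw j e' e'0) => k h t tS.
    by have [_ _ bwk _] := admk k; rewrite integ_B//; exact: h.
have ckc' : \forall k \near F, forall j,
    integ 0 S (fun s => enorm (ck k j s - c j s) * `|wk k j s|) <= a / (sC + 1).
  by apply: filter_forall => j; exact: ckc.
apply: filterS2 (filterI weak ckc') (pkp _ e10) => k [Hw Hc] Hp.
have [[mpk Upk] [mck Vck] bwk wkW] := admk k; have [myk ykB ykE] := solk k.
have adm1 : admissible U V W (wk k) p (ck k) by [].
have adm2 : admissible U V W (wk k) p c by [].
have b0 := bm_rhs U_compact M_ge0 g_continuous g_growth (admk k) myk ykB.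
have b1 := bm_rhs U_compact M_ge0 g_continuous g_growth adm1 my yB.
have b2 := bm_rhs U_compact M_ge0 g_continuous g_growth adm2 my yB.
have b3 := bm_rhs U_compact M_ge0 g_continuous g_growth adm my yB.
pose f0 := rhs g (wk k) (pk k) (ck k) (yk k).
pose f1 := rhs g (wk k) p (ck k) y.
pose f2 := rhs g (wk k) p c y.
pose f3 := rhs g w p c y.
have bmc (v : R -> 'rV[R]_n) : vmeas v -> (exists B, forall t, enorm (v t) <= B) ->
    forall i, bm (fun t => v t ord0 i).
  move=> mv [B vB] i; split; first exact: mv.
  by exists B => t; exact: le_trans (enorm_coord _ _) (vB t).
have bz : bm (fun t => enorm (yk k t - y t)).
  by apply: bm_enorm => i; under eq_fun do rewrite !mxE; apply: bmB; exact: bmc.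
have b02 i : bm (fun s => (f0 s - f2 s) ord0 i).
  by under eq_fun do rewrite !mxE; exact: bmB.
have bc0 j : bm (fun s => enorm (ck k j s - c j s) * `|wk k j s|).
  apply: bmM; last exact: bm_norm.
  have [BV _ VB] := compact_enorm_bounded V_compact.
  apply: bm_enorm => i; under eq_fun do rewrite !mxE; apply: bmB.
    split; first exact: mck.
    by exists BV => s; apply: le_trans (enorm_coord _ _) (VB _ (Vck j s)).
  split; first exact: mc.
  by exists BV => s; apply: le_trans (enorm_coord _ _) (VB _ (Vc j s)).
have bcc j : bm (fun s => C j * (enorm (ck k j s - c j s) * `|wk k j s|)).
  by apply: bmM => //; exact: bm_cst.
have f02 s : 0 <= s <= S -> enorm (f0 s - f2 s) <=
    (K * enorm (yk k s - y s) + (K * e1 + m.+1%:R * W * e2)) +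
    \sum_(j < m.+1) C j * (enorm (ck k j s - c j s) * `|wk k j s|).
  move=> sS; apply: le_trans (enorm_triangle (f1 s) _ _) _.
  have h1 : enorm (f0 s - f1 s) <= K * enorm (yk k s - y s) + K * e1.
    apply: le_trans (KP (wk k) (pk k) p (ck k) (yk k) y s wkW Vck (Upk s) (Up s)
      (ykr k s sS) (yr s sS)) _.
    by rewrite mulrDr lerD2l ler_wpM2l// Hp.
  have h2 : enorm (f1 s - f2 s) <= m.+1%:R * W * e2 +
      \sum_(j < m.+1) C j * (enorm (ck k j s - c j s) * `|wk k j s|).
    rewrite /f1 /f2 /rhs -sumrB (le_trans (enorm_sum _ _ _))//.
    have -> : m.+1%:R * W * e2 = \sum_(j < m.+1) W * e2.
      by rewrite sumr_const card_ord -mulrA [in LHS]mulr_natl.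
    rewrite -big_split/=; apply: ler_sum => j _; rewrite -scalerBr enormZ.
    have [_ CPj] := CP j.
    apply: le_trans (ler_wpM2l (normr_ge0 _) (CPj _ _ _ _ (yr s sS) (Up s) (Vck j s) (Vc j s))) _.
    rewrite mulrDr lerD ?ler_wpM2r ?(ltW e20)//.
    by rewrite mulrC -mulrA.
  by apply: le_trans (lerD h1 h2) _; rewrite -!addrA.
have main t : 0 <= t <= S -> enorm (yk k t - y t) <= 4 * a +
    K * integ 0 t (fun s => enorm (yk k s - y s)).
  move=> /[dup] tS /andP[t0 tS'].
  pose v3 := \row_i integ 0 t (fun s => (f2 s - f3 s) ord0 i).
  have v3a : enorm v3 <= a.
    apply: le_trans (enorm_le_sum _) _.
    apply: (@le_trans _ _ (\sum_(i < n) \sum_(j < m.+1) a / (n%:R * m.+1%:R + 1))); last first.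
      rewrite !sumr_const !card_ord -mulrnA -mulnC.
      rewrite (_ : _ *+ _ = n%:R * m.+1%:R * (a / (n%:R * m.+1%:R + 1))); last first.
        by rewrite -natrM mulr_natl mulnC.
      by apply: absorb_le; [exact: mulr_ge0 | exact: ltW].
    apply: ler_sum => i _; rewrite mxE.
    rewrite (_ : integ _ _ _ = \sum_(j < m.+1) integ 0 t (fun s => (wk k j s - w j s) * H j i s)).
      by apply: le_trans (ler_norm_sum _ _ _) _; apply: ler_sum => j _; exact: Hw.
    rewrite -integ_sum; last by move=> j; apply: bmM => //; exact: bmB.
    apply: integ_eq => s _; rewrite !mxE /f2 /f3 /rhs !summxE -sumrB.
    by apply: eq_bigr => j _; rewrite !mxE -mulrBl.
  have -> : yk k t - y t = (yk k t - y t - v3) + v3 by rewrite subrK.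
  apply: le_trans (enormD _ _) _.
  have -> : 4 * a + K * integ 0 t (fun s => enorm (yk k s - y s)) =
    (3 * a + K * integ 0 t (fun s => enorm (yk k s - y s))) + a by ring.
  apply: lerD => //.
  apply: le_trans (enorm_integ t0 b02 _) _.
    move=> i; rewrite !mxE ykE// yE// (_ : integ 0 t (fun s => (f0 s - f2 s) ord0 i) =
      integ 0 t (fun s => f0 s ord0 i) - integ 0 t (fun s => f2 s ord0 i)); last first.
      by rewrite -integ_B//; apply: integ_eq => s _; rewrite !mxE.
    rewrite (_ : integ 0 t (fun s => (f2 s - f3 s) ord0 i) =
      integ 0 t (fun s => f2 s ord0 i) - integ 0 t (fun s => f3 s ord0 i)); last first.
      by rewrite -integ_B//; apply: integ_eq => s _; rewrite !mxE.
    by rewrite /f0 /f2 /f3; ring.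
  have bK : bm (fun s => K * enorm (yk k s - y s)) by apply: bmM => //; exact: bm_cst.
  have bsum := bm_sum (index_enum 'I_m.+1) predT bcc.
  apply: (@le_trans _ _ (integ 0 t (fun s => (K * enorm (yk k s - y s) + (K * e1 + m.+1%:R * W * e2)) +
    \sum_(j < m.+1) C j * (enorm (ck k j s - c j s) * `|wk k j s|)))).
    apply: integ_le; first exact: bm_enorm.
      by apply: bmD => //; apply: bmD => //; exact: bm_cst.
    by move=> s /andP[s0 st]; apply: f02; rewrite s0 (le_trans st).
  rewrite integ_D//; last by apply: bmD => //; exact: bm_cst.
  rewrite integ_D//; last exact: bm_cst.
  rewrite integ_cst// subr0 integ_Zl// integ_sum//.
  rewrite [3 * a + _]addrC -addrA lerD2l.
  have h1 : (K * e1 + m.+1%:R * W * e2) * t <= a + a.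
    apply: (@le_trans _ _ (K * S * e1 + m.+1%:R * W * S * e2)).
      apply: (@le_trans _ _ ((K * e1 + m.+1%:R * W * e2) * S)); last first.
        by rewrite le_eqVlt; apply/orP; left; apply/eqP; ring.
      have e1' := ltW e10; have e2' := ltW e20.
      apply: ler_wpM2l => //; apply: addr_ge0; first exact: mulr_ge0.
      by apply: mulr_ge0 => //; exact: mulr_ge0.
    by apply: lerD; (apply: absorb_le; last exact: ltW); repeat apply: mulr_ge0.
  have h2 : \sum_(j < m.+1) integ 0 t (fun s => C j * (enorm (ck k j s - c j s) * `|wk k j s|)) <= a.
    apply: (@le_trans _ _ (\sum_(j < m.+1) C j * (a / (sC + 1)))); last first.
      by rewrite -mulr_suml; apply: absorb_le; [exact: sumr_ge0 | exact: ltW].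
    apply: ler_sum => j _; apply: (@le_trans _ _ (integ 0 S
        (fun s => C j * (enorm (ck k j s - c j s) * `|wk k j s|)))).
      rewrite (integ_cat (bcc j) t0 tS') lerDl; apply: integ_ge0 => s _.
      by rewrite !mulr_ge0 ?enorm_ge0.
    by rewrite integ_Zl// ler_wpM2l.
  by apply: le_trans (lerD h1 h2) _; rewrite le_eqVlt; apply/orP; left; apply/eqP; ring.
move=> t tS.
have -> : e = 2 * (4 * a) * expR (2 * K * S).
  rewrite /a /X; field; rewrite gt_eqF// expR_gt0//.
apply: (gronwall K0 S0 _ bz _ main tS); first by rewrite mulr_ge0// ltW.
by move=> s; exact: enorm_ge0.
Qed.

End stability.

(** * Clocks and their inverses *)

Section clock_pairs.
Context {R : realType}.
Implicit Types (a b s t e B S T L : R) (f h sigma tau : R -> R).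
Local Notation mu := (@lebesgue_measure R).

(** The relation between a clock and the time component of a space-time
    control: sigma jumps over the intervals on which tau is constant. *)
Definition clock_pair T S L sigma tau :=
  [/\ forall t, 0 <= t <= T -> 0 <= sigma t <= S /\ tau (sigma t) = t,
      forall s, 0 <= s <= S -> 0 <= tau s <= T,
      forall s t, 0 <= s -> s <= t -> t <= S -> tau s <= tau t,
      lip_on 0 S L tau & measurable_fun setT sigma /\ measurable_fun setT tau].

(** Otherwise tau would be constant between s and sigma (tau s). *)
Lemma clock_pair_flat T S L sigma tau s d : clock_pair T S L sigma tau ->
  0 <= s <= S -> is_derive s 1 tau d -> d != 0 -> sigma (tau s) = s.
Proof.
move=> [sT tS nd _ _] /[dup] sS /andP[s0 sS'] sd d0; apply/eqP; apply: contraNT d0 => ne.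
have [/andP[q0 qS] tq] := sT _ (tS _ sS).
apply/eqP; apply: (is_derive_const_side sd ne) => y.
case: (ltgtP (sigma (tau s)) s) ne => // qs _ /andP[h1 h2]; apply/eqP; rewrite eq_le; apply/andP; split.
- by apply: nd => //; exact: le_trans h1.
- by rewrite -[leLHS]tq; apply: nd => //; exact: le_trans h2 _.
- by rewrite -[leRHS]tq; apply: nd => //; exact: le_trans h1.
- by apply: nd => //; exact: le_trans h2 _.
Qed.

Lemma clock_pair_ends T S L sigma tau : 0 <= T -> clock_pair T S L sigma tau ->
  [/\ 0 <= S, tau 0 = 0 & tau S = T].
Proof.
move=> T0 [sT tS nd _ _].
have [/andP[h1 h2] h3] := sT 0 (introT andP (conj (lexx 0) T0)).
have [/andP[h4 h5] h6] := sT T (introT andP (conj T0 (lexx T))).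
have S0 := le_trans h1 h2.
have /andP[h7 h8] := tS 0 (introT andP (conj (lexx 0) S0)).
have /andP[h9 h10] := tS S (introT andP (conj S0 (lexx S))).
split => //; apply/eqP; rewrite eq_le.
  by rewrite h7 andbT -[leRHS]h3 nd.
by rewrite h10 -[leLHS]h6 nd.
Qed.

Lemma nd_lip_density S L tau : 0 < S -> 0 <= L -> lip_on 0 S L tau ->
  (forall s t, 0 <= s -> s <= t -> t <= S -> tau s <= tau t) -> exists h,
  [/\ bm h, forall s, 0 <= h s <= L,
    {ae mu, forall s, 0 < s < S -> is_derive s 1 tau (h s)} &
    forall s t, 0 <= s -> s <= t -> t <= S -> integ s t h = tau t - tau s].
Proof.
move=> S0 L0 lt nd; have [h [bh hL hd hI]] := lip_derive S0 L0 lt.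
have hE : {ae mu, forall s, 0 < s < S -> Num.max 0 (Num.min L (h s)) = h s}.
  apply: aeS hd => s + /[dup] sS /andP[s0 sS'] => /(_ sS) sd; apply: clamp_id.
  apply/andP; split; last exact: le_trans (ler_norm _) (hL s).
  apply: (is_derive_lb sd); exists (S - s); first by rewrite subr_gt0.
  by move=> y /andP[ty yS]; rewrite mul0r subr_ge0 nd//; lra.
have bh' : bm (fun s => Num.max 0 (Num.min L (h s))) by apply: bm_clamp => //; case: bh.
exists (fun s => Num.max 0 (Num.min L (h s))); split => //.
- by move=> s; exact: clamp_ge.
- by apply: aeS (aeI hE hd) => s [h1 h2] sS; rewrite h1//; exact: h2.
move=> s t s0 st tS'; rewrite -hI//; apply: integ_eq_ae => //.
apply: aeS hE => q h1 /andP[sq qt]; apply: h1.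
by rewrite (le_lt_trans s0 sq) (lt_le_trans qt tS').
Qed.

Lemma clock_pair_density T S L sigma tau : 0 < S -> 0 <= L -> clock_pair T S L sigma tau ->
  exists h, [/\ bm h, forall s, 0 <= h s <= L,
    {ae mu, forall s, 0 < s < S -> is_derive s 1 tau (h s)} &
    forall s t, 0 <= s -> s <= t -> t <= S -> integ s t h = tau t - tau s].
Proof. by move=> S0 L0 [_ _ nd lt _]; exact: nd_lip_density. Qed.

(** The change of variable s = sigma t, although sigma may jump: what sigma
    misses are points where tau is constant, which h does not see. *)
Lemma integ_clock T S L sigma tau f h : 0 < S -> 0 <= T -> 0 <= L -> clock_pair T S L sigma tau ->
  bm f -> bm h -> {ae mu, forall s, 0 < s < S -> is_derive s 1 tau (h s)} ->
  integ 0 T (fun t => f (sigma t)) = integ 0 S (fun s => f s * h s).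
Proof.
move=> S0 T0 L0 cp bf bh hd; have [_ t0 tS] := clock_pair_ends T0 cp.
have [sT tST nd lt [ms mt]] := cp.
have bfs := bm_comp bf ms.
rewrite -{1}t0 -{1}tS (integ_comp S0 L0 lt nd mt bfs bh hd); last by rewrite lexx ltW.
apply: integ_eq_ae; [by apply: bmM => //; exact: (bm_comp bfs mt)|exact: bmM|].
apply: aeS hd => s + /[dup] sS /andP[s0 sS'] => /(_ sS) sd.
have [->|h0] := eqVneq (h s) 0; first by rewrite !mulr0.
by rewrite (clock_pair_flat cp _ sd)// !ltW.
Qed.

(** By integ_clock the measure of the times that sigma sends to a null set is
    an integral over this null set. *)
Lemma ae_clock T S L sigma tau (P : R -> Prop) : 0 < S -> 0 <= T -> 0 <= L ->
  clock_pair T S L sigma tau -> {ae mu, forall s, P s} ->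
  {ae mu, forall t, 0 < t < T -> P (sigma t)}.
Proof.
move=> S0 T0 L0 cp [B [mB B0 PB]].
have [h [bh h0 hd _]] := clock_pair_density S0 L0 cp.
have bB : bm (\1_B : R -> R) by exact: bm_indic.
have [_ _ _ _ [ms _]] := cp; have bBs := bm_comp bB ms.
have : {ae mu, forall t, 0 < t < T -> \1_B (sigma t) = 0 :> R}.
  apply: (integ_eq0_ae bBs).
    by apply: aeW => t _; rewrite indicE ler0n.
  rewrite (integ_clock S0 T0 L0 cp bB bh hd).
  rewrite (@integ_eq_ae _ 0 S _ (fun=> 0)).
  - by rewrite integ_cst ?mul0r// ltW.
  - exact: bmM.
  - exact: bm_cst.
  have : {ae mu, forall s, ~ B s} by exists B; split => // s /=; exact: contrapT.
  by apply: aeS => s Bs _; rewrite indicE memNset// mul0r.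
apply: aeS => t + tT => /(_ tT); rewrite indicE => h1; apply: contrapT => /PB Bt.
by move: h1; rewrite mem_set// => /eqP; rewrite oner_eq0.
Qed.

(** By integ_clock the measure of the excluded times is the integral of h over
    the set where h = 0. *)
Lemma ae_clock_ne0 T S L sigma tau h : 0 < S -> 0 <= T -> 0 <= L ->
  clock_pair T S L sigma tau ->
  bm h -> {ae mu, forall s, 0 < s < S -> is_derive s 1 tau (h s)} ->
  {ae mu, forall t, 0 < t < T -> h (sigma t) != 0}.
Proof.
move=> S0 T0 L0 cp bh hd; pose Z := h @^-1` [set 0].
have mZ : measurable Z by have [mh _] := bh; rewrite -[Z]setTI; exact: mh.
have bZ : bm (\1_Z : R -> R) by exact: bm_indic.
have [_ _ _ _ [ms _]] := cp; have bZs := bm_comp bZ ms.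
have : {ae mu, forall t, 0 < t < T -> \1_Z (sigma t) = 0 :> R}.
  apply: (integ_eq0_ae bZs).
    by apply: aeW => t _; rewrite indicE ler0n.
  rewrite (integ_clock S0 T0 L0 cp bZ bh hd).
  rewrite (@integ_eq _ 0 S _ (fun=> 0)); first by rewrite integ_cst ?mul0r// ltW.
  move=> s _; rewrite indicE; have [|Zs] := pselect (Z s).
    by rewrite /Z/= => ->; rewrite mulr0.
  by rewrite memNset// mul0r.
apply: aeS => t + tT => /(_ tT); rewrite indicE => h1; apply/eqP => h0.
by move: h1; rewrite mem_set// => /eqP; rewrite oner_eq0.
Qed.

Lemma is_derive_inv sigma tau t d : d != 0 ->
  (exists2 r : R, 0 < r & forall y, `|y - t| < r -> tau (sigma y) = y) ->
  (forall e : R, 0 < e -> exists2 r : R, 0 < r &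
     forall y, `|y - t| < r -> `|sigma y - sigma t| < e) ->
  is_derive (sigma t) 1 tau d -> is_derive t 1 sigma d^-1.
Proof.
move=> d0 [r0 r00 r0P] cs /is_deriveP td; apply/is_deriveP => e e0.
have nd0 : 0 < `|d| by rewrite normr_gt0.
pose q := Num.min (`|d| / 2) (e * (`|d| ^+ 2 / 2)).
have q0 : 0 < q by rewrite lt_min !(divr_gt0, mulr_gt0, exprn_gt0).
have [r1 r10 r1P] := td q q0; have [r2 r20 r2P] := cs r1 r10.
exists (Num.min r0 r2); first by rewrite lt_min r00.
move=> y; rewrite lt_min => /andP[/r0P h1 /r2P/r1P].
have h2 : tau (sigma t) = t by apply: r0P; rewrite subrr normr0.
rewrite h1 h2 => h3.
have h4 : `|sigma y - sigma t| <= 2 / `|d| * `|y - t|.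
  rewrite mulrAC ler_pdivlMr//.
  have qd : q <= `|d| / 2 by rewrite ge_min lexx.
  have h5 := le_trans h3 (ler_wpM2r (normr_ge0 _) qd).
  have := ler_normB (y - t) (y - t - d * (sigma y - sigma t)).
  rewrite opprB addrC subrK normrM; lra.
have -> : sigma y - sigma t - d^-1 * (y - t) = - (y - t - d * (sigma y - sigma t)) / d.
  by field.
rewrite normrM normrN normfV ler_pdivrMr//; apply: le_trans h3 _.
have qe : q <= e * (`|d| ^+ 2 / 2) by rewrite ge_min lexx orbT.
apply: le_trans (ler_wpM2r (normr_ge0 _) qe) _.
apply: le_trans (ler_wpM2l _ h4) _.
  by rewrite mulr_ge0 ?(ltW e0)// divr_ge0// exprn_ge0.
rewrite le_eqVlt; apply/orP; left; apply/eqP; field; rewrite gt_eqF//.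
Qed.

Lemma measurable_clamp d a b (f : R -> 'rV[R]_d) : a <= b ->
  (forall i, measurable_fun (`[a, b]%classic : set R) (fun t => f t ord0 i)) ->
  vmeas (fun t => f (Num.max a (Num.min b t))).
Proof.
move=> ab mf i.
apply: (@measurable_comp _ _ _ _ _ _ `[a, b]%classic (fun t => f t ord0 i)) => //.
  by move=> _ [t _ <-]; rewrite /= in_itv/= clamp_ge.
by apply: measurable_maxr => //; apply: measurable_minr.
Qed.

End clock_pairs.

Section arc_clocks.
Context {R : realType}.
Implicit Types (a b s t e S T : R).
Local Notation mu := (@lebesgue_measure R).

Lemma continuous_clampP (T : R) (f : R -> R) : 0 <= T ->
  (forall t e, 0 <= t <= T -> 0 < e -> exists2 r : R, 0 < r &
     forall y, 0 <= y <= T -> `|y - t| < r -> `|f y - f t| <= e) ->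
  continuous (fun t => f (Num.max 0 (Num.min T t))).
Proof.
move=> T0 cf t; apply/cvgrPdist_le => e e0.
have tT := clamp_ge t T0; have [r r0 rP] := cf _ e tT e0.
near=> y; rewrite distrC; apply: rP; first exact: clamp_ge.
apply: (@le_lt_trans _ _ `|y - t|); last first.
  by rewrite distrC; near: y; exact: cvgr_dist_lt.
exact: clamp_dist.
Unshelve. all: by end_near. Qed.

Lemma ac_continuous d (w : R -> 'rV[R]_d) T i : 0 <= T -> abs_continuous 0 T w ->
  continuous (fun t => w (Num.max 0 (Num.min T t)) ord0 i).
Proof.
move=> T0 wAC; apply: (continuous_clampP (f := fun t => w t ord0 i)) => // t e tT e0.
have [r r0 rP] := wAC e e0; exists r => // y yT yt.
have H p q : 0 <= p -> p <= q -> q <= T -> q - p < r -> `|w q ord0 i - w p ord0 i| <= e.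
  move=> p0 pq qT qpr.
  have := rP 1%N (fun=> p) (fun=> q); rewrite !big_ord_recl !big_ord0 !addr0.
  move=> /(_ (fun=> conj p0 (conj pq qT))) h.
  apply: (@le_trans _ _ (enorm (w q - w p))).
    by apply: le_trans (enorm_coord _ i); rewrite !mxE.
  by apply/ltW/h => // a b _ _ _; rewrite (ord1 a) (ord1 b).
have /andP[t0 t1] := tT; have /andP[y0 y1] := yT.
have /orP[ty|yt'] := le_total t y.
  by apply: H => //; rewrite (le_lt_trans (ler_norm _)).
by rewrite distrC; apply: H => //; rewrite (le_lt_trans (ler_norm _))// distrC.
Qed.

Lemma continuous_clamp_bounded (f : R -> R) T : 0 <= T ->
  continuous (fun t => f (Num.max 0 (Num.min T t))) ->
  exists B : R, forall t : R, 0 <= t <= T -> `|f t| <= B.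
Proof.
move=> T0 cf; pose k t := f (Num.max 0 (Num.min T t)).
have [c1 _ c1P] := EVT_max T0 (continuous_subspaceT cf).
have [c2 _ c2P] := EVT_min T0 (continuous_subspaceT cf).
exists (`|k c1| + `|k c2|) => t tT.
have tI : t \in `[0, T] by rewrite in_itv.
have := c1P t tI; have := c2P t tI; rewrite -/(k c1) -/(k c2) /= clamp_id// => h1 h2.
have h3 := ler_norm (k c1); have h4 := ler_norm (- k c2); rewrite normrN in h4.
have h5 := normr_ge0 (k c1); have h6 := normr_ge0 (k c2).
by rewrite ler_norml; apply/andP; split; lra.
Qed.

Context {m : nat}.
Implicit Types (u : R -> 'rV[R]_m).

Lemma arc_clock_incr T u s t : (total_evariation 0 T u < +oo)%E ->
  0 <= s -> s <= t -> t <= T ->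
  enorm (u t - u s) + (t - s) <= arc_clock u t - arc_clock u s.
Proof.
move=> fin s0 st tT; have := var_majorant fin s0 st tT.
by rewrite /arc_clock -/(var 0 t u) -/(var 0 s u); lra.
Qed.

Lemma arc_clock0 u : arc_clock u 0 = 0.
Proof. by rewrite /arc_clock -/(var 0 0 u) var_aa addr0. Qed.

Lemma arc_clock_nd T u s t : (total_evariation 0 T u < +oo)%E ->
  0 <= s -> s <= t -> t <= T -> arc_clock u s <= arc_clock u t.
Proof.
move=> fin s0 st tT; have := arc_clock_incr fin s0 st tT.
by have := enorm_ge0 (u t - u s); lra.
Qed.

Lemma arc_clock_ge0 T u t : (total_evariation 0 T u < +oo)%E ->
  0 <= t -> t <= T -> 0 <= arc_clock u t.
Proof. by move=> fin t0 tT; rewrite -(arc_clock0 u); exact: arc_clock_nd fin _ _ _. Qed.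

Lemma arc_clock_continuous T u t e : (total_evariation 0 T u < +oo)%E ->
  abs_continuous 0 T u -> 0 <= t <= T -> 0 < e -> exists2 r : R, 0 < r &
     forall y, 0 <= y <= T -> `|y - t| < r -> `|arc_clock u y - arc_clock u t| <= e.
Proof.
move=> fin uAC tT e0; have e2 : 0 < e / 2 by rewrite divr_gt0.
have [r r0 rP] := ac_var_small tT uAC fin e2.
have /andP[t0 t1] := tT.
exists (Num.min r (e / 2)); first by rewrite lt_min r0.
move=> y /andP[y0 y1]; rewrite lt_min => /andP[h1 h2].
rewrite /arc_clock -/(var 0 y u) -/(var 0 t u).
move: h1 h2; rewrite !ltr_norml => /andP[h1 h2] /andP[h3 h4].
have /orP[ty|yt] := le_total t y.
  have h7 : var 0 y u - var 0 t u <= e / 2 by apply: rP => //; lra.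
  have h6 := var_nd fin t0 ty y1.
  by rewrite ger0_norm; lra.
have h6 := var_nd fin y0 yt t1.
have h7 : var 0 t u - var 0 y u <= e / 2 by apply: rP => //; lra.
by rewrite ler0_norm; lra.
Qed.

(** The arc-length clock grows at least as fast as time and as the path u, so
    its inverse tau and the reparametrized path u o tau are nonexpansive. This
    is the point of the space-time point of view: bounded variation becomes a
    uniform Lipschitz bound. *)
Lemma arc_clock_inverse T u : 0 <= T -> (total_evariation 0 T u < +oo)%E ->
  abs_continuous 0 T u -> exists tau : R -> R,
  [/\ forall s, 0 <= tau s <= T,
      forall s, arc_clock u (tau s) = Num.max 0 (Num.min (arc_clock u T) s),
      forall s t, s <= t -> 0 <= tau t - tau s <= t - s,
      forall t, 0 <= t <= T -> tau (arc_clock u t) = t &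
      forall s t, s <= t -> enorm (u (tau t) - u (tau s)) <= t - s].
Proof.
move=> T0 fin uAC; set sg := arc_clock u.
have inc s t (s0 : 0 <= s) (st : s <= t) (tT : t <= T) := arc_clock_incr fin s0 st tT.
have sg0 : sg 0 = 0 := arc_clock0 u.
have sgT0 : 0 <= sg T.
  by have := inc 0 T (lexx _) T0 (lexx _); rewrite -/sg sg0; have := enorm_ge0 (u T - u 0); lra.
have csg : continuous (fun t => sg (Num.max 0 (Num.min T t))).
  apply: continuous_clampP => // t e tT e0; exact: arc_clock_continuous.
have /choice[tau tauP] s : exists t, 0 <= t <= T /\ sg t = Num.max 0 (Num.min (sg T) s).
  have [] := IVT T0 (continuous_subspaceT csg) (v := Num.max 0 (Num.min (sg T) s)).
    have e0 : Num.max 0 (Num.min T 0) = 0 by rewrite clamp_id// lexx.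
    have eT : Num.max 0 (Num.min T T) = T by rewrite clamp_id// lexx andbT.
    by rewrite e0 eT sg0 (min_l sgT0) (max_r sgT0) clamp_ge.
  move=> t; rewrite in_itv/= => tT; rewrite clamp_id// => h.
  by exists t.
exists tau.
have taund s t : s <= t -> tau s <= tau t.
  move=> st; have [/andP[s1 s2] s3] := tauP s; have [/andP[t1 t2] t3] := tauP t.
  rewrite leNgt; apply/negP => h; have := inc _ _ t1 (ltW h) s2.
  rewrite -/sg s3 t3; have := enorm_ge0 (u (tau s) - u (tau t)).
  by have /andP[] := clamp_lip 0 (sg T) st; lra.
have incr s t : s <= t -> enorm (u (tau t) - u (tau s)) + (tau t - tau s) <= t - s.
  move=> st; have [/andP[s1 s2] s3] := tauP s; have [/andP[t1 t2] t3] := tauP t.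
  have := inc _ _ s1 (taund _ _ st) t2; rewrite -/sg s3 t3.
  by have /andP[] := clamp_lip 0 (sg T) st; lra.
split.
- by move=> s; case: (tauP s).
- by move=> s; case: (tauP s).
- move=> s t st; have := incr s t st; have := enorm_ge0 (u (tau t) - u (tau s)).
  by have := taund s t st; move=> *; apply/andP; split; lra.
- move=> t /andP[t0 tT]; have [/andP[s1 s2] s3] := tauP (sg t).
  have e : sg (tau (sg t)) = sg t.
    rewrite s3 clamp_id//; apply/andP; split.
      by have := inc 0 t (lexx _) t0 tT; rewrite -/sg sg0; have := enorm_ge0 (u t - u 0); lra.
    by have := inc t T t0 tT (lexx _); rewrite -/sg; have := enorm_ge0 (u T - u t); lra.
  have /orP[h|h] := le_total (tau (sg t)) t.
    by have := inc _ _ s1 h tT; rewrite -/sg e; have := enorm_ge0 (u t - u (tau (sg t))); lra.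
  by have := inc _ _ t0 h s2; rewrite -/sg e; have := enorm_ge0 (u (tau (sg t)) - u t); lra.
- by move=> s t st; have := incr s t st; have := taund s t st; lra.
Qed.

End arc_clocks.

(** * From time to space-time *)

Section conversion.
Context {R : realType} {n m l : nat} (U : set 'rV[R]_m) (V : set 'rV[R]_l).
Context (g : 'I_m.+1 -> 'rV[R]_n -> 'rV[R]_m -> 'rV[R]_l -> 'rV[R]_n) (M : R).
Hypotheses (U_compact : compact U) (V_compact : compact V) (M_ge0 : 0 <= M)
  (g_continuous : forall i, field_continuous U V (g i))
  (g_growth : forall i, linear_growth U V M (g i)).
Local Notation mu := (@lebesgue_measure R).

(** Time first, then the components of D, in the order of the fields. *)
Definition densities (h : R -> R) (D : R -> 'rV[R]_m) (j : 'I_m.+1) (t : R) : R :=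
  if unlift ord0 j is Some i then D t ord0 i else h t.

Definition ordinary (v1 v2 : R -> 'rV[R]_l) (j : 'I_m.+1) (t : R) : 'rV[R]_l :=
  if j == ord0 then v1 t else v2 t.

Lemma rhsE h (D : R -> 'rV[R]_m) p v1 v2 (y : R -> 'rV[R]_n) t :
  rhs g (densities h D) p (ordinary v1 v2) y t =
  h t *: g ord0 (y t) (p t) (v1 t) +
  \sum_(i < m) D t ord0 i *: g (lift ord0 i) (y t) (p t) (v2 t).
Proof.
rewrite /rhs big_ord_recl /densities /ordinary unlift_none eqxx; congr (_ + _).
by apply: eq_bigr => i _; rewrite liftK.
Qed.

Lemma densities_admissible (W : R) h (D : R -> 'rV[R]_m) p v1 v2 : bm h -> (forall i, bm (fun t => D t ord0 i)) ->
  (forall t, `|h t| <= W) -> (forall t i, `|D t ord0 i| <= W) ->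
  vmeas p -> (forall t, U (p t)) -> vmeas v1 -> vmeas v2 ->
  (forall t, V (v1 t)) -> (forall t, V (v2 t)) ->
  admissible U V W (densities h D) p (ordinary v1 v2).
Proof.
move=> bh bD hW DW mp Up m1 m2 V1 V2; split=> //.
- split=> [j|j t]; rewrite /ordinary; last by case: ifP.
  by case: (j == ord0).
- by move=> j; rewrite /densities; case: (unlift ord0 j).
- by move=> j t; rewrite /densities; case: (unlift ord0 j).
Qed.

Lemma near_interval (T t y : R) : `|y - t| < Num.min t (T - t) -> 0 <= y <= T.
Proof.
by rewrite lt_min !ltr_norml => /andP[/andP[? ?] /andP[? ?]]; apply/andP; split; lra.
Qed.

Lemma addr_le (a b c : R) : 0 <= a -> a + b <= c -> b <= c.
Proof. by move=> a0; apply: le_trans; rewrite lerDr. Qed.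

Lemma subr_swap (a b c d : R) : a - b - (c - d) = (a - c) - (b - d).
Proof. by ring. Qed.

Lemma near_gt (c q y : R) : `|y - q| < q - c -> c < y.
Proof. by rewrite ltr_norml => /andP[? _]; lra. Qed.

(** The difference between the solution and the space-time integral is, as a
    function of t, dominated by the absolutely continuous x and u, and it has zero
    derivative a.e., by the chain rule at the times where the clock is differentiable;
    so it is constant. *)
Lemma caratheodory_space_time (T S : R) (x0 : 'rV[R]_n) (u : R -> 'rV[R]_m) (v1 v2 : R -> 'rV[R]_l)
    (x : R -> 'rV[R]_n)
    (tau h : R -> R) (D : R -> 'rV[R]_m) :
  0 < T -> AC_fun 0 T U u -> L1_fun 0 T V v1 -> L1_fun 0 T V v2 ->
  (total_evariation 0 T u < +oo)%E ->
  caratheodory_solution g T x0 u v1 v2 x ->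
  0 < S -> arc_clock u T <= S ->
  (forall s : R, 0 <= tau s <= T) ->
  (forall s : R, arc_clock u (tau s) = Num.max 0 (Num.min (arc_clock u T) s)) ->
  (forall s t : R, s <= t -> 0 <= tau t - tau s <= t - s) ->
  (forall t : R, 0 <= t <= T -> tau (arc_clock u t) = t) ->
  (forall s t : R, s <= t -> enorm (u (tau t) - u (tau s)) <= t - s) ->
  bm h -> (forall t, `|h t| <= 1) ->
  {ae mu, forall s, 0 < s < S -> is_derive s 1 tau (h s)} ->
  (forall i, bm (fun s => D s ord0 i)) -> (forall t i, `|D t ord0 i| <= 1) ->
  {ae mu, forall s, 0 < s < S -> is_derive s 1 (fun s => u (tau s)) (D s)} ->
  admissible U V 1 (densities h D) (u \o tau) (ordinary (v1 \o tau) (v2 \o tau)) /\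
  integral_solution g S x0 (densities h D) (u \o tau) (ordinary (v1 \o tau) (v2 \o tau)) (x \o tau).
Proof.
move=> T0 [Uu uAC] [Vv1 iv1] [Vv2 iv2] fin [xAC x00 xd] S0 sgS tauT sgtau tauL tausg utau
  bh hW hd bD DW Dd.
have T0' := ltW T0; have S0' := ltW S0.
set sg := arc_clock u in sgS sgtau tausg *.
have mtau : measurable_fun setT tau.
  apply: nondecreasing_measurable => // s t st; have /andP[] := tauL s t st.
  by rewrite subr_ge0.
pose cl (t : R) : R := Num.max 0 (Num.min T t).
have cltau s : cl (tau s) = tau s by rewrite /cl clamp_id.
have mcomp d (f : R -> 'rV[R]_d) : vmeas (fun t => f (cl t)) -> vmeas (f \o tau).
  move=> mf i; have := measurableT_comp (mf i) mtau.
  rewrite (_ : (_ \o tau) = (fun t => (f \o tau) t ord0 i))//.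
  by apply/funext => s; rewrite /= cltau.
have mL1 d (E : set 'rV[R]_d) (v : R -> 'rV[R]_d) : L1_fun 0 T E v -> vmeas (v \o tau).
  move=> [_ iv]; apply: mcomp; apply: measurable_clamp => // i.
  by apply/measurable_EFinP; exact: measurable_int (iv i).
have mAC d (f : R -> 'rV[R]_d) : abs_continuous 0 T f -> vmeas (f \o tau).
  by move=> fAC; apply: mcomp => i; apply: continuous_measurable_fun; exact: ac_continuous.
have inT s : tau s \in `[0, T] by rewrite in_itv/= tauT.
have adm : admissible U V 1 (densities h D) (u \o tau) (ordinary (v1 \o tau) (v2 \o tau)).
  apply: densities_admissible => //; [exact: mAC| |
    exact: (mL1 _ V _ (conj Vv1 iv1))|exact: (mL1 _ V _ (conj Vv2 iv2))| |] => t /=.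
  - exact: Uu.
  - exact: Vv1.
  - exact: Vv2.
split => //.
have mx : vmeas (x \o tau) by exact: mAC.
have xB : exists B, forall t, enorm ((x \o tau) t) <= B.
  have /choice[B BP] (i : 'I_n) : exists B : R, forall t : R, 0 <= t <= T -> `|x t ord0 i| <= B.
    exact: (@continuous_clamp_bounded _ (fun t => x t ord0 i) T T0' (@ac_continuous _ _ x T i T0' xAC)).
  exists (\sum_(i < n) B i) => t; rewrite (le_trans (enorm_le_sum _))//.
  by apply: ler_sum => i _; exact: BP.
have br := bm_rhs U_compact M_ge0 g_continuous g_growth adm mx xB.
split => // s i /andP[s0 sS].
have sg0 : sg 0 = 0 := arc_clock0 u.
have sginc (s' t' : R) (s0 : 0 <= s') (st : s' <= t') (tT : t' <= T) := arc_clock_incr fin s0 st tT.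
have sgnd (s' t' : R) : 0 <= s' -> s' <= t' -> t' <= T -> sg s' <= sg t'.
  move=> h1 h2 h3; rewrite -subr_ge0; apply: le_trans (addr_le (enorm_ge0 _) (sginc _ _ h1 h2 h3)).
  by rewrite subr_ge0.
have sgb (t : R) : 0 <= t <= T -> 0 <= sg t <= sg T.
  by move=> /andP[h1 h2]; rewrite -{1}sg0 !sgnd.
have sgT0 : 0 < sg T.
  have := addr_le (enorm_ge0 _) (sginc 0 T (lexx _) T0' (lexx _)).
  by rewrite -/sg sg0 !subr0; exact: lt_le_trans.
pose scl t := sg (cl t).
have sclE t : 0 <= t <= T -> scl t = sg t by move=> tT; rewrite /scl /cl clamp_id.
have csg : continuous scl.
  apply: (continuous_clampP (f := sg)) => // t e tT e0; exact: arc_clock_continuous.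
have tausg' (t : R) : 0 <= t <= T -> tau (scl t) = t.
  by move=> tT; rewrite /scl /cl clamp_id// tausg.
have cp : clock_pair T S 1 scl tau.
  split => //.
  - move=> t tT; split; last exact: tausg'.
    by rewrite /scl /cl clamp_id//; have /andP[-> h2] := sgb t tT; rewrite (le_trans h2).
  - by move=> s1 t1 _ st _; have /andP[] := tauL _ _ st; rewrite subr_ge0.
  - by move=> s1 t1 _ st _; have /andP[h1 h2] := tauL _ _ st; rewrite ger0_norm// mul1r.
  - by split => //; exact: continuous_measurable_fun.
pose r s := rhs g (densities h D) (u \o tau) (ordinary (v1 \o tau) (v2 \o tau)) (x \o tau) s ord0 i.
pose G s := integ 0 s r.
have brr : bm r by exact: br.
have [_ [B rB]] := brr; have B0 : 0 <= B by apply: le_trans (rB 0).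
have ode : {ae mu, forall t, 0 < t < T ->
    is_derive t 1 (fun t => x t ord0 i - G (scl t)) 0}.
  have q : {ae mu, forall s, (0 < s < S -> is_derive s 1 tau (h s)) /\
     ((0 < s < S -> is_derive s 1 (fun s => u (tau s)) (D s)) /\
      (0 < s -> is_derive s 1 G (r s)))}.
    by apply: aeI hd (aeI Dd _); exact: integ_derive.
  have q1 := ae_clock S0 T0' ler01 cp q.
  have q2 := ae_clock_ne0 S0 T0' ler01 cp bh hd.
  apply: aeS (aeI xd (aeI q1 q2)) => t [h1 [h2 h3]] /[dup] tT /andP[t0 tT'].
  have tT2 : 0 <= t <= T by rewrite !ltW.
  have {}h1 : is_derive t 1 x (g ord0 (x t) (u t) (v1 t)
         + \sum_(i < m) (derive1 u t) ord0 i *: g (lift ord0 i) (x t) (u t) (v2 t)).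
    by apply: h1; rewrite in_itv/= !ltW.
  have s_t : scl t = sg t by rewrite /scl /cl clamp_id.
  have st0 : 0 < scl t.
    have := addr_le (enorm_ge0 _) (sginc 0 t (lexx _) (ltW t0) (ltW tT')).
    by rewrite -/sg sg0 !subr0 s_t; exact: lt_le_trans.
  have stS : scl t < S.
    apply: lt_le_trans sgS; rewrite s_t -subr_gt0.
    apply: lt_le_trans (addr_le (enorm_ge0 _) (sginc t T (ltW t0) (ltW tT') (lexx _))).
    by rewrite subr_gt0.
  have ss : 0 < scl t < S by rewrite st0 stS.
  have [d1 [d2 d3]] := h2 tT.
  have {}d1 := d1 ss; have {}d2 := d2 ss; have {}d3 := d3 st0.
  have h0 := h3 tT.
  have k0 : 0 < Num.min t (T - t) by rewrite lt_min t0 subr_gt0.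
  have nearT (y : R) : `|y - t| < Num.min t (T - t) -> 0 <= y <= T.
    exact: near_interval.
  have sd : is_derive t 1 scl (h (scl t))^-1.
    apply: is_derive_inv d1 => //.
      by exists (Num.min t (T - t)) => // y /nearT; exact: tausg'.
    move=> e e0; have /cvgrPdist_lt/(_ _ e0)/nbhs_ballP[r' /= r'0 r'P] := csg t.
    exists r' => // y yt; rewrite distrC; apply: r'P.
    by rewrite /ball/= distrC.
  have ud : is_derive t 1 u ((h (scl t))^-1 *: D (scl t)).
    apply/is_derive_rVP => k; rewrite mxE.
    move/is_derive_rVP : d2 => /(_ k) d2.
    have := is_derive_compf sd d2; rewrite mulrC; apply: (is_derive_near k0) => y /nearT yT.
    by rewrite tausg'.
  have uE : derive1 u t = (h (scl t))^-1 *: D (scl t).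
    by case: ud => _ <-; rewrite derive1E.
  move/is_derive_rVP : h1 => /(_ i) h1.
  have := is_deriveBf h1 (is_derive_compf sd d3).
  rewrite (_ : _ - _ = 0)//.
  have ht : tau (scl t) = t by exact: tausg'.
  rewrite /r rhsE /= ht uE !mxE !summxE.
  rewrite mulrDl -(mulrAC (h _)) mulfV// mul1r mulr_suml.
  rewrite (eq_bigr (fun k => ((D (scl t) ord0 k *: g (lift ord0 k) (x t) (u t) (v2 t)) ord0 i) / h (scl t))).
    by rewrite subrr.
  by move=> k _; rewrite !mxE; ring.
have key (t : R) : 0 <= t <= T -> x t ord0 i = x0 ord0 i + G (sg t).
  move=> /andP[t0 tT].
  have wAC : abs_continuous 0 t (fun t => row_mx (x t) (u t)).
    move=> e e0; have [r' r'0 r'P] := abs_continuous_row_mx xAC uAC e0.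
    exists r' => // N p q pq tI; apply: r'P => // k.
    by have [h1 [h2 h3]] := pq k; split => //; split => //; exact: le_trans tT.
  have := @ac_derive0 _ _ (fun t => row_mx (x t) (u t)) (fun t => x t ord0 i - G (scl t))
     0 t (1 + B) t0.
  have -> : scl 0 = 0 by rewrite sclE ?lexx.
  have -> : scl t = sg t by rewrite sclE// t0.
  have -> : G 0 = 0 by rewrite /G integ_aa.
  rewrite subr0 x00 => H.
  rewrite -H; [by rewrite subrK|by rewrite addr_ge0|exact: wAC| |].
  - move=> a b psi a0 ab bt hpsi; have bT := le_trans bt tT.
    have -> : scl a = sg a by rewrite sclE// a0 (le_trans ab).
    have -> : scl b = sg b by rewrite sclE// (le_trans a0 ab).
    rewrite /G.
    have vb : var 0 b u - var 0 a u <= psi b - psi a.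
      apply: (var_min fin a0 ab bT) => x1 y1 ax xy yb; apply: le_trans (hpsi _ _ ax xy yb).
      by rewrite opp_row_mx add_row_mx enorm_row_mxr.
    have xb : `|x b ord0 i - x a ord0 i| <= psi b - psi a.
      apply: le_trans (hpsi _ _ (lexx _) ab (lexx _)); rewrite opp_row_mx add_row_mx.
      apply: le_trans (enorm_row_mxl _ _); apply: le_trans (enorm_coord _ i).
      by rewrite !mxE.
    have sab := sgnd _ _ a0 ab bT.
    have sga0 : 0 <= sg a by have /andP[] := sgb a (introT andP (conj a0 (le_trans ab bT))).
    have Gb : `|integ 0 (sg b) r - integ 0 (sg a) r| <= B * (sg b - sg a).
      by rewrite integ_incr//; exact: integ_bound.
    rewrite subr_swap.
    apply: le_trans (ler_normB _ _) _.
    have h4 : B * (sg b - sg a) <= B * ((b - a) + (psi b - psi a)).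
      rewrite ler_wpM2l// /sg /arc_clock -/(var 0 b u) -/(var 0 a u).
      by rewrite opprD addrACA lerD2l.
    rewrite mulrDl mul1r; apply: lerD; last exact: le_trans Gb h4.
    by apply: le_trans xb _; rewrite lerDr subr_ge0.
  - apply: aeS ode => q + /andP[q0 qt]; apply; by rewrite q0 (lt_le_trans qt).
have [s1|s1] := leP s (sg T).
  rewrite /= key// sgtau clamp_id//; exact/andP.
rewrite /= key// sgtau min_l ?(ltW s1)// max_r ?(ltW sgT0)// /G.
rewrite (integ_cat brr (ltW sgT0) (ltW s1)) -/r (_ : integ (sg T) s r = 0) ?addr0//.
rewrite (@integ_eq_ae _ (sg T) s r (fun=> 0)) ?integ_cst ?mul0r//; [exact: ltW|exact: bm_cst|].
have tauc (y : R) : sg T < y -> tau y = T.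
  by move=> yT; rewrite -[tau y]tausg// sgtau min_l ?(ltW yT)// max_r ?(ltW sgT0)// tausg// lexx T0'.
apply: aeS (aeI hd Dd) => q [h1 h2] /andP[q1 q2].
have qS : 0 < q < S by rewrite (lt_trans sgT0 q1) (lt_le_trans q2).
have hq : h q = 0.
  apply: is_derive_uniq (h1 qS) _; have := is_derive_cstf q T.
  have k0 : 0 < q - sg T by rewrite subr_gt0.
  by apply: (is_derive_near k0) => y /near_gt yT; rewrite tauc.
have Dq k : D q ord0 k = 0.
  have /is_derive_rVP/(_ k) h4 := h2 qS.
  apply: is_derive_uniq h4 _; have := is_derive_cstf q (u T ord0 k).
  have k0 : 0 < q - sg T by rewrite subr_gt0.
  by apply: (is_derive_near k0) => y /near_gt yT; rewrite tauc.
rewrite /r rhsE hq scale0r add0r summxE big1// => k _.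
by rewrite Dq scale0r mxE.
Qed.

End conversion.

Section limits.
Context {R : realType}.
Local Notation mu := (@lebesgue_measure R).

(** Smallness on a fine finite grid spreads to the interval by equicontinuity. *)
Lemma unif_small (F : set_system nat) (S : R) (z : nat -> R -> R) : Filter F -> 0 < S ->
  (forall k s t, z k s <= z k t + 2 * `|s - t|) ->
  (forall s e : R, 0 < e -> \forall k \near F, z k s < e) ->
  forall e : R, 0 < e -> \forall k \near F, forall s, 0 <= s <= S -> z k s <= e.
Proof.
move=> FF S0 zL z0 e e0.
pose N := Num.bound `|4 * S / e|; pose q := S / N.+1%:R.
have q0 : 0 < q by rewrite divr_gt0.
have qe : 2 * q <= e / 2.
  have : 4 * S / e <= N.+1%:R.
    apply: le_trans (ler_norm _) _; apply: ltW; apply: lt_trans (archi_boundP (normr_ge0 _)) _.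
    by rewrite ltr_nat.
  rewrite ler_pdivrMr// => h; rewrite /q mulrA ler_pdivrMr//.
  by rewrite [N.+1%:R * e]mulrC in h; lra.
have e2 : 0 < e / 2 by rewrite divr_gt0.
have : \forall k \near F, forall i : 'I_N.+2, z k (i%:R * q) < e / 2.
  by apply: filter_forall => i; exact: z0.
apply: filterS => k H s /andP[s0 sS].
have sq0 : 0 <= s / q by rewrite divr_ge0// ltW.
have /andP[h1 h2] := truncn_itv sq0.
have iN : (Num.truncn (s / q) < N.+2)%N.
  rewrite -(ltr_nat R); apply: le_lt_trans h1 _.
  apply: (@le_lt_trans _ _ N.+1%:R); last by rewrite ltr_nat.
  by rewrite ler_pdivrMr// /q mulrC divfK.
have := H (Ordinal iN); rewrite /= => h3.
apply: le_trans (zL k s ((Num.truncn (s / q))%:R * q)) _.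
have h4 : `|s - (Num.truncn (s / q))%:R * q| <= q.
  rewrite ler_pdivlMr// in h1; rewrite ltr_pdivrMr// -natr1 mulrDl mul1r in h2.
  by rewrite ger0_norm ?subr_ge0// lerBlDl ltW.
apply: le_trans (lerD (ltW h3) (ler_wpM2l _ h4)) _ => //.
by rewrite -lerBrDl (le_trans qe)// lerBrDl -splitr.
Qed.

Lemma ereal_cvg0 (f : nat -> \bar R) : (forall k, 0 <= f k)%E ->
  f k @[k --> \oo] --> 0%E ->
  forall e : R, 0 < e -> \forall k \near \oo, (f k <= e%:E)%E.
Proof.
move=> f0 /fine_cvgP[h1 /cvgrPdist_lt h2] e e0.
apply: filterS2 h1 (h2 _ e0) => k fk h; rewrite -[leLHS]fineK// lee_fin ltW//.
by apply: le_lt_trans h; rewrite /= sub0r normrN ler_norm.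
Qed.

(** The integral of a nonnegative function is a supremum over the simple
    functions below it, and this supremum is monotone in the function. *)
Lemma ge0_integral_mono (D : set R) (f1 f2 : R -> \bar R) :
  (forall t, D t -> (0 <= f1 t)%E) -> (forall t, D t -> (f1 t <= f2 t)%E) ->
  (\int[mu]_(t in D) f1 t <= \int[mu]_(t in D) f2 t)%E.
Proof.
move=> f10 f12.
have f20 t : D t -> (0 <= f2 t)%E by move=> Dt; exact: le_trans (f10 t Dt) (f12 t Dt).
rewrite !ge0_integralE//; apply: le_ereal_sup => _ [h hf <-]; exists h => //.
move=> t; apply: le_trans (hf t) _; rewrite /patch; case: ifPn => //.
by rewrite inE => Dt; exact: f12.
Qed.

End limits.

Section space_time.
Context {R : realType} {n m l : nat} (U : set 'rV[R]_m) (V : set 'rV[R]_l).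
Context (g : 'I_m.+1 -> 'rV[R]_n -> 'rV[R]_m -> 'rV[R]_l -> 'rV[R]_n) (M : R).
Hypotheses (U_compact : compact U) (V_compact : compact V) (M_ge0 : 0 <= M)
  (g_continuous : forall i, field_continuous U V (g i))
  (g_lipschitz : forall i, locally_lipschitz_unif U V (g i))
  (g_growth : forall i, linear_growth U V M (g i)).
Local Notation mu := (@lebesgue_measure R).

(** The space-time form of an absolutely continuous control u: tau is the
    inverse of its arc-length clock, h and D are the derivatives of tau and of
    u o tau. *)
Definition space_time_data (T S : R) (u : R -> 'rV[R]_m) (tau h : R -> R) (D : R -> 'rV[R]_m) :=
  [/\ [/\ forall s : R, 0 <= tau s <= T,
          forall s : R, arc_clock u (tau s) = Num.max 0 (Num.min (arc_clock u T) s),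
          forall s t : R, s <= t -> 0 <= tau t - tau s <= t - s,
          forall t : R, 0 <= t <= T -> tau (arc_clock u t) = t &
          forall s t : R, s <= t -> enorm (u (tau t) - u (tau s)) <= t - s],
      [/\ bm h, forall s : R, 0 <= h s <= 1,
          {ae mu, forall s : R, 0 < s < S -> is_derive s 1 tau (h s)} &
          forall s t : R, 0 <= s -> s <= t -> t <= S -> integ s t h = tau t - tau s] &
      [/\ forall i, bm (fun s => D s ord0 i), forall t i, `|D t ord0 i| <= 1,
          {ae mu, forall s : R, 0 < s < S -> is_derive s 1 (fun s => u (tau s)) (D s)} &
          forall (s t : R) i, 0 <= s -> s <= t -> t <= S ->
            integ s t (fun s => D s ord0 i) = u (tau t) ord0 i - u (tau s) ord0 i]].

Lemma measurable_tau (tau : R -> R) :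
  (forall s t : R, s <= t -> 0 <= tau t - tau s <= t - s) -> measurable_fun setT tau.
Proof.
move=> tauL; apply: nondecreasing_measurable => // s t st.
by have /andP[] := tauL s t st; rewrite subr_ge0.
Qed.

Lemma nd_density (S : R) (tau : R -> R) : 0 < S ->
  (forall s t : R, s <= t -> 0 <= tau t - tau s <= t - s) -> exists h,
  [/\ bm h, forall s : R, 0 <= h s <= 1,
      {ae mu, forall s : R, 0 < s < S -> is_derive s 1 tau (h s)} &
      forall s t : R, 0 <= s -> s <= t -> t <= S -> integ s t h = tau t - tau s].
Proof.
move=> S0 tauL; apply: nd_lip_density => // s t _ st _; have /andP[h1 h2] := tauL s t st.
  by rewrite ger0_norm// mul1r.
by rewrite -subr_ge0.
Qed.

Lemma nd_integ (T S : R) (tau h f : R -> R) : 0 < S ->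
  (forall s t : R, s <= t -> 0 <= tau t - tau s <= t - s) -> tau 0 = 0 -> tau S = T ->
  bm h -> {ae mu, forall s : R, 0 < s < S -> is_derive s 1 tau (h s)} -> bm f ->
  integ 0 T f = integ 0 S (fun s => f (tau s) * h s).
Proof.
move=> S0 tauL tau0 tauS bh hd bf.
rewrite -{1}tau0 -{1}tauS; apply: (integ_comp S0 ler01) => //.
- by move=> s t _ st _; have /andP[q1 q2] := tauL s t st; rewrite ger0_norm// mul1r.
- by move=> s t _ st _; have /andP[] := tauL s t st; rewrite subr_ge0.
- exact: measurable_tau.
- by rewrite lexx ltW.
Qed.

Lemma nd_clock_pair (T S : R) (sg tau : R -> R) : measurable_fun setT sg ->
  (forall s t : R, s <= t -> 0 <= tau t - tau s <= t - s) -> tau 0 = 0 -> tau S = T ->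
  (forall t : R, 0 <= t <= T -> 0 <= sg t <= S /\ tau (sg t) = t) ->
  clock_pair T S 1 sg tau.
Proof.
move=> msg tauL tau0 tauS sgP; split => //.
- move=> s /andP[s0 s1]; have /andP[q1 _] := tauL _ _ s0; have /andP[q2 _] := tauL _ _ s1.
  by rewrite tau0 subr0 in q1; rewrite tauS subr_ge0 in q2; rewrite q1.
- by move=> s t _ st _; have /andP[] := tauL s t st; rewrite subr_ge0.
- by move=> s t _ st _; have /andP[q1 q2] := tauL s t st; rewrite ger0_norm// mul1r.
- by split => //; exact: measurable_tau.
Qed.

Lemma space_time_data_ex (T S : R) (u : R -> 'rV[R]_m) : 0 < T -> 0 < S ->
  (total_evariation 0 T u < +oo)%E -> abs_continuous 0 T u ->
  exists tau h D, space_time_data T S u tau h D.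
Proof.
move=> T0 S0 fin uAC.
have [tau [t1 t2 t3 t4 t5]] := arc_clock_inverse (ltW T0) fin uAC.
have [h hP] := nd_density S0 t3.
have vl : vlip_on 0 S 1 (fun s => u (tau s)).
  by move=> s t _ st _; rewrite mul1r; exact: t5.
have [D DP] := vlip_derive S0 ler01 vl.
by exists tau, h, D.
Qed.

Lemma space_time_ends (T S : R) u tau h D : 0 < T -> arc_clock u T <= S ->
  (total_evariation 0 T u < +oo)%E -> space_time_data T S u tau h D ->
  tau 0 = 0 /\ forall s : R, arc_clock u T <= s -> tau s = T.
Proof.
move=> T0 sgS fin [[t1 t2 t3 t4 t5] _ _]; have T0' := ltW T0.
split; first by rewrite -[in LHS](arc_clock0 u) t4// lexx.
move=> s sT; rewrite -[tau s]t4// t2 (min_l sT) (max_r _) ?t4 ?lexx ?T0'//.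
exact: (arc_clock_ge0 fin).
Qed.

Lemma space_time_integ (T S : R) u tau h D f : 0 < T -> 0 < S -> arc_clock u T <= S ->
  (total_evariation 0 T u < +oo)%E ->
  space_time_data T S u tau h D -> bm f ->
  integ 0 T f = integ 0 S (fun s => f (tau s) * h s).
Proof.
move=> T0 S0 sgS fin dt bf; have [tau0 tauT] := space_time_ends T0 sgS fin dt.
by have [[t1 t2 t3 t4 t5] [bh h01 hd hI] _] := dt; apply: nd_integ => //; exact: tauT.
Qed.

(** The primitives of the densities are the inverse clocks themselves. *)
Lemma space_time_density_cvg (F : set_system nat) (T S : R) uk tauk hk Dk (phi0 h : R -> R) :
  Filter F -> 0 < T -> (forall k, (total_evariation 0 T (uk k) < +oo)%E) ->
  (forall k, arc_clock (uk k) T <= S) ->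
  (forall k, space_time_data T S (uk k) (tauk k) (hk k) (Dk k)) -> phi0 0 = 0 ->
  (forall s t : R, 0 <= s -> s <= t -> t <= S -> integ s t h = phi0 t - phi0 s) ->
  (forall e : R, 0 < e -> \forall k \near F, forall s, 0 <= s <= S ->
     `|tauk k s - phi0 s| <= e) ->
  forall e : R, 0 < e -> \forall k \near F, forall s, 0 <= s <= S ->
    `|integ 0 s (hk k) - integ 0 s h| <= e.
Proof.
move=> FF T0 fink sgS datak phi00 hI tauC e e0.
apply: filterS (tauC e e0) => k H s /[dup] sS /andP[s0 s1].
have [tau0 _] := space_time_ends T0 (sgS k) (fink k) (datak k).
have [_ [_ _ _ hIk] _] := datak k.
by rewrite hIk// hI// tau0 phi00 !subr0; exact: H.
Qed.

(** Beyond the final value of the clock tau is constant. *)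
Lemma space_time_tail (T S : R) u tau h D : 0 < T -> arc_clock u T <= S ->
  (total_evariation 0 T u < +oo)%E -> space_time_data T S u tau h D ->
  {ae mu, forall s : R, arc_clock u T < s < S -> h s = 0 /\ forall i, D s ord0 i = 0}.
Proof.
move=> T0 sgS fin dt; have [_ tauc] := space_time_ends T0 sgS fin dt.
have [[t1 t2 t3 t4 t5] [bh h01 hd hI] [bD D1 Dd DI]] := dt.
have sgT := arc_clock_ge0 fin (ltW T0) (lexx T).
apply: aeS (aeI hd Dd) => q [h1 h2] /andP[q1' q2].
have qS : 0 < q < S by rewrite (le_lt_trans sgT q1') q2.
have k0 : 0 < q - arc_clock u T by rewrite subr_gt0.
split.
  apply: is_derive_uniq (h1 qS) _; have := is_derive_cstf q T.
  by apply: (is_derive_near k0) => y /near_gt/ltW yT; rewrite tauc.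
move=> i; have /is_derive_rVP/(_ i) h4 := h2 qS.
apply: is_derive_uniq h4 _; have := is_derive_cstf q (u T ord0 i).
by apply: (is_derive_near k0) => y /near_gt/ltW yT; rewrite tauc.
Qed.

Lemma bm_valued (E : set 'rV[R]_l) (v : R -> 'rV[R]_l) : compact E -> vmeas v ->
  (forall t, E (v t)) -> forall i, bm (fun t => v t ord0 i).
Proof.
move=> cE mv Ev i; have [B _ EB] := compact_enorm_bounded cE; split; first exact: mv.
by exists B => t; exact: le_trans (enorm_coord _ _) (EB _ (Ev t)).
Qed.

Lemma bm_enormB d (v w : R -> 'rV[R]_d) : (forall i, bm (fun t => v t ord0 i)) ->
  (forall i, bm (fun t => w t ord0 i)) -> bm (fun t => enorm (v t - w t)).
Proof.
by move=> bv bw; apply: bm_enorm => i; under eq_fun do rewrite !mxE; exact: bmB.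
Qed.

Lemma vmeas_comp d (v : R -> 'rV[R]_d) (tau : R -> R) : vmeas v -> measurable_fun setT tau ->
  vmeas (fun s => v (tau s)).
Proof. by move=> mv mt i; exact: (measurableT_comp (mv i) mt). Qed.

Lemma L1_fun_clamp d (E : set 'rV[R]_d) (T : R) v : 0 <= T -> L1_fun 0 T E v ->
  vmeas (fun t => v (Num.max 0 (Num.min T t))) /\ (forall t, E (v (Num.max 0 (Num.min T t)))).
Proof.
move=> T0 [Ev iv]; split.
  by apply: measurable_clamp => // i; apply/measurable_EFinP; exact: measurable_int (iv i).
by move=> t; apply: Ev; rewrite in_itv/= clamp_ge.
Qed.

Lemma L1_fun_comp d (E : set 'rV[R]_d) (T : R) v (tau : R -> R) : 0 <= T -> L1_fun 0 T E v ->
  measurable_fun setT tau -> (forall s, 0 <= tau s <= T) ->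
  vmeas (fun s => v (tau s)) /\ (forall s, E (v (tau s))).
Proof.
move=> T0 vL mt tT; have [mv Ev] := L1_fun_clamp T0 vL.
have cE s : v (tau s) = v (Num.max 0 (Num.min T (tau s))) by rewrite clamp_id.
split=> [|s]; last by rewrite cE; exact: Ev.
rewrite (_ : (fun s => _) = fun s => v (Num.max 0 (Num.min T (tau s)))).
  exact: (vmeas_comp mv mt).
by apply/funext => s.
Qed.

End space_time.

Section limit.
Context {R : realType} {n m l : nat} (U : set 'rV[R]_m) (V : set 'rV[R]_l).
Context (g : 'I_m.+1 -> 'rV[R]_n -> 'rV[R]_m -> 'rV[R]_l -> 'rV[R]_n) (M : R).
Hypotheses (U_compact : compact U) (V_compact : compact V) (M_ge0 : 0 <= M)
  (g_continuous : forall i, field_continuous U V (g i))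
  (g_lipschitz : forall i, locally_lipschitz_unif U V (g i))
  (g_growth : forall i, linear_growth U V M (g i)).
Local Notation mu := (@lebesgue_measure R).

(** The passage to the limit in both implications. Read in space-time, the
    Caratheodory solutions have densities bounded by 1, whose primitives
    converge because the controls do; so ode_stability applies. The first
    ordinary controls are handled by vcomp_cvg, through the transport of
    Lebesgue measure along tauk. *)
Lemma space_time_limit (F : set_system nat) (T S : R) (x0 : 'rV[R]_n)
    (uk : nat -> R -> 'rV[R]_m) (v1k v2k : nat -> R -> 'rV[R]_l) (xk : nat -> R -> 'rV[R]_n)
    (tauk hk : nat -> R -> R) (Dk : nat -> R -> 'rV[R]_m)
    (phi0 h : R -> R) (phi D : R -> 'rV[R]_m) (v1 psi2 : R -> 'rV[R]_l) (xi : R -> 'rV[R]_n) :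
  ProperFilter F -> 0 < T -> 0 < S ->
  (forall k, AC_fun 0 T U (uk k)) ->
  (forall k, L1_fun 0 T V (v1k k) /\ L1_fun 0 T V (v2k k)) ->
  (forall k, (total_evariation 0 T (uk k) < +oo)%E) ->
  (forall k, arc_clock (uk k) T <= S) ->
  (forall k, caratheodory_solution g T x0 (uk k) (v1k k) (v2k k) (xk k)) ->
  (forall k, space_time_data T S (uk k) (tauk k) (hk k) (Dk k)) ->
  (forall s t : R, s <= t -> 0 <= phi0 t - phi0 s <= t - s) -> phi0 0 = 0 -> phi0 S = T ->
  bm h -> (forall s : R, 0 <= h s <= 1) ->
  {ae mu, forall s : R, 0 < s < S -> is_derive s 1 phi0 (h s)} ->
  (forall s t : R, 0 <= s -> s <= t -> t <= S -> integ s t h = phi0 t - phi0 s) ->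
  vmeas phi -> (forall s, U (phi s)) ->
  (forall i, bm (fun s => D s ord0 i)) -> (forall t i, `|D t ord0 i| <= 1) ->
  (forall (s t : R) i, 0 <= s -> s <= t -> t <= S ->
     integ s t (fun s => D s ord0 i) = phi t ord0 i - phi s ord0 i) ->
  vmeas v1 -> (forall t, V (v1 t)) -> vmeas psi2 -> (forall t, V (psi2 t)) ->
  integral_solution g S x0 (densities h D) phi (ordinary (v1 \o phi0) psi2) xi ->
  (forall e : R, 0 < e -> \forall k \near F, forall s, 0 <= s <= S ->
     `|tauk k s - phi0 s| <= e) ->
  (forall e : R, 0 < e -> \forall k \near F, forall s, 0 <= s <= S ->
     enorm (uk k (tauk k s) - phi s) <= e) ->
  (forall e : R, 0 < e -> \forall k \near F,
     integ 0 T (fun t => enorm (v1k k (Num.max 0 (Num.min T t)) - v1 t)) <= e) ->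
  (forall i (e : R), 0 < e -> \forall k \near F,
     integ 0 S (fun s => enorm (v2k k (tauk k s) - psi2 s) * `|Dk k s ord0 i|) <= e) ->
  forall e : R, 0 < e -> \forall k \near F, forall s, 0 <= s <= S ->
    enorm (xk k (tauk k s) - xi s) <= e.
Proof.
move=> FF T0 S0 Uk Vk fink sgS solk datak phi0L phi00 phi0S bh h01 hd hI mphi Uphi bD D1 DI
  mv1 Vv1 mpsi Vpsi sol tauC uC v1C v2C.
have T0' := ltW T0; have S0' := ltW S0.
have mphi0 := measurable_tau phi0L.
have hW (s : R) : `|h s| <= 1 by have /andP[p q] := h01 s; rewrite ger0_norm.
have mv1p := vmeas_comp mv1 mphi0.
have adm : admissible U V 1 (densities h D) phi (ordinary (v1 \o phi0) psi2).
  by apply: densities_admissible => //= t; exact: Vv1.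
have conv k : admissible U V 1 (densities (hk k) (Dk k)) (uk k \o tauk k)
      (ordinary (v1k k \o tauk k) (v2k k \o tauk k)) /\
    integral_solution g S x0 (densities (hk k) (Dk k)) (uk k \o tauk k)
      (ordinary (v1k k \o tauk k) (v2k k \o tauk k)) (xk k \o tauk k).
  have [[t1 t2 t3 t4 t5] [bhk h01k hdk hIk] [bDk D1k Ddk DIk]] := datak k.
  have [L1 L2] := Vk k.
  apply: (caratheodory_space_time U_compact M_ge0 g_continuous g_growth (T := T)) => //.
  by move=> s; have /andP[p q] := h01k s; rewrite ger0_norm.
have phi0I (f : R -> R) : bm f -> integ 0 T f = integ 0 S (fun s => f (phi0 s) * h s).
  exact: nd_integ.
have hkC := space_time_density_cvg FF T0 fink sgS datak phi00 hI tauC.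
apply: (ode_stability U_compact V_compact M_ge0 g_continuous g_lipschitz g_growth FF S0'
  adm sol (fun k => (conv k).1) (fun k => (conv k).2)).
- exact: uC.
- move=> j e e0; rewrite /densities; case: (unlift ord0 j) => [i|]; last exact: hkC.
  have e2 : 0 < e / 2 by rewrite divr_gt0.
  apply: filterS (uC _ e2) => k H s /[dup] sS /andP[s0 s1].
  have [tauk0 _] := space_time_ends T0 (sgS k) (fink k) (datak k).
  have [_ _ [_ _ _ DIk]] := datak k; rewrite DIk// DI//.
  have h1 := H s sS; have h2 : enorm (uk k (tauk k 0) - phi 0) <= e / 2.
    by apply: H; rewrite lexx.
  rewrite subr_swap (splitr e); apply: le_trans (ler_normB _ _) _; apply: lerD.
    by apply: le_trans h1; apply: le_trans (enorm_coord _ i); rewrite !mxE.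
  by apply: le_trans h2; apply: le_trans (enorm_coord _ i); rewrite !mxE.
move=> j e e0; rewrite /ordinary /densities; case: unliftP => [i|] ->; last first.
  rewrite eqxx /=.
  have e2 : 0 < e / 2 by rewrite divr_gt0.
  have bv1 := bm_valued V_compact mv1 Vv1.
  have C1 : \forall k \near F, integ 0 S
      (fun s => enorm (v1 (tauk k s) - v1 (phi0 s)) * hk k s) <= e / 2.
    apply: (@vcomp_cvg _ F S T 1 FF S0' T0' tauk hk phi0 h) => //.
    - by move=> k; have [[t1 t2 t3 t4 t5] _ _] := datak k; exact: measurable_tau.
    - by move=> k; have [_ [] ] := datak k.
    - by move=> k s; have [_ [_ /(_ s)/andP[] ]] := datak k.
    - by move=> k s; have [_ [_ /(_ s)/andP[] ]] := datak k.
    - by move=> s; have /andP[] := h01 s.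
    - by move=> s; have /andP[] := h01 s.
    - by move=> k f bf; exact: space_time_integ (datak k) bf.
  apply: filterS2 C1 (v1C _ e2) => k H1 H2.
  have [[t1 t2 t3 t4 t5] [bhk h01k hdk hIk] _] := datak k.
  have [[mpk Upk] [mck Vck] _ _] := (conv k).1.
  have mv1k : vmeas (v1k k \o tauk k) by have := mck ord0; rewrite /ordinary eqxx.
  have Vv1k t : V (v1k k (tauk k t)) by have := Vck ord0 t; rewrite /ordinary eqxx.
  have bv1k := bm_valued V_compact mv1k Vv1k.
  have mtk := measurable_tau t3.
  have bv1t := bm_valued V_compact (vmeas_comp mv1 mtk) (fun s => Vv1 (tauk k s)).
  have bv1p := bm_valued V_compact mv1p (fun s => Vv1 (phi0 s)).
  pose q (t : R) := enorm (v1k k (Num.max 0 (Num.min T t)) - v1 t).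
  have [mc Vc] := L1_fun_clamp T0' (Vk k).1.
  have bq : bm q.
    by apply: bm_enormB => //; exact: (bm_valued V_compact mc).
  rewrite (space_time_integ T0 S0 (sgS k) (fink k) (datak k) bq) in H2.
  rewrite (splitr e); apply: le_trans (lerD H2 H1).
  rewrite -integ_D; [|by apply: bmM => //; apply: bm_comp|
    by apply: bmM => //; exact: bm_enormB].
  apply: integ_le.
  - by apply: bmM; [exact: bm_enormB | exact: bm_norm].
  - apply: bmD; first by apply: bmM => //; apply: bm_comp.
    by apply: bmM => //; exact: bm_enormB.
  move=> s _; have /andP[hs0 _] := h01k s.
  rewrite (ger0_norm hs0) -mulrDl ler_wpM2r// /q clamp_id//.
  exact: enorm_triangle.
apply: filterS (v2C i e e0) => k.
by rewrite eq_sym (negbTE (neq_lift _ _)).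
Qed.

End limit.

(** * Reparametrization by arc length *)

Section lipschitz_curves.
Context {R : realType}.
Local Notation mu := (@lebesgue_measure R).

Lemma valued_L1_fun d (E : set 'rV[R]_d) (a b : R) v : compact E -> vmeas v -> (forall t, E (v t)) ->
  L1_fun a b E v.
Proof.
move=> cE mv Ev; split=> [t _ //|i]; apply: bm_integrable.
exact: (bm_valued cE mv Ev).
Qed.

Lemma vlip_abs_continuous d (f : R -> 'rV[R]_d) (a b L : R) : 0 <= L -> vlip_on a b L f ->
  abs_continuous a b f.
Proof.
move=> L0 fL e e0; exists (e / (L + 1)); first by rewrite divr_gt0// ltr_wpDl.
move=> N p q pq _ H; apply: (@le_lt_trans _ _ (L * \sum_(i < N) (q i - p i))).
  by rewrite mulr_sumr; apply: ler_sum => i _; have [h1 [h2 h3]] := pq i; exact: fL.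
have s0 : 0 <= \sum_(i < N) (q i - p i).
  by apply: sumr_ge0 => i _; have [h1 [h2 h3]] := pq i; rewrite subr_ge0.
rewrite ltr_pdivlMr ?ltr_wpDl// in H; apply: le_lt_trans H.
by rewrite mulrDr mulr1 mulrC lerDl.
Qed.

Lemma var_eq d (a b : R) (f k : R -> 'rV[R]_d) : a <= b ->
  (forall t, a <= t <= b -> f t = k t) ->
  (total_evariation a b f < +oo)%E -> (total_evariation a b k < +oo)%E ->
  var a b f = var a b k.
Proof.
move=> ab fk finf fink.
have le f1 k1 : (forall t, a <= t <= b -> f1 t = k1 t) ->
    (total_evariation a b f1 < +oo)%E -> (total_evariation a b k1 < +oo)%E ->
    var a b f1 <= var a b k1.
  move=> e1 fin1 fin2; rewrite -lee_fin -(varE ab fin1).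
  rewrite (_ : var a b k1 = var a b k1 - var a a k1); last by rewrite var_aa subr0.
  apply: (tv_le (F := fun t => var a t k1)) => // x y ax xy yb.
  rewrite !e1; [|by rewrite ax (le_trans xy)|by rewrite (le_trans ax xy)].
  exact: (var_majorant fin2).
by apply/eqP; rewrite eq_le !le// => t tab; rewrite fk.
Qed.

Lemma vlip_tv_fin d (f : R -> 'rV[R]_d) (a b L : R) : a <= b -> vlip_on a b L f ->
  (total_evariation a b f < +oo)%E.
Proof. by move=> ab fL; apply: le_lt_trans (vlip_tv ab fL) _; rewrite ltry. Qed.

Lemma lip_surj (a b C : R) (f : R -> R) (v : R) : a <= b -> lip_on a b C f ->
  f a <= v <= f b -> exists2 c : R, a <= c <= b & f c = v.
Proof.
move=> ab fL /andP[h1 h2].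
have := IVT ab (continuous_subspaceT (lip_continuous ab fL)).
move=> /(_ v) /=; rewrite !clamp_id ?lexx ?ab//.
have h12 := le_trans h1 h2.
rewrite (min_l h12) (max_r h12) h1 h2 => /(_ isT)[c].
by rewrite in_itv/= => cab; rewrite clamp_id// => <-; exists c.
Qed.

Lemma lipschitz_pair d (a b : R) (phi0 : R -> R) (phi : R -> 'rV[R]_d) : a <= b ->
  (forall s t : R, s <= t -> `|phi0 t - phi0 s| <= t - s) ->
  (forall s t : R, s <= t -> enorm (phi t - phi s) <= t - s) ->
  [lipschitz (phi0 s, phi s) | s in `[a, b]%classic].
Proof.
move=> ab l0 l1.
have PF : ProperFilter (globally (`[a, b]%classic `*` `[a, b]%classic)).
  apply: (@globally_properfilter _ _ (a, a)); apply: inferP.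
  by split; rewrite /= in_itv/= lexx.
apply: (klipschitzW (k := 1)).
move=> [x y] _ /=; rewrite mul1r prod_normE /= ge_max.
wlog xy : x y / x <= y.
  move=> H; have [xy|/ltW yx] := leP x y; first exact: H.
  by have := H y x yx; rewrite [`|phi0 _ - _|]distrC [`|phi _ - _|]distrC [`|y - x|]distrC.
rewrite [`|phi0 _ - _|]distrC [`|phi _ - _|]distrC [`|x - y|]distrC.
rewrite (ger0_norm (_ : 0 <= y - x)) ?subr_ge0// l0//=.
exact: le_trans (enorm_mx_norm _) (l1 _ _ xy).
Qed.

Lemma lipschitz_pairP d (a b : R) (phi0 : R -> R) (phi : R -> 'rV[R]_d) : a <= b ->
  [lipschitz (phi0 s, phi s) | s in `[a, b]%classic] ->
  exists2 L : R, 0 <= L & lip_on a b L phi0 /\ vlip_on a b L phi.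
Proof.
move=> ab.
have PF : ProperFilter (globally (`[a, b]%classic `*` `[a, b]%classic)).
  apply: (@globally_properfilter _ _ (a, a)); apply: inferP.
  by split; rewrite /= in_itv/= lexx.
move=> /ex_dom_bound[K KP]; exists (d.+1%:R * `|K|); first by rewrite mulr_ge0.
have H (s t : R) : a <= s -> s <= t -> t <= b ->
    Num.max `|phi0 t - phi0 s| `|phi t - phi s| <= `|K| * (t - s).
  move=> s1 st tb; have := KP (t, s); rewrite /= prod_normE /= => h.
  have {}h : Num.max `|phi0 t - phi0 s| `|phi t - phi s| <= K * `|t - s|.
    by apply: h; split; rewrite /= in_itv/=; apply/andP; split => //;
      [exact: le_trans s1 st|exact: le_trans st tb].
  apply: le_trans h _; rewrite ger0_norm ?subr_ge0// ler_wpM2r ?subr_ge0//.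
  exact: ler_norm.
split=> s t s1 st tb; have := H s t s1 st tb; rewrite ge_max => /andP[h1 h2].
  apply: le_trans h1 _; rewrite ler_wpM2r ?subr_ge0//.
  by rewrite ler_peMl// ler1n.
apply: le_trans (mx_norm_enorm _) _; rewrite -mulrA; apply: ler_pM => //.
by rewrite ler_nat.
Qed.

End lipschitz_curves.

Section arc_length.
Context {R : realType} {m : nat}.
Local Notation mu := (@lebesgue_measure R).

(** A limit of the graphs (tauk, uk o tauk) is parametrized on [0, S] with
    speed at most 1, possibly less. Here ell is its arc length, L the total
    length, and rho a right inverse of ell; (phi0, phi) factors through ell as
    (phi0 o rho, phi o rho), which is parametrized by arc length. *)
Definition arc_length_change (S L : R) (phi0 : R -> R) (phi : R -> 'rV[R]_m) (ell rho : R -> R) :=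
  [/\ [/\ ell 0 = 0, ell S = L & forall s t : R, 0 <= s -> s <= t -> t <= S ->
          (phi0 t - phi0 s) + enorm (phi t - phi s) <= ell t - ell s <= 2 * (t - s)],
      [/\ forall r : R, 0 <= rho r <= S, forall r : R, ell (rho r) = Num.max 0 (Num.min L r) &
          forall r q : R, r <= q -> rho r <= rho q],
      [/\ forall r q : R, r <= q -> 0 <= phi0 (rho q) - phi0 (rho r) <= q - r &
          forall r q : R, r <= q -> enorm (phi (rho q) - phi (rho r)) <= q - r],
      forall s : R, 0 <= s <= S -> phi0 (rho (ell s)) = phi0 s /\ phi (rho (ell s)) = phi s &
      (forall r : R, 0 <= r <= L -> phi0 (rho r) + var 0 r (phi \o rho) = r) /\
      forall s t : R, 0 <= s -> s <= t -> t <= S -> phi0 t = phi0 s ->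
        (forall q, s <= q <= t -> phi q = phi s) -> ell t = ell s].

(** The arc length phi0 + var phi dominates the increments of phi0 and of phi.
    So it is constant only where the graph does not move, and the choice of rho
    does not matter for phi0 o rho and phi o rho. *)
Lemma arc_length_change_ex (S : R) (phi0 : R -> R) (phi : R -> 'rV[R]_m) : 0 < S ->
  (forall s t : R, s <= t -> 0 <= phi0 t - phi0 s <= t - s) -> phi0 0 = 0 ->
  (forall s t : R, s <= t -> enorm (phi t - phi s) <= t - s) ->
  exists L ell rho, arc_length_change S L phi0 phi ell rho.
Proof.
move=> S0 phi0L phi00 phiL; have S0' := ltW S0.
have vl : vlip_on 0 S 1 phi by move=> s t _ st _; rewrite mul1r; exact: phiL.
have fin := vlip_tv_fin S0' vl.
pose ell (s : R) : R := phi0 s + var 0 s phi.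
have ell0 : ell 0 = 0 by rewrite /ell phi00 var_aa addr0.
have ellL (s t : R) : 0 <= s -> s <= t -> t <= S ->
    (phi0 t - phi0 s) + enorm (phi t - phi s) <= ell t - ell s <= 2 * (t - s).
  move=> s0 st tS; have -> : ell t - ell s = (phi0 t - phi0 s) + (var 0 t phi - var 0 s phi).
    by rewrite /ell opprD addrACA.
  have h1 := var_majorant fin s0 st tS; rewrite lerD2l h1 /=.
  have /andP[_ h2] := phi0L s t st.
  have -> : 2 * (t - s) = (t - s) + (t - s) by ring.
  apply: lerD => //; apply: (var_min (F := id) fin s0 st tS) => x y _ xy _; exact: phiL.
have ellnd (s t : R) : 0 <= s -> s <= t -> t <= S -> ell s <= ell t.
  move=> s0 st tS; have /andP[h _] := ellL s t s0 st tS; rewrite -subr_ge0.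
  apply: le_trans h; have /andP[h1 _] := phi0L s t st.
  by rewrite addr_ge0 ?enorm_ge0.
have ell2 : lip_on 0 S 2 ell.
  move=> s t s0 st tS; have /andP[_ h] := ellL s t s0 st tS.
  by rewrite ger0_norm// subr_ge0; exact: ellnd.
pose L := ell S.
have L0 : 0 <= L by rewrite -ell0; exact: ellnd.
have /choice[rho0 rho0P] (r : R) : exists s : R, 0 <= s <= S /\ ell s = Num.max 0 (Num.min L r).
  have rL := clamp_ge r L0.
  have [|s sS sE] := @lip_surj _ 0 S 2 ell (Num.max 0 (Num.min L r)) S0' ell2.
    by rewrite ell0.
  by exists s.
(* the clamp makes rho monotone: two arguments with the same image under ell
   are clamped to the same number *)
pose rho (r : R) : R := rho0 (Num.max 0 (Num.min L r)).
have rhoS r : 0 <= rho r <= S by case: (rho0P (Num.max 0 (Num.min L r))).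
have ellrho r : ell (rho r) = Num.max 0 (Num.min L r).
  have [_ ->] := rho0P (Num.max 0 (Num.min L r)).
  by rewrite clamp_id// clamp_ge.
have rhond (r q : R) : r <= q -> rho r <= rho q.
  move=> rq; have [//|h] := leP (rho r) (rho q).
  have /andP[q0 q1] := rhoS q; have /andP[r0 r1] := rhoS r.
  have h1 := ellnd _ _ q0 (ltW h) r1; rewrite !ellrho in h1.
  have /andP[h2 _] := clamp_lip 0 L rq; rewrite subr_ge0 in h2.
  have h3 : Num.max 0 (Num.min L r) = Num.max 0 (Num.min L q) :> R.
    by apply/eqP; rewrite eq_le h2 h1.
  have h4 : rho r = rho q by rewrite /rho; congr (rho0 _).
  by rewrite h4 ltxx in h.
have inc (r q : R) : r <= q ->
    (phi0 (rho q) - phi0 (rho r)) + enorm (phi (rho q) - phi (rho r)) <= q - r.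
  move=> rq; have /andP[q0 q1] := rhoS q; have /andP[r0 r1] := rhoS r.
  have /andP[h _] := ellL _ _ r0 (rhond _ _ rq) q1; apply: le_trans h _.
  by rewrite !ellrho; have /andP[] := clamp_lip 0 L rq.
have phi0r (r q : R) : r <= q -> 0 <= phi0 (rho q) - phi0 (rho r).
  by move=> rq; have /andP[] := phi0L _ _ (rhond _ _ rq).
have same (s t : R) : 0 <= s <= S -> 0 <= t <= S -> ell s = ell t ->
    phi0 s = phi0 t /\ phi s = phi t.
  wlog st : s t / s <= t.
    move=> H sS tS e; have [st|/ltW ts] := leP s t; first exact: H.
    by have [-> ->] := H t s ts tS sS (esym e).
  move=> /andP[s0 _] /andP[_ t1] e; have /andP[h _] := ellL s t s0 st t1.
  rewrite e subrr in h; have /andP[h1 _] := phi0L s t st.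
  have h2 : phi0 t - phi0 s <= 0 by apply: le_trans h; rewrite lerDl enorm_ge0.
  have h3 := addr_le h1 h.
  split; last first.
    apply/esym/eqP; rewrite -subr_eq0; apply/eqP/enorm_eq0/eqP.
    by rewrite eq_le h3 enorm_ge0.
  by apply/esym/eqP; rewrite -subr_eq0 eq_le h2 h1.
have back (s : R) : 0 <= s <= S -> phi0 (rho (ell s)) = phi0 s /\ phi (rho (ell s)) = phi s.
  move=> /[dup] sS /andP[s0 s1]; apply: same => //.
  by rewrite ellrho clamp_id// -ell0 !ellnd.
have phir (r q : R) : r <= q -> enorm (phi (rho q) - phi (rho r)) <= q - r.
  by move=> rq; exact: addr_le (phi0r _ _ rq) (inc _ _ rq).
exists L, ell, rho; split => //.
  split => // r q rq; rewrite phi0r//=; apply: le_trans (inc _ _ rq).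
  by rewrite lerDl enorm_ge0.
split; last first.
  move=> s t s0 st tS e1 e2; rewrite /ell e1; congr (_ + _); apply/eqP.
  rewrite eq_le; apply/andP; split; last exact: (var_nd fin).
  rewrite -subr_le0 -[leRHS](subrr (0 : R)).
  apply: (var_min (F := fun=> 0) fin s0 st tS) => x z sx xz zt.
  by rewrite !e2 ?subrr ?enorm0// ?sx ?(le_trans sx)// (le_trans xz).
move=> r /[dup] rL /andP[r0 r1].
have vlr : vlip_on 0 L 1 (phi \o rho) by move=> s t _ st _; rewrite mul1r; exact: phir.
have /andP[p0 p1] := rhoS r.
have e : ell (rho r) = r by rewrite ellrho clamp_id.
rewrite -[RHS]e /ell; congr (_ + _).
have finr : (total_evariation 0 r (phi \o rho) < +oo)%E.
  exact: tv_sub_fin (vlip_tv_fin L0 vlr).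
have finp : (total_evariation 0 (rho r) phi < +oo)%E by exact: tv_sub_fin fin.
have tvE : total_evariation 0 (rho r) ((phi \o rho) \o ell) = total_evariation 0 r (phi \o rho).
  rewrite (tv_comp (phi \o rho) p0); first by rewrite ell0 e.
    by move=> s t s0 st tr; apply: ellnd => //; exact: le_trans p1.
  move=> y yh; apply: (lip_surj (C := 2) p0 _ yh) => s t s0 st tr; apply: ell2 => //.
  exact: le_trans p1.
have finc : (total_evariation 0 (rho r) ((phi \o rho) \o ell) < +oo)%E by rewrite tvE.
rewrite [in LHS]/var -tvE; apply: var_eq => // t /andP[t0 t1].
by have [_] := back t (introT andP (conj t0 (le_trans t1 p1))).
Qed.

(** Where phi0 moves, no other parameter has the same arc length. *)
Lemma arc_length_flat (S L : R) (phi0 : R -> R) (phi : R -> 'rV[R]_m) ell rho (s d : R) :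
  arc_length_change S L phi0 phi ell rho ->
  (forall s t : R, s <= t -> 0 <= phi0 t - phi0 s <= t - s) ->
  0 <= s <= S -> is_derive s 1 phi0 d -> d != 0 -> rho (ell s) = s.
Proof.
move=> [_ _ _ back _] phi0L sS sd d0; have [e _] := back s sS.
have nd (p q : R) : p <= q -> phi0 p <= phi0 q by move=> /phi0L/andP[]; rewrite subr_ge0.
apply/eqP/negP => /negP ne; move: d0; rewrite (is_derive_const_side sd ne) ?eqxx// => z.
case: (leP (rho (ell s)) s) => cmp /andP[z1 z2]; apply/eqP; rewrite eq_le.
  by rewrite nd//= -[leLHS]e nd.
by rewrite -[leRHS]e !nd.
Qed.

End arc_length.

Section reparametrization.
Context {R : realType} {n m l : nat} (U : set 'rV[R]_m) (V : set 'rV[R]_l).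
Context (g : 'I_m.+1 -> 'rV[R]_n -> 'rV[R]_m -> 'rV[R]_l -> 'rV[R]_n) (M : R).
Hypotheses (U_compact : compact U) (V_compact : compact V) (M_ge0 : 0 <= M)
  (g_continuous : forall i, field_continuous U V (g i))
  (g_lipschitz : forall i, locally_lipschitz_unif U V (g i))
  (g_growth : forall i, linear_growth U V M (g i)).
Local Notation mu := (@lebesgue_measure R).

(** Along the arc-length parameter r the identity phi0 + var phi = r holds; its
    derivative is the normalization of feasible controls, by vlip_var_derive. *)
Lemma arc_length_feasible (T S L : R) (u0 : 'rV[R]_m) (phi0 ell rho : R -> R) (phi : R -> 'rV[R]_m)
    (psi1 psi2 : R -> 'rV[R]_l) : 0 < T -> 0 < S ->
  arc_length_change S L phi0 phi ell rho ->
  (forall s t : R, s <= t -> 0 <= phi0 t - phi0 s <= t - s) -> phi0 0 = 0 -> phi0 S = T ->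
  (forall s, U (phi s)) -> phi 0 = u0 ->
  vmeas psi1 -> (forall s, V (psi1 s)) -> vmeas psi2 -> (forall s, V (psi2 s)) ->
  0 < L /\ feasible_control U V T u0 (phi0 \o rho) (phi \o rho) psi1 psi2 L.
Proof.
move=> T0 S0 [[ell0 ellS ellL] [rhoS ellrho rhond] [p0L pL] back [lenE _]] phi0L phi00 phi0S Uphi phi0u
  m1 V1 m2 V2.
have S0' := ltW S0; have T0' := ltW T0.
have TL : T <= L.
  have /andP[h _] := ellL 0 S (lexx _) S0' (lexx _).
  rewrite ell0 ellS subr0 phi00 phi0S subr0 in h.
  by apply: le_trans h; rewrite lerDl enorm_ge0.
have L0 : 0 < L by exact: lt_le_trans TL.
have L0' := ltW L0.
have at0 : phi0 (rho 0) = 0 /\ phi (rho 0) = u0.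
  by have := back 0 (introT andP (conj (lexx _) S0')); rewrite ell0 phi00 phi0u.
have atL : phi0 (rho L) = T.
  by have [] := back S (introT andP (conj S0' (lexx _))); rewrite ellS phi0S.
split => //.
have vl : vlip_on 0 L 1 (phi \o rho) by move=> s t _ st _; rewrite mul1r; exact: pL.
have [h [bh h01 hd hI]] := nd_density L0 p0L.
have [D [bD D1 Dd DI]] := vlip_derive L0 ler01 vl.
have vd := vlip_var_derive L0 ler01 vl.
split => //.
- split.
  + move=> s _ /=; rewrite -phi00; have /andP[r0 _] := rhoS s.
    by have /andP[] := phi0L _ _ r0; rewrite subr_ge0.
  + by move=> s _; exact: Uphi.
  + apply: lipschitz_pair => // s t st; have /andP[h1 h2] := p0L s t st.
    by rewrite /= ger0_norm.
- by split; apply: valued_L1_fun.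
- by case: at0.
apply: aeS (aeI hd (aeI Dd (aeI vd (aeI (ae_ne 0) (ae_ne L))))).
move=> s [h1 [h2 [h3 [s0 sL]]]]; rewrite in_itv/= => /andP[s1 s2].
have sl : 0 < s < L by rewrite lt_neqAle eq_sym s0 s1 lt_neqAle sL s2.
have {}h1 := h1 sl; have {}h2 := h2 sl; have {}h3 := h3 sl _ h2.
have -> : derive1 (phi0 \o rho) s = h s by exact: is_derive1E.
have -> : derive1 (phi \o rho) s = D s by case: h2 => _ <-; rewrite derive1E.
have /andP[-> _] := h01 s; split=> //.
have h4 := is_deriveDf h1 h3; apply: is_derive_uniq h4 _; have := is_derive_idf s.
have k0 : 0 < Num.min s (L - s) by rewrite lt_min subr_gt0.
by apply: (is_derive_near k0) => y /near_interval yL; rewrite lenE.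
Qed.

Lemma feasible_solution (L : R) (x0 : 'rV[R]_n) (phi0 : R -> R) (phi : R -> 'rV[R]_m)
    (h : R -> R) (D : R -> 'rV[R]_m) (psi1 psi2 : R -> 'rV[R]_l) (W : R) (y : R -> 'rV[R]_n) :
  0 <= L ->
  admissible U V W (densities h D) phi (ordinary psi1 psi2) ->
  integral_solution g L x0 (densities h D) phi (ordinary psi1 psi2) y ->
  {ae mu, forall s : R, 0 < s < L -> is_derive s 1 phi0 (h s)} ->
  {ae mu, forall s : R, 0 < s < L -> is_derive s 1 phi (D s)} ->
  space_time_solution g x0 phi0 phi psi1 psi2 L y.
Proof.
move=> L0 adm sol hd Dd.
have [C C0 yL] := integral_solution_vlip U_compact M_ge0 g_continuous g_growth adm sol.
split.
- exact: vlip_abs_continuous yL.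
- case: sol => _ _ yE; apply/rowP => i; rewrite yE ?lexx//.
  by rewrite integ_aa addr0.
have yd := integral_solution_derive U_compact M_ge0 g_continuous g_growth adm sol.
apply: aeS (aeI hd (aeI Dd (aeI yd (aeI (ae_ne 0) (ae_ne L))))).
move=> s [h1 [h2 [h3 [s0 sL]]]]; rewrite in_itv/= => /andP[s1 s2].
have sl : 0 < s < L by rewrite lt_neqAle eq_sym s0 s1 lt_neqAle sL s2.
have {}h1 := h1 sl; have {}h2 := h2 sl; have {}h3 := h3 sl.
have -> : derive1 phi0 s = h s by exact: is_derive1E.
have -> : derive1 phi s = D s by case: h2 => _ <-; rewrite derive1E.
by move: h3; rewrite rhsE.
Qed.

(** Where ell' = 0 the graph (phi0, phi) has derivative zero too, and both
    integrands vanish. Elsewhere rho (ell s) = s, the equation at ell s is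
    available by lip_null, and the chain rule relates the densities. *)
Lemma arc_length_pullback (S L : R) (x0 : 'rV[R]_n) (phi0 h ell rho : R -> R) (phi D : R -> 'rV[R]_m)
    (v1 psi2 : R -> 'rV[R]_l) (h' : R -> R) (D' : R -> 'rV[R]_m) (W : R) (y : R -> 'rV[R]_n) :
  0 < S -> arc_length_change S L phi0 phi ell rho ->
  (forall s t : R, s <= t -> 0 <= phi0 t - phi0 s <= t - s) ->
  admissible U V W (densities h D) phi (ordinary (v1 \o phi0) psi2) ->
  admissible U V W (densities h' D') (phi \o rho) (ordinary (v1 \o (phi0 \o rho)) (psi2 \o rho)) ->
  integral_solution g L x0 (densities h' D') (phi \o rho)
    (ordinary (v1 \o (phi0 \o rho)) (psi2 \o rho)) y ->
  {ae mu, forall s : R, 0 < s < S -> is_derive s 1 phi0 (h s)} ->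
  {ae mu, forall s : R, 0 < s < S -> is_derive s 1 phi (D s)} ->
  {ae mu, forall s : R, 0 < s < L -> is_derive s 1 (phi0 \o rho) (h' s)} ->
  {ae mu, forall s : R, 0 < s < L -> is_derive s 1 (phi \o rho) (D' s)} ->
  integral_solution g S x0 (densities h D) phi (ordinary (v1 \o phi0) psi2)
    (fun s => y (ell (Num.max 0 (Num.min S s)))).
Proof.
move=> S0 [[ell0 ellS ellL] [rhoS ellrho rhond] [p0L pL] back [lenE _]] phi0L adm adm' sol hd Dd hd' Dd'.
have S0' := ltW S0; have [my [B yB] yE] := sol.
pose el (s : R) : R := ell (Num.max 0 (Num.min S s)).
have elE (s : R) : 0 <= s <= S -> el s = ell s by move=> sS; rewrite /el clamp_id.
have ellnd (s t : R) : 0 <= s -> s <= t -> t <= S -> ell s <= ell t.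
  move=> s0 st tS; have /andP[q _] := ellL s t s0 st tS; rewrite -subr_ge0.
  apply: le_trans q; have /andP[h1 _] := phi0L s t st.
  by rewrite addr_ge0 ?enorm_ge0.
have elnd (s t : R) : 0 <= s -> s <= t -> t <= S -> el s <= el t.
  by move=> s0 st tS; rewrite !elE ?s0 ?tS ?(le_trans s0 st) ?(le_trans st tS)//; exact: ellnd.
have ell2 : lip_on 0 S 2 ell.
  move=> s t s0 st tS; have /andP[_ q] := ellL s t s0 st tS.
  by rewrite ger0_norm// subr_ge0; exact: ellnd.
have el2 : lip_on 0 S 2 el.
  by move=> s t s0 st tS; rewrite !elE ?s0 ?tS ?(le_trans s0 st) ?(le_trans st tS)//; exact: ell2.
have mel : measurable_fun setT el := lip_measurable S0' ell2.
have myel : vmeas (fun s => y (el s)) by exact: vmeas_comp.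
have yelB : exists B, forall s, enorm (y (el s)) <= B by exists B.
split => // t i /[dup] tS /andP[t0 t1].
have L0 : 0 <= L by rewrite -ell0 -ellS; exact: ellnd.
have [dl [bdl dlW dld dlI]] := lip_derive S0 (ler0n _ 2) el2.
have br := bm_rhs U_compact M_ge0 g_continuous g_growth adm' my (ex_intro _ B yB) i.
have br' := bm_rhs U_compact M_ge0 g_continuous g_growth adm myel yelB i.
rewrite -/(el t) yE; last by rewrite elE// -{1}ell0 -ellS !ellnd.
congr (_ + _).
have := integ_comp S0 (ler0n _ 2) el2 elnd mel br bdl dld tS.
rewrite {1}/el clamp_id ?lexx// ell0 => ->.
apply: integ_eq_ae => //.
  by apply: bmM => //; exact: (bm_comp br mel).
pose P (r : R) := (0 < r < L -> is_derive r 1 (phi0 \o rho) (h' r)) /\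
  ((0 < r < L -> is_derive r 1 (phi \o rho) (D' r)) /\ (r != 0 /\ r != L)).
have aeP : {ae mu, forall r, P r} by apply: aeI hd' (aeI Dd' (aeI (ae_ne 0) (ae_ne L))).
have nullP := lip_null S0 (ler0n _ 2) el2 elnd aeP.
apply: aeS (aeI nullP (aeI dld (aeI hd Dd))) => q [h1 [h2 [h3 h4]]] /andP[q0 qt].
have qS : 0 < q < S by rewrite q0 (lt_le_trans qt).
have qS' : 0 <= q <= S by rewrite ltW// ltW// (lt_le_trans qt).
have {}h2 := h2 qS; have {}h3 := h3 qS; have {}h4 := h4 qS; have {}h1 := h1 qS.
have k0 : 0 < Num.min q (S - q) by have /andP[? ?] := qS; rewrite lt_min subr_gt0; apply/andP.
cbn beta; rewrite !rhsE.
have dist (y1 y2 : R) : 0 <= y1 <= S -> 0 <= y2 <= S ->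
    `|phi0 y2 - phi0 y1| <= `|el y2 - el y1| /\ enorm (phi y2 - phi y1) <= `|el y2 - el y1|.
  wlog y12 : y1 y2 / y1 <= y2.
    move=> H yS1 yS2; have [y12|/ltW y21] := leP y1 y2; first exact: H.
    by rewrite distrC (distrC (el y2)) enormB; exact: H.
  move=> yS1 yS2; rewrite !elE//; have /andP[y10 _] := yS1; have /andP[_ y2S] := yS2.
  have /andP[q1 _] := ellL _ _ y10 y12 y2S; have /andP[q2 _] := phi0L _ _ y12.
  have q3 := addr_ge0 q2 (enorm_ge0 (phi y2 - phi y1)).
  rewrite (ger0_norm q2) (ger0_norm (le_trans q3 q1)).
  split; last exact: addr_le q1.
  by apply: le_trans q1; rewrite lerDl enorm_ge0.
have [dl0|dl0] := eqVneq (dl q) 0.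
  rewrite dl0 mulr0.
  have hq : h q = 0.
    rewrite dl0 in h2; apply: is_derive_uniq h3 _; apply: (is_derive_comp0 (C := 1) h2).
    exists (Num.min q (S - q)) => // z /near_interval zS; rewrite mul1r.
    by have [] := dist q z qS' zS.
  have Dq k : D q ord0 k = 0.
    rewrite dl0 in h2; move/is_derive_rVP : h4 => /(_ k) h4.
    apply: is_derive_uniq h4 _; apply: (is_derive_comp0 (C := 1) h2).
    exists (Num.min q (S - q)) => // z /near_interval zS; rewrite mul1r.
    have [_ q2] := dist q z qS' zS; apply: le_trans q2.
    by apply: le_trans (enorm_coord _ k); rewrite !mxE.
  by rewrite hq scale0r add0r summxE big1// => k _; rewrite Dq scale0r mxE.
have [[g1 [g2 [g3 g4]]]|d0] := h1; last first.
  by move: dl0; rewrite (is_derive_uniq h2 d0) eqxx.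
have elq : 0 < el q < L.
  have q1 : 0 <= el q <= L by rewrite elE// -{1}ell0 -ellS; have /andP[? ?] := qS'; rewrite !ellnd.
  by have /andP[z1 z2] := q1; rewrite !lt_neqAle eq_sym g3 z1 g4 z2.
have {}g1 := g1 elq; have {}g2 := g2 elq.
have rq : rho (el q) = q.
  apply/eqP/negP => /negP ne; move: dl0; rewrite -(negbK (_ == 0)) => /negP; apply; apply/negPn/eqP.
  apply: (is_derive_const_side h2 ne) => z /andP[z1 z2].
  have rS := rhoS (el q); have /andP[r0 r1] := rS; have /andP[q1 q2] := qS'.
  have er : el (rho (el q)) = el q.
    by rewrite elE// ellrho clamp_id//; have /andP[? ?] := elq; rewrite !ltW.
  move: z1 z2; case: (leP (rho (el q)) q) => cmp z1 z2.
    apply/eqP; rewrite eq_le elnd//= ?(le_trans r0)// -[leLHS]er elnd//.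
    exact: le_trans q2.
  apply/eqP; rewrite eq_le -[leRHS]er !elnd// ?(le_trans z2)//.
  exact: le_trans z1.
have hq : h q = h' (el q) * dl q.
  apply: is_derive_uniq h3 _; have := is_derive_compf h2 g1.
  apply: (is_derive_near k0) => z /near_interval zS /=.
  by rewrite elE//; case: (back z zS).
have Dq k : D q ord0 k = D' (el q) ord0 k * dl q.
  move/is_derive_rVP : h4 => /(_ k) h4; move/is_derive_rVP : g2 => /(_ k) g2.
  apply: is_derive_uniq h4 _; have := is_derive_compf h2 g2.
  apply: (is_derive_near k0) => z /near_interval zS /=.
  by rewrite elE//; case: (back z zS) => _ ->.
have -> : (phi \o rho) (el q) = phi q by rewrite /= rq.
have -> : (v1 \o (phi0 \o rho)) (el q) = (v1 \o phi0) q by rewrite /= rq.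
have -> : (psi2 \o rho) (el q) = psi2 q by rewrite /= rq.
rewrite hq !mxE !summxE mulrDl mulr_suml; congr (_ + _); first by rewrite mulrAC.
by apply: eq_bigr => k _; rewrite !mxE Dq mulrAC.
Qed.

End reparametrization.

(** * From limit solutions to graph completions *)

Section limit_estimates.
Context {R : realType}.
Local Notation mu := (@lebesgue_measure R).

Lemma near_lim_le (F : set_system nat) (a : nat -> R) (l c : R) : ProperFilter F ->
  (forall e : R, 0 < e -> \forall k \near F, `|a k - l| < e) -> (forall k, a k <= c) -> l <= c.
Proof.
move=> FF al ac; rewrite leNgt; apply/negP => cl; have e0 : 0 < l - c by rewrite subr_gt0.
have [k] := filter_ex (al _ e0); have h := ac k; rewrite ltr_norml => /andP[h1 _].
by move: h1; rewrite opprB ltrD2r ltNge h.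
Qed.

Lemma near_limB (F : set_system nat) (a b : nat -> R) (l1 l2 : R) : Filter F ->
  (forall e : R, 0 < e -> \forall k \near F, `|a k - l1| < e) ->
  (forall e : R, 0 < e -> \forall k \near F, `|b k - l2| < e) ->
  forall e : R, 0 < e -> \forall k \near F, `|(a k - b k) - (l1 - l2)| < e.
Proof.
move=> FF h1 h2 e e0; have e2 : 0 < e / 2 by rewrite divr_gt0.
apply: filterS2 (h1 _ e2) (h2 _ e2) => k q1 q2.
rewrite subr_swap (splitr e); apply: le_lt_trans (ler_normB _ _) _.
exact: ltrD.
Qed.

Lemma small_eq d (x y : 'rV[R]_d) (C : R) : 0 <= C ->
  (forall e : R, 0 < e -> enorm (x - y) <= C * e) -> x = y.
Proof.
move=> C0 h; apply/eqP; rewrite -subr_eq0; apply/eqP/enorm_eq0/eqP.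
rewrite eq_le enorm_ge0 andbT; apply/ler_addgt0Pr => e e0; rewrite add0r.
apply: le_trans (h (e / (C + 1)) _) _; first by rewrite divr_gt0// ltr_wpDl.
by apply: absorb_le => //; exact: ltW.
Qed.

Lemma small_eqr (x y C : R) : 0 <= C ->
  (forall e : R, 0 < e -> `|x - y| <= C * e) -> x = y.
Proof.
move=> C0 h; apply/eqP; rewrite -subr_eq0 -normr_eq0 eq_le normr_ge0 andbT.
apply/ler_addgt0Pr => e e0; rewrite add0r.
apply: le_trans (h (e / (C + 1)) _) _; first by rewrite divr_gt0// ltr_wpDl.
by apply: absorb_le => //; exact: ltW.
Qed.

Lemma near_lim_enorm_le (F : set_system nat) d (a b : nat -> 'rV[R]_d) (l1 l2 : 'rV[R]_d) (c : R) :
  ProperFilter F ->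
  (forall e : R, 0 < e -> \forall k \near F, enorm (a k - l1) < e) ->
  (forall e : R, 0 < e -> \forall k \near F, enorm (b k - l2) < e) ->
  (forall k, enorm (a k - b k) <= c) -> enorm (l1 - l2) <= c.
Proof.
move=> FF h1 h2 ab; apply/ler_addgt0Pr => e e0.
have e2 : 0 < e / 2 by rewrite divr_gt0.
have [k [q1 q2]] := filter_ex (filterI (h1 _ e2) (h2 _ e2)).
apply: le_trans (enorm_triangle (a k) _ _) _; rewrite addrC.
apply: le_trans (lerD (enorm_triangle (b k) _ _) (lexx _)) _.
rewrite -addrA lerD// (splitr e) lerD//; first exact: ltW.
by rewrite enormB ltW.
Qed.

Lemma lip1_vmeas d (phi : R -> 'rV[R]_d) :
  (forall s t : R, s <= t -> enorm (phi t - phi s) <= t - s) -> vmeas phi.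
Proof.
move=> phiL i; rewrite (_ : (fun t => _) = (fun t => (phi t ord0 i + t) - t)); last first.
  by apply/funext => t; rewrite addrK.
apply: measurable_funB => //; apply: nondecreasing_measurable => // s t st /=.
have h : phi s ord0 i - phi t ord0 i <= t - s.
  apply: le_trans (phiL s t st); apply: le_trans (enorm_coord _ i).
  by rewrite !mxE distrC; exact: ler_norm.
by rewrite -lerBlDr -addrA -opprB lerBlDl -lerBlDr.
Qed.

Lemma incr_dist (tau : R -> R) : (forall s t : R, s <= t -> 0 <= tau t - tau s <= t - s) ->
  forall s t : R, `|tau s - tau t| <= `|s - t|.
Proof.
move=> tauL s t; wlog st : s t / s <= t.
  move=> H; have [st|/ltW ts] := leP s t; first exact: H.
  by rewrite distrC (distrC s); exact: H.
rewrite distrC (distrC s); have /andP[h1 h2] := tauL s t st.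
by rewrite !ger0_norm// subr_ge0.
Qed.

Lemma vlip_dist d (phi : R -> 'rV[R]_d) :
  (forall s t : R, s <= t -> enorm (phi t - phi s) <= t - s) ->
  forall s t : R, enorm (phi s - phi t) <= `|s - t|.
Proof.
move=> phiL s t; wlog st : s t / s <= t.
  move=> H; have [st|/ltW ts] := leP s t; first exact: H.
  by rewrite enormB (distrC s); exact: H.
rewrite enormB (distrC s); apply: le_trans (phiL s t st) _; exact: ler_norm.
Qed.

Lemma integE (a b : R) f : bm f ->
  ((integ a b f)%:E = \int[mu]_(t in `[a, b]%classic) (f t)%:E)%E.
Proof.
by move=> bf; rewrite /integ /Rintegral fineK//; apply: integrable_fin_num => //; exact: bm_integrable.
Qed.

Lemma integ_le_L1_norm d (a b : R) q (f : R -> 'rV[R]_d) : bm q ->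
  (forall t, a <= t <= b -> 0 <= q t <= enorm (f t)) ->
  ((integ a b q)%:E <= L1_norm a b f)%E.
Proof.
move=> bq qf; rewrite integE// /L1_norm; apply: ge0_integral_mono => t.
  by rewrite /= in_itv/= lee_fin => /qf/andP[].
by rewrite /= in_itv/= lee_fin => /qf/andP[].
Qed.

(** For the comparison of integrals over [0, S] with integrals over the range
    [0, c] of a clock, beyond which the densities vanish. *)
Lemma integ_tail (S c : R) q w : bm q -> bm w -> 0 <= c -> c <= S ->
  (forall s, 0 <= q s) -> (forall s, w s <= 1) ->
  {ae mu, forall s : R, c < s < S -> w s = 0} ->
  integ 0 S (fun s => q s * w s) <= integ 0 c q.
Proof.
move=> bq bw c0 cS q0 w1 wz; have bqw : bm (fun s => q s * w s) by exact: bmM.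
rewrite (integ_cat bqw c0 cS) (@integ_eq_ae _ c S _ (fun=> 0))//; last 2 first.
- exact: bm_cst.
- by apply: aeS wz => s h sc; rewrite h// mulr0.
rewrite integ_cst// mul0r addr0; apply: integ_le => // s _.
by rewrite ler_piMr.
Qed.

End limit_estimates.

(** The arrangement of the error terms in limit_control: a, c and e are
    distances that add up to a bound of b, and the change of weight from h to w
    is the last term. *)
Lemma combine_le (R : realType) (a c e b h w : R) : 0 <= w -> b <= a + c + e ->
  b * h <= (a * w + c * w) + (e * w + - ((w - h) * b)).
Proof.
move=> w0 H; have -> : (a * w + c * w) + (e * w + - ((w - h) * b)) =
  b * h + (a + c + e - b) * w by ring.
by rewrite lerDl mulr_ge0// subr_ge0.
Qed.

Section limit_control.
Context {R : realType} {n m l : nat} (U : set 'rV[R]_m) (V : set 'rV[R]_l).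
Hypotheses (V_compact : compact V).
Local Notation mu := (@lebesgue_measure R).

(** Both psi2 and v2 o phi0 are limits in mean of v2k o tauk for the densities
    hk: the first by hypothesis, the second by vcomp_cvg and the convergence of
    v2k to v2. As the hk converge weakly to h, the two coincide wherever h does
    not vanish. *)
Lemma limit_control (F : set_system nat) (T S : R)
    (uk : nat -> R -> 'rV[R]_m) (v2k : nat -> R -> 'rV[R]_l)
    (tauk hk : nat -> R -> R) (Dk : nat -> R -> 'rV[R]_m)
    (phi0 h : R -> R) (v2 psi2 : R -> 'rV[R]_l) :
  ProperFilter F -> 0 < T -> 0 < S ->
  (forall k, L1_fun 0 T V (v2k k)) ->
  (forall k, (total_evariation 0 T (uk k) < +oo)%E) ->
  (forall k, arc_clock (uk k) T <= S) ->
  (forall k, space_time_data T S (uk k) (tauk k) (hk k) (Dk k)) ->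
  (forall s t : R, s <= t -> 0 <= phi0 t - phi0 s <= t - s) -> phi0 0 = 0 -> phi0 S = T ->
  bm h -> (forall s : R, 0 <= h s <= 1) ->
  {ae mu, forall s : R, 0 < s < S -> is_derive s 1 phi0 (h s)} ->
  (forall s t : R, 0 <= s -> s <= t -> t <= S -> integ s t h = phi0 t - phi0 s) ->
  vmeas v2 -> (forall t, V (v2 t)) -> vmeas psi2 -> (forall t, V (psi2 t)) ->
  (forall e : R, 0 < e -> \forall k \near F, forall s, 0 <= s <= S ->
     `|tauk k s - phi0 s| <= e) ->
  (forall e : R, 0 < e -> \forall k \near F,
     integ 0 T (fun t => enorm (v2k k (Num.max 0 (Num.min T t)) - v2 t)) <= e) ->
  (forall e : R, 0 < e -> \forall k \near F,
     integ 0 S (fun s => enorm (v2k k (tauk k s) - psi2 s) * hk k s) <= e) ->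
  integ 0 S (fun s => enorm (psi2 s - v2 (phi0 s)) * h s) <= 0.
Proof.
move=> FF T0 S0 Vk fink sgS datak phi0L phi00 phi0S bh h01 hd hI
  mv2 Vv2 mpsi Vpsi tauC v2C psiC.
have T0' := ltW T0; have S0' := ltW S0.
have mphi0 := measurable_tau phi0L.
have phi0I (f : R -> R) : bm f -> integ 0 T f = integ 0 S (fun s => f (phi0 s) * h s).
  exact: nd_integ.
have hkC := space_time_density_cvg FF T0 fink sgS datak phi00 hI tauC.
have bv2 := bm_valued V_compact mv2 Vv2.
have mv2p := vmeas_comp mv2 mphi0.
have bv2p := bm_valued V_compact mv2p (fun s => Vv2 (phi0 s)).
have bpsi := bm_valued V_compact mpsi Vpsi.
pose f (s : R) := enorm (psi2 s - v2 (phi0 s)).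
have bf : bm f by exact: bm_enormB.
apply/ler_addgt0Pr => e e0; rewrite add0r.
have e4 : 0 < e / 4 by rewrite divr_gt0.
have C1 : \forall k \near F, integ 0 S
    (fun s => enorm (v2 (tauk k s) - v2 (phi0 s)) * hk k s) <= e / 4.
  apply: (@vcomp_cvg _ F S T 1 FF S0' T0' tauk hk phi0 h) => //.
  - by move=> k; have [[t1 t2 t3 t4 t5] _ _] := datak k; exact: measurable_tau.
  - by move=> k; have [_ [] ] := datak k.
  - by move=> k s; have [_ [_ /(_ s)/andP[] ]] := datak k.
  - by move=> k s; have [_ [_ /(_ s)/andP[] ]] := datak k.
  - by move=> s; have /andP[] := h01 s.
  - by move=> s; have /andP[] := h01 s.
  - by move=> k b bb; exact: space_time_integ (datak k) bb.
have weak : \forall k \near F, forall t, 0 <= t <= S ->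
    `|integ 0 t (fun s => (hk k s - h s) * f s)| <= e / 4.
  apply: (weak_cvg (W := 1) FF S0') => //.
  - by move=> k; have [_ [bhk _ _ _] _] := datak k; exact: bmB.
  - move=> k t; have [_ [_ /(_ t)/andP[a1 a2] _ _] _] := datak k.
    have /andP[b1 b2] := h01 t; rewrite ler_norml lerBrDl.
    by apply/andP; split; [rewrite lerBlDr (le_trans b2)// lerDr|
       rewrite lerBlDr (le_trans a2)// lerDl].
  - move=> e' e'0; apply: filterS (hkC _ e'0) => k H t tS.
    by have [_ [bhk _ _ _] _] := datak k; rewrite integ_B//; exact: H.
have [k [H1 [H2 [H3 H4]]]] := filter_ex (filterI C1 (filterI weak (filterI (v2C _ e4) (psiC _ e4)))).
have [[t1 t2 t3 t4 t5] [bhk h01k hdk hIk] _] := datak k.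
have mtk := measurable_tau t3.
have [mc Vc] := L1_fun_clamp T0' (Vk k).
have cE s : v2k k (tauk k s) = v2k k (Num.max 0 (Num.min T (tauk k s))) by rewrite clamp_id.
have [mv2k Vv2k] := L1_fun_comp T0' (Vk k) mtk t1.
have bc := bm_valued V_compact mc Vc; have bv2k := bm_valued V_compact mv2k Vv2k.
have bv2t := bm_valued V_compact (vmeas_comp mv2 mtk) (fun s => Vv2 (tauk k s)).
rewrite (space_time_integ T0 S0 (sgS k) (fink k) (datak k)) in H3; last exact: bm_enormB.
have {}H2 := H2 S (introT andP (conj S0' (lexx _))).
pose A s := enorm (v2 (tauk k s) - v2 (phi0 s)) * hk k s.
pose C s := enorm (v2k k (Num.max 0 (Num.min T (tauk k s))) - v2 (tauk k s)) * hk k s.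
pose E s := enorm (v2k k (tauk k s) - psi2 s) * hk k s.
pose G s := (hk k s - h s) * f s.
have bA : bm A by apply: bmM => //; exact: bm_enormB.
have bC : bm C.
  apply: bmM => //; rewrite (_ : (fun s => _) = fun s => enorm (v2k k (tauk k s) - v2 (tauk k s))).
    exact: bm_enormB.
  by apply/funext => s; rewrite -cE.
have bE : bm E by apply: bmM => //; exact: bm_enormB.
have bG : bm G by apply: bmM => //; exact: bmB.
have {}H2 : integ 0 S (fun s => - G s) <= e / 4.
  rewrite (integ_eq (g := fun s => (-1) * G s)); last by move=> s _; rewrite mulN1r.
  by rewrite integ_Zl// mulN1r; apply: le_trans H2; rewrite -normrN; exact: ler_norm.
apply: (@le_trans _ _ (integ 0 S (fun s => (A s + C s) + (E s + - G s)))).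
  apply: integ_le; first by apply: bmM.
    by apply: bmD; apply: bmD => //; exact: bmN.
  move=> s _; rewrite /A /C /E /G -/(f s) -cE.
  have /andP[hk0 _] := h01k s.
  apply: combine_le hk0 _; rewrite /f.
  apply: le_trans (enorm_triangle (v2k k (tauk k s)) _ _) _.
  rewrite (enormB (psi2 s)) [leRHS]addrC lerD2l [leRHS]addrC; exact: enorm_triangle.
rewrite integ_D; [|exact: bmD|by apply: bmD => //; exact: bmN].
rewrite integ_D// integ_D//; last exact: bmN.
have -> : e = (e / 4 + e / 4) + (e / 4 + e / 4) by field.
by rewrite !lerD.
Qed.

End limit_control.

Section limit_clock.
Context {R : realType} {m : nat} (U : set 'rV[R]_m).
Hypotheses (U_compact : compact U).

(** Along an ultrafilter no subsequence has to be extracted: the inverse clocks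
    and the controls, read in space-time, converge pointwise because they are
    bounded, and uniformly because they are nonexpansive. *)
Lemma limit_clock (F : set_system nat) (T S : R) (uk : nat -> R -> 'rV[R]_m)
    (tauk hk : nat -> R -> R) (Dk : nat -> R -> 'rV[R]_m) (u : R -> 'rV[R]_m) (u0 : 'rV[R]_m) :
  UltraFilter F -> 0 < T -> 0 < S -> (forall k, AC_fun 0 T U (uk k)) ->
  (forall k, (total_evariation 0 T (uk k) < +oo)%E) ->
  (forall k, arc_clock (uk k) T <= S) ->
  (forall k, space_time_data T S (uk k) (tauk k) (hk k) (Dk k)) ->
  (forall k, uk k 0 = u0) ->
  (forall t : R, 0 <= t <= T -> forall e : R, 0 < e -> \forall k \near F, enorm (uk k t - u t) < e) ->
  exists (phi0 : R -> R) (phi : R -> 'rV[R]_m) (sg : R -> R),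
  [/\ [/\ forall s t : R, s <= t -> 0 <= phi0 t - phi0 s <= t - s, phi0 0 = 0 & phi0 S = T],
      [/\ forall s t : R, s <= t -> enorm (phi t - phi s) <= t - s,
          forall s : R, U (phi s) & phi 0 = u0],
      (forall e : R, 0 < e -> \forall k \near F, forall s, 0 <= s <= S ->
         `|tauk k s - phi0 s| <= e),
      (forall e : R, 0 < e -> \forall k \near F, forall s, 0 <= s <= S ->
         enorm (uk k (tauk k s) - phi s) <= e) &
      [/\ measurable_fun setT sg,
          forall t : R, 0 <= t <= T -> [/\ 0 <= sg t <= S, phi0 (sg t) = t & phi (sg t) = u t],
          (forall t : R, 0 <= t <= T -> forall e : R, 0 < e ->
             \forall k \near F, `|arc_clock (uk k) t - sg t| < e) &
          forall s : R, sg T <= s -> phi s = u T]].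
Proof.
move=> FU T0 S0 ACk fink sgS datak uk0 uC; have T0' := ltW T0; have S0' := ltW S0.
have FF : ProperFilter F by exact: ultra_proper.
have inT (t : R) : 0 <= t <= T -> t \in `[0, T] by rewrite in_itv.
have tT k s : 0 <= tauk k s <= T by have [[]] := datak k.
have sgt k s : arc_clock (uk k) (tauk k s) = Num.max 0 (Num.min (arc_clock (uk k) T) s).
  by have [[]] := datak k.
have tL k (s t : R) : s <= t -> 0 <= tauk k t - tauk k s <= t - s.
  by have [[_ _ h _ _] _ _] := datak k; exact: h.
have tsg k (t : R) : 0 <= t <= T -> tauk k (arc_clock (uk k) t) = t.
  by have [[_ _ _ h _] _ _] := datak k; exact: h.
have uL k (s t : R) : s <= t -> enorm (uk k (tauk k t) - uk k (tauk k s)) <= t - s.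
  by have [[_ _ _ _ h] _ _] := datak k; exact: h.
have [BU _ UB] := compact_enorm_bounded U_compact.
have Uk k s : U (uk k (tauk k s)) by have [h _] := ACk k; apply: h; exact: inT.
have /choice[phi0 phi0P] (s : R) : exists l : R, forall e : R, 0 < e ->
    \forall k \near F, `|tauk k s - l| < e.
  by apply: (ultra_lim (B := T)) => k; have /andP[h1 h2] := tT k s; rewrite ger0_norm.
have /choice[phi phiP] (s : R) : exists l : 'rV[R]_m, forall e : R, 0 < e ->
    \forall k \near F, enorm (uk k (tauk k s) - l) < e.
  by apply: (ultra_vlim (B := BU)) => k; exact: UB.
have sgTk k : 0 <= arc_clock (uk k) T := arc_clock_ge0 (fink k) T0' (lexx T).
have sginc k (s t : R) : 0 <= s -> s <= t -> t <= T -> t - s <= arc_clock (uk k) t - arc_clock (uk k) s.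
  by move=> s0 st t1; exact: addr_le (enorm_ge0 _) (arc_clock_incr (fink k) s0 st t1).
have sgnd k (s t : R) : 0 <= s -> s <= t -> t <= T -> arc_clock (uk k) s <= arc_clock (uk k) t.
  exact: arc_clock_nd (fink k).
have sgb k (t : R) : 0 <= t <= T -> 0 <= arc_clock (uk k) t <= S.
  move=> /andP[t0 t1]; have := sgnd k _ _ (lexx 0) t0 t1; rewrite arc_clock0 => -> /=.
  exact: le_trans (sgnd k _ _ t0 t1 (lexx _)) (sgS k).
pose cl (t : R) : R := Num.max 0 (Num.min T t).
have clT t : 0 <= cl t <= T by exact: clamp_ge.
have /choice[sg0 sg0P] (t : R) : exists l : R, forall e : R, 0 < e ->
    \forall k \near F, `|arc_clock (uk k) (cl t) - l| < e.
  by apply: (ultra_lim (B := S)) => k; have /andP[h1 h2] := sgb k _ (clT t); rewrite ger0_norm.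
pose sg (t : R) : R := sg0 (cl t).
have sgP (t : R) : forall e : R, 0 < e -> \forall k \near F, `|arc_clock (uk k) (cl t) - sg t| < e.
  move=> e e0; apply: filterS (sg0P (cl t) e e0) => k.
  have -> : cl (cl t) = cl t by apply: clamp_id; exact: clT.
  by [].
have sgP' (t : R) : 0 <= t <= T -> forall e : R, 0 < e ->
    \forall k \near F, `|arc_clock (uk k) t - sg t| < e.
  by move=> h e e0; apply: filterS (sgP t e e0) => k; rewrite /cl clamp_id.
have phi0L (s t : R) : s <= t -> 0 <= phi0 t - phi0 s <= t - s.
  move=> st; apply/andP; split.
    rewrite -opprB oppr_ge0; apply: (near_lim_le FF (near_limB _ (phi0P s) (phi0P t))) => k.
    by have /andP[h _] := tL k s t st; rewrite -oppr_ge0 opprB.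
  apply: (near_lim_le FF (near_limB _ (phi0P t) (phi0P s))) => k.
  by have /andP[_ h] := tL k s t st.
have phiL (s t : R) : s <= t -> enorm (phi t - phi s) <= t - s.
  by move=> st; apply: (near_lim_enorm_le FF (phiP t) (phiP s)) => k; exact: uL.
have ends k := space_time_ends T0 (sgS k) (fink k) (datak k).
have tk0 k : tauk k 0 = 0 by case: (ends k).
have tauT k (s : R) : arc_clock (uk k) T <= s -> tauk k s = T by case: (ends k) => _; exact.
have lim_cst (l c s : R) (F' : nat -> R) : (forall e : R, 0 < e -> \forall k \near F, `|F' k - l| < e) ->
    (forall k, F' k = c) -> l = c.
  move=> h hc; apply/esym; apply: (@small_eqr _ c l 1 ler01) => e e0.
  by have [k] := filter_ex (h e e0); rewrite hc mul1r => /ltW.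
have phi00 : phi0 0 = 0 by exact: (lim_cst _ _ 0 _ (phi0P 0)).
have phi0S : phi0 S = T by apply: (lim_cst _ _ 0 _ (phi0P S)) => k; exact: tauT.
have Uphi s : U (phi s) by exact: compact_enorm_lim (phiP s).
have phiu0 : phi 0 = u0.
  apply/esym; apply: (@small_eq _ _ u0 (phi 0) 1 ler01) => e e0.
  by have [k] := filter_ex (phiP 0 e e0); rewrite tk0 uk0 mul1r => /ltW.
have tauC : forall e : R, 0 < e -> \forall k \near F, forall s, 0 <= s <= S -> `|tauk k s - phi0 s| <= e.
  apply: (unif_small (z := fun k s => `|tauk k s - phi0 s|) _ S0) => [k s t|s e e0]; last exact: phi0P.
  have -> : tauk k s - phi0 s = (tauk k t - phi0 t) + ((tauk k s - tauk k t) - (phi0 s - phi0 t)) by ring.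
  apply: le_trans (ler_normD _ _) _; rewrite lerD2l.
  apply: le_trans (ler_normB _ _) _.
  have -> : 2 * `|s - t| = `|s - t| + `|s - t| by ring.
  by apply: lerD; [exact: (incr_dist (tL k))|exact: (incr_dist phi0L)].
have uC' : forall e : R, 0 < e -> \forall k \near F, forall s, 0 <= s <= S ->
    enorm (uk k (tauk k s) - phi s) <= e.
  apply: (unif_small (z := fun k s => enorm (uk k (tauk k s) - phi s)) _ S0) => [k s t|s e e0]; last exact: phiP.
  apply: le_trans (enorm_triangle (uk k (tauk k t)) _ _) _.
  apply: le_trans (lerD (lexx _) (enorm_triangle (phi t) _ _)) _.
  have -> : 2 * `|s - t| = `|s - t| + `|s - t| by ring.
  rewrite addrCA lerD2l; apply: lerD.
    exact: (vlip_dist (uL k)).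
  by rewrite (distrC s); apply: le_trans (vlip_dist phiL _ _) _.
have sgS' (t : R) : 0 <= t <= T -> 0 <= sg t <= S.
  move=> h; apply/andP; split.
    rewrite -oppr_le0 -sub0r; apply: (near_lim_le FF (near_limB (a := fun=> 0) _ _ (sgP' t h))).
      by move=> e e0; apply: filterE => k; rewrite subrr normr0.
    by move=> k; rewrite sub0r oppr_le0; have /andP[] := sgb k t h.
  by apply: (near_lim_le FF (sgP' t h)) => k; have /andP[] := sgb k t h.
have phi0sg (t : R) : 0 <= t <= T -> phi0 (sg t) = t.
  move=> h; apply: (small_eqr (C := 2)) => // e e0.
  have [k [h1 h2]] := filter_ex (filterI (phi0P (sg t) e e0) (sgP' t h e e0)).
  have -> : phi0 (sg t) - t = (phi0 (sg t) - tauk k (sg t)) + (tauk k (sg t) - tauk k (arc_clock (uk k) t)).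
    by rewrite tsg// addrA subrK.
  apply: le_trans (ler_normD _ _) _; have -> : 2 * e = e + e by ring.
  apply: lerD; first by rewrite distrC ltW.
  apply: le_trans (incr_dist (tL k) _ _) _; by rewrite distrC ltW.
have phisg (t : R) : 0 <= t <= T -> phi (sg t) = u t.
  move=> h; apply: (small_eq (C := 3)) => // e e0.
  have [k [h1 [h2 h3]]] := filter_ex (filterI (phiP (sg t) e e0) (filterI (sgP' t h e e0) (uC t h e e0))).
  have -> : 3 * e = e + (e + e) by ring.
  apply: le_trans (enorm_triangle (uk k (tauk k (sg t))) _ _) _; apply: lerD.
    by rewrite enormB ltW.
  apply: le_trans (enorm_triangle (uk k (tauk k (arc_clock (uk k) t))) _ _) _; apply: lerD.
    apply: le_trans (vlip_dist (uL k) _ _) _; by rewrite distrC ltW.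
  by rewrite tsg// ltW.
have TT : 0 <= T <= T by rewrite T0' lexx.
exists phi0, phi, sg; split => //; split => //.
- apply: nondecreasing_measurable => // s t st; rewrite -subr_ge0 -opprB oppr_ge0.
  apply: (near_lim_le FF (near_limB _ (sgP s) (sgP t))) => k; rewrite subr_le0.
  have /andP[c1 c2] := clamp_lip 0 T st; rewrite subr_ge0 in c1.
  by apply: sgnd => //; [have /andP[] := clT s|have /andP[] := clT t].
- by move=> t h; split; [exact: sgS'|exact: phi0sg|exact: phisg].
move=> s; rewrite le_eqVlt => /orP[/eqP<-|sgs]; first exact: phisg.
apply: (small_eq (C := 2)) => // e e0.
have d0 : 0 < s - sg T by rewrite subr_gt0.
have [k [h1 [h2 h3]]] := filter_ex (filterI (phiP s e e0) (filterI (sgP' T TT _ d0) (uC T TT e e0))).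
have -> : 2 * e = e + e by ring.
apply: le_trans (enorm_triangle (uk k (tauk k s)) _ _) _; apply: lerD.
  by rewrite enormB ltW.
rewrite tauT; first exact: ltW.
by move: h2; rewrite ltr_norml => /andP[_]; rewrite ltrD2r => /ltW.
Qed.

End limit_clock.

Section extraction.
Context {R : realType} {n m l : nat} (U : set 'rV[R]_m) (V : set 'rV[R]_l).
Hypotheses (V_compact : compact V).
Context (g : 'I_m.+1 -> 'rV[R]_n -> 'rV[R]_m -> 'rV[R]_l -> 'rV[R]_n).
Local Notation mu := (@lebesgue_measure R).

(** The limit solution in terms of real integrals and of the inverse clocks
    tauk, with the representative psi2 extended to the line by constants. The
    space-time interval [0, S] is the same for all k, thanks to the uniform
    bound of the variations. *)
Lemma E_BVS_extract (T : R) (x0 : 'rV[R]_n) (u0 : 'rV[R]_m) (u : R -> 'rV[R]_m)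
    (v1 v2 : R -> 'rV[R]_l) (x : R -> 'rV[R]_n) : 0 < T ->
  L1_fun 0 T V v1 -> L1_fun 0 T V v2 ->
  E_BVS_limit_solution U V g T x0 u0 u v1 v2 x ->
  exists (uk : nat -> R -> 'rV[R]_m) (v1k v2k : nat -> R -> 'rV[R]_l)
    (xk : nat -> R -> 'rV[R]_n) (S : R) (tauk hk : nat -> R -> R) (Dk : nat -> R -> 'rV[R]_m)
    (psi2 : R -> 'rV[R]_l),
  [/\ 0 < S, (forall k, [/\ AC_fun 0 T U (uk k), uk k 0 = u0,
                 L1_fun 0 T V (v1k k) & L1_fun 0 T V (v2k k)]) /\
      (forall k, caratheodory_solution g T x0 (uk k) (v1k k) (v2k k) (xk k)),
      [/\ forall k, (total_evariation 0 T (uk k) < +oo)%E, forall k, arc_clock (uk k) T <= S &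
          forall k, space_time_data T S (uk k) (tauk k) (hk k) (Dk k)],
      [/\ (forall t : R, 0 <= t <= T -> forall e : R, 0 < e -> \forall k \near \oo,
             enorm (xk k t - x t) < e),
          (forall t : R, 0 <= t <= T -> forall e : R, 0 < e -> \forall k \near \oo,
             enorm (uk k t - u t) < e),
          (forall e : R, 0 < e -> \forall k \near \oo, integ 0 T (fun t =>
             enorm (v1k k (Num.max 0 (Num.min T t)) - v1 (Num.max 0 (Num.min T t)))) <= e) &
          (forall e : R, 0 < e -> \forall k \near \oo, integ 0 T (fun t =>
             enorm (v2k k (Num.max 0 (Num.min T t)) - v2 (Num.max 0 (Num.min T t)))) <= e)] &
      [/\ vmeas psi2, forall s, V (psi2 s) & forall e : R, 0 < e -> \forall k \near \oo,
         integ 0 (arc_clock (uk k) T) (fun s => enorm (v2k k (tauk k s) - psi2 s)) <= e]].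
Proof.
move=> T0 v1L v2L [xL [uk [v1k [v2k [xk [ck [K KP] solk cvg [psi2 [Vpsi mpsi psiC]]]]]]]].
have T0' := ltW T0.
have fink k : (total_evariation 0 T (uk k) < +oo)%E by apply: le_lt_trans (KP k) _; rewrite ltry.
have K0 : 0 <= K by rewrite -lee_fin; apply: le_trans (KP 0%N); exact: tv_partition.
pose S := T + K; have S0 : 0 < S by rewrite ltr_wpDr.
have S0' := ltW S0.
have sgS k : arc_clock (uk k) T <= S.
  by rewrite /arc_clock lerD2l -lee_fin -/(var 0 T (uk k)) -(varE T0' (fink k)).
have /choice[d dP] (k : nat) : exists d : (R -> R) * (R -> R) * (R -> 'rV[R]_m),
    space_time_data T S (uk k) d.1.1 d.1.2 d.2.
  have [[_ uAC] _ _ _] := ck k.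
  have [tau [h [D P]]] := space_time_data_ex T0 S0 (fink k) uAC.
  by exists (tau, h, D).
have L1ge0 d' (f : R -> 'rV[R]_d') (a b : R) : (0 <= L1_norm a b f)%E.
  by apply: integral_ge0 => t _; rewrite lee_fin enorm_ge0.
have near1 (t : R) : 0 <= t <= T -> forall e : R, 0 < e -> \forall k \near \oo,
    enorm (row_mx (xk k t - x t) (uk k t - u t)) <= e /\
    (L1_norm 0 T (fun t => row_mx (row_mx (xk k t - x t) (uk k t - u t))
                    (row_mx (v1k k t - v1 t) (v2k k t - v2 t))) <= e%:E)%E.
  move=> tT e e0; have := cvg t; rewrite in_itv/= => /(_ tT)/ereal_cvg0.
  move=> /(_ _ e e0) H; have {}H := H (fun k => adde_ge0 (enorm_ge0 _ : (0 <= (enorm _)%:E)%E) (L1ge0 _ _ _ _)).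
  apply: filterS H => k H; split.
    by rewrite -lee_fin; apply: le_trans H; rewrite leeDl.
  by apply: le_trans H; rewrite leeDr// lee_fin enorm_ge0.
have TT : 0 <= (0 : R) <= T by rewrite lexx T0'.
have [mv1 Vv1] := L1_fun_clamp T0' v1L; have [mv2 Vv2] := L1_fun_clamp T0' v2L.
pose cl (s : R) : R := Num.max 0 (Num.min S s).
have mpsic : vmeas (fun s => psi2 (cl s)).
  apply: measurable_clamp => // i; apply: measurable_funS (mpsi i) => //.
  by move=> s; rewrite /= !in_itv/= andbT => /andP[].
exists uk, v1k, v2k, xk, S, (fun k => (d k).1.1), (fun k => (d k).1.2), (fun k => (d k).2), (psi2 \o cl).
split => //.
- split.
  + move=> t tT e e0; have e2 : 0 < e / 2 by rewrite divr_gt0.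
    apply: filterS (near1 t tT _ e2) => k [h _]; apply: le_lt_trans (enorm_row_mxl _ _) _.
    apply: le_lt_trans h _; by rewrite ltr_pdivrMr// ltr_pMr// ltr1n.
  + move=> t tT e e0; have e2 : 0 < e / 2 by rewrite divr_gt0.
    apply: filterS (near1 t tT _ e2) => k [h _]; apply: le_lt_trans (enorm_row_mxr _ _) _.
    apply: le_lt_trans h _; by rewrite ltr_pdivrMr// ltr_pMr// ltr1n.
  + move=> e e0; apply: filterS (near1 0 TT e e0) => k [_ h]; rewrite -lee_fin; apply: le_trans h.
    have [_ _ h1 h2] := ck k; have [mk Vk] := L1_fun_clamp T0' h1.
    apply: integ_le_L1_norm.
      by apply: bm_enormB; [exact: (bm_valued V_compact mk)|exact: (bm_valued V_compact mv1)].
    move=> t tT; rewrite enorm_ge0 clamp_id//.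
    exact: le_trans (enorm_row_mxl _ _) (enorm_row_mxr _ _).
  + move=> e e0; apply: filterS (near1 0 TT e e0) => k [_ h]; rewrite -lee_fin; apply: le_trans h.
    have [_ _ h1 h2] := ck k; have [mk Vk] := L1_fun_clamp T0' h2.
    apply: integ_le_L1_norm.
      by apply: bm_enormB; [exact: (bm_valued V_compact mk)|exact: (bm_valued V_compact mv2)].
    move=> t tT; rewrite enorm_ge0 clamp_id//.
    exact: le_trans (enorm_row_mxr _ _) (enorm_row_mxr _ _).
split => //.
  by move=> s; apply: Vpsi; have /andP[] := clamp_ge s S0'.
move=> e e0; have := ereal_cvg0 _ psiC e0.
move=> H; have {}H := H (fun k => L1ge0 _ _ _ _); apply: filterS H => k H.
rewrite -lee_fin; apply: le_trans H.
have [[uV uAC] _ h1 h2] := ck k; have [mk Vk] := L1_fun_clamp T0' h2.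
have [[t1 t2 t3 t4 t5] _ _] := dP k.
have mt := measurable_tau t3.
apply: integ_le_L1_norm.
  apply: bm_enormB; last by apply: (bm_valued V_compact mpsic) => s; apply: Vpsi; have /andP[] := clamp_ge s S0'.
  have [mv2k Vv2k] := L1_fun_comp T0' h2 mt t1.
  exact: (bm_valued V_compact mv2k Vv2k).
move=> s sS; rewrite enorm_ge0 /=.
have sgT : arc_clock (uk k) T <= S by exact: sgS.
have -> : cl s = s by rewrite /cl clamp_id//; have /andP[-> q] := sS; exact: le_trans q sgT.
set p := (pinv_ _ _ _ _).
have -> : p = (d k).1.1 s.
  have s_E : s = arc_clock (uk k) ((d k).1.1 s) by rewrite t2 clamp_id.
  rewrite /p [in LHS]s_E; apply: pinvKV; last by rewrite inE /= in_itv/= t1.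
  move=> a b; rewrite !inE /= !in_itv/= => aT bT ab.
  by rewrite -[a]t4// -[b]t4// ab.
by [].
Qed.

End extraction.

Section limit_to_completion.
Context {R : realType} {n m l : nat} (U : set 'rV[R]_m) (V : set 'rV[R]_l).
Context (g : 'I_m.+1 -> 'rV[R]_n -> 'rV[R]_m -> 'rV[R]_l -> 'rV[R]_n) (M : R).
Hypotheses (U_compact : compact U) (V_compact : compact V) (M_ge0 : 0 <= M)
  (g_continuous : forall i, field_continuous U V (g i))
  (g_lipschitz : forall i, locally_lipschitz_unif U V (g i))
  (g_growth : forall i, linear_growth U V M (g i)).
Local Notation mu := (@lebesgue_measure R).

(** The limit graph of limit_clock, reparametrized by arc length, is the graph
    completion, and the clock is the limit of the arc-length clocks followed by
    the arc length. The ordinary controls are v1 o phi0 and the limit psi2. The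
    latter equals v2 along the clock only almost everywhere, by limit_control;
    so w2 is defined as psi2 along the clock. *)
Lemma limit_solution_graph_completion (T : R) (x0 : 'rV[R]_n) (u0 : 'rV[R]_m)
  (u : R -> 'rV[R]_m) (v1 v2 : R -> 'rV[R]_l) (x : R -> 'rV[R]_n) : 0 < T ->
  L1_fun 0 T V v1 -> L1_fun 0 T V v2 ->
  E_BVS_limit_solution U V g T x0 u0 u v1 v2 x ->
  graph_completion_solution U V g T x0 u0 u v1 v2 x.
Proof.
move=> T0 v1L v2L limx; have T0' := ltW T0.
have [uk [v1k [v2k [xk [S [tauk [hk [Dk [psi2 H]]]]]]]]] := E_BVS_extract V_compact T0 v1L v2L limx.
have [S0 [ck solk] [fink sgS datak] [xC uC v1C v2C] [mpsi Vpsi psiC]] := H => {H}.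
have S0' := ltW S0.
have [F [FU ooF]] := ultraFilterLemma (eventually_filter : ProperFilter \oo).
have FF : ProperFilter F by exact: ultra_proper.
have ACk k : AC_fun 0 T U (uk k) by case: (ck k).
have uk0 k : uk k 0 = u0 by case: (ck k).
have L2k k : L1_fun 0 T V (v2k k) by case: (ck k).
have [phi0 [phi [sg [[phi0L phi00 phi0S] [phiL Uphi phiu0] tauC ukC [msg sgP sgC sgflat]]]]] :=
  limit_clock U_compact FU T0 S0 ACk fink sgS datak uk0 (fun t tT e e0 => ooF _ (uC t tT e e0)).
pose v1c (t : R) := v1 (Num.max 0 (Num.min T t)).
pose v2c (t : R) := v2 (Num.max 0 (Num.min T t)).
have [mv1 Vv1] : vmeas v1c /\ forall t, V (v1c t) by exact: L1_fun_clamp.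
have [mv2 Vv2] : vmeas v2c /\ forall t, V (v2c t) by exact: L1_fun_clamp.
have mphi0 := measurable_tau phi0L.
have mphi := lip1_vmeas phiL.
have [h [bh h01 hd hI]] := nd_density S0 phi0L.
have hW s : `|h s| <= 1 by have /andP[p q] := h01 s; rewrite ger0_norm.
have vl : vlip_on 0 S 1 phi by move=> s t _ st _; rewrite mul1r; exact: phiL.
have [D [bD D1 Dd DI]] := vlip_derive S0 ler01 vl.
have sgTk k : 0 <= arc_clock (uk k) T := arc_clock_ge0 (fink k) T0' (lexx T).
have bdiff k : bm (fun s => enorm (v2k k (tauk k s) - psi2 s)).
  apply: bm_enormB; last exact: (bm_valued V_compact mpsi).
  have [[t1 _ t3 _ _] _ _] := datak k.
  have [mv2k Vv2k] := L1_fun_comp T0' (L2k k) (measurable_tau t3) t1.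
  exact: (bm_valued V_compact mv2k Vv2k).
(* the densities hk and |Dk| are such weights: at most 1, and zero beyond the clock *)
have psiC' (w : nat -> R -> R) : (forall k, bm (w k)) -> (forall k s, w k s <= 1) ->
    (forall k, {ae mu, forall s : R, arc_clock (uk k) T < s < S -> w k s = 0}) ->
    forall e : R, 0 < e -> \forall k \near F,
      integ 0 S (fun s => enorm (v2k k (tauk k s) - psi2 s) * w k s) <= e.
  move=> bw w1 wz e e0; apply: filterS (ooF _ (psiC e e0)) => k; apply: le_trans.
  by apply: integ_tail => // s; exact: enorm_ge0.
have tail k := space_time_tail T0 (sgS k) (fink k) (datak k).
have hpsiC : forall e : R, 0 < e -> \forall k \near F,
      integ 0 S (fun s => enorm (v2k k (tauk k s) - psi2 s) * hk k s) <= e.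
  apply: psiC' => k; first by have [_ []] := datak k.
    by move=> s; have [_ [_ /(_ s)/andP[]]] := datak k.
  by apply: aeS (tail k) => s hs /hs[].
have DpsiC i : forall e : R, 0 < e -> \forall k \near F,
      integ 0 S (fun s => enorm (v2k k (tauk k s) - psi2 s) * `|Dk k s ord0 i|) <= e.
  apply: psiC' => k; first by have [_ _ []] := datak k => *; exact: bm_norm.
    by move=> s; have [_ _ [_ q _ _]] := datak k; exact: q.
  by apply: aeS (tail k) => s hs /hs[_ ->]; rewrite normr0.
have TT : 0 <= T <= T by rewrite T0' lexx.
have claim0 := limit_control V_compact FF T0 S0 L2k fink sgS datak phi0L phi00 phi0S bh h01 hd hI
   mv2 Vv2 mpsi Vpsi tauC (fun e e0 => ooF _ (v2C e e0)) hpsiC.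
have [L [ell [rho ch]]] := arc_length_change_ex S0 phi0L phi00 phiL.
have [[ell0 ellS ellL] [rhoS ellrho rhond] [p0L pL] back [lenE ellflat]] := ch.
have mrho : measurable_fun setT rho by exact: nondecreasing_measurable.
have mv1r : vmeas (v1c \o (phi0 \o rho)).
  by apply: (vmeas_comp mv1); exact: (measurableT_comp mphi0 mrho).
have mpsir : vmeas (psi2 \o rho) by exact: vmeas_comp.
have [L0 feas] := arc_length_feasible V_compact T0 S0 ch phi0L phi00 phi0S Uphi phiu0 mv1r (fun s => Vv1 (phi0 (rho s))) mpsir (fun s => Vpsi (rho s)).
have L0' := ltW L0.
have [h' [bh' h01' hd' hI']] := nd_density L0 p0L.
have vl' : vlip_on 0 L 1 (phi \o rho) by move=> s t _ st _; rewrite mul1r; exact: pL.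
have [D' [bD' D1' Dd' DI']] := vlip_derive L0 ler01 vl'.
have hW' s : `|h' s| <= 1 by have /andP[p q] := h01' s; rewrite ger0_norm.
have adm : admissible U V 1 (densities h D) phi (ordinary (v1c \o phi0) psi2).
  by apply: densities_admissible => //; [exact: vmeas_comp|move=> t; exact: Vv1].
have adm' : admissible U V 1 (densities h' D') (phi \o rho)
    (ordinary (v1c \o (phi0 \o rho)) (psi2 \o rho)).
  apply: densities_admissible => //; first exact: lip1_vmeas.
  - by move=> t; exact: Uphi.
  - by move=> t; exact: Vv1.
  - by move=> t; exact: Vpsi.
have [y soly] := ode_exists U_compact M_ge0 g_continuous g_lipschitz g_growth x0 L0' adm'.
have sts := feasible_solution U_compact M_ge0 g_continuous g_growth L0' adm' soly hd' Dd'.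
have pull := arc_length_pullback U_compact M_ge0 g_continuous g_growth S0 ch phi0L adm adm' soly hd Dd hd' Dd'.
set xi := (fun s : R => _) in pull.
have lim := space_time_limit U_compact V_compact M_ge0 g_continuous g_lipschitz g_growth FF T0 S0
  ACk (fun k => conj (let: And4 _ _ p _ := ck k in p) (L2k k)) fink sgS solk datak phi0L phi00 phi0S
  bh h01 hd hI mphi Uphi bD D1 DI mv1 Vv1 mpsi Vpsi pull tauC ukC
  (fun e e0 => ooF _ (v1C e e0)) DpsiC.
have [Lx Lx0 xiL] := integral_solution_vlip U_compact M_ge0 g_continuous g_growth adm pull.
have sgS' t : 0 <= t <= T -> 0 <= sg t <= S by move=> /sgP[].
have xE t : 0 <= t <= T -> x t = xi (sg t).
  move=> tT; apply: (small_eq (C := 2 + Lx)); first by rewrite addr_ge0.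
  move=> e e0; have [st ft pt] := sgP t tT.
  have [k [h1 [h2 h3]]] := filter_ex (filterI (ooF _ (xC t tT e e0)) (filterI (sgC t tT e e0) (lim e e0))).
  have sk : 0 <= arc_clock (uk k) t <= S.
    have /andP[t0 t1] := tT; rewrite (arc_clock_ge0 (fink k) t0 t1) /=.
    exact: le_trans (arc_clock_nd (fink k) t0 t1 (lexx T)) (sgS k).
  have := h3 _ sk; have [[_ _ _ t4 _] _ _] := datak k; rewrite t4// => h4.
  have h5 : enorm (xi (arc_clock (uk k) t) - xi (sg t)) <= Lx * e.
    have key (p q : R) : 0 <= p -> p <= q -> q <= S -> `|p - q| < e -> enorm (xi q - xi p) <= Lx * e.
      move=> p0 pq qS pe; apply: le_trans (xiL _ _ p0 pq qS) _; rewrite ler_wpM2l//.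
      by apply: le_trans (ltW pe); rewrite distrC; exact: ler_norm.
    have /andP[s0 s1] := sk; have /andP[r0 r1] := st.
    have /orP[cmp|cmp] := le_total (arc_clock (uk k) t) (sg t).
      by rewrite enormB; exact: key.
    by apply: key; rewrite // distrC.
  rewrite mulrDl; apply: le_trans (enorm_triangle (xi (arc_clock (uk k) t)) _ _) _; apply: lerD => //.
  have -> : 2 * e = e + e by ring.
  apply: le_trans (enorm_triangle (xk k t) _ _) _; apply: lerD => //.
  by rewrite enormB ltW.
pose w2 (t : R) := psi2 (rho (ell (Num.max 0 (Num.min S (sg (Num.max 0 (Num.min T t))))))).
have ellnd (s t : R) : 0 <= s -> s <= t -> t <= S -> ell s <= ell t.
  move=> s0 st tS; have /andP[q _] := ellL s t s0 st tS; rewrite -subr_ge0.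
  apply: le_trans q; have /andP[q1 _] := phi0L s t st.
  by rewrite addr_ge0 ?enorm_ge0.
have ellb s : 0 <= s <= S -> 0 <= ell s <= L.
  by move=> /andP[s0 s1]; rewrite -{1}ell0 -ellS !ellnd.
have w2E t : 0 <= t <= T -> w2 t = psi2 (rho (ell (sg t))).
  by move=> tT; rewrite /w2 (@clamp_id _ 0 T t tT) clamp_id//; exact: sgS'.
exists (phi0 \o rho), (phi \o rho), (v1c \o (phi0 \o rho)), (psi2 \o rho), L, (fun t => ell (sg t)), y.
split => //; last first.
- move=> t; rewrite in_itv/= => tT; rewrite xE// /xi.
  by rewrite clamp_id//; exact: sgS'.
- split.
  + by move=> t; rewrite !in_itv/= => tT; apply/ellb/sgS'.
  + move=> t1 t2; rewrite !in_itv/= => t1T t2T t12.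
    have [/andP[r0 r1] r2 _] := sgP t1 t1T; have [/andP[q0 q1] q2 _] := sgP t2 t2T.
    have sg12 : sg t1 <= sg t2.
      rewrite leNgt; apply/negP => /ltW /phi0L/andP[]; rewrite r2 q2 subr_ge0 leNgt.
      by rewrite t12.
    have /andP[h1 _] := ellL _ _ r0 sg12 q1; rewrite -subr_gt0; apply: lt_le_trans h1.
    by rewrite r2 q2 ltr_wpDr ?enorm_ge0// subr_gt0.
  + have [/andP[r0 r1] r2 r3] := sgP 0 (introT andP (conj (lexx 0) T0')).
    have e0 : sg 0 = 0.
      apply: (small_eqr (C := 1)) => // e e0.
      have [k] := filter_ex (sgC 0 (introT andP (conj (lexx 0) T0')) e e0).
      by rewrite arc_clock0 mul1r distrC => /ltW.
    by rewrite e0.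
  + have [/andP[r0 r1] r2 r3] := sgP T TT.
    rewrite -ellS; apply/esym/ellflat => //; first by rewrite phi0S r2.
    by move=> q /andP[q1 q2]; rewrite !sgflat.
  + move=> t; rewrite in_itv/= => tT; have [h1 h2 h3] := sgP t tT.
    by have [-> ->] := back _ h1; rewrite h2 h3.
split => //; exists v1, w2, (v1c \o (phi0 \o rho)), (psi2 \o rho); split.
- have mell : measurable_fun setT (fun s : R => ell (Num.max 0 (Num.min S s))).
    apply: (lip_measurable (C := 2) S0') => s t s0 st tS; have /andP[_ q] := ellL s t s0 st tS.
    by rewrite ger0_norm// subr_ge0; exact: ellnd.
  split => //.
  + apply: valued_L1_fun => //; last by move=> t; exact: Vpsi.
    have mcl : measurable_fun setT (fun t : R => Num.max 0 (Num.min T t)).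
      by apply: nondecreasing_measurable => // a b ab; have /andP[] := clamp_lip 0 T ab; rewrite subr_ge0.
    apply: (vmeas_comp mpsi (tau := fun t : R => rho (ell (Num.max 0 (Num.min S (sg (Num.max 0 (Num.min T t)))))))).
    apply: (measurableT_comp mrho (measurableT_comp mell (measurableT_comp msg mcl))).
  + by apply: valued_L1_fun => // t; exact: Vv1.
  + by apply: valued_L1_fun => // t; exact: Vpsi.
- split; first exact: ae_eq_refl.
  have cp : clock_pair T S 1 sg phi0 by apply: nd_clock_pair => // t /sgP[].
  have bf : bm (fun s => enorm (psi2 s - v2c (phi0 s))).
    apply: bm_enormB; first exact: (bm_valued V_compact mpsi).
    by apply: (bm_valued V_compact (vmeas_comp mv2 mphi0)) => s; exact: Vv2.
  rewrite -(integ_clock S0 T0' ler01 cp bf bh hd) in claim0.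
  have bfs := bm_comp bf msg.
  have ae1 := integ_eq0_ae bfs (aeW _ (fun t _ => enorm_ge0 _)) claim0.
  have ae2 := ae_clock S0 T0' ler01 cp hd.
  have ae3 := ae_clock_ne0 S0 T0' ler01 cp bh hd.
  apply: aeS (aeI ae1 (aeI ae2 (aeI ae3 (aeI (ae_ne 0) (ae_ne T))))).
  move=> t [h1 [h2 [h3 [t0 t1]]]]; rewrite /= in_itv/= => /[dup] tT /andP[a1 a2].
  have tl : 0 < t < T by rewrite lt_neqAle eq_sym t0 a1 lt_neqAle t1 a2.
  have {}h1 := h1 tl; have {}h2 := h2 tl; have {}h3 := h3 tl.
  have [/andP[s0 s1] s2 _] := sgP t tT.
  have sl : 0 < sg t < S.
    rewrite !lt_neqAle s0 s1 !andbT; apply/andP; split.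
      by apply/eqP => e; move: s2 t0; rewrite -e phi00 => <-; rewrite eqxx.
    by apply/eqP => e; move: s2 t1; rewrite e phi0S => <-; rewrite eqxx.
  rewrite w2E// (arc_length_flat ch phi0L (sgS' t tT) (h2 sl) h3).
  move/enorm_eq0/eqP : h1; rewrite subr_eq0 s2 => /eqP ->.
  by rewrite /v2c clamp_id.
- by split; exact: ae_eq_refl.
move=> t; rewrite in_itv/= => tT; have [h1 h2 h3] := sgP t tT.
have [b1 b2] := back _ h1.
exists (ell (sg t)); first by rewrite in_itv/=; exact: ellb.
split => //=; rewrite ?b1 ?b2 ?h2 ?h3//; last by rewrite w2E.
by rewrite /v1c clamp_id.
Qed.

End limit_to_completion.

(** * From graph completions to limit solutions *)

Section arc_length_controls.
Context {R : realType} {m l : nat} (U : set 'rV[R]_m) (V : set 'rV[R]_l).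
Local Notation mu := (@lebesgue_measure R).

(** The normalization of feasible controls makes s the arc length of the graph: in
    phi0' + |phi'| = 1, the speed |phi'| is the derivative of the variation. *)
Lemma feasible_arc_length (T S : R) (u0 : 'rV[R]_m) (phi0 : R -> R) (phi : R -> 'rV[R]_m)
    (psi1 psi2 : R -> 'rV[R]_l) :
  feasible_control U V T u0 phi0 phi psi1 psi2 S ->
  [/\ forall s t : R, 0 <= s -> s <= t -> t <= S -> 0 <= phi0 t - phi0 s,
      forall s : R, 0 <= s <= S -> phi0 s + var 0 s phi = s &
      (total_evariation 0 S phi < +oo)%E].
Proof.
move=> [S0 [p0 Up lipp] _ [p00 pu pS] dd]; have S0' := ltW S0.
have [L L0 [l0 l1]] := lipschitz_pairP S0' lipp.
have fin := vlip_tv_fin S0' l1.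
have [h [bh hL hd hI]] := lip_derive S0 L0 l0.
have [D [bD DL Dd DI]] := vlip_derive S0 L0 l1.
have lV : lip_on 0 S L (fun s => var 0 s phi).
  move=> s t s0 st tS; rewrite ger0_norm ?subr_ge0; last exact: (var_nd fin).
  rewrite mulrBr; apply: (var_min (F := fun t => L * t) fin s0 st tS) => y z sy yz zt.
  by rewrite -mulrBr; apply: l1 => //; [exact: le_trans sy|exact: le_trans tS].
have [dV [bdV dVL dVd dVI]] := lip_derive S0 L0 lV.
have vd := vlip_var_derive S0 L0 l1.
have ae1 : {ae mu, forall s : R, 0 < s < S -> 0 <= h s /\ h s + dV s = 1}.
  apply: aeS (aeI dd (aeI hd (aeI Dd (aeI dVd vd)))) => s [h1 [h2 [h3 [h4 h5]]]] sS.
  have {}h2 := h2 sS; have {}h3 := h3 sS; have {}h4 := h4 sS.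
  have e1 : derive1 phi0 s = h s by exact: is_derive1E.
  have e2 : derive1 phi s = D s by case: h3 => _ <-; rewrite derive1E.
  have -> : dV s = enorm (D s) by apply: is_derive_uniq h4 _; exact: h5.
  by rewrite -e1 -e2; apply: h1; rewrite in_itv/=; have /andP[? ?] := sS; rewrite !ltW.
split => //.
  move=> s t s0 st tS; rewrite -hI//.
  have -> : 0 = integ s t (fun=> 0 : R) by rewrite integ_cst// mul0r.
  apply: integ_le_ae => //; first exact: bm_cst.
  apply: aeS ae1 => q H /andP[sq qt]; suff /H[] : 0 < q < S by [].
  by rewrite (le_lt_trans s0 sq) (lt_le_trans qt tS).
move=> s /andP[s0 sS].
have := hI 0 s (lexx _) s0 sS; rewrite p00 subr0 => <-.
have := dVI 0 s (lexx _) s0 sS; rewrite var_aa subr0 => <-.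
rewrite -integ_D//.
have {2}-> : s = integ 0 s (fun=> 1 : R) by rewrite integ_cst// mul1r subr0.
apply: integ_eq_ae; [exact: bmD|exact: bm_cst|].
apply: aeS ae1 => q H /andP[sq qt]; suff /H[] : 0 < q < S by [].
by rewrite sq (lt_le_trans qt sS).
Qed.

End arc_length_controls.

Section interpolation.
Context {R : realType}.

(** Monotonicity spreads convergence on a finite grid over the interval. *)
Lemma mono_unif (F : set_system nat) (T : R) (a : nat -> R -> R) : Filter F -> 0 < T ->
  (forall k s t, 0 <= s -> s <= t -> t <= T -> a k s <= a k t) ->
  (forall t : R, 0 <= t <= T -> forall e : R, 0 < e -> \forall k \near F, `|a k t - t| < e) ->
  forall e : R, 0 < e -> \forall k \near F, forall t, 0 <= t <= T -> `|a k t - t| <= e.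
Proof.
move=> FF T0 and_ aC e e0; have T0' := ltW T0.
pose N := Num.bound `|2 * T / e|; pose q := T / N.+1%:R.
have q0 : 0 < q by rewrite divr_gt0.
have qe : q <= e / 2.
  have : 2 * T / e <= N.+1%:R.
    apply: le_trans (ler_norm _) _; apply: ltW; apply: lt_trans (archi_boundP (normr_ge0 _)) _.
    by rewrite ltr_nat.
  rewrite ler_pdivrMr// => h; rewrite /q ler_pdivrMr//.
  by rewrite mulrAC ler_pdivlMr// [T * 2]mulrC [e * _]mulrC.
pose nd (i : nat) : R := Num.min T (i%:R * q).
have ndT i : 0 <= nd i <= T.
  by rewrite /nd ge_min lexx /= andbT le_min T0' mulr_ge0// ltW.
have e2 : 0 < e / 2 by rewrite divr_gt0.
have : \forall k \near F, forall i : 'I_N.+3, `|a k (nd i) - nd i| < e / 2.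
  by apply: filter_forall => i; apply: aC.
apply: filterS => k H t /[dup] tT /andP[t0 t1].
have sq0 : 0 <= t / q by rewrite divr_ge0// ltW.
have /andP[h1 h2] := truncn_itv sq0.
set i := Num.truncn (t / q) in h1 h2.
have iN : (i < N.+2)%N.
  rewrite -(ltr_nat R); apply: le_lt_trans h1 _.
  apply: (@le_lt_trans _ _ N.+1%:R); last by rewrite ltr_nat.
  by rewrite ler_pdivrMr// /q mulrC divfK.
rewrite ler_pdivlMr// in h1; rewrite ltr_pdivrMr// in h2.
have := H (Ordinal (ltnW iN : (i < N.+3)%N)); have := H (Ordinal (iN : (i.+1 < N.+3)%N)).
rewrite /= => H1 H0.
have n0t : nd i <= t by rewrite /nd ge_min h1 orbT.
have tn1 : t <= nd i.+1 by rewrite /nd le_min t1 ltW.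
have n01 : nd i.+1 - nd i <= q.
  have n0E : nd i = i%:R * q by rewrite /nd min_r// (le_trans h1).
  by rewrite n0E lerBlDl /nd ge_min -natr1 mulrDl mul1r lexx orbT.
have /andP[x0 x1] := ndT i; have /andP[y0 y1] := ndT i.+1.
have m0 := and_ k _ _ x0 n0t t1; have m1 := and_ k _ _ t0 tn1 y1.
move: H1 H0; rewrite !ltr_norml => /andP[a1 a2] /andP[b1 b2].
clear -qe n0t tn1 n01 m0 m1 a1 a2 b1 b2.
by rewrite ler_norml; apply/andP; split; lra.
Qed.

(** The largest K-Lipschitz nondecreasing function below S and below sigma at
    the nodes ds: McShane's extension formula, in its one-sided form. *)
Definition interpolant (sigma : R -> R) (K S : R) (ds : seq R) (t : R) : R :=
  foldr (fun d acc => Num.min (sigma d + K * Num.max 0 (t - d)) acc) S ds.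

Lemma interpolant_nd sigma (K S : R) ds (s t : R) : 0 <= K -> s <= t ->
  interpolant sigma K S ds s <= interpolant sigma K S ds t.
Proof.
move=> K0 st; elim: ds => [|d ds IH] //=; rewrite le_min !ge_min IH orbT andbT.
by rewrite lerD2l ler_wpM2l//= ge_max !le_max lexx /= lerD2r st orbT.
Qed.

Lemma interpolant_lip sigma (K S : R) ds (s t : R) : 0 <= K -> s <= t ->
  interpolant sigma K S ds t <= interpolant sigma K S ds s + K * (t - s).
Proof.
move=> K0 st; have st0 : 0 <= K * (t - s) by rewrite mulr_ge0// subr_ge0.
elim: ds => [|d ds IH] /=; first by rewrite lerDl.
rewrite -lerBlDr le_min !lerBlDr !ge_min IH orbT andbT; apply/orP; left.
rewrite -addrA lerD2l -mulrDr ler_wpM2l// ge_max; apply/andP; split.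
  by rewrite addr_ge0 ?le_max ?lexx// subr_ge0.
by rewrite -lerBlDr (_ : t - d - (t - s) = s - d) ?le_max ?lexx ?orbT//; ring.
Qed.

Lemma interpolant_le sigma (K S : R) ds (t d : R) : d \in ds ->
  interpolant sigma K S ds t <= sigma d + K * Num.max 0 (t - d).
Proof.
elim: ds => [|c ds IH] //=; rewrite inE => /orP[/eqP->|/IH h]; rewrite ge_min ?lexx//.
by rewrite h orbT.
Qed.

Lemma interpolant_leS sigma (K S : R) ds (t : R) : interpolant sigma K S ds t <= S.
Proof. by elim: ds => [|c ds IH] //=; rewrite ge_min IH orbT. Qed.

Lemma interpolant_ge sigma (K S : R) ds (t c : R) : c <= S ->
  (forall d, d \in ds -> c <= sigma d + K * Num.max 0 (t - d)) -> c <= interpolant sigma K S ds t.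
Proof.
move=> cS; elim: ds => [|d ds IH] //= H; rewrite le_min H ?inE ?eqxx//=.
by apply: IH => d' d'ds; apply: H; rewrite inE d'ds orbT.
Qed.

Lemma seq_bounded (s : seq R) : exists2 K : R, 0 <= K & forall y, y \in s -> y <= K.
Proof.
elim: s => [|y s [K K0 KP]]; first by exists 0.
exists (Num.max y K); first by rewrite le_max K0 orbT.
by move=> z; rewrite inE => /orP[/eqP->|/KP h]; rewrite le_max ?lexx// h orbT.
Qed.

(** K has to exceed the slopes of sigma between nodes; S over the smallest gap
    between nodes is enough. *)
Lemma interpolant_ex (sigma : R -> R) (T S : R) (ds : seq R) : 0 <= S ->
  (forall t : R, 0 <= t <= T -> 0 <= sigma t <= S) ->
  (forall s t : R, 0 <= s -> s <= t -> t <= T -> sigma s <= sigma t) ->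
  (forall d, d \in ds -> 0 <= d <= T) ->
  exists (f : R -> R) (K : R), [/\ 0 <= K, forall t, 0 <= f t <= S,
    forall s t : R, s <= t -> 0 <= f t - f s <= K * (t - s) &
    forall d, d \in ds -> f d = sigma d].
Proof.
move=> S0 sS snd dsT.
have [K K0 KP] := seq_bounded [seq S / (d - d') | d <- ds, d' <- ds].
exists (interpolant sigma K S ds), K; split => //.
- move=> t; rewrite interpolant_leS andbT; apply: interpolant_ge => // d dd.
  have /andP[h _] := sS d (dsT d dd); rewrite addr_ge0// mulr_ge0//.
  by rewrite le_max lexx.
- by move=> s t st; rewrite subr_ge0 interpolant_nd//= lerBlDl interpolant_lip.
move=> d dd; have dT := dsT d dd; have /andP[d0 d1] := dT.
have /andP[sd0 sdS] := sS d dT.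
apply/eqP; rewrite eq_le; apply/andP; split.
  by apply: le_trans (interpolant_le _ _ _ _ dd) _; rewrite subrr maxxx mulr0 addr0.
apply: interpolant_ge => // d' dd'; have d'T := dsT d' dd'; have /andP[d'0 d'1] := d'T.
have /andP[sd'0 _] := sS d' d'T.
have [le|lt] := leP d d'.
  apply: le_trans (snd _ _ d0 le d'1) _; rewrite lerDl mulr_ge0//.
  by rewrite le_max lexx.
have := KP _ (allpairs_f (fun d d' => S / (d - d')) dd dd').
have dd0 : 0 < d - d' by rewrite subr_gt0.
rewrite ler_pdivrMr// => h; rewrite (max_r (ltW dd0)).
by apply: le_trans sdS _; apply: le_trans h _; rewrite lerDr.
Qed.

End interpolation.

Section approximation.
Context {R : realType}.
Local Notation mu := (@lebesgue_measure R).

(** The clocks interpolate sigma at more and more nodes, the values of phi0 at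
    rational parameters. A time t that is not a node has a fibre of phi0 without
    rational points, that is a single point; so sigma is continuous at t, and its
    values at neighbouring nodes squeeze the approximations. At the nodes, which
    include all the jumps of sigma, the convergence is trivial. *)
Lemma approximate_clock (T S : R) (phi0 sigma : R -> R) : 0 < T -> 0 < S ->
  (forall s t : R, s <= t -> 0 <= phi0 t - phi0 s <= t - s) -> phi0 0 = 0 -> phi0 S = T ->
  (forall t : R, 0 <= t <= T -> 0 <= sigma t <= S /\ phi0 (sigma t) = t) ->
  sigma 0 = 0 -> sigma T = S ->
  exists (sgk : nat -> R -> R) (K : nat -> R),
  [/\ forall k, 0 <= K k, forall k t, 0 <= sgk k t <= S,
      forall k (s t : R), s <= t -> 0 <= sgk k t - sgk k s <= K k * (t - s),
      forall k, sgk k 0 = 0 /\ sgk k T = S &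
      forall t : R, 0 <= t <= T -> forall e : R, 0 < e -> \forall k \near \oo, `|sgk k t - sigma t| < e].
Proof.
move=> T0 S0 phi0L phi00 phi0S sgP sg0 sgT; have T0' := ltW T0; have S0' := ltW S0.
have nd (s t : R) : s <= t -> phi0 s <= phi0 t by move=> /phi0L/andP[]; rewrite subr_ge0.
have sgnd (s t : R) : 0 <= s -> s <= t -> t <= T -> sigma s <= sigma t.
  move=> s0 st tT; have [//|h] := leP (sigma s) (sigma t).
  have [_ e1] := sgP s (introT andP (conj s0 (le_trans st tT))).
  have [_ e2] := sgP t (introT andP (conj (le_trans s0 st) tT)).
  have := nd _ _ (ltW h); rewrite e1 e2 => ts.
  have e : s = t by apply/eqP; rewrite eq_le st ts.
  by rewrite e ltxx in h.
pose qj (j : nat) : R := ratr (odflt (0 : rat) (unpickle j)).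
pose node j : R := phi0 (Num.max 0 (Num.min S (qj j))).
have nodeT j : 0 <= node j <= T.
  by rewrite -phi00 -phi0S; have /andP[h1 h2] := clamp_ge (qj j) S0'; rewrite !nd.
pose ds k : seq R := 0 :: T :: [seq node j | j <- iota 0 k].
have dsT k d : d \in ds k -> 0 <= d <= T.
  by rewrite !inE => /or3P[/eqP->|/eqP->|/mapP[j _ ->]]; rewrite ?lexx ?T0' ?nodeT.
have /choice[sgk sgkP] (k : nat) := interpolant_ex S0' (fun t h => (sgP t h).1) sgnd (dsT k).
have /choice[K KP] := sgkP.
exists sgk, K; split.
- by move=> k; case: (KP k).
- by move=> k; case: (KP k).
- by move=> k; case: (KP k).
- by move=> k; case: (KP k) => _ _ _ H; rewrite !H ?sg0 ?sgT// !inE eqxx// orbT.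
move=> t /[dup] tT /andP[t0 t1] e e0.
have [/andP[s0 s1] st] := sgP t tT.
have kn j : \forall k \near \oo, sgk k (node j) = sigma (node j).
  near=> k; have [_ _ _ H] := KP k; apply: H; rewrite !inE map_f ?orbT// mem_iota add0n /=.
  by near: k; exact: nbhs_infty_gt.
have sgknd k (x y : R) : x <= y -> sgk k x <= sgk k y.
  by move=> xy; have [_ _ H _] := KP k; have /andP[] := H _ _ xy; rewrite subr_ge0.
have qE (r : rat) : qj (pickle r) = ratr r by rewrite /qj pickleK.
have nodeE (r : rat) : 0 <= (ratr r : R) <= S -> node (pickle r) = phi0 (ratr r).
  by move=> h; rewrite /node qE clamp_id.
(* at a node the approximations are eventually exact *)
have [[r [rS rt]]|nr] := pselect (exists r : rat, 0 <= (ratr r : R) <= S /\ phi0 (ratr r) = t).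
  apply: filterS (kn (pickle r)) => k; rewrite nodeE// rt => ->.
  by rewrite subrr normr0.
have up : \forall k \near \oo, sgk k t < sigma t + e.
  have [h|h] := ltP S (sigma t + e).
    by apply: filterE => k; apply: le_lt_trans h; have [_ /(_ t)/andP[]] := KP k.
  have sse : sigma t < sigma t + e by rewrite ltrDl.
  have d0 : t < phi0 (sigma t + e).
    rewrite lt_neqAle -{3}st nd ?(ltW sse)// andbT; apply/eqP => te.
    have [r] := rat_in_itvoo sse; rewrite in_itv/= => /andP[r0 r1].
    apply: nr; exists r; split; first by rewrite (le_trans s0 (ltW r0)) (le_trans (ltW r1)).
    have h1 := nd _ _ (ltW r0); have h2 := nd _ _ (ltW r1); rewrite st in h1; rewrite -te in h2.
    by apply/eqP; rewrite eq_le h1 h2.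
  have m0 : sigma t < Num.min (sigma t + e) (sigma t + (phi0 (sigma t + e) - t)).
    by rewrite lt_min sse ltrDl subr_gt0.
  have [r] := rat_in_itvoo m0; rewrite in_itv/= => /andP[r0]; rewrite lt_min => /andP[r1 r2].
  have rS : 0 <= (ratr r : R) <= S by rewrite (le_trans s0 (ltW r0)) (le_trans (ltW r1)).
  have dt : t <= phi0 (ratr r) by rewrite -{1}st nd// ltW.
  have dT : 0 <= phi0 (ratr r) <= T by rewrite -(nodeE r rS).
  have sd : sigma (phi0 (ratr r)) < sigma t + e.
    rewrite ltNge; apply/negP => /nd; have [_ ->] := sgP _ dT; rewrite leNgt; apply/negP/negPn.
    have /andP[_ h2] := phi0L _ _ (ltW r0); rewrite st in h2.
    by clear -h2 r2; lra.
  apply: filterS (kn (pickle r)) => k; rewrite nodeE// => h1.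
  by apply: le_lt_trans (sgknd k _ _ dt) _; rewrite h1.
have down : \forall k \near \oo, sigma t - e < sgk k t.
  have [h|h] := ltP (sigma t - e) 0.
    by apply: filterE => k; apply: lt_le_trans h _; have [_ /(_ t)/andP[]] := KP k.
  have sse : sigma t - e < sigma t by rewrite ltrBlDr ltrDl.
  have d0 : phi0 (sigma t - e) < t.
    rewrite lt_neqAle -{4}st nd ?(ltW sse)// andbT; apply/eqP => te.
    have [r] := rat_in_itvoo sse; rewrite in_itv/= => /andP[r0 r1].
    apply: nr; exists r; split; first by rewrite (le_trans h (ltW r0)) (le_trans (ltW r1)).
    have h1 := nd _ _ (ltW r0); have h2 := nd _ _ (ltW r1); rewrite te in h1; rewrite st in h2.
    by apply/eqP; rewrite eq_le h1 h2.
  have m0 : Num.max (sigma t - e) (sigma t - (t - phi0 (sigma t - e))) < sigma t.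
    by rewrite gt_max sse ltrBlDr ltrDl subr_gt0.
  have [r] := rat_in_itvoo m0; rewrite in_itv/= gt_max => /andP[/andP[r1 r2] r0].
  have rS : 0 <= (ratr r : R) <= S by rewrite (le_trans h (ltW r1)) (le_trans (ltW r0)).
  have dt : phi0 (ratr r) <= t by rewrite -{1}st nd// ltW.
  have dT : 0 <= phi0 (ratr r) <= T by rewrite -(nodeE r rS).
  have sd : sigma t - e < sigma (phi0 (ratr r)).
    rewrite ltNge; apply/negP => /nd; have [_ ->] := sgP _ dT; rewrite leNgt; apply/negP/negPn.
    have /andP[_ h2] := phi0L _ _ (ltW r0); rewrite st in h2.
    by clear -h2 r2; lra.
  apply: filterS (kn (pickle r)) => k; rewrite nodeE// => h1.
  by apply: lt_le_trans (sgknd k _ _ dt); rewrite h1.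
apply: filterS2 up down => k h1 h2.
by rewrite ltr_norml ltrBrDr ltrBlDr [_ + sigma t]addrC h2 addrC.
Unshelve. all: by end_near. Qed.

Lemma bounded_cvg (T C : R) (q : nat -> R -> R) : 0 <= T -> (forall k, bm (q k)) ->
  (forall k t, 0 <= t <= T -> 0 <= q k t <= C) ->
  (forall t : R, 0 <= t <= T -> forall e : R, 0 < e -> \forall k \near \oo, q k t <= e) ->
  forall e : R, 0 < e -> \forall k \near \oo, integ 0 T (q k) <= e.
Proof.
move=> T0 bq qC qc e e0.
have mq k : measurable_fun (`[0, T]%classic : set R) (EFin \o q k).
  by apply/measurable_EFinP; apply: measurable_funTS; have [] := bq k.
have ic : mu.-integrable (`[0, T]%classic : set R) (EFin \o (fun=> C)).
  by apply: bm_integrable; exact: bm_cst.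
have [] := @dominated_convergence _ _ _ mu (`[0, T]%classic : set R) (measurable_itv _)
  (fun k => EFin \o q k) (EFin \o (fun=> 0 : R)) (EFin \o (fun=> C)) mq.
- exact: measurable_cst.
- apply: aeW => t; rewrite /= in_itv/= => tT; apply/fine_cvgP; split; first exact: filterE.
  apply/cvgrPdist_le => d d0; apply: filterS (qc t tT d d0) => k h /=.
  by rewrite sub0r normrN ger0_norm//; have /andP[] := qC k t tT.
- exact: ic.
- apply: aeW => t k; rewrite /= in_itv/= => tT; rewrite lee_fin.
  by have /andP[h1 h2] := qC k t tT; rewrite ger0_norm.
move=> _ _; rewrite integral_cst//= mul0e.
under eq_fun do rewrite -integE//.
move=> /ereal_cvg0 H; have {}H := H (fun k => _) e e0.
have : forall k, (0 <= (integ 0 T (q k))%:E)%E.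
  by move=> k; rewrite lee_fin; apply: integ_ge0 => t tT; have /andP[] := qC k t tT.
move=> /H; apply: filterS => k.
by rewrite lee_fin.
Qed.

(** The function f is replaced in mean by a uniformly continuous c, for which
    pointwise convergence of the clocks suffices. The cost of this is
    transported by integ_clock, with densities at most 1, so it is the same for
    all the clocks. *)
Lemma clock_comp_cvg (T S : R) (f : R -> R) (sgk : nat -> R -> R) (sg : R -> R)
    (tauk : nat -> R -> R) (tau : R -> R) : 0 < T -> 0 < S -> bm f ->
  (forall k, clock_pair T S 1 (sgk k) (tauk k)) -> clock_pair T S 1 sg tau ->
  (forall t : R, 0 <= t <= T -> forall e : R, 0 < e -> \forall k \near \oo, `|sgk k t - sg t| < e) ->
  forall e : R, 0 < e -> \forall k \near \oo, integ 0 T (fun t => `|f (sgk k t) - f (sg t)|) <= e.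
Proof.
move=> T0 S0 bf cpk cp sgC e e0; have T0' := ltW T0; have S0' := ltW S0.
have [_ [B fB]] := bf; have e3 : 0 < e / 3 by rewrite divr_gt0.
have [c [bc cB cu fc]] := bm_dense bf fB S0' e3.
have msgk k : measurable_fun setT (sgk k) by have [_ _ _ _ []] := cpk k.
have msg : measurable_fun setT sg by have [_ _ _ _ []] := cp.
have cC : \forall k \near \oo, integ 0 T (fun t => `|c (sgk k t) - c (sg t)|) <= e / 3.
  apply: (bounded_cvg (C := B + B) T0') => //.
  - by move=> k; apply: bm_norm; apply: bmB; exact: bm_comp.
  - by move=> k t _; rewrite normr_ge0/= (le_trans (ler_normB _ _))// lerD.
  move=> t tT d d0; have [r r0 rP] := cu d d0.
  by apply: filterS (sgC t tT r r0) => k h; apply: rP; exact: ltW.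
have bfc : bm (fun s => `|f s - c s|) by apply: bm_norm; exact: bmB.
have transport s1 t1 : clock_pair T S 1 s1 t1 -> integ 0 T (fun t => `|f (s1 t) - c (s1 t)|) <= e / 3.
  move=> cp1; have [h [bh h01 hd hI]] := clock_pair_density S0 ler01 cp1.
  rewrite (integ_clock S0 T0' ler01 cp1 bfc bh hd); apply: le_trans fc.
  apply: integ_le => //; first exact: bmM.
  by move=> s _; rewrite ler_piMr//; have /andP[] := h01 s.
apply: filterS cC => k H.
have b1 := bm_comp bfc (msgk k); have b2 := bm_comp bfc msg.
have b3 : bm (fun t => `|c (sgk k t) - c (sg t)|) by apply: bm_norm; apply: bmB; exact: bm_comp.
apply: (@le_trans _ _ (integ 0 T (fun t => (`|f (sgk k t) - c (sgk k t)| + `|f (sg t) - c (sg t)|) +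
    `|c (sgk k t) - c (sg t)|))).
  apply: integ_le.
  - by apply: bm_norm; apply: bmB; exact: bm_comp.
  - by apply: bmD => //; exact: bmD.
  move=> t _; have -> : f (sgk k t) - f (sg t) = (f (sgk k t) - c (sgk k t)) - (f (sg t) - c (sg t)) +
    (c (sgk k t) - c (sg t)) by ring.
  by rewrite (le_trans (ler_normD _ _))// lerD2r ler_normB.
rewrite integ_D//; last exact: bmD.
rewrite integ_D//.
have -> : e = (e / 3 + e / 3) + e / 3 by field.
by apply: lerD => //; apply: lerD; [exact: (transport _ _ (cpk k))|exact: (transport _ _ cp)].
Qed.

End approximation.

Section completion.
Context {R : realType} {n m l : nat} (U : set 'rV[R]_m) (V : set 'rV[R]_l).
Context (g : 'I_m.+1 -> 'rV[R]_n -> 'rV[R]_m -> 'rV[R]_l -> 'rV[R]_n) (M : R).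
Hypotheses (U_compact : compact U) (V_compact : compact V) (M_ge0 : 0 <= M)
  (g_continuous : forall i, field_continuous U V (g i))
  (g_lipschitz : forall i, locally_lipschitz_unif U V (g i))
  (g_growth : forall i, linear_growth U V M (g i)).
Local Notation mu := (@lebesgue_measure R).

Lemma ac_vmeas_bounded (S : R) (xi : R -> 'rV[R]_n) : 0 <= S -> abs_continuous 0 S xi ->
  vmeas (fun s => xi (Num.max 0 (Num.min S s))) /\
  exists B : R, forall s, enorm (xi (Num.max 0 (Num.min S s))) <= B.
Proof.
move=> S0 xiAC; split.
  by move=> i; apply: continuous_measurable_fun; exact: ac_continuous.
have /choice[B BP] (i : 'I_n) : exists B : R, forall t : R, 0 <= t <= S -> `|xi t ord0 i| <= B.
  exact: (@continuous_clamp_bounded _ (fun t => xi t ord0 i) S S0 (@ac_continuous _ _ xi S i S0 xiAC)).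
exists (\sum_(i < n) B i) => t; rewrite (le_trans (enorm_le_sum _))//.
by apply: ler_sum => i _; apply: BP; exact: clamp_ge.
Qed.

Lemma clamp_incr (S : R) (phi0 : R -> R) : 0 <= S ->
  (forall s t : R, 0 <= s -> s <= t -> t <= S -> 0 <= phi0 t - phi0 s <= t - s) ->
  forall s t : R, s <= t ->
    0 <= phi0 (Num.max 0 (Num.min S t)) - phi0 (Num.max 0 (Num.min S s)) <= t - s.
Proof.
move=> S0 h s t st; have /andP[c1 c2] := clamp_lip 0 S st; rewrite subr_ge0 in c1.
have /andP[s0 s1] := clamp_ge s S0; have /andP[t0 t1] := clamp_ge t S0.
by have /andP[-> h2] := h _ _ s0 c1 t1; exact: le_trans h2 c2.
Qed.

Lemma clamp_vlip d (S : R) (phi : R -> 'rV[R]_d) : 0 <= S ->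
  (forall s t : R, 0 <= s -> s <= t -> t <= S -> enorm (phi t - phi s) <= t - s) ->
  forall s t : R, s <= t ->
    enorm (phi (Num.max 0 (Num.min S t)) - phi (Num.max 0 (Num.min S s))) <= t - s.
Proof.
move=> S0 h s t st; have /andP[c1 c2] := clamp_lip 0 S st; rewrite subr_ge0 in c1.
have /andP[s0 s1] := clamp_ge s S0; have /andP[t0 t1] := clamp_ge t S0.
exact: le_trans (h _ _ s0 c1 t1) c2.
Qed.

(** A graph completion solution in the form in which space_time_limit can use
    it: everything is extended to the line by constants, and the control psi1
    is replaced by v1 o phi0. The definition of a graph completion provides,
    over each t, some parameter s where psi takes the value v t; over almost
    every t the fibre of phi0 is a single point, so this parameter is sigma t. *)
Lemma completion_data (T : R) (x0 : 'rV[R]_n) (u0 : 'rV[R]_m)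
  (u : R -> 'rV[R]_m) (v1 v2 : R -> 'rV[R]_l) (x : R -> 'rV[R]_n) : 0 < T ->
  L1_fun 0 T V v1 -> L1_fun 0 T V v2 ->
  graph_completion_solution U V g T x0 u0 u v1 v2 x ->
  exists (S : R) (phi0 h : R -> R) (phi D : R -> 'rV[R]_m) (sg : R -> R) (psi2 : R -> 'rV[R]_l)
    (xi : R -> 'rV[R]_n),
  [/\ 0 < S /\ (forall t : R, 0 <= t <= T -> x t = xi (sg t)),
      [/\ forall s t : R, s <= t -> 0 <= phi0 t - phi0 s <= t - s, phi0 0 = 0 /\ phi0 S = T,
          bm h /\ (forall s : R, 0 <= h s <= 1),
          {ae mu, forall s : R, 0 < s < S -> is_derive s 1 phi0 (h s)} &
          forall s t : R, 0 <= s -> s <= t -> t <= S -> integ s t h = phi0 t - phi0 s],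
      [/\ forall s t : R, s <= t -> enorm (phi t - phi s) <= t - s,
          (forall s : R, U (phi s)) /\ phi 0 = u0,
          (forall i, bm (fun s => D s ord0 i)) /\ (forall t i, `|D t ord0 i| <= 1),
          (forall (s t : R) i, 0 <= s -> s <= t -> t <= S ->
             integ s t (fun s => D s ord0 i) = phi t ord0 i - phi s ord0 i) &
          forall s : R, 0 <= s <= S -> phi0 s + var 0 s phi = s],
      [/\ measurable_fun setT sg, sg 0 = 0, sg T = S &
          forall t : R, 0 <= t <= T -> [/\ 0 <= sg t <= S, phi0 (sg t) = t & phi (sg t) = u t]] &
      [/\ vmeas psi2, forall s, V (psi2 s),
          {ae mu, forall t : R, 0 < t < T -> psi2 (sg t) = v2 t} &
          integral_solution g S x0 (densities h D) phi
            (ordinary ((fun t => v1 (Num.max 0 (Num.min T t))) \o phi0) psi2) xi]].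
Proof.
move=> T0 v1L v2L [phi0 [phi [psi1 [psi2 [S [sigma [xi [[feas comp] clk sts xE]]]]]]]].
have [nd0 arc fin] := feasible_arc_length feas.
have [S0 [p0 Up lipp] [psi1L psi2L] [p00 pu pS] dd] := feas.
have S0' := ltW S0; have T0' := ltW T0.
have arcB (s t : R) : 0 <= s -> s <= t -> t <= S ->
    t - s = (phi0 t - phi0 s) + (var 0 t phi - var 0 s phi).
  move=> s0 st tS; have a1 := arc t (introT andP (conj (le_trans s0 st) tS)).
  have a2 := arc s (introT andP (conj s0 (le_trans st tS))).
  by rewrite addrACA a1 -opprD a2.
have inc (s t : R) : 0 <= s -> s <= t -> t <= S -> 0 <= phi0 t - phi0 s <= t - s.
  move=> s0 st tS; rewrite nd0//= (arcB _ _ s0 st tS) lerDl subr_ge0; exact: (var_nd fin).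
have vinc (s t : R) : 0 <= s -> s <= t -> t <= S -> enorm (phi t - phi s) <= t - s.
  move=> s0 st tS; apply: le_trans (var_majorant fin s0 st tS) _.
  by rewrite (arcB _ _ s0 st tS) lerDr; exact: nd0.
pose cl (s : R) : R := Num.max 0 (Num.min S s).
pose clT (t : R) : R := Num.max 0 (Num.min T t).
have clE s : 0 <= s <= S -> cl s = s by exact: clamp_id.
have clTE t : 0 <= t <= T -> clT t = t by exact: clamp_id.
have clS s : 0 <= cl s <= S by exact: clamp_ge.
have clTT t : 0 <= clT t <= T by exact: clamp_ge.
pose P0 s := phi0 (cl s); pose P s := phi (cl s); pose sg t := sigma (clT t).
have P0L : forall s t : R, s <= t -> 0 <= P0 t - P0 s <= t - s by exact: clamp_incr.
have PL : forall s t : R, s <= t -> enorm (P t - P s) <= t - s by exact: clamp_vlip.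
have z0 : 0 <= (0 : R) <= S by rewrite lexx.
have zS : 0 <= S <= S by rewrite lexx S0'.
have P00 : P0 0 = 0 by rewrite /P0 clE.
have P0S : P0 S = T by rewrite /P0 clE.
have [c1 c2 c3 c4 c5] := clk.
have z0T : 0 <= (0 : R) <= T by rewrite lexx.
have zT : 0 <= T <= T by rewrite lexx T0'.
have sgP t : 0 <= t <= T -> [/\ 0 <= sg t <= S, P0 (sg t) = t & P (sg t) = u t].
  move=> tT; have tT' : t \in `[0, T] by rewrite in_itv.
  have := c1 t tT'; rewrite in_itv/= => sS; have [q1 q2] := c5 t tT'.
  by rewrite /sg /P0 /P clTE// clE.
have sgnd (s t : R) : s <= t -> sg s <= sg t.
  move=> st; have /andP[h _] := clamp_lip 0 T st; rewrite subr_ge0 in h.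
  rewrite le_eqVlt in h; case/orP: h => [/eqP h|h]; first by rewrite /sg /clT h.
  by apply/ltW/c2 => //; rewrite in_itv/=; exact: clTT.
have msg : measurable_fun setT sg by exact: nondecreasing_measurable.
have vl : vlip_on 0 S 1 P by move=> s t _ st _; rewrite mul1r; exact: PL.
have [h [bh h01 hd hI]] := nd_density S0 P0L.
have [D [bD D1 Dd DI]] := vlip_derive S0 ler01 vl.
have [mpsi2 Vpsi2] := L1_fun_clamp S0' psi2L.
have mP0 := measurable_tau P0L.
have cp : clock_pair T S 1 sg P0 by apply: nd_clock_pair => // t /sgP[].
have [w1 [w2 [chi1 [chi2 [_ [ew1 ew2] [ec1 ec2] pts]]]]] := comp.
(* almost every fibre of phi0 is a point, which is then the one that the
   completion provides *)
have fib (chi psi w v : R -> 'rV[R]_l) : w = v %[ae mu in `[0, T]%classic] ->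
    chi = psi %[ae mu in `[0, S]%classic] ->
    (forall t : R, 0 <= t <= T -> exists2 s : R, 0 <= s <= S & phi0 s = t /\ chi s = w t) ->
    {ae mu, forall t : R, 0 < t < T -> psi (sg t) = v t}.
  move=> ew ec pt; have a1 := ae_clock S0 T0' ler01 cp ec.
  have a2 := ae_clock S0 T0' ler01 cp hd; have a3 := ae_clock_ne0 S0 T0' ler01 cp bh hd.
  apply: aeS (aeI ew (aeI a1 (aeI a2 a3))) => t [h1 [h2 [h3 h4]]] tT.
  have {}h2 := h2 tT; have {}h3 := h3 tT; have {}h4 := h4 tT; have /andP[t0 t1] := tT.
  have tT' : 0 <= t <= T by rewrite !ltW.
  rewrite /= in_itv/= in h1; have {}h1 := h1 tT'.
  have [sS sE _] := sgP t tT'; rewrite /= in_itv/= in h2; have {}h2 := h2 sS.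
  have sl : 0 < sg t < S.
    have /andP[s0 s1] := sS; rewrite !lt_neqAle s0 s1 !andbT; apply/andP; split.
      by apply/eqP => e; move: sE t0; rewrite -e P00 => <-; rewrite ltxx.
    by apply/eqP => e; move: sE t1; rewrite e P0S => <-; rewrite ltxx.
  have {}h3 := h3 sl; have [s sS' [st cs]] := pt t tT'.
  suff e : s = sg t by rewrite -h2 -h1 -cs e.
  apply/eqP/negP => /negP ne; move: h4; rewrite (is_derive_const_side h3 ne) ?eqxx// => y.
  have ps : P0 s = t by rewrite /P0 clE.
  have ndP (p q : R) : p <= q -> P0 p <= P0 q by move=> /P0L/andP[]; rewrite subr_ge0.
  rewrite sE; case: (leP s (sg t)) => _ /andP[/ndP y1 /ndP y2]; apply/eqP.
    by rewrite ps in y1; rewrite sE in y2; rewrite eq_le y1 y2.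
  by rewrite sE in y1; rewrite ps in y2; rewrite eq_le y1 y2.
have psi1v : {ae mu, forall t : R, 0 < t < T -> psi1 (sg t) = v1 t}.
  apply: (fib chi1 psi1 w1 v1) => // t tT; have [|s] := pts t; first by rewrite in_itv.
  by rewrite in_itv/= => sS [q1 _ q2 _]; exists s.
have psi2v : {ae mu, forall t : R, 0 < t < T -> psi2 (sg t) = v2 t}.
  apply: (fib chi2 psi2 w2 v2) => // t tT; have [|s] := pts t; first by rewrite in_itv.
  by rewrite in_itv/= => sS [q1 _ _ q2]; exists s.
have UP s : U (P s) by apply: Up; rewrite in_itv/=.
have [xiAC xi0 xid] := sts.
have [my yB] := ac_vmeas_bounded S0' xiAC.
have [mv1 Vv1] := L1_fun_clamp T0' v1L.
have adm : admissible U V 1 (densities h D) P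
    (ordinary ((fun t => v1 (clT t)) \o P0) (fun s => psi2 (cl s))).
  apply: densities_admissible => //.
  - by move=> s; have /andP[p q] := h01 s; rewrite ger0_norm.
  - exact: lip1_vmeas.
  - exact: (vmeas_comp mv1).
  - by move=> t; exact: Vv1.
have aeP : {ae mu, forall t : R, (0 < t < T -> psi1 (sg t) = v1 t) /\ (t != 0 /\ t != T)}.
  exact: aeI psi1v (aeI (ae_ne 0) (ae_ne T)).
have lP0 : lip_on 0 S 1 P0.
  by move=> s t _ st _; have /andP[q1 q2] := P0L s t st; rewrite ger0_norm// mul1r.
have ndP0 (s t : R) : 0 <= s -> s <= t -> t <= S -> P0 s <= P0 t.
  by move=> _ st _; have /andP[] := P0L s t st; rewrite subr_ge0.
have nullP := lip_null S0 ler01 lP0 ndP0 aeP.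
exists S, P0, h, P, D, sg, (fun s => psi2 (cl s)), (fun s => xi (cl s)); split => //.
- split => // t tT; have [q1 _ _] := sgP t tT; rewrite xE ?in_itv//.
  by rewrite clE// /sg clTE.
- split => //.
    by split => //; rewrite /P clE.
  move=> s sS; rewrite /P0 clE// -[RHS]arc//; congr (_ + _).
  have /andP[s0 s1] := sS.
  apply: var_eq => //.
  + move=> t /andP[t0 t1]; rewrite /P clE//.
    by rewrite t0 (le_trans t1).
  + apply: tv_sub_fin (vlip_tv_fin S0' vl) => //.
  + exact: tv_sub_fin fin.
- by split => //; rewrite /sg clTE.
split => //.
  apply: aeS psi2v => t H /[dup] tT /andP[t0 t1]; rewrite -H//.
  by have [q1 _ _] := sgP t (introT andP (conj (ltW t0) (ltW t1))); rewrite clE.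
split => // t i /[dup] tS /andP[t0 t1].
rewrite clE// -xi0.
have br := bm_rhs U_compact M_ge0 g_continuous g_growth adm my yB i.
apply: (ac_integ (w := xi)) => //.
  move=> e e0; have [r' r'0 r'P] := xiAC e e0.
  exists r' => // N p q pq tI; apply: r'P => // k.
  by have [h1 [h2 h3]] := pq k; split => //; split => //; exact: le_trans t1.
apply: aeS (aeI xid (aeI hd (aeI Dd nullP))) => s [h1 [h2 [h3 h4]]] /andP[s0 st].
have sS : 0 < s < S by rewrite s0 (lt_le_trans st).
have sS' : 0 <= s <= S by have /andP[? ?] := sS; rewrite !ltW.
have {}h2 := h2 sS; have {}h3 := h3 sS; have {}h4 := h4 sS.
rewrite in_itv/= in h1; have {}h1 := h1 sS'.
have k0 : 0 < Num.min s (S - s) by have /andP[? ?] := sS; rewrite lt_min subr_gt0; apply/andP.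
have e1 : derive1 phi0 s = h s.
  apply: is_derive1E; apply: (is_derive_near k0 _ h2) => y /near_interval yS.
  by rewrite /P0 clE.
have e2 : derive1 phi s = D s.
  have : is_derive s 1 phi (D s).
    apply/is_derive_rVP => k; move/is_derive_rVP : h3 => /(_ k); apply: (is_derive_near k0).
    by move=> y /near_interval yS; rewrite /P clE.
  by case=> _ <-; rewrite derive1E.
move/is_derive_rVP : h1 => /(_ i); rewrite e1 e2 rhsE /=.
have -> : P s = phi s by rewrite /P clE.
rewrite clE// (_ : h s *: g ord0 (xi s) (phi s) (psi1 s) =
  h s *: g ord0 (xi s) (phi s) (v1 (clT (P0 s))))//.
have [hs|hs] := eqVneq (h s) 0; first by rewrite hs !scale0r.
have [[h5 [h6 h7]]|d0] := h4; last first.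
  by move: hs; rewrite (is_derive_uniq h2 d0) eqxx.
have ps : 0 <= P0 s <= T.
  have /andP[a b] := sS'; have /andP[q1 _] := P0L _ _ a; have /andP[q2 _] := P0L _ _ b.
  by rewrite P00 subr0 in q1; rewrite P0S subr_ge0 in q2; rewrite q1.
have pl : 0 < P0 s < T.
  by have /andP[a b] := ps; rewrite !lt_neqAle a b !andbT eq_sym h6.
have := h5 pl; rewrite (clock_pair_flat cp sS' h2 hs) => ->.
by rewrite clTE.
Qed.

End completion.

Lemma interval_dist (R : realType) (S a b : R) : 0 <= a <= S -> 0 <= b <= S -> `|a - b| <= S.
Proof.
by move=> /andP[? ?] /andP[? ?]; rewrite ler_norml; apply/andP; split; lra.
Qed.

Section completion_to_limit.
Context {R : realType} {n m l : nat} (U : set 'rV[R]_m) (V : set 'rV[R]_l).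
Context (g : 'I_m.+1 -> 'rV[R]_n -> 'rV[R]_m -> 'rV[R]_l -> 'rV[R]_n) (M : R).
Hypotheses (U_compact : compact U) (V_compact : compact V) (M_ge0 : 0 <= M)
  (g_continuous : forall i, field_continuous U V (g i))
  (g_lipschitz : forall i, locally_lipschitz_unif U V (g i))
  (g_growth : forall i, linear_growth U V M (g i)).
Local Notation mu := (@lebesgue_measure R).

Lemma near0_ereal (f : nat -> \bar R) : (forall k, 0 <= f k)%E ->
  (forall e : R, 0 < e -> \forall k \near \oo, (f k <= e%:E)%E) ->
  f k @[k --> \oo] --> 0%E.
Proof.
move=> f0 fe; apply/fine_cvgP; split.
  apply: filterS (fe 1 ltr01) => k h; rewrite ge0_fin_numE//.
  by apply: le_lt_trans h _; rewrite ltry.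
apply/cvgrPdist_le => e e0; apply: filterS (fe e e0) => k h /=.
rewrite sub0r normrN ger0_norm ?fine_ge0// -lee_fin fineK// ge0_fin_numE//.
by apply: le_lt_trans h _; rewrite ltry.
Qed.

Lemma L1_norm_le_integ d (a b : R) q (f : R -> 'rV[R]_d) : bm q ->
  (forall t, a <= t <= b -> enorm (f t) <= q t) ->
  (L1_norm a b f <= (integ a b q)%:E)%E.
Proof.
move=> bq qf; rewrite integE// /L1_norm; apply: ge0_integral_mono => t.
  by move=> _; rewrite lee_fin enorm_ge0.
by rewrite /= in_itv/= lee_fin => /qf.
Qed.

(** The equation in t is a space-time equation in which time is the identity. *)
Lemma caratheodory_ex (T K : R) (x0 : 'rV[R]_n) (u : R -> 'rV[R]_m) (v1 v2 : R -> 'rV[R]_l) :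
  0 < T -> 0 <= K -> vmeas u -> (forall t, U (u t)) ->
  (forall s t : R, s <= t -> enorm (u t - u s) <= K * (t - s)) ->
  L1_fun 0 T V v1 -> vmeas v2 -> (forall t, V (v2 t)) ->
  exists x, caratheodory_solution g T x0 u v1 v2 x.
Proof.
move=> T0 K0 mu_ Uu uL v1L m2 V2; have T0' := ltW T0.
have [mv1 Vv1] := L1_fun_clamp T0' v1L.
have vl : vlip_on 0 T K u by move=> s t _ st _; exact: uL.
have [D [bD D1 Dd DI]] := vlip_derive T0 K0 vl.
have adm : admissible U V (Num.max 1 K) (densities (fun=> 1) D) u
    (ordinary (fun t => v1 (Num.max 0 (Num.min T t))) v2).
  apply: densities_admissible => //; first exact: bm_cst.
    by move=> _; rewrite normr1 le_max lexx.
  by move=> t i; rewrite le_max D1 orbT.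
have [y soly] := ode_exists U_compact M_ge0 g_continuous g_lipschitz g_growth x0 T0' adm.
have idd : {ae mu, forall s : R, 0 < s < T -> is_derive s 1 (fun s : R => s) (1 : R)}.
  by apply: aeW => s _; exact: is_derive_idf.
have [yAC y0 yd] := feasible_solution U_compact M_ge0 g_continuous g_growth T0' adm soly idd Dd.
exists y; split => //; apply: aeS yd => t H tT; have := H tT.
by rewrite (is_derive1E (is_derive_idf t)) scale1r clamp_id.
Qed.

(** Let sgk be the clocks of approximate_clock. The controls uk = phi o sgk
    have the arc-length clocks t + sgk t - phi0 (sgk t), because phi is
    parametrized by arc length together with phi0; these converge to sigma.
    With v2k = psi2 along these clocks, condition (ii) holds without error, and
    v2k converges in mean by clock_comp_cvg. Since phi0 o sgk converges to the
    identity uniformly, the space-time graphs of uk converge uniformly to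
    (phi0, phi), and space_time_limit gives the convergence of the solutions. *)
Lemma graph_completion_limit_solution (T : R) (x0 : 'rV[R]_n) (u0 : 'rV[R]_m)
  (u : R -> 'rV[R]_m) (v1 v2 : R -> 'rV[R]_l) (x : R -> 'rV[R]_n) : 0 < T ->
  L1_fun 0 T V v1 -> L1_fun 0 T V v2 ->
  graph_completion_solution U V g T x0 u0 u v1 v2 x ->
  E_BVS_limit_solution U V g T x0 u0 u v1 v2 x.
Proof.
move=> T0 v1L v2L gcs; have T0' := ltW T0.
have [S [phi0 [h [phi [D [sg [psi2 [xi H]]]]]]]] :=
  completion_data U_compact M_ge0 g_continuous g_growth T0 v1L v2L gcs.
have [[S0 xE] [phi0L [phi00 phi0S] [bh h01] hd hI] [phiL [Uphi phiu0] [bD D1] DI arc]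
  [msg sg0 sgT sgP] [mpsi Vpsi psiv sol]] := H => {H gcs}.
have S0' := ltW S0.
have [sgk [K [K0 sgkS sgkL sgk0 sgkC]]] := approximate_clock T0 S0 phi0L phi00 phi0S
  (fun t tT => let: And3 a b _ := sgP t tT in conj a b) sg0 sgT.
have sgknd k (s t : R) : s <= t -> sgk k s <= sgk k t.
  by move=> st; have /andP[] := sgkL k s t st; rewrite subr_ge0.
have mphi := lip1_vmeas phiL.
have phid := vlip_dist phiL; have phi0d := incr_dist phi0L.
pose uk k (t : R) := phi (sgk k t).
have msgk k : measurable_fun setT (sgk k) by apply: nondecreasing_measurable => // s t; exact: sgknd.
have ukL k (s t : R) : s <= t -> enorm (uk k t - uk k s) <= K k * (t - s).
  by move=> st; have /andP[_ q] := sgkL k s t st; apply: le_trans q; apply/phiL/sgknd.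
have ukvl k : vlip_on 0 T (K k) (uk k) by move=> s t _ st _; exact: ukL.
have ACk k : AC_fun 0 T U (uk k).
  by split; [move=> t _; exact: Uphi|exact: (vlip_abs_continuous (K0 k) (ukvl k))].
have fink k : (total_evariation 0 T (uk k) < +oo)%E by exact: (vlip_tv_fin T0' (ukvl k)).
have uk0 k : uk k 0 = u0 by rewrite /uk; have [-> _] := sgk0 k.
have arcE k (t : R) : 0 <= t <= T -> arc_clock (uk k) t = t + (sgk k t - phi0 (sgk k t)).
  move=> /andP[t0 t1]; rewrite /arc_clock; congr (_ + _).
  rewrite [X in fine X](_ : _ = total_evariation (sgk k 0) (sgk k t) phi); last first.
    apply: (tv_comp phi t0) => [p q _ pq _|y yh]; first exact: sgknd.
    apply: (lip_surj (C := K k) t0 _ yh) => p q _ pq _.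
    by have /andP[q1 q2] := sgkL k p q pq; rewrite ger0_norm.
  have [-> _] := sgk0 k; rewrite -/(var 0 (sgk k t) phi).
  by rewrite -{2}(arc _ (sgkS k t)) addrC addKr.
have arcT k : arc_clock (uk k) T = S.
  rewrite arcE; last by rewrite T0' lexx.
  by have [_ ->] := sgk0 k; rewrite phi0S addrC subrK.
pose clT (t : R) : R := Num.max 0 (Num.min T t).
have clTT t : 0 <= clT t <= T by exact: clamp_ge.
have clTE t : 0 <= t <= T -> clT t = t by exact: clamp_id.
pose ak k (t : R) : R := arc_clock (uk k) (clT t).
have acnd k (s t : R) : 0 <= s -> s <= t -> t <= T -> arc_clock (uk k) s <= arc_clock (uk k) t.
  exact: arc_clock_nd (fink k).
have aknd k (s t : R) : s <= t -> ak k s <= ak k t.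
  move=> st; have /andP[c1 _] := clamp_lip 0 T st; rewrite subr_ge0 in c1.
  by apply: acnd => //; [have /andP[] := clTT s|have /andP[] := clTT t].
have mak k : measurable_fun setT (ak k) by apply: nondecreasing_measurable => // s t; exact: aknd.
have akS k t : 0 <= ak k t <= S.
  have /andP[t0 t1] := clTT t; rewrite -(arcT k) -{1}(arc_clock0 (uk k)).
  by rewrite !acnd.
have akC (t : R) : 0 <= t <= T -> forall e : R, 0 < e -> \forall k \near \oo, `|ak k t - sg t| < e.
  move=> tT e e0; have e2 : 0 < e / 2 by rewrite divr_gt0.
  apply: filterS (sgkC t tT _ e2) => k q; rewrite /ak clTE// arcE//.
  have [_ st _] := sgP t tT.
  have -> : t + (sgk k t - phi0 (sgk k t)) - sg t =
    (sgk k t - sg t) - (phi0 (sgk k t) - phi0 (sg t)) by rewrite st; ring.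
  apply: le_lt_trans (ler_normB _ _) _; rewrite (splitr e); apply: ltrD => //.
  exact: le_lt_trans (phi0d _ _) q.
have /choice[d dP] (k : nat) : exists d : (R -> R) * (R -> R) * (R -> 'rV[R]_m),
    space_time_data T S (uk k) d.1.1 d.1.2 d.2.
  have [tau [h1 [D2 P]]] := space_time_data_ex T0 S0 (fink k) (ACk k).2.
  by exists (tau, h1, D2).
pose tauk k := (d k).1.1.
have tauT k s : 0 <= tauk k s <= T by have [[t1 _ _ _ _] _ _] := dP k; exact: t1.
have acK k s : 0 <= s <= S -> arc_clock (uk k) (tauk k s) = s.
  by move=> sS; have [[_ t2 _ _ _] _ _] := dP k; rewrite /tauk t2 arcT clamp_id.
have tauK k t : 0 <= t <= T -> tauk k (arc_clock (uk k) t) = t.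
  by have [[_ _ _ t4 _] _ _] := dP k; exact: t4.
have unif := mono_unif (a := fun k t => phi0 (sgk k t)) eventually_filter T0.
have {}unif (e : R) : 0 < e -> \forall k \near \oo, forall t, 0 <= t <= T -> `|phi0 (sgk k t) - t| <= e.
  move: e; apply: unif => [k s t _ st _|t tT e e0].
    by have /andP[] := phi0L _ _ (sgknd k _ _ st); rewrite subr_ge0.
  apply: filterS (sgkC t tT e e0) => k q; have [_ st _] := sgP t tT.
  by rewrite -[X in _ - X]st; exact: le_lt_trans (phi0d _ _) q.
have near_s k s e : 0 <= s <= S -> (forall t, 0 <= t <= T -> `|phi0 (sgk k t) - t| <= e) ->
    `|sgk k (tauk k s) - s| <= e.
  move=> sS q; have e' := acK k s sS; rewrite arcE ?tauT// in e'.
  have -> : sgk k (tauk k s) - s = phi0 (sgk k (tauk k s)) - tauk k s.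
    by rewrite -[X in _ - X = _]e'; ring.
  by apply: q; exact: tauT.
have tauC (e : R) : 0 < e -> \forall k \near \oo, forall s, 0 <= s <= S -> `|tauk k s - phi0 s| <= e.
  move=> e0; have e2 : 0 < e / 2 by rewrite divr_gt0.
  apply: filterS (unif _ e2) => k q s sS.
  have -> : tauk k s - phi0 s = (phi0 (sgk k (tauk k s)) - phi0 s) - (phi0 (sgk k (tauk k s)) - tauk k s) by ring.
  apply: le_trans (ler_normB _ _) _; rewrite (splitr e); apply: lerD; last exact: q.
  by apply: le_trans (phi0d _ _) _; exact: near_s.
have ukC (e : R) : 0 < e -> \forall k \near \oo, forall s, 0 <= s <= S -> enorm (uk k (tauk k s) - phi s) <= e.
  move=> e0; apply: filterS (unif _ e0) => k q s sS.
  by apply: le_trans (phid _ _) _; exact: near_s.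
pose v2k k (t : R) := psi2 (ak k t).
have mv2k k : vmeas (v2k k) by exact: vmeas_comp.
have Vv2k k t : V (v2k k t) by exact: Vpsi.
have v2kL k : L1_fun 0 T V (v2k k) by exact: valued_L1_fun.
have v2kE k s : 0 <= s <= S -> v2k k (tauk k s) = psi2 s.
  by move=> sS; rewrite /v2k /ak clTE// acK.
have /choice[xk solk] (k : nat) := caratheodory_ex x0 T0 (K0 k) (vmeas_comp mphi (msgk k))
  (fun t => Uphi (sgk k t)) (ukL k) v1L (mv2k k) (Vv2k k).
have [mv1 Vv1] := L1_fun_clamp T0' v1L.
have FF : ProperFilter \oo by exact: eventually_filter.
have lim : forall e : R, 0 < e -> \forall k \near \oo, forall s, 0 <= s <= S ->
    enorm (xk k (tauk k s) - xi s) <= e.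
  apply: (space_time_limit U_compact V_compact M_ge0 g_continuous g_lipschitz g_growth FF T0 S0
    ACk (fun k => conj v1L (v2kL k)) fink _ solk dP phi0L phi00 phi0S bh h01 hd hI mphi Uphi
    bD D1 DI mv1 Vv1 mpsi Vpsi sol tauC ukC).
  - by move=> k; rewrite arcT.
  - move=> e e0; apply: filterE => k; rewrite (integ_eq (g := fun=> 0)).
      by rewrite integ_cst// mul0r ltW.
    by move=> t _; rewrite subrr enorm0.
  - move=> i e e0; apply: filterE => k; rewrite (integ_eq (g := fun=> 0)).
      by rewrite integ_cst// mul0r ltW.
    by move=> s sS; rewrite v2kE// subrr enorm0 mul0r.
have adm : admissible U V 1 (densities h D) phi
    (ordinary ((fun t => v1 (clT t)) \o phi0) psi2).
  apply: densities_admissible => //.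
  - by move=> s; have /andP[p q] := h01 s; rewrite ger0_norm.
  - by apply: (vmeas_comp mv1); exact: measurable_tau.
  - by move=> t; exact: Vv1.
have [Lx Lx0 xiL] := integral_solution_vlip U_compact M_ge0 g_continuous g_growth adm sol.
have xkx (e : R) : 0 < e -> \forall k \near \oo, forall t : R, 0 <= t <= T ->
    enorm (xk k t - x t) <= e + Lx * `|ak k t - sg t|.
  move=> e0; apply: filterS (lim e e0) => k q t tT.
  have := q _ (akS k t); rewrite /ak clTE// tauK// -/(ak k t) => q1.
  rewrite xE//; have [/andP[r0 r1] _ _] := sgP t tT.
  apply: le_trans (enorm_triangle (xi (arc_clock (uk k) t)) _ _) _; apply: lerD => //.
  have /andP[s0 s1] := akS k t; rewrite /ak clTE// in s0 s1.
  have /orP[cmp|cmp] := le_total (arc_clock (uk k) t) (sg t).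
    rewrite enormB distrC; apply: le_trans (xiL _ _ s0 cmp r1) _.
    by rewrite ler_wpM2l//; exact: ler_norm.
  by apply: le_trans (xiL _ _ r0 cmp s1) _; rewrite ler_wpM2l//; exact: ler_norm.
have uku k (t : R) : 0 <= t <= T -> enorm (uk k t - u t) <= `|sgk k t - sg t|.
  by move=> tT; have [_ _ <-] := sgP t tT; exact: phid.
pose sgc (t : R) := sg (clT t).
have sgcS t : 0 <= sgc t <= S by have [] := sgP _ (clTT t).
have mcl : measurable_fun setT clT.
  by apply: nondecreasing_measurable => // a b ab; have /andP[] := clamp_lip 0 T ab; rewrite subr_ge0.
have msgc : measurable_fun setT sgc by exact: (measurableT_comp msg mcl).
have sgcE t : 0 <= t <= T -> sgc t = sg t by move=> tT; rewrite /sgc clTE.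
have dS := @interval_dist R S.
have bound_bm (f : R -> R) : measurable_fun setT f -> (forall t, 0 <= f t <= S) -> bm f.
  by move=> mf fS; split => //; exists S => t; have /andP[a b] := fS t; rewrite ger0_norm.
have bak k := bound_bm _ (mak k) (akS k); have bsgk k := bound_bm _ (msgk k) (sgkS k).
have bsgc := bound_bm _ msgc sgcS.
have bA k : bm (fun t => `|ak k t - sgc t|) by apply: bm_norm; exact: bmB.
have bB k : bm (fun t => `|sgk k t - sgc t|) by apply: bm_norm; exact: bmB.
have A1 : forall e : R, 0 < e -> \forall k \near \oo, integ 0 T (fun t => `|ak k t - sgc t|) <= e.
  apply: (bounded_cvg (C := S)) => // [k t tT|t tT e e0]; first by apply/andP; split => //; apply: dS => //; rewrite sgcE//; have [] := sgP t tT.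
  by apply: filterS (akC t tT e e0) => k; rewrite sgcE// => /ltW.
have A2 : forall e : R, 0 < e -> \forall k \near \oo, integ 0 T (fun t => `|sgk k t - sgc t|) <= e.
  apply: (bounded_cvg (C := S)) => // [k t tT|t tT e e0]; first by apply/andP; split => //; apply: dS => //; rewrite sgcE//; have [] := sgP t tT.
  by apply: filterS (sgkC t tT e e0) => k; rewrite sgcE// => /ltW.
have cpk k : clock_pair T S 1 (ak k) (tauk k).
  have [[_ _ t3 _ _] _ _] := dP k; split => //.
  - by move=> t tT; split; [exact: akS|rewrite /ak clTE// tauK].
  - by move=> s t _ st _; have /andP[] := t3 s t st; rewrite subr_ge0.
  - by move=> s t _ st _; have /andP[q1 q2] := t3 s t st; rewrite ger0_norm// mul1r.
  - by split => //; exact: measurable_tau.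
have cp : clock_pair T S 1 sgc phi0.
  by apply: nd_clock_pair => // t tT; have [q1 q2 _] := sgP t tT; rewrite sgcE.
have akC' (t : R) : 0 <= t <= T -> forall e : R, 0 < e -> \forall k \near \oo, `|ak k t - sgc t| < e.
  by move=> tT e e0; rewrite sgcE//; exact: akC.
have bpsi := bm_valued V_compact mpsi Vpsi.
have [mv2 Vv2] := L1_fun_clamp T0' v2L.
have bv2 := bm_valued V_compact mv2 Vv2.
have bE k : bm (fun t => enorm (v2k k t - v2 (clT t))).
  by apply: bm_enormB => //; exact: (bm_valued V_compact (mv2k k)).
have A3 (e : R) : 0 < e -> \forall k \near \oo, integ 0 T (fun t => enorm (v2k k t - v2 (clT t))) <= e.
  move=> e0; have en : 0 < e / (l%:R + 1) by rewrite divr_gt0// ltr_wpDl.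
  have : \forall k \near \oo, forall i : 'I_l,
      integ 0 T (fun t => `|psi2 (ak k t) ord0 i - psi2 (sgc t) ord0 i|) <= e / (l%:R + 1).
    apply: filter_forall => i.
    exact: (clock_comp_cvg T0 S0 (bpsi i) cpk cp akC').
  apply: filterS => k q.
  have bi i : bm (fun t => `|psi2 (ak k t) ord0 i - psi2 (sgc t) ord0 i|).
    by apply: bm_norm; apply: bmB; exact: (bm_comp (bpsi i)).
  apply: (@le_trans _ _ (integ 0 T (fun t => \sum_i `|psi2 (ak k t) ord0 i - psi2 (sgc t) ord0 i|))).
    apply: integ_le_ae => //; first exact: bm_sum.
    apply: aeS psiv => t q1 /[dup] tT /andP[t0 t1].
    have tT' : 0 <= t <= T by rewrite !ltW.
    rewrite (clTE t tT') -(q1 tT) (sgcE t tT').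
    apply: le_trans (enorm_le_sum _) _.
    by apply: ler_sum => i _; rewrite !mxE.
  rewrite integ_sum//; apply: (@le_trans _ _ (\sum_(i < l) e / (l%:R + 1))).
    by apply: ler_sum => i _; exact: q.
  rewrite sumr_const card_ord (_ : _ *+ l = l%:R * (e / (l%:R + 1))); last by rewrite mulr_natl.
  by rewrite absorb_le// ltW.
have L1ge0 d' (f : R -> 'rV[R]_d') (a b : R) : (0 <= L1_norm a b f)%E.
  by apply: integral_ge0 => t _; rewrite lee_fin enorm_ge0.
have row0 k t : 0 <= t <= T ->
    enorm (row_mx (row_mx (xk k t - x t) (uk k t - u t)) (row_mx (v1 t - v1 t) (v2k k t - v2 t))) <=
    (enorm (xk k t - x t) + enorm (uk k t - u t)) + enorm (v2k k t - v2 (clT t)).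
  move=> tT; apply: le_trans (enorm_row_mx _ _) _; apply: lerD; first exact: enorm_row_mx.
  apply: le_trans (enorm_row_mx _ _) _; by rewrite subrr enorm0 add0r clTE.
have Lx1 : 0 < Lx + 1 by rewrite ltr_wpDl.
have mean (e : R) : 0 < e -> \forall k \near \oo, (L1_norm 0 T (fun t =>
             row_mx (row_mx (xk k t - x t) (uk k t - u t))
                    (row_mx (v1 t - v1 t) (v2k k t - v2 t))) <= e%:E)%E.
  move=> e0; have e4 : 0 < e / 4 by rewrite divr_gt0.
  have eT : 0 < e / 4 / (T + 1) by rewrite divr_gt0// ltr_wpDl.
  have eL : 0 < e / 4 / (Lx + 1) by rewrite divr_gt0.
  apply: filterS2 (filterI (xkx _ eT) (A1 _ eL)) (filterI (A2 _ e4) (A3 _ e4)) => k [q1 q2] [q3 q4].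
  have bq1 : bm (fun t => e / 4 / (T + 1) + Lx * `|ak k t - sgc t|).
    by apply: bmD; [exact: bm_cst|apply: bmM => //; exact: bm_cst].
  apply: le_trans (L1_norm_le_integ (q := fun t =>
    ((e / 4 / (T + 1) + Lx * `|ak k t - sgc t|) + `|sgk k t - sgc t|) + enorm (v2k k t - v2 (clT t))) _ _) _.
  - by apply: bmD => //; exact: bmD.
  - move=> t tT; apply: le_trans (row0 k t tT) _; rewrite lerD2r sgcE//.
    by apply: lerD; [exact: q1|exact: uku].
  rewrite lee_fin integ_D//; last exact: bmD.
  rewrite integ_D// integ_D; [|exact: bm_cst|by apply: bmM => //; exact: bm_cst].
  rewrite integ_cst// integ_Zl// subr0.
  rewrite [leRHS](_ : e = ((e / 4 + e / 4) + e / 4) + e / 4); last by field.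
  apply: lerD => //; apply: lerD => //; apply: lerD.
    by rewrite mulrC absorb_le// ltW.
  apply: le_trans (ler_wpM2l Lx0 q2) _; rewrite absorb_le// ltW//.
split.
  split=> // i; have [my [B yB] _] := sol.
  apply: (@eq_integrable _ _ _ mu (`[0, T]%classic : set R) (measurable_itv _) (EFin \o (fun t => xi (sgc t) ord0 i))) => //.
    move=> t; rewrite inE /= in_itv/= => tT; congr EFin.
    by rewrite xE// sgcE.
  apply: bm_integrable; split; first exact: (measurableT_comp (my i) msgc).
  by exists B => t; apply: le_trans (enorm_coord _ _) (yB _).
exists uk, (fun=> v1), v2k, xk; split.
- by move=> k; split.
- exists S => k; rewrite (varE T0' (fink k)) lee_fin; have := arcT k.
  by rewrite /arc_clock -/(var 0 T (uk k)) => <-; rewrite lerDr.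
- exact: solk.
- move=> t; rewrite in_itv/= => tT; apply: near0_ereal => [k|e e0].
    by apply: adde_ge0 => //; rewrite lee_fin enorm_ge0.
  have e2 : 0 < e / 2 by rewrite divr_gt0.
  have e6 : 0 < e / 6 by rewrite divr_gt0.
  have eL : 0 < e / 6 / (Lx + 1) by rewrite divr_gt0.
  apply: filterS2 (filterI (xkx _ e6) (akC t tT _ eL)) (filterI (sgkC t tT _ e6) (mean _ e2)).
  move=> k [q1 q2] [q3 q4].
  rewrite (splitr e) EFinD; apply: leeD => //; rewrite lee_fin.
  apply: le_trans (enorm_row_mx _ _) _.
  have -> : e / 2 = (e / 6 + e / 6) + e / 6 by field.
  apply: lerD; last by apply: le_trans (uku k t tT) (ltW q3).
  apply: le_trans (q1 t tT) _; rewrite lerD2l.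
  by apply: le_trans (ler_wpM2l Lx0 (ltW q2)) _; rewrite absorb_le// ltW.
exists psi2; split => //.
  by move=> i; apply: measurable_funTS; exact: mpsi.
apply: near0_ereal => [k|e e0]; first exact: L1ge0.
apply: filterE => k; apply: le_trans (L1_norm_le_integ (q := fun=> 0) _ _) _.
- exact: bm_cst.
- move=> s; rewrite -/(arc_clock (uk k) T) arcT => sS.
  set p := (pinv_ _ _ _ _); have -> : p = tauk k s.
    rewrite /p -[in LHS](acK k s sS); apply: pinvKV; last by rewrite inE /= in_itv/= tauT.
    move=> a b; rewrite !inE /= !in_itv/= => aT bT ab.
    by rewrite -[a](tauK k)// -[b](tauK k)// ab.
  by rewrite v2kE// subrr enorm0.
rewrite -/(arc_clock (uk k) T) arcT integ_cst// mul0r lee_fin ltW//.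
Qed.

End completion_to_limit.

(** * Equivalence of the two notions of solution *)

Unset Implicit Arguments.

Theorem theorem5p2 (R : realType) (n m l : nat)
  (U : set 'rV[R]_m) (V : set 'rV[R]_l)
  (g : 'I_m.+1 -> 'rV[R]_n -> 'rV[R]_m -> 'rV[R]_l -> 'rV[R]_n)
  (U_compact : compact U) (V_compact : compact V) (U_whitney : whitney U)
  (g_continuous : forall i, field_continuous U V (g i))
  (g_lipschitz : forall i, locally_lipschitz_unif U V (g i))
  (g_growth : exists2 M : R, 0 < M & forall i, linear_growth U V M (g i))
  (T : R) (T_gt0 : 0 < T)
  (x0 : 'rV[R]_n) (u0 : 'rV[R]_m) (U_u0 : U u0)
  (u : R -> 'rV[R]_m) (v1 v2 : R -> 'rV[R]_l)
  (u_BV : BV_fun 0 T U u) (v1_L1 : L1_fun 0 T V v1) (v2_L1 : L1_fun 0 T V v2)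
  (u_init : u 0 = u0)
  (x : R -> 'rV[R]_n) :
  E_BVS_limit_solution U V g T x0 u0 u v1 v2 x <->
  graph_completion_solution U V g T x0 u0 u v1 v2 x.
Proof.
have [M M0 MP] := g_growth; have M0' := ltW M0.
split.
  exact: (limit_solution_graph_completion U_compact V_compact M0' g_continuous g_lipschitz MP T_gt0).
exact: (graph_completion_limit_solution U_compact V_compact M0' g_continuous g_lipschitz MP T_gt0).
Qed.
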